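(* Let $C\in\mathcal{K}_{(0)}(\mathbb{C})$ and let $K\in\mathcal{S}_0(\mathbb{C}^n)$ be convex and $\mathbb{S}^1$-invariant. Then: (i) if $-2<p<-1$, the interior $\mathrm{int}\,\mathrm{I}_{C,p}K$ is pseudo-convex; (ii) if $p\ge -1$ and $p\ne 0$, $\mathrm{I}_{C,p}K$ is convex.
   Context: Identify $\mathbb{C}^n\cong\mathbb{R}^{2n}$ with Euclidean inner product $\langle\cdot,\cdot\rangle$ and unit sphere $\mathbb{S}^{2n-1}$; $\mathbb{S}^1\subseteq\mathbb{C}$ is the unit circle. $\mathcal{S}_0(\mathbb{C}^n)$ is the set of star bodies: compact sets, star-shaped with respect to the origin, whose radial function $\rho_K(u)=\sup\{\lambda\ge0:\lambda u\in K\}$, $u\neq0$, is positive and continuous. $K$ is $\mathbb{S}^1$-invariant if $cK=K$ for all $c\in\mathbb{S}^1$. $\mathcal{K}_{(0)}(\mathbb{C})$ is the set of compact convex subsets of $\mathbb{C}\cong\mathbb{R}^2$ containing the origin in their interior. For $C\in\mathcal{K}_{(0)}(\mathbb{C})$, $p>-2$ non-zero and $K\in\mathcal{S}_0(\mathbb{C}^n)$, the complex $L_p$-intersection body $\mathrm{I}_{C,p}K$ is the star body with radial function $$\rho_{\mathrm{I}_{C,p}K}(u)^{-p}=\int_K h_{Cu}(x)^p\,dx,\quad u\in\mathbb{S}^{2n-1},$$ where $Cu=\{cu:c\in C\}$ and $h_L(x)=\sup\{\langle x,y\rangle:y\in L\}$. A function $\varphi:\Omega\to[-\infty,\infty)$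 on an open set $\Omega\subseteq\mathbb{C}^n$ is plurisubharmonic if it is upper semi-continuous and for all $u,v\in\mathbb{C}^n$ the map $z\mapsto\varphi(u+zv)$ is subharmonic where it is defined. An open connected set $\Omega\subseteq\mathbb{C}^n$ is pseudo-convex if there exists a continuous plurisubharmonic function $\varphi$ on $\Omega$ such that the sets $\{z\in \Omega:\varphi(z)<c\}$, $c\in\mathbb{R}$, are all relatively compact in $\Omega$. *)

(* Defs.v *)
From HB Require Import structures.
From mathcomp Require Import all_boot all_order all_algebra.
From mathcomp Require Import complex.
From mathcomp Require Import all_classical all_reals all_analysis.

Set Implicit Arguments.
Unset Strict Implicit.
Unset Printing Implicit Defensive.

Import Order.TTheory GRing.Theory Num.Theory.
Import numFieldNormedType.Exports.
Local Open Scope classical_set_scope.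
Local Open Scope complex_scope.
Local Open Scope ring_scope.

(* R[i] carries the metric topology of its modulus (the library only attaches
   it to R[i]^o).  Together with the library's instance on matrices this
   topologizes 'rV[R[i]]_n by the sup norm, i.e. with the usual topology. *)
HB.instance Definition _ (R : realType) := NormedModule.copy R[i] R[i]^o.

Section power_measure.
Context d (T : measurableType d) (R : realType).
Variable m : {sigma_finite_measure set T -> \bar R}.

Definition tuple_cons n (x : T * n.-tuple T) : n.+1.-tuple T :=
  [tuple of x.1 :: x.2].

Lemma measurable_tuple_cons n : measurable_fun [set: T * n.-tuple T] (@tuple_cons n).
Proof. exact: measurable_cons. Qed.

Section step.
Variables (n : nat) (mn : {sigma_finite_measure set (n.-tuple T) -> \bar R}).

Definition power_step : set (n.+1.-tuple T) -> \bar R :=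
  pushforward (m \x mn)%E (@tuple_cons n).

Let power_step0 : power_step set0 = 0%E.
Proof. by rewrite /power_step /pushforward preimage_set0 measure0. Qed.

Let power_step_ge0 A : (0 <= power_step A)%E.
Proof. by rewrite /power_step /pushforward measure_ge0. Qed.

Let power_step_sigma_additive : semi_sigma_additive power_step.
Proof.
have mc := @measurable_tuple_cons n.
move=> F mF tF mUF; rewrite /power_step /pushforward preimage_bigcup.
apply: measure_semi_sigma_additive.
- by move=> k; rewrite -[X in measurable X]setTI; exact: mc.
- apply/trivIsetP => /= i j _ _ ij; rewrite -preimage_setI.
  by move/trivIsetP : tF => /(_ _ _ _ _ ij) ->//; rewrite preimage_set0.
- by rewrite -preimage_bigcup -[X in measurable X]setTI; exact: mc.
Qed.

HB.instance Definition _ := isMeasure.Build _ _ _ power_step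
  power_step0 power_step_ge0 power_step_sigma_additive.

Let power_step_sigma_finite : sigma_finite setT power_step.
Proof.
have /sigma_finiteP[F [FT ndF Foo]] := sigma_finiteT m.
have /sigma_finiteP[G [GT ndG Goo]] := sigma_finiteT mn.
pose g (t : n.+1.-tuple T) : T * n.-tuple T := (thead t, [tuple of behead t]).
have Kg x : g (tuple_cons x) = x.
  by case: x => x t; congr pair; apply/val_inj.
have mg : measurable_fun setT g.
  apply/measurable_fun_pair; first exact: measurable_tnth.
  exact: measurable_behead.
exists (fun k => g @^-1` (F k `*` G k)).
  rewrite -preimage_bigcup (_ : \bigcup_k _ = setT) ?preimage_setT//.
  apply/seteqP; split => // -[x y] _.
  have [k _ Fkx] : (\bigcup_k F k) x by rewrite -FT.
  have [l _ Gly] : (\bigcup_k G k) y by rewrite -GT.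
  exists (maxn k l) => //; split => /=.
    by move: x Fkx; exact/subsetPset/ndF/leq_maxl.
  by move: y Gly; exact/subsetPset/ndG/leq_maxr.
move=> k; have [mF Fk] := Foo k; have [mG Gk] := Goo k; split.
  by rewrite -[X in measurable X]setTI; apply: mg => //; exact: measurableX.
rewrite /power_step /pushforward -comp_preimage.
rewrite (_ : g \o _ = id) ?preimage_id; last by apply/funext => x /=; exact: Kg.
by rewrite product_measure1E// lte_mul_pinfty// ge0_fin_numE.
Qed.

HB.instance Definition _ := Measure_isSigmaFinite.Build _ _ _ power_step
  power_step_sigma_finite.

End step.

(* n-fold product of m with itself; the library has binary products only *)
Fixpoint power_measure n : {sigma_finite_measure set (n.-tuple T) -> \bar R} :=
  match n with
  | 0 => \d_([tuple] : 0.-tuple T)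
  | n'.+1 => power_step (power_measure n')
  end.

End power_measure.

Section complex_euclidean.
Variables (R : realType) (n : nat).
Local Notation Cn := 'rV[R[i]]_n.
Implicit Types (x y u : Cn) (K L : set Cn).

(* the inner product of R^{2n}, i.e. the real part of the Hermitian product *)
Definition rdot x y : R :=
  \sum_(j < n) (complex.Re (x ord0 j) * complex.Re (y ord0 j)
              + complex.Im (x ord0 j) * complex.Im (y ord0 j)).

Definition unit_sphere : set Cn := [set u | rdot u u = 1].

Definition of_coords (t : (n + n).-tuple (measurableTypeR R)) : Cn :=
  \row_j (tnth t (lshift n j) +i* tnth t (rshift n j)).

Definition lebesgue_measure2n :
    {sigma_finite_measure set ((n + n).-tuple (measurableTypeR R)) -> \bar R} :=
  power_measure (@lebesgue_measure R) (n + n).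

(* Lebesgue integral over a subset of C^n, identified with R^{2n} *)
Definition integralCn K (f : Cn -> R) : R :=
  (\int[lebesgue_measure2n]_(t in of_coords @^-1` K) f (of_coords t))%R.

Definition radial K u : R := sup [set l : R | 0 <= l /\ K (l%:C *: u)].

Definition star_shaped K : Prop :=
  forall x (t : R), K x -> 0 <= t <= 1 -> K (t%:C *: x).

Definition star_body K : Prop :=
  [/\ compact K, star_shaped K, forall u, u != 0 -> 0 < radial K u
    & {within [set~ 0], continuous (radial K)}].

Definition circle_invariant K : Prop :=
  forall c : R[i], `|c| = 1 -> [set c *: x | x in K] = K.

Definition support_fun L x : R := sup [set rdot x y | y in L].

(* the star-shaped set whose radial function is rho on the sphere *)
Definition set_of_radial (rho : Cn -> R) : set Cn :=
  [set x | exists u (l : R), [/\ unit_sphere u, 0 <= l <= rho u & x = l%:C *: u]].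

(* The solution rho of rho^{-p} = integral over K of h_{Cu}^p.  For p < 0 the
   integrand should be +oo, but powR gives 0, where h_{Cu} vanishes; if 0 is
   interior to C and u != 0, these x form the null set where the Hermitian
   product of u and x is 0. *)
Definition Lp_intersection_radial (C : set R[i]) (p : R) K u : R :=
  integralCn K (fun x => support_fun [set c *: u | c in C] x `^ p) `^ (- p^-1).

Definition Lp_intersection_body (C : set R[i]) (p : R) K : set Cn :=
  set_of_radial (Lp_intersection_radial C p K).

End complex_euclidean.

(* For the order of R[i], 0 <= t <= 1 forces t to be real, so that convex_set
   over the scalars R[i] is real convexity. *)
Definition convex_body0 (R : realType) (C : set R[i]) : Prop :=
  [/\ compact C, convex_set (C : set R[i]^o) & C° 0].

Section pseudoconvexity.
Variable R : realType.

Definition usc_on (T : topologicalType) (D : set T) (f : T -> \bar R) : Prop :=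
  forall x (a : R), D x -> (f x < a%:E)%E ->
    \forall y \near within D (nbhs x), (f y < a%:E)%E.

(* Values -oo are allowed (also identically); the sub-mean value inequality is
   required on every closed disc inside D. *)
Definition subharmonic (D : set R[i]) (f : R[i] -> \bar R) : Prop :=
  [/\ usc_on D f, forall z, D z -> (f z < +oo)%E
    & forall (a : R[i]) (r : R), 0 < r ->
        [set z | `|z - a| <= r%:C] `<=` D ->
        (f a <= ((2 * pi)^-1)%:E *
                \int[lebesgue_measure]_(t in `[0%R, (2 * pi)%R])
                   f (a + r%:C * (cos t +i* sin t))%R)%E].

Definition plurisubharmonic n (Omega : set 'rV[R[i]]_n)
    (phi : 'rV[R[i]]_n -> \bar R) : Prop :=
  [/\ usc_on Omega phi, forall z, Omega z -> (phi z < +oo)%E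
    & forall u v : 'rV[R[i]]_n,
        subharmonic [set z : R[i] | Omega (u + z *: v)]
                    (fun z => phi (u + z *: v))].

Definition relatively_compact_in (T : topologicalType) (Omega A : set T) : Prop :=
  compact (closure A) /\ closure A `<=` Omega.

Definition pseudo_convex n (Omega : set 'rV[R[i]]_n) : Prop :=
  [/\ open Omega, connected Omega
    & exists phi : 'rV[R[i]]_n -> \bar R,
        [/\ {within Omega, continuous phi}, plurisubharmonic Omega phi
          & forall c : R, relatively_compact_in Omega
              (Omega `&` [set z | (phi z < c%:E)%E])]].

End pseudoconvexity.

(* Main.v *)
(** Write N(u) for the p-th root of the integral of |<x,u>|^p over K, where <.,.> is the complex
    Hermitian product.  Averaging over the circle action shows that the radial function of the
    body is a constant multiple of 1/N, so C plays no role and the body is {N <= c}.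

    Fix u != 0 and v.  Integrating over the fibres of x |-> (<x,u>, <x,v>) turns the integral into
    one over C^2 of |a|^p f(a,b), where f is log-concave by Prekopa-Leindler.  By Ball's theorem
    (int r^(q-1) f(r x) dr)^(-1/q) is a norm, and Hahn-Banach supplies a shear, that is a vector
    w = v + c u in whose coordinates the norm of (a,b) is at least that of (0,b).  Symmetrising then
    shows that, for -2 < p < 0, the mean of N^p over every circle u + r e^(it) w is at most N(u)^p,
    and gives a similar two-point inequality over the reals for -1 < p < 1.

    Convexity for -1 < p < 1: at the leftmost maximum of N on a segment the two-point inequality
    would fail.  The case p = -1 follows by letting p decrease to -1, and p >= 1 is pointwise.

    Pseudo-convexity: in the line through u and v the circles u + r e^(it) w become, up to a
    factor of modulus |1 - k e^(it)| whose logarithm has mean zero, the images of circles under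
    Moebius maps.  Hence -1 / log(max(N/c, 1/2)) satisfies a mean inequality on small Moebius
    circles around every point of a complex line; comparison with the Poisson integral of its
    boundary values makes it subharmonic, and it is an exhaustion of {N < c}. *)

Require Import Defs.
From HB Require Import structures.
From mathcomp Require Import all_boot all_order all_algebra.
From mathcomp Require Import complex.
From mathcomp Require Import all_classical all_reals all_analysis.
From mathcomp Require Import measurable_realfun.
From mathcomp Require Import ring lra.

Set Implicit Arguments.
Unset Strict Implicit.
Unset Printing Implicit Defensive.

Import Order.TTheory GRing.Theory Num.Theory.
Import numFieldNormedType.Exports.
Local Open Scope classical_set_scope.
Local Open Scope ring_scope.

(** Linear substitutions are made without determinants: an additive measurable bijection carries one
    Haar measure to a multiple of another, and the unknown factor either cancels or is found by
    testing one set. The exponent in Ball's theorem is q = p + 4 over the complex numbers and q = p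
    + 2 over the reals: |a|^p, the Jacobian of a = b w and the radial measure in b leave r^(q-1)
    along each ray. The singularity of |a|^p is integrable in the plane for p > -2 but on the line
    only for p > -1, so below -1 only the circle inequality is available. Two difficulties remain
    there. The inequality concerns N^p and not log N: the bound (X^p - 1)/p <= ln X for p < 0 passes
    to log N, of which -1/log is a convex increasing function. And the shear c comes from
    Hahn-Banach, so it varies with u and v without any control, which rules out smoothing; but the
    Poisson kernel has the exact mean property on every small Moebius circle, and this is enough for
    a maximum principle. *)

Lemma measurable_preimT d1 d2 (X : measurableType d1) (Y : measurableType d2)
    (f : X -> Y) (A : set Y) :
  measurable_fun setT f -> measurable A -> measurable (f @^-1` A).
Proof. by move=> mf mA; rewrite -[X in measurable X]setTI; exact: mf. Qed.

(** The group laws appear in exactly the form in which the uniqueness argument substitutes them; the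
    inverse of y is [sub zero y]. Invariance is stated on preimages, so that no image set has to be
    shown measurable. *)
Record is_haar d (X : measurableType d) (R : realType) (add sub : X -> X -> X)
    (zero : X) (mu : {sigma_finite_measure set X -> \bar R}) : Prop := IsHaar {
  haar_madd : measurable_fun setT (fun z : X * X => add z.1 z.2) ;
  haar_msub : measurable_fun setT (fun z : X * X => sub z.1 z.2) ;
  haar_addC : forall x y, add x y = add y x ;
  haar_addK : forall x y, sub (add x y) y = x ;
  haar_subK : forall x y, add (sub x y) y = x ;
  haar_subD : forall x y, sub x (add y x) = sub zero y ;
  haar_inv : forall y A, measurable A -> mu ((add ^~ y) @^-1` A) = mu A ;
  haar_neq0 : mu setT != 0%E }.

Lemma measure_int_indic d (X : measurableType d) (R : realType)
    (m : {measure set X -> \bar R}) (C : set X) : measurable C ->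
  m C = (\int[m]_x (\1_C x)%:E)%E.
Proof. by move=> mC; rewrite integral_indic// setIT. Qed.

Lemma measurable_indicE d (X : measurableType d) (R : realType) (C : set X) :
  measurable C -> measurable_fun setT (fun x : X => ((\1_C x : R)%:E)).
Proof. by move=> mC; apply/measurable_EFinP; exact: measurable_indic. Qed.

Lemma fin_muleI (R : realType) (a x y : \bar R) : a \is a fin_num ->
  (0 < a)%E -> (a * x = a * y)%E -> x = y.
Proof.
move=> afin a0 axy; apply/eqP; rewrite eq_le.
by rewrite -(lee_pmul2l afin a0) axy lexx -(lee_pmul2l afin a0) axy lexx.
Qed.

(** * Uniqueness of Haar measure *)

Section haar_uniqueness.
Context d (X : measurableType d) (R : realType) (add sub : X -> X -> X)
  (zero : X).
Local Open Scope ereal_scope.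
Implicit Types mu nu : {sigma_finite_measure set X -> \bar R}.

Lemma measurable_haar_add mu d' (Y : measurableType d') (f g : Y -> X) :
  is_haar add sub zero mu -> measurable_fun setT f -> measurable_fun setT g ->
  measurable_fun setT (fun y => add (f y) (g y)).
Proof.
move=> H mf mg.
exact: (measurableT_comp (haar_madd H) (measurable_fun_pair mf mg)).
Qed.

Lemma measurable_haar_sub mu d' (Y : measurableType d') (f g : Y -> X) :
  is_haar add sub zero mu -> measurable_fun setT f -> measurable_fun setT g ->
  measurable_fun setT (fun y => sub (f y) (g y)).
Proof.
move=> H mf mg.
exact: (measurableT_comp (haar_msub H) (measurable_fun_pair mf mg)).
Qed.

Lemma haar_integral mu y (g : X -> \bar R) : is_haar add sub zero mu ->
  measurable_fun setT g -> (forall x, 0 <= g x) ->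
  \int[mu]_x g (add x y) = \int[mu]_x g x.
Proof.
move=> H mg g0.
have ma : measurable_fun setT (add ^~ y) by exact: (measurable_haar_add H).
rewrite -[LHS](@ge0_integral_pushforward _ _ _ _ _ _ ma mu setT)//.
by apply: eq_measure_integral => C mC _; exact: (haar_inv H).
Qed.

(** Weil's double integral: integrate 1_A(x) 1_B(y + x) against both measures. Translating y gives
    the left side. Translating x by y and then y by x, with Tonelli in between, turns the first
    indicator into that of -y in A. *)
Lemma haar_swap mu nu A B :
  is_haar add sub zero mu -> is_haar add sub zero nu ->
  measurable A -> measurable B ->
  mu A * nu B = mu B * nu (sub zero @^-1` A).
Proof.
move=> hmu hnu mA mB.
have mi := @measurable_indicE _ X R.
have mf1 : measurable_fun setT
    (fun z : X * X => (\1_A z.1)%:E * (\1_B (add z.2 z.1))%:E : \bar R).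
  apply: emeasurable_funM.
    by apply: (measurableT_comp (mi A mA)); exact: measurable_fst.
  by apply: (measurableT_comp (mi B mB)); exact: (measurable_haar_add hmu).
have mf2 : measurable_fun setT
    (fun z : X * X => (\1_A (sub z.1 z.2))%:E * (\1_B z.1)%:E : \bar R).
  apply: emeasurable_funM.
    by apply: (measurableT_comp (mi A mA)); exact: haar_msub hmu.
  by apply: (measurableT_comp (mi B mB)); exact: measurable_fst.
transitivity (\int[mu]_x \int[nu]_y ((\1_A x)%:E * (\1_B (add y x))%:E)).
  rewrite (measure_int_indic _ mA) muleC -ge0_integralZl//; first last.
  - exact: mi.
  apply: eq_integral => x _; rewrite ge0_integralZl//; last first.
    apply: (measurableT_comp (mi B mB)).
    exact: (measurable_haar_add hmu).
  rewrite muleC; congr (_ * _).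
  rewrite (haar_integral x hnu (mi B mB))//.
  exact: measure_int_indic.
rewrite (fubini_tonelli (fun z : X * X => (\1_A z.1)%:E * (\1_B (add z.2 z.1))%:E))//.
transitivity (\int[nu]_y \int[mu]_x ((\1_A (sub x y))%:E * (\1_B x)%:E)).
  apply: eq_integral => y _ /=.
  rewrite -[RHS](haar_integral y hmu)//; last first.
    exact: (measurableT_comp mf2 (measurable_pair2 y)).
  apply: eq_integral => x _ /=; by rewrite (haar_addK hmu) (haar_addC hmu).
rewrite -(fubini_tonelli (fun z : X * X => (\1_A (sub z.1 z.2))%:E * (\1_B z.1)%:E))//.
rewrite muleC (measure_int_indic mu mB) -ge0_integralZl//; first last.
- exact: mi.
apply: eq_integral => x _ /=; rewrite ge0_integralZr//; last first.
  apply: (measurableT_comp (mi A mA)).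
  exact: (measurable_haar_sub hmu).
congr (_ * _).
rewrite -(haar_integral x hnu)//=; last first.
  apply: (measurableT_comp (mi A mA)).
  exact: (measurable_haar_sub hmu).
under eq_integral do rewrite (haar_subD hmu).
rewrite (measure_int_indic nu)//.
apply: measurable_preimT => //; exact: (measurable_haar_sub hmu).
Qed.

(* [A := B] of positive finite measure shows that a Haar measure is symmetric. *)
Lemma haar_pos_set mu : is_haar add sub zero mu ->
  exists2 B, measurable B & 0 < mu B < +oo.
Proof.
move=> H; have /sigma_finiteP[F [FT ndF Foo]] := sigma_finiteT mu.
apply: contrapT => nB.
have F0 k : mu (F k) = 0.
  apply/eqP; rewrite eq_le measure_ge0 andbT leNgt; apply/negP => F0.
  by apply: nB; exists (F k); [exact: (Foo k).1|rewrite F0 (Foo k).2].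
have /negP[] := haar_neq0 H; rewrite FT -measure_le0 /=.
apply: (le_trans (measure_sigma_subadditive _ _ _ (@subset_refl _ _))) => //.
- by move=> k; exact: (Foo k).1.
- by apply: bigcupT_measurable => k; exact: (Foo k).1.
- by rewrite eseries0//; move=> k _ _; exact: F0.
Qed.

Lemma haar_opp mu A : is_haar add sub zero mu -> measurable A ->
  mu (sub zero @^-1` A) = mu A.
Proof.
move=> H mA; have [B mB /andP[B0 Boo]] := haar_pos_set H.
have := haar_swap H H mA mB; rewrite muleC => /esym.
have : mu B \is a fin_num by rewrite ge0_fin_numE.
by move=> Bfin; exact: fin_muleI.
Qed.

(** Symmetry of [nu] turns [haar_swap] into mu B nu A = mu A nu B, so the ratio does not depend on
    A. The set [B] is chosen for [mu]; the set [D], chosen for [nu], shows that [nu B] is neither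
    zero nor infinite. *)
Theorem haar_unique mu nu : is_haar add sub zero mu -> is_haar add sub zero nu ->
  exists2 c : R, (0 < c)%R & forall A, measurable A -> nu A = c%:E * mu A.
Proof.
move=> hmu hnu; have [B mB /andP[B0 Boo]] := haar_pos_set hmu.
have Bfin : mu B \is a fin_num by rewrite ge0_fin_numE.
have nuE A : measurable A -> mu B * nu A = mu A * nu B.
  by move=> mA; rewrite (haar_swap hmu hnu mA mB) (haar_opp hnu).
have [D mD /andP[D0 Doo]] := haar_pos_set hnu.
have Dfin : nu D \is a fin_num by rewrite ge0_fin_numE.
have p0 : 0 < mu D * nu B by rewrite -nuE// mule_gt0.
have poo : mu D * nu B < +oo by rewrite -nuE// lte_mul_pinfty.
have nuB0 : 0 < nu B.
  by rewrite lt0e measure_ge0 andbT; apply: contraTneq p0 => ->; rewrite mule0 ltxx.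
have muD0 : 0 < mu D.
  by rewrite lt0e measure_ge0 andbT; apply: contraTneq p0 => ->; rewrite mul0e ltxx.
have nuBfin : nu B \is a fin_num.
  rewrite ge0_fin_numE// ltey; apply: contraTneq poo => ->.
  by rewrite gt0_muley.
exists (fine (nu B) / fine (mu B))%R.
  by rewrite divr_gt0// fine_gt0 ?B0 ?nuB0//= ltey_eq ?nuBfin.
move=> A mA; apply: (fin_muleI Bfin) => //; rewrite nuE//.
rewrite muleA -[in X in X * mu A](fineK Bfin) -EFinM mulrCA divff ?mulr1.
  by rewrite fineK// muleC.
by rewrite gt_eqF// fine_gt0// B0 Boo.
Qed.

Corollary haar_unique_integral mu nu :
  is_haar add sub zero mu -> is_haar add sub zero nu ->
  exists2 c : R, (0 < c)%R & forall g : X -> \bar R, measurable_fun setT g ->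
    (forall x, 0 <= g x) -> \int[nu]_x g x = c%:E * \int[mu]_x g x.
Proof.
move=> hmu hnu; have [c c0 cE] := haar_unique hmu hnu.
exists c => // g mg g0.
rewrite (@eq_measure_integral _ _ _ _ (mscale (NngNum (ltW c0)) mu)).
  by rewrite ge0_integral_mscale.
by move=> A mA _; exact: cE.
Qed.

End haar_uniqueness.

(** * Change of variables up to a constant *)

Section haar_transfer.
Context d1 d2 (X : measurableType d1) (Y : measurableType d2) (R : realType).
Variables (addX subX : X -> X -> X) (zX : X) (addY subY : Y -> Y -> Y) (zY : Y).
Variables (mu : {sigma_finite_measure set X -> \bar R}).
Variables (nu : {sigma_finite_measure set Y -> \bar R}).
Variables (f : X -> Y) (g : Y -> X).
Hypotheses (mf : measurable_fun setT f) (mg : measurable_fun setT g).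
Hypotheses (fK : cancel f g) (gK : cancel g f).
Hypothesis fD : {morph f : x y / addX x y >-> addY x y}.
Hypotheses (hX : is_haar addX subX zX mu) (hY : is_haar addY subY zY nu).
Local Open Scope ereal_scope.

Let push : set Y -> \bar R := pushforward mu f.

Let push0 : push set0 = 0.
Proof. by rewrite /push /pushforward preimage_set0 measure0. Qed.

Let push_ge0 A : 0 <= push A.
Proof. exact: measure_ge0. Qed.

Let push_semi : semi_sigma_additive push.
Proof.
move=> F mF tF mUF; rewrite /push /pushforward preimage_bigcup.
apply: measure_semi_sigma_additive.
- by move=> k; exact: measurable_preimT.
- apply/trivIsetP => /= i j _ _ ij; rewrite -preimage_setI.
  by move/trivIsetP : tF => /(_ _ _ _ _ ij) ->//; rewrite preimage_set0.
- by rewrite -preimage_bigcup; exact: measurable_preimT.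
Qed.

HB.instance Definition _ := isMeasure.Build _ _ _ push push0 push_ge0 push_semi.

Let push_sf : sigma_finite setT push.
Proof.
have /sigma_finiteP[F [FT ndF Foo]] := sigma_finiteT mu.
exists (fun k => g @^-1` F k); first by rewrite -preimage_bigcup -FT.
move=> k; split; first by apply: measurable_preimT => //; exact: (Foo k).1.
rewrite /push /pushforward -comp_preimage (_ : g \o f = id) ?preimage_id.
  exact: (Foo k).2.
by apply/funext => x /=; exact: fK.
Qed.

HB.instance Definition _ := Measure_isSigmaFinite.Build _ _ _ push push_sf.

Lemma haar_pushforward : is_haar addY subY zY push.
Proof.
split; try by [exact: haar_madd hY | exact: haar_msub hY | exact: haar_addK hY
  | exact: haar_subK hY | exact: haar_subD hY | exact: haar_addC hY].
  move=> y A mA; rewrite /push /pushforward -comp_preimage.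
  rewrite -[RHS](haar_inv hX (g y)); last exact: measurable_preimT.
  rewrite -comp_preimage; congr (mu (_ @^-1` A)); apply/funext => x /=.
  by rewrite fD gK.
exact: haar_neq0 hX.
Qed.

(** The image of a Haar measure under an additive bijection is again invariant, hence proportional
    to [nu]. The constant [c] takes the place of a Jacobian and is evaluated only where its value
    matters, by testing one set. *)
Theorem haar_transfer : exists2 c : R, (0 < c)%R &
  forall h : Y -> \bar R, measurable_fun setT h -> (forall y, 0 <= h y) ->
    \int[nu]_y h y = c%:E * \int[mu]_x h (f x).
Proof.
have [c c0 cE] := haar_unique_integral haar_pushforward hY.
exists c => // h mh h0; rewrite cE//; congr (_ * _).
exact: (@ge0_integral_pushforward _ _ _ _ _ _ mf mu setT).
Qed.

End haar_transfer.

Section sigma_finite_product.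
Context d1 d2 (X : measurableType d1) (Y : measurableType d2) (R : realType).
Variables (mu : {sigma_finite_measure set X -> \bar R}).
Variables (nu : {sigma_finite_measure set Y -> \bar R}).

(* The library does not attach its sigma-finiteness proof to the product. *)
Definition sprod : set (X * Y) -> \bar R := (mu \x nu)%E.

HB.instance Definition _ := Measure.on sprod.

Let sprod_sigma_finite : sigma_finite setT sprod.
Proof.
have /sigma_finiteP[F [FT ndF Foo]] := sigma_finiteT mu.
have /sigma_finiteP[G [GT ndG Goo]] := sigma_finiteT nu.
exists (fun k => F k `*` G k).
  apply/seteqP; split => // -[x y] _.
  have [k _ Fkx] : (\bigcup_k F k) x by rewrite -FT.
  have [l _ Gly] : (\bigcup_k G k) y by rewrite -GT.
  exists (maxn k l) => //; split => /=.
    by move: x Fkx; exact/subsetPset/ndF/leq_maxl.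
  by move: y Gly; exact/subsetPset/ndG/leq_maxr.
move=> k; have [mF Fk] := Foo k; have [mG Gk] := Goo k; split.
  exact: measurableX.
by rewrite /sprod product_measure1E// lte_mul_pinfty// ge0_fin_numE.
Qed.

HB.instance Definition _ := Measure_isSigmaFinite.Build _ _ _ sprod
  sprod_sigma_finite.

End sigma_finite_product.

(** * Lebesgue measure on R^n as a Haar measure *)

Section haar_instances.
Context (R : realType).
Local Notation mR := (measurableTypeR R).
Local Notation lam := (@lebesgue_measure R).

Lemma lebesgue_shift (y : R) (A : set R) : measurable A ->
  lam ((fun x => x + y) @^-1` A) = lam A.
Proof.
have mf : measurable_fun setT (fun x : mR => x + y : mR).
  exact: (@measurable_funD _ R R setT id (cst y)).
move=> mA; apply/esym.
apply: (@lebesgue_measure_unique R (pushforward lam (fun x : mR => x + y : mR))) => //.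
move=> _ [[a b]] _ <-.
rewrite /=.
rewrite /pushforward (_ : +%R^~ y @^-1` _ = `]a - y, b - y]%classic); last first.
  by apply/seteqP; split=> x; rewrite /= !in_itv/= ltrBlDr lerBrDr.
rewrite !lebesgue_measure_itv/= !lte_fin ltrD2r; case: ifP => // _.
by rewrite -!EFinB; congr (_%:E); ring.
Qed.

Lemma is_haar_R : is_haar (fun x y : mR => x + y : mR) (fun x y : mR => x - y : mR)
  (0 : R) lam.
Proof.
split => //.
- exact: (@measurable_funD _ (R * R)%type R setT fst snd).
- exact: (@measurable_funB _ (R * R)%type R setT fst snd).
- exact: addrC.
- by move=> x y; rewrite addrK.
- by move=> x y; rewrite subrK.
- by move=> x y; rewrite opprD addrCA subrr addr0 sub0r.
- by move=> y A mA; exact: lebesgue_shift.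
- by have := @lebesgue_measure_itv R `]-oo, +oo[; rewrite set_itvE /= => ->.
Qed.

Lemma is_haar_prod d1 d2 (X : measurableType d1) (Y : measurableType d2)
    addX subX zX addY subY zY (mu : {sigma_finite_measure set X -> \bar R})
    (nu : {sigma_finite_measure set Y -> \bar R}) :
  is_haar addX subX zX mu -> is_haar addY subY zY nu ->
  @is_haar _ (X * Y)%type R (fun x y : X * Y => (addX x.1 y.1, addY x.2 y.2))
    (fun x y : X * Y => (subX x.1 y.1, subY x.2 y.2)) (zX, zY)
    (sprod mu nu).
Proof.
move=> hX hY; split.
- by apply: measurable_fun_pair;
    [apply: (measurable_haar_add hX)|apply: (measurable_haar_add hY)];
    exact: measurableT_comp.
- by apply: measurable_fun_pair;
    [apply: (measurable_haar_sub hX)|apply: (measurable_haar_sub hY)];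
    exact: measurableT_comp.
- by move=> x y; rewrite (haar_addC hX) (haar_addC hY).
- by move=> [x1 x2] y; rewrite (haar_addK hX) (haar_addK hY).
- by move=> [x1 x2] y; rewrite (haar_subK hX) (haar_subK hY).
- by move=> [x1 x2] y; rewrite (haar_subD hX) (haar_subD hY).
- move=> [a b] A mA.
  have mAab : measurable ((fun x : X * Y => (addX x.1 a, addY x.2 b)) @^-1` A).
    apply: measurable_preimT => //.
    by apply: measurable_fun_pair;
      [apply: (measurable_haar_add hX)|apply: (measurable_haar_add hY)].
  rewrite /sprod /product_measure1 /=.
  rewrite -[RHS](haar_integral a hX)//; last exact: measurable_fun_xsection.
  apply: eq_integral => x _ /=.
  rewrite -[RHS](haar_inv hY b); last exact: measurable_xsection.
  congr (nu _); apply/seteqP; split => y /=; rewrite /xsection/= !inE//=.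
- have [B mB /andP[B0 Boo]] := haar_pos_set hX.
  have [D mD /andP[D0 Doo]] := haar_pos_set hY.
  rewrite -setXTT; change ((mu \x nu)%E (setT `*` setT) != 0%E).
  rewrite product_measure1E//.
  by rewrite mule_neq0 ?(haar_neq0 hX) ?(haar_neq0 hY).
Qed.

Definition tuple_add n (s t : n.-tuple mR) : n.-tuple mR :=
  [tuple (tnth s i + tnth t i : R) | i < n].
Definition tuple_sub n (s t : n.-tuple mR) : n.-tuple mR :=
  [tuple (tnth s i - tnth t i : R) | i < n].
Definition tuple_zero n : n.-tuple mR := [tuple (0 : R) | i < n].

Lemma tuple_add_cons n (x y : mR) (s t : n.-tuple mR) :
  tuple_add (tuple_cons (x, s)) (tuple_cons (y, t)) =
  tuple_cons ((x + y : R), tuple_add s t).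
Proof.
apply: eq_from_tnth => i; rewrite tnth_mktuple.
case: (unliftP ord0 i) => [j ->|->]; last by rewrite !tnth0.
by rewrite !tnthS tnth_mktuple.
Qed.

Lemma tuple_cons_surj n (t : n.+1.-tuple mR) :
  t = tuple_cons (thead t, [tuple of behead t]).
Proof. by rewrite [LHS]tuple_eta; apply: val_inj. Qed.

Lemma tuple_haar_laws n (mu : {sigma_finite_measure set (n.-tuple mR) -> \bar R}) :
  (forall y A, measurable A -> mu ((@tuple_add n ^~ y) @^-1` A) = mu A) ->
  mu setT != 0%E ->
  is_haar (@tuple_add n) (@tuple_sub n) (tuple_zero n) mu.
Proof.
move=> inv neq0; split => //.
- apply/measurable_fun_tnthP => i.
  rewrite (_ : _ \o _ = (fun z => tnth z.1 i + tnth z.2 i : R)); last first.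
    by apply/funext => z /=; rewrite tnth_mktuple.
  by apply: (measurable_haar_add is_haar_R);
    [exact: (measurableT_comp (measurable_tnth i) measurable_fst)
    |exact: (measurableT_comp (measurable_tnth i) measurable_snd)].
- apply/measurable_fun_tnthP => i.
  rewrite (_ : _ \o _ = (fun z => tnth z.1 i - tnth z.2 i : R)); last first.
    by apply/funext => z /=; rewrite tnth_mktuple.
  by apply: (measurable_haar_sub is_haar_R);
    [exact: (measurableT_comp (measurable_tnth i) measurable_fst)
    |exact: (measurableT_comp (measurable_tnth i) measurable_snd)].
- by move=> x y; apply: eq_from_tnth => i; rewrite !tnth_mktuple addrC.
- by move=> x y; apply: eq_from_tnth => i; rewrite !tnth_mktuple addrK.
- by move=> x y; apply: eq_from_tnth => i; rewrite !tnth_mktuple subrK.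
- by move=> x y; apply: eq_from_tnth => i;
    rewrite !tnth_mktuple opprD addrCA subrr addr0 sub0r.
Qed.

Lemma is_haar_tuple n : is_haar (@tuple_add n) (@tuple_sub n) (tuple_zero n)
  (power_measure lam n).
Proof.
elim: n => [|n hn]; apply: tuple_haar_laws.
- move=> y A mA /=; rewrite (_ : _ @^-1` A = A)//.
  by apply/seteqP; split => x /=; rewrite [x]tuple0 [tuple_add _ _]tuple0.
- by rewrite /= diracT.
- move=> y A mA /=; rewrite [y]tuple_cons_surj /power_step /pushforward -comp_preimage.
  have mA' : measurable (@tuple_cons _ mR n @^-1` A).
    by apply: measurable_preimT => //; exact: measurable_tuple_cons.
  rewrite -[RHS](haar_inv (is_haar_prod is_haar_R hn) (thead y, [tuple of behead y]) mA').
  congr (sprod _ _ _); apply/seteqP; split => -[a b]/=; by rewrite tuple_add_cons.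
- rewrite /= /power_step /pushforward preimage_setT.
  exact: haar_neq0 (is_haar_prod is_haar_R hn).
Qed.

End haar_instances.

Section lebesgue_scaling.
Context (R : realType).
Local Notation mR := (measurableTypeR R).
Local Notation lam := (@lebesgue_measure R).

Lemma lebesgue_scale_pos (c : R) (A : set R) : 0 < c -> measurable A ->
  lam A = (c%:E * lam ((fun x => c * x)%R @^-1` A))%E.
Proof.
move=> c0 mA.
have mf : measurable_fun setT (fun x : mR => c * x : mR).
  exact: (@measurable_funM _ R R setT (cst c) id).
apply: (@lebesgue_measure_unique R (mscale (NngNum (ltW c0)) (pushforward lam (fun x : mR => c * x : mR)))) => //.
move=> _ [[a b]] _ <-; transitivity (c%:E * lam `](a / c)%R, (b / c)%R])%E; last first.
  congr (_ * lam _)%E; apply/seteqP; split=> x.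
    by rewrite /= !in_itv/= ltr_pdivrMr// ler_pdivlMr// mulrC.
  by rewrite /= !in_itv/= ltr_pdivrMr// ler_pdivlMr// mulrC.
rewrite !lebesgue_measure_itv/= !lte_fin ltr_pM2r ?invr_gt0//.
case: ifP => _; last by rewrite mule0.
by rewrite -!EFinB -EFinM; congr (_%:E); field; rewrite gt_eqF.
Qed.

Lemma lebesgue_integral_scale_pos (c : R) (g : mR -> \bar R) : 0 < c ->
  measurable_fun setT g -> (forall x, 0 <= g x)%E ->
  (\int[lam]_x g x = c%:E * \int[lam]_x g (c * x)%R)%E.
Proof.
move=> c0 mg g0.
have mf : measurable_fun setT (fun x : mR => c * x : mR).
  exact: (@measurable_funM _ R R setT (cst c) id).
rewrite (@eq_measure_integral _ _ _ _ (mscale (NngNum (ltW c0)) (pushforward lam (fun x : mR => c * x : mR)))).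
  rewrite ge0_integral_mscale//; congr (_ * _)%E.
  exact: (@ge0_integral_pushforward _ _ _ _ _ _ mf lam setT).
by move=> A mA _; exact: lebesgue_scale_pos.
Qed.

Lemma lebesgue_integral_opp (g : mR -> \bar R) :
  measurable_fun setT g -> (forall x, 0 <= g x)%E ->
  (\int[lam]_x g (- x)%R = \int[lam]_x g x)%E.
Proof.
move=> mg g0.
have mf : measurable_fun setT (fun x : mR => - x : mR).
  exact: (@oppr_measurable R setT).
rewrite -[LHS](@ge0_integral_pushforward _ _ _ _ _ _ mf lam setT)//.
by apply: eq_measure_integral => A mA _; exact: lebesgue_measureN.
Qed.

Lemma lebesgue_integral_shift (c : R) (g : mR -> \bar R) :
  measurable_fun setT g -> (forall x, 0 <= g x)%E ->
  (\int[lam]_x g (x + c)%R = \int[lam]_x g x)%E.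
Proof. by move=> mg g0; exact: (@haar_integral _ mR _ _ _ _ _ c g (is_haar_R R)). Qed.

Lemma lebesgue_integral_scale (c : R) (g : mR -> \bar R) : c != 0 ->
  measurable_fun setT g -> (forall x, 0 <= g x)%E ->
  (\int[lam]_x g x = `|c|%:E * \int[lam]_x g (c * x)%R)%E.
Proof.
move=> c0 mg g0; have [cp|cn] := ltP 0 c.
  by rewrite gtr0_norm//; exact: lebesgue_integral_scale_pos.
have {c0}cn : c < 0 by rewrite lt_neqAle c0.
rewrite ltr0_norm// (@lebesgue_integral_scale_pos (- c)) ?oppr_gt0//; congr (_ * _)%E.
rewrite -[RHS]lebesgue_integral_opp//.
- by apply: eq_integral => x _; rewrite mulrN mulNr.
- apply: (measurableT_comp mg).
  exact: (@measurable_funM _ R R setT (cst c) id).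
Qed.

End lebesgue_scaling.

(** * Brunn-Minkowski and Prekopa-Leindler inequalities *)

Section brunn_minkowski_line.
Context (R : realType).
Local Notation mR := (measurableTypeR R).
Local Notation lam := (@lebesgue_measure R).

Lemma lebesgue_affine_le (t b : R) (A C : set R) : 0 < t ->
  measurable A -> measurable C -> (forall a, A a -> C (t * a + b)) ->
  (t%:E * lam A <= lam C)%E.
Proof.
move=> t0 mA mC AC.
have mC' : measurable ((fun x => x + b) @^-1` C).
  apply: measurable_preimT => //.
  exact: (@measurable_funD _ R R setT id (cst b)).
rewrite -(lebesgue_shift b mC) (lebesgue_scale_pos t0 mC').
rewrite lee_pmul2l// le_measure ?inE//; last first.
  by apply: measurable_preimT => //; exact: (@measurable_funM _ R R setT (cst t) id).
Qed.

(** Cut [A] at [a], within e/2 of its supremum, and [B] at [b], within e/2 of its infimum. The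
    copies tA' + (1-t)b and ta + (1-t)B' lie in [C] on opposite sides of ta + (1-t)b, so their
    lengths add, and the cuts lose at most e. Taking [C] as a given superset avoids the
    measurability of a sum set. *)
Lemma brunn_minkowski_line (t : R) (A B C : set R) : 0 < t < 1 ->
  measurable A -> measurable B -> measurable C -> A !=set0 -> B !=set0 ->
  has_ubound A -> has_lbound B ->
  (forall a b, A a -> B b -> C (t * a + (1 - t) * b)) ->
  (t%:E * lam A + (1 - t)%:E * lam B <= lam C)%E.
Proof.
move=> /andP[t0 t1] mA mB mC A0 B0 ubA lbB ABC.
have t1' : 0 < 1 - t by rewrite subr_gt0.
apply/lee_addgt0Pr => e e0.
have e2 : 0 < e / 2 by rewrite divr_gt0.
have [a Aa aA] : exists2 a, A a & sup A - e / 2 < a.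
  by apply: sup_adherent => //; split.
have [b Bb bB] : exists2 b, B b & b < inf B + e / 2.
  by apply: inf_adherent => //; split.
pose A' := A `&` `]-oo, a]; pose B' := B `&` `]b, +oo[.
have mA' : measurable A' by exact: measurableI.
have mB' : measurable B' by exact: measurableI.
have lA : (lam A <= lam A' + (e / 2)%:E)%E.
  apply: (@le_trans _ _ (lam A' + lam `]a, sup A])%E).
    rewrite -measureU//; last 1 first.
      apply/seteqP; split => x //= -[[_]]; rewrite !in_itv/= => xa /andP[ax _].
      by move: (lt_le_trans ax xa); rewrite ltxx.
    apply: le_measure; rewrite ?inE//; first exact: measurableU.
    move=> x Ax; have [xa|ax] := leP x a; [left; split => //|right] => /=.
    by rewrite in_itv/= ax/=; exact: (ub_le_sup ubA).
  rewrite leeD2l// lebesgue_measure_itv/= lte_fin; case: ifP => _; last by rewrite lee_fin ltW.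
  by rewrite -EFinB lee_fin lerBlDr -lerBlDl ltW.
have lB : (lam B <= lam B' + (e / 2)%:E)%E.
  apply: (@le_trans _ _ (lam B' + lam `[inf B, b])%E).
    rewrite -measureU//; last 1 first.
      apply/seteqP; split => x //= -[[_]] xa; rewrite in_itv/= => /andP[_ ax].
      move: xa; rewrite /= in_itv/= andbT => xa.
      by move: (lt_le_trans xa ax); rewrite ltxx.
    apply: le_measure; rewrite ?inE//; first exact: measurableU.
    move=> x Ax; have [xa|ax] := leP x b; [right|left; split => //] => /=.
      by rewrite in_itv/= xa andbT; exact: (ge_inf lbB).
    by rewrite in_itv/= ax.
  rewrite leeD2l// lebesgue_measure_itv/= lte_fin; case: ifP => _; last by rewrite lee_fin ltW.
  by rewrite -EFinB lee_fin lerBlDl ltW.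
pose m := t * a + (1 - t) * b.
have C1 : (t%:E * lam A' <= lam (C `&` `]-oo, m]))%E.
  apply: (@lebesgue_affine_le _ ((1 - t) * b)) => //; first exact: measurableI.
  move=> x [Ax /=]; rewrite !in_itv/= => xa; split; first exact: ABC.
  by rewrite /= ?in_itv/= /m lerD2r ler_pM2l.
have C2 : ((1 - t)%:E * lam B' <= lam (C `&` `]m, +oo[))%E.
  apply: (@lebesgue_affine_le _ (t * a)) => //; first exact: measurableI.
  move=> x [Ax /=]; rewrite !in_itv/= andbT => xa; split; first by rewrite addrC; exact: ABC.
  by rewrite /= ?in_itv/= ?andbT /m addrC ltrD2r ltr_pM2l.
apply: (@le_trans _ _ (t%:E * (lam A' + (e / 2)%:E) + (1 - t)%:E * (lam B' + (e / 2)%:E)))%E.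
  by rewrite leeD// lee_pmul2l.
rewrite !muleDr ?fin_num_adde_defl// addeACA -!EFinM -EFinD -mulrDl subrKC mul1r.
rewrite leeD//; last by rewrite lee_fin [leRHS]splitr lerDl ltW.
apply: (le_trans (leeD C1 C2)); rewrite -measureU//.
- by apply: le_measure; rewrite ?inE//; [apply: measurableU; exact: measurableI|move=> x [] []].
- exact: measurableI.
- exact: measurableI.
- apply/seteqP; split => x //= -[[_]]; rewrite !in_itv/= => xa [_] /andP[ax _].
  by move: (lt_le_trans ax xa); rewrite ltxx.
Qed.

(** Truncation at 1 restricts the levels to 0 < t < 1. For a function of supremum 1 the superlevel
    sets at these levels are nonempty, as [brunn_minkowski_line] requires. *)
Lemma layer_cake1 (v : mR -> R) : measurable_fun setT v -> (forall s : R, 0 <= v s) ->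
  (\int[lam]_s (Num.min (v s) 1)%:E =
   \int[lam]_(t in `]0%R, 1%R[) lam (v @^-1` `]t, +oo[))%E.
Proof.
move=> mv v0.
pose G := [set z : mR * mR | (0 < (z.1 : R) < 1) && ((z.1 : R) < v z.2)].
have mG : measurable G.
  rewrite (_ : G = (fst @^-1` `]0, 1[) `&` (fun z : mR * mR => v z.2 - (z.1 : R)) @^-1` `]0, +oo[).
    apply: measurableI; first exact: measurable_preimT.
    apply: measurable_preimT => //.
    apply: (@measurable_funB _ (mR * mR)%type R setT) => //.
    exact: (measurableT_comp mv measurable_snd).
  apply/seteqP; split => -[x y]; rewrite /G/= !in_itv/= ?andbT subr_gt0.
    by move=> /andP[].
  by move=> [-> ->].
have mg := @measurable_indicE _ (mR * mR)%type R G mG.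
transitivity (\int[lam]_s \int[lam]_t (\1_G (t, s))%:E)%E.
  apply: eq_integral => s _.
  transitivity (lam `]0, Num.min (v s) 1[).
    rewrite lebesgue_measure_itv/= lte_fin; case: ifP.
      by rewrite -EFinB subr0.
    move=> /negbT; rewrite -leNgt => h; congr (_%:E); apply/eqP.
    by rewrite eq_le h le_min v0 ler01.
  rewrite measure_int_indic//; apply: eq_integral => x _.
  congr (_%:E); rewrite !indicE; congr ((_ : bool)%:R).
  apply/idP/idP; rewrite !inE /G /= in_itv/= lt_min.
    by move=> /and3P[-> -> ->].
  by move=> /andP[/andP[-> ->] ->].
rewrite -(fubini_tonelli (fun z : mR * mR => (\1_G z)%:E))//.
rewrite [RHS]integral_mkcond; apply: eq_integral => t _.
rewrite patchE; case: ifPn => [|]; rewrite ?inE ?notin_setE/= in_itv/=.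
  move=> t01; rewrite measure_int_indic; last exact: measurable_preimT.
  apply: eq_integral => s _; congr (_%:E); rewrite !indicE; congr ((_ : bool)%:R).
  by apply/idP/idP; rewrite !inE /G /= in_itv/= t01 andbT.
move=> /negP t01; apply: integral0_eq => s _; rewrite indicE memNset//.
by rewrite /G /= (negbTE t01).
Qed.

(* The dimension-free core of the Prekopa-Leindler and Borell-Brascamp-Lieb
   inequalities on the line: both follow by rescaling to supremum 1. *)
Lemma normalized_brunn_minkowski (t : R) (v0 v1 h : mR -> R) : 0 < t < 1 ->
  measurable_fun setT v0 -> measurable_fun setT v1 -> measurable_fun setT h ->
  (forall s : R, 0 <= v0 s <= 1) -> (forall s : R, 0 <= v1 s <= 1) ->
  (forall s : R, 0 <= h s) ->
  (forall l : R, 0 < l < 1 -> exists s, l < v0 s) ->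
  (forall l : R, 0 < l < 1 -> exists s, l < v1 s) ->
  (forall l : R, 0 < l -> exists M : R, forall s, l < v0 s -> `|s| <= M) ->
  (forall l : R, 0 < l -> exists M : R, forall s, l < v1 s -> `|s| <= M) ->
  (forall (l s0 s1 : R), 0 < l -> l < v0 s0 -> l < v1 s1 ->
     l < h (t * s0 + (1 - t) * s1)) ->
  (t%:E * \int[lam]_s (v0 s)%:E + (1 - t)%:E * \int[lam]_s (v1 s)%:E
   <= \int[lam]_s (h s)%:E)%E.
Proof.
move=> t01 mv0 mv1 mh b0 b1 hpos e0 e1 c0 c1 H.
have /andP[t0 t1] := t01; have t1' : 0 < 1 - t by rewrite subr_gt0.
have mini (v : mR -> R) : (forall s : R, 0 <= v s <= 1) -> forall s, v s = Num.min (v s) 1.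
  by move=> b s; have /andP[_ h1] := b s; rewrite (min_idPl h1).
have mlev (v : mR -> R) : measurable_fun setT v ->
    measurable_fun (`]0%R, 1%R[%classic : set mR) (fun l : mR => lam (v @^-1` `]l, +oo[)).
  move=> mv; pose G := [set z : mR * mR | (z.1 : R) < v z.2].
  have mG : measurable G.
    rewrite (_ : G = (fun z : mR * mR => v z.2 - (z.1 : R)) @^-1` `]0, +oo[).
      apply: measurable_preimT => //.
      apply: (@measurable_funB _ (mR * mR)%type R setT) => //.
      exact: (measurableT_comp mv measurable_snd).
    by apply/seteqP; split => -[x y]; rewrite /G/= in_itv/= andbT subr_gt0.
  apply: (@measurable_funTS _ _ _ _ _ _).
  have := @measurable_fun_xsection _ _ mR mR R lam G mG.
  congr measurable_fun; apply/funext => l /=; congr (lam _).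
  by apply/seteqP; split => x; rewrite /xsection /= in_itv/= andbT inE.
under eq_integral do rewrite (mini v0 b0).
under [X in (_ + _ * X <= _)%E]eq_integral do rewrite (mini v1 b1).
rewrite !layer_cake1//; try by move=> s; case/andP: (b0 s).
  apply: (@le_trans _ _ (\int[lam]_s (Num.min (h s) 1)%:E)%E); last first.
    apply: ge0_le_integral => //.
    - by move=> s _; rewrite lee_fin le_min hpos ler01.
    - by apply/measurable_EFinP; exact: measurable_minr.
    - exact/measurable_EFinP.
    - by move=> s _; rewrite lee_fin ge_min lexx.
  rewrite layer_cake1// -!ge0_integralZl//; try by [exact: mlev | exact: ltW | rewrite lee_fin ltW].
  rewrite -ge0_integralD//; try by [move=> s _; rewrite mule_ge0// lee_fin ltW | apply: emeasurable_funM => //; exact: mlev].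
  apply: ge0_le_integral => //.
  - by move=> s _; rewrite adde_ge0// mule_ge0// lee_fin ltW.
  - by apply: emeasurable_funD; apply: emeasurable_funM => //; exact: mlev.
  - exact: mlev.
  move=> l; rewrite /= in_itv/= => /andP[l0 l1].
  have lev (v : mR -> R) : (exists M : R, forall s, l < v s -> `|s| <= M) ->
      has_ubound (v @^-1` `]l, +oo[) /\ has_lbound (v @^-1` `]l, +oo[).
    move=> [M HM]; split; [exists M|exists (- M)] => x /=; rewrite in_itv/= andbT => /HM.
      exact: ler_normlW.
    by move/ler_normlP => [? _]; rewrite lerNl.
  apply: brunn_minkowski_line => //; try exact: measurable_preimT.
  - by have [s ls] := e0 l (introT andP (conj l0 l1)); exists s => /=; rewrite in_itv/= ls.
  - by have [s ls] := e1 l (introT andP (conj l0 l1)); exists s => /=; rewrite in_itv/= ls.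
  - by have [] := lev v0 (c0 l l0).
  - by have [] := lev v1 (c1 l l0).
  - by move=> a b /=; rewrite !in_itv/= !andbT; exact: H.
by move=> s; case/andP: (b1 s).
Qed.

End brunn_minkowski_line.

Section amgm.
Context (R : realType).
Implicit Types x y t : R.

Lemma amgm x y t : 0 <= x -> 0 <= y -> 0 < t < 1 ->
  x `^ t * y `^ (1 - t) <= t * x + (1 - t) * y.
Proof.
move=> x0 y0 /andP[t0 t1]; have t1' : 0 < 1 - t by rewrite subr_gt0.
have := @conjugate_powR R (x `^ t) (y `^ (1 - t)) t^-1 (1 - t)^-1
  (powR_ge0 _ _) (powR_ge0 _ _).
rewrite !invr_gt0 !invrK -!powRrM !divff ?gt_eqF// !powRr1// => H.
by rewrite mulrC [t * _]mulrC [(1 - t) * _]mulrC mulrC H// subrKC.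
Qed.

Lemma powR_inv x t : 0 <= x -> (x^-1) `^ t = (x `^ t)^-1.
Proof.
move=> x0; rewrite -powR_inv1// -powRrM mulrC powRrM powR_inv1 ?powR_ge0//.
Qed.

Lemma powR_weighted_div a b x y t : 0 < a -> 0 < b -> 0 <= x -> 0 <= y ->
  (a `^ t * b `^ (1 - t))^-1 * (x `^ t * y `^ (1 - t)) =
  (a^-1 * x) `^ t * (b^-1 * y) `^ (1 - t).
Proof.
move=> /ltW a0 /ltW b0 x0 y0.
by rewrite !powRM ?invr_ge0// !powR_inv// invfM mulrACA.
Qed.

Lemma measurable_inv : measurable_fun setT (fun x : R => x^-1).
Proof.
(* Expressed through [powR], which is measurable; at 0 both sides are 0. *)
rewrite (_ : (fun x => _) = (fun x => (x ^+ 2) `^ (- 1) * x)).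
  apply: measurable_funM => //.
  apply: (measurableT_comp (@measurable_powR R (- 1))).
  exact: exprn_measurable.
apply/funext => x; have [->|x0] := eqVneq x 0; first by rewrite invr0 mulr0.
by rewrite powR_inv1 ?sqr_ge0// expr2 invfM mulfVK.
Qed.

End amgm.

Section prekopa_leindler_line.
Context (R : realType).
Local Notation mR := (measurableTypeR R).
Local Notation lam := (@lebesgue_measure R).

Lemma le_integral_bounded (f : mR -> R) (B M : R) : 0 <= M -> 0 <= B ->
  measurable_fun setT f -> (forall s : R, 0 <= f s <= B) ->
  (forall s : R, 0 < f s -> `|s| <= M) ->
  (\int[lam]_s (f s)%:E <= (2 * M * B)%:E)%E.
Proof.
move=> M0 B0 mf fB fM.
apply: (@le_trans _ _ (\int[lam]_s (B%:E * (\1_(`[(- M)%R, M] : set mR) s)%:E))%E).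
  apply: ge0_le_integral => //.
  - by move=> s _; rewrite lee_fin; case/andP: (fB s).
  - exact/measurable_EFinP.
  - apply: emeasurable_funM => //; exact: measurable_indicE.
  move=> s _; rewrite -EFinM lee_fin indicE.
  have [/fM sM|s0] := ltP 0 (f s); last first.
    by apply: (le_trans s0); rewrite mulr_ge0.
  rewrite mem_set ?mulr1; first by case/andP: (fB s).
  by rewrite /= in_itv/= -ler_norml.
rewrite ge0_integralZl//; last exact: measurable_indicE.
rewrite -measure_int_indic//.
rewrite [X in (_ * X)%E](@lebesgue_measure_itv R `[(- M)%R, M])/= lte_fin; case: ifP => _.
  by rewrite -EFinB -EFinM lee_fin le_eqVlt; apply/orP; left; apply/eqP; ring.
by rewrite mule0 lee_fin !mulr_ge0.
Qed.

Lemma sup_normalize (f : R -> R) (B z : R) : (forall s : R, 0 <= f s <= B) -> 0 < f z ->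
    [/\ 0 < sup (range f), forall s : R, 0 <= f s / sup (range f) <= 1 &
     forall l : R, 0 < l < 1 -> exists s : R, l < f s / sup (range f)].
Proof.
move=> bf fz; have ub : has_ubound (range f).
  by exists B => _ [s _ <-]; case/andP: (bf s).
have le s : f s <= sup (range f) by apply: ub_le_sup => //; exists s.
have a0 : 0 < sup (range f) by apply: lt_le_trans (le z).
split => // [s|l /andP[l0 l1]].
  by rewrite divr_ge0 ?(ltW a0)//=; [rewrite ler_pdivrMr// mul1r|case/andP: (bf s)].
have el : 0 < (1 - l) * sup (range f) by rewrite mulr_gt0// subr_gt0.
have hs : has_sup (range f) by split => //; exists (f z), z.
have [_ [s _ <-] ls] := sup_adherent el hs.
exists s; rewrite ltr_pdivlMr//; apply: le_lt_trans ls.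
  by rewrite mulrBl mul1r opprB addrCA subrr addr0.
Qed.

(** Divide f0 and f1 by their suprema A0 and A1, and h by A0^t A1^(1-t): the pointwise hypothesis
    becomes the superlevel hypothesis of [normalized_brunn_minkowski], and the arithmetic-geometric
    mean inequality turns its weighted sum back into the product. If f0 or f1 vanishes identically,
    so does the left side. *)
Lemma prekopa_leindler_line (t B M : R) (f0 f1 h : mR -> R) : 0 < t < 1 ->
  measurable_fun setT f0 -> measurable_fun setT f1 -> measurable_fun setT h ->
  (forall s : R, 0 <= f0 s <= B) -> (forall s : R, 0 <= f1 s <= B) ->
  (forall s : R, 0 <= h s) ->
  (forall s : R, 0 < f0 s -> `|s| <= M) -> (forall s : R, 0 < f1 s -> `|s| <= M) ->
  (forall s0 s1 : R, f0 s0 `^ t * f1 s1 `^ (1 - t) <= h (t * s0 + (1 - t) * s1)) ->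
  ((fine (\int[lam]_s (f0 s)%:E) `^ t *
    fine (\int[lam]_s (f1 s)%:E) `^ (1 - t))%:E <= \int[lam]_s (h s)%:E)%E.
Proof.
move=> t01 mf0 mf1 mh b0 b1 h0 c0 c1 H; have /andP[t0 t1] := t01.
have t1' : 0 < 1 - t by rewrite subr_gt0.
have hI0 : (0 <= \int[lam]_s (h s)%:E)%E.
  by apply: integral_ge0 => s _; rewrite lee_fin.
have B0 : 0 <= B by have /andP[l1 l2] := b0 0; exact: le_trans l1 l2.
have zero (f : mR -> R) : (forall s : R, 0 <= f s) -> ~ (exists s : R, 0 < f s) ->
    (\int[lam]_s (f s)%:E = 0)%E.
  move=> fge nf; apply: integral0_eq => s _; congr (_%:E); apply/eqP.
  rewrite eq_le fge andbT leNgt; apply/negP => fs; apply: nf; by exists s.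
have [[z0 fz0]|n0] := pselect (exists s : R, 0 < f0 s); last first.
  rewrite (zero f0)// => [|s]; last by case/andP: (b0 s).
  by rewrite /= powR0 ?gt_eqF// mul0r.
have [[z1 fz1]|n1] := pselect (exists s : R, 0 < f1 s); last first.
  rewrite (zero f1)// => [|s]; last by case/andP: (b1 s).
  by rewrite /= (@powR0 _ (1 - t)) ?gt_eqF// mulr0.
have M0 : 0 <= M by apply: le_trans (c0 _ fz0).
have [a0 nb0 ex0] := sup_normalize b0 fz0.
have [a1 nb1 ex1] := sup_normalize b1 fz1.
set A0 := sup (range f0) in a0 nb0 ex0; set A1 := sup (range f1) in a1 nb1 ex1.
pose k := A0 `^ t * A1 `^ (1 - t).
have k0 : 0 < k by rewrite mulr_gt0// powR_gt0.
have mdiv (f : mR -> R) (c : R) : measurable_fun setT f -> measurable_fun setT (fun s => f s / c).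
  by move=> mf; apply: measurable_funM.
have cdiv (f : mR -> R) (c : R) : 0 < c -> (forall s : R, 0 < f s -> `|s| <= M) ->
    forall l : R, 0 < l -> exists M : R, forall s : R, l < f s / c -> `|s| <= M.
  move=> cp fM l l0; exists M => s ls; apply: fM.
  by have := lt_trans l0 ls; rewrite pmulr_lgt0// invr_gt0.
have Idiv (f : mR -> R) (c : R) : 0 < c -> measurable_fun setT f -> (forall s : R, 0 <= f s) ->
    (\int[lam]_s (f s / c)%:E = (c^-1)%:E * \int[lam]_s (f s)%:E)%E.
  move=> cp mf fge; rewrite -ge0_integralZl//.
  - by apply: eq_integral => s _; rewrite -EFinM mulrC.
  - exact/measurable_EFinP.
  - by move=> s _; rewrite lee_fin.
  - by rewrite lee_fin invr_ge0 ltW.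
have f0ge (s : R) : 0 <= f0 s by case/andP: (b0 s).
have f1ge (s : R) : 0 <= f1 s by case/andP: (b1 s).
have := @normalized_brunn_minkowski R t (fun s => f0 s / A0) (fun s => f1 s / A1)
  (fun s => h s / k) t01 (mdiv _ _ mf0) (mdiv _ _ mf1) (mdiv _ _ mh) nb0 nb1.
move=> /(_ (fun s => divr_ge0 (h0 s) (ltW k0)) ex0 ex1 (cdiv _ _ a0 c0) (cdiv _ _ a1 c1)).
(* With k = A0^t A1^(1-t) the number l k is (l A0)^t (l A1)^(1-t), which lies below f0^t
   f1^(1-t). *)
have hyp (l s0 s1 : R) : 0 < l -> l < f0 s0 / A0 -> l < f1 s1 / A1 ->
    l < h (t * s0 + (1 - t) * s1) / k.
  move=> l0 l0' l1'; rewrite ltr_pdivlMr//; apply: lt_le_trans (H s0 s1).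
  rewrite ltr_pdivlMr// in l0'; rewrite ltr_pdivlMr// in l1'.
  have -> : l * k = (l * A0) `^ t * (l * A1) `^ (1 - t).
    rewrite !powRM ?ltW// /k mulrACA -powRD ?subrKC ?powRr1 ?ltW// ?oner_eq0//.
  by apply: ltr_pM; rewrite ?powR_ge0//; apply: gt0_ltr_powR => //;
    rewrite nnegrE ?f0ge ?f1ge// mulr_ge0// ltW.
move=> /(_ hyp); rewrite (Idiv f0)// (Idiv f1)// (Idiv h)//.
have I0fin : (\int[lam]_s (f0 s)%:E)%E \is a fin_num.
  rewrite ge0_fin_numE ?integral_ge0//; last by move=> s _; rewrite lee_fin.
  by rewrite (le_lt_trans (le_integral_bounded M0 B0 mf0 b0 c0))// ltry.
have I1fin : (\int[lam]_s (f1 s)%:E)%E \is a fin_num.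
  rewrite ge0_fin_numE ?integral_ge0//; last by move=> s _; rewrite lee_fin.
  by rewrite (le_lt_trans (le_integral_bounded M0 B0 mf1 b1 c1))// ltry.
have J0 : 0 <= fine (\int[lam]_s (f0 s)%:E).
  by rewrite fine_ge0 ?integral_ge0//; move=> s _; rewrite lee_fin.
have J1 : 0 <= fine (\int[lam]_s (f1 s)%:E).
  by rewrite fine_ge0 ?integral_ge0//; move=> s _; rewrite lee_fin.
rewrite -[X in (_ * (_ * X) + _ <= _)%E]fineK// -[X in (_ + _ * (_ * X) <= _)%E]fineK//.
set x := fine _ in J0 *; set y := fine _ in J1 *.
rewrite -!EFinM -EFinD => le1.
rewrite -(@lee_pmul2l _ (k^-1)%:E) ?lte_fin ?invr_gt0//.
apply: le_trans le1; rewrite -EFinM lee_fin.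
have -> : k^-1 * (x `^ t * y `^ (1 - t)) = (A0^-1 * x) `^ t * (A1^-1 * y) `^ (1 - t).
  exact: powR_weighted_div.
by apply: amgm => //; rewrite mulr_ge0// invr_ge0 ltW.
Qed.

Lemma measurable_fine_section d (X : measurableType d)
    (m : {sigma_finite_measure set X -> \bar R}) (A : set (mR * X)) : measurable A ->
  measurable_fun setT (fun s : mR => fine (m (xsection A s))).
Proof.
move=> mA; apply: (measurableT_comp (@fine_measurable R setT measurableT)).
exact: measurable_fun_xsection.
Qed.

Definition tuple_conv n (t : R) (x y : n.-tuple mR) : n.-tuple mR :=
  [tuple (t * tnth x i + (1 - t) * tnth y i : R) | i < n].

Lemma tuple_conv_cons n (t a b : R) (x y : n.-tuple mR) :
  tuple_conv t (tuple_cons ((a : mR), x)) (tuple_cons ((b : mR), y)) =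
  tuple_cons ((t * a + (1 - t) * b : mR), tuple_conv t x y).
Proof.
apply: eq_from_tnth => i; rewrite tnth_mktuple.
case: (unliftP ord0 i) => [j ->|->]; last by rewrite !tnth0.
by rewrite !tnthS tnth_mktuple.
Qed.

(** Log-concavity of fibre volumes by induction on the fibre dimension. The parameter type [V] and
    its combination [cv] are arbitrary because the induction moves the first fibre coordinate into
    the parameter, replacing V by V * R. The volume bound is proved along with it: it makes [fine]
    harmless and supplies the bounded integrands of [prekopa_leindler_line]. *)
Theorem section_log_concave (m : nat) (V : Type) (cv : R -> V -> V -> V)
    (S : V -> set (m.-tuple mR)) (M : R) : 0 <= M ->
  (forall x, measurable (S x)) ->
  (forall x y i, S x y -> `|tnth y i : R| <= M) ->
  (forall (t : R) x0 x1 y0 y1, 0 < t < 1 -> S x0 y0 -> S x1 y1 ->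
     S (cv t x0 x1) (tuple_conv t y0 y1)) ->
  (forall x, (power_measure lam m (S x) <= ((2 * M) ^+ m)%:E)%E) /\
  (forall (t : R) x0 x1, 0 < t < 1 ->
    fine (power_measure lam m (S x0)) `^ t * fine (power_measure lam m (S x1)) `^ (1 - t)
    <= fine (power_measure lam m (S (cv t x0 x1)))).
Proof.
elim: m V cv S => [|m IHm] V cv S M0 mS bS cS; first split.
- by move=> x; rewrite expr0 /= diracE lee_fin; case: (_ \in _).
- have dE (A : set (0.-tuple mR)) : fine (power_measure lam 0 A) = ([tuple] \in A)%:R.
    by rewrite -[LHS]/(fine (@dirac _ _ [tuple] R A)) diracE.
  move=> t x0 x1 t01; have /andP[t0 t1] := t01; rewrite !dE.
  have [s0|] := boolP (_ \in S x0); last first.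
    by rewrite powR0 ?gt_eqF// mul0r.
  have [s1|] := boolP (_ \in S x1); last first.
    by rewrite (@powR0 _ (1 - t)) ?gt_eqF ?subr_gt0// mulr0.
  rewrite mem_set ?powR1 ?mulr1//.
  rewrite (_ : [tuple] = tuple_conv t ([tuple] : 0.-tuple mR) [tuple]); last first.
    by rewrite [RHS]tuple0.
  by apply: cS => //; apply: set_mem.
pose S' (z : V * R) : set (m.-tuple mR) := [set y | S z.1 (tuple_cons (z.2 : mR, y))].
pose cv' t (z w : V * R) := (cv t z.1 w.1, t * z.2 + (1 - t) * w.2).
have mT x : measurable (@tuple_cons _ mR m @^-1` S x).
  by apply: measurable_preimT => //; exact: measurable_tuple_cons.
have S'E x (s : R) : S' (x, s) = xsection (@tuple_cons _ mR m @^-1` S x) s.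
  by apply/seteqP; split => y; rewrite /xsection/= inE.
have mS' z : measurable (S' z).
  by case: z => x s; rewrite S'E; exact: measurable_xsection.
have bS' z y i : S' z y -> `|tnth y i : R| <= M.
  by move=> /bS -/(_ (lift ord0 i)); rewrite tnthS.
have cS' t x0 x1 y0 y1 : 0 < t < 1 -> S' x0 y0 -> S' x1 y1 ->
    S' (cv' t x0 x1) (tuple_conv t y0 y1).
  by move=> t01 h0 h1; rewrite /S' /=  -tuple_conv_cons; exact: cS.
have [bd lc] := IHm _ cv' S' M0 mS' bS' cS'.
pose F x (s : mR) : R := fine (power_measure lam m (S' (x, s))).
have FE x (s : R) : (F x s)%:E = power_measure lam m (S' (x, s)).
  by rewrite fineK// ge0_fin_numE// (le_lt_trans (bd _))// ltry.
have mF x : measurable_fun setT (F x).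
  rewrite /F; under eq_fun do rewrite S'E; exact: measurable_fine_section.
have bF x (s : R) : 0 <= F x s <= (2 * M) ^+ m.
  by rewrite -!lee_fin FE bd measure_ge0.
have cF x (s : R) : 0 < F x s -> `|s| <= M.
  move=> F0; apply: contrapT => /negP; rewrite -ltNge => Ms.
  suff S0 : S' (x, s) = set0 by move: F0; rewrite /F S0 measure0 ltxx.
  apply/seteqP; split => // y /bS -/(_ ord0); rewrite tnth0.
  by move/(lt_le_trans Ms); rewrite ltxx.
have PE x : power_measure lam m.+1 (S x) = (\int[lam]_s (F x s)%:E)%E.
  rewrite /= /power_step /pushforward /product_measure1 /=.
  by apply: eq_integral => s _; rewrite FE S'E.
have M2 : 0 <= (2 * M) ^+ m by rewrite exprn_ge0// mulr_ge0.
have bI x := le_integral_bounded M0 M2 (mF x) (bF x) (cF x).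
split => [x|t x0 x1 t01]; first by rewrite PE exprS.
rewrite !PE -lee_fin fineK; last first.
  rewrite ge0_fin_numE ?(le_lt_trans (bI _)) ?ltry//.
  by apply: integral_ge0 => s _; rewrite lee_fin; case/andP: (bF (cv t x0 x1) s).
apply: (@prekopa_leindler_line t ((2 * M) ^+ m) M) => //.
- by move=> s; case/andP: (bF (cv t x0 x1) s).
- exact: cF.
- exact: cF.
- by move=> s0 s1; exact: (lc t (x0, s0) (x1, s1)).
Qed.

End prekopa_leindler_line.

Lemma indic_in (T : Type) (R : pzRingType) (A : set T) x : A x -> \1_A x = 1 :> R.
Proof. by move=> Ax; rewrite indicE mem_set. Qed.

Lemma indic_notin (T : Type) (R : pzRingType) (A : set T) x : ~ A x -> \1_A x = 0 :> R.
Proof. by move=> Ax; rewrite indicE memNset. Qed.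

(** * Ball's norm *)

Section ball_line.
Context (R : realType).
Local Notation mR := (measurableTypeR R).
Local Notation lam := (@lebesgue_measure R).
Local Open Scope ereal_scope.

Lemma measurable_divR d (X : measurableType d) (f g : X -> R) :
  measurable_fun setT f -> measurable_fun setT g ->
  measurable_fun setT (fun x => (f x / g x)%R).
Proof.
move=> mf mg; apply: measurable_funM => //.
exact: (measurableT_comp (@measurable_inv R) mg).
Qed.

Let pos : set mR := `]0%R, +oo[%classic.
Let unit_itv : set mR := `]0%R, 1%R]%classic.

(* Both sides are the integral of [g (x / y) / y] over [x > 0, 0 < y <= 1]. *)
Lemma lebesgue_integral_inv (g : mR -> \bar R) : measurable_fun setT g ->
  (forall x, 0 <= g x) ->
  \int[lam]_(x in pos) g x = \int[lam]_(s in pos) ((s^-1 ^+ 2)%:E * g (s^-1)%R).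
Proof.
move=> mg g0.
have mi (A : set mR) : measurable A -> measurable_fun setT (fun x : mR => (\1_A x : R)%:E).
  by move=> mA; exact: measurable_indicE.
have mpos : measurable pos by exact: measurable_itv.
have mu : measurable unit_itv by exact: measurable_itv.
have mV : measurable_fun setT (fun x : mR => (x^-1)%:E : \bar R).
  by apply/measurable_EFinP; exact: measurable_inv.
have mV' : measurable_fun setT (fun x : mR => (x^-1)%R : mR) by exact: measurable_inv.
pose G (z : mR * mR) := (\1_pos z.1)%:E * ((\1_unit_itv z.2)%:E *
   ((z.2^-1)%:E * g (z.1 / z.2)%R)).
have mG : measurable_fun setT G.
  apply: emeasurable_funM; first exact: (measurableT_comp (mi _ mpos) measurable_fst).
  apply: emeasurable_funM; first exact: (measurableT_comp (mi _ mu) measurable_snd).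
  apply: emeasurable_funM; first exact: (measurableT_comp mV measurable_snd).
  apply: (measurableT_comp mg).
  exact: (@measurable_divR _ (mR * mR)%type fst snd measurable_fst measurable_snd).
have restr (h : mR -> \bar R) (A : set mR) : measurable A ->
    \int[lam]_(x in A) h x = \int[lam]_x ((\1_A x)%:E * h x).
  move=> mA; rewrite integral_mkcond; apply: eq_integral => x _.
  rewrite patchE indicE; case: ifP => _; by rewrite ?mul1e ?mul0e.
have V0 (y : R) : unit_itv y -> 0 <= (y^-1)%:E.
  by rewrite /unit_itv/= in_itv/= => /andP[y0 _]; rewrite lee_fin invr_ge0 ltW.
have G0 z : 0 <= G z.
  rewrite /G; have [/V0 h|h] := pselect (unit_itv z.2).
    by rewrite !mule_ge0 ?lee_fin.
  by rewrite [\1_ _ z.2]indic_notin// mul0e mule0.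
transitivity (\int[lam]_y \int[lam]_x G (x, y)).
  transitivity (\int[lam]_(y in unit_itv) \int[lam]_(x in pos) g x).
    rewrite integral_cst//= /unit_itv [X in _ * X](@lebesgue_measure_itv R `]0%R, 1%R])/=.
    by rewrite lte_fin ltr01 -EFinB subr0 mule1.
  rewrite restr//; apply: eq_integral => y _; rewrite /G/=.
  have [uy|nuy] := pselect (unit_itv y); last first.
    rewrite indic_notin// mul0e; apply/esym/integral0_eq => x _.
    by rewrite mul0e mule0.
  have [y0 y1] : (0 < y)%R /\ (y <= 1)%R.
    by move: uy; rewrite /unit_itv/= in_itv/= => /andP[].
  have mgy : measurable_fun setT (fun x : mR => g (x / y)%R).
    apply: (measurableT_comp mg).
    exact: (@measurable_funM _ R R setT id (cst y^-1)%R).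
  have mGy : measurable_fun setT (fun x : mR => (\1_pos x)%:E * ((y^-1)%:E * g (x / y)%R)).
    by apply: emeasurable_funM; [exact: mi|exact: emeasurable_funM].
  rewrite indic_in// mul1e; under [RHS]eq_integral do rewrite mul1e.
  rewrite [RHS](@lebesgue_integral_scale_pos R y)//; last first.
    by move=> x; rewrite !mule_ge0 ?lee_fin// invr_ge0 ltW.
  rewrite [LHS]restr// -ge0_integralZl//; last 3 first.
  - apply: (measurableT_comp mGy).
    exact: (@measurable_funM _ R R setT (cst y) id).
  - by move=> x _; rewrite !mule_ge0 ?lee_fin// invr_ge0 ltW.
  - by rewrite lee_fin ltW.
  apply: eq_integral => x _.
  rewrite mulrAC divff ?gt_eqF// mul1r muleCA [RHS]muleCA.
  rewrite [RHS]muleCA [y%:E * _]muleA -EFinM divff ?gt_eqF// mul1e.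
  congr ((_%:R)%:E * _); congr nat_of_bool; apply/idP/idP; rewrite !inE/= /pos/= !in_itv/= !andbT.
    by rewrite pmulr_rgt0.
  by rewrite pmulr_rgt0.
rewrite -(fubini_tonelli G)//.
(* After Tonelli, substitute y = x s for fixed x: then x / y = 1/s, and all that remains of x is the
   indicator of 0 < x <= 1/s, whose length gives the second factor 1/s. *)
pose H (z : mR * mR) := (\1_pos z.1)%:E * (\1_pos z.2)%:E * ((\1_unit_itv (z.1 * z.2)%R)%:E *
   ((z.2^-1)%:E * g (z.2^-1)%R)).
have mH : measurable_fun setT H.
  apply: emeasurable_funM.
    apply: emeasurable_funM; first exact: (measurableT_comp (mi _ mpos) measurable_fst).
    exact: (measurableT_comp (mi _ mpos) measurable_snd).
  apply: emeasurable_funM.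
    apply: (measurableT_comp (mi _ mu)).
    exact: (@measurable_funM _ (mR * mR)%type R setT fst snd measurable_fst measurable_snd).
  apply: emeasurable_funM; first exact: (measurableT_comp mV measurable_snd).
  exact: (measurableT_comp mg (measurableT_comp mV' measurable_snd)).
have H0 z : 0 <= H z.
  rewrite /H; have [h|h] := pselect (pos z.2); last first.
    by rewrite [\1_ _ z.2]indic_notin// mule0 mul0e.
  rewrite !mule_ge0 ?lee_fin// invr_ge0 ltW//.
  by move: h; rewrite /pos/= in_itv/= andbT.
transitivity (\int[lam]_x \int[lam]_y H (x, y)).
  apply: eq_integral => x _; have [px|npx] := pselect (pos x); last first.
    rewrite integral0_eq ?integral0_eq// => y _.
      by rewrite /H/= [\1_ _ x]indic_notin// !mul0e.
    by rewrite /G/= [\1_ _ x]indic_notin// mul0e.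
  have x0 : (0 < x)%R by move: px; rewrite /pos/= in_itv/= andbT.
  rewrite [LHS](@lebesgue_integral_scale_pos R x)//; last first.
    exact: (measurableT_comp mG (measurable_pair1 x)).
  rewrite -ge0_integralZl//; last 2 first.
  - apply: (measurableT_comp mG); apply: measurable_fun_pair => //.
  - by rewrite lee_fin ltW.
  apply: eq_integral => s _; rewrite /G /H/=.
  have [ps|nps] := pselect (pos s); last first.
    rewrite [\1_pos s]indic_notin// mule0 mul0e [\1_unit_itv _]indic_notin ?mul0e ?mule0//.
    apply: contra_not nps; rewrite /unit_itv /pos/= !in_itv/= andbT => /andP[+ _].
    by rewrite pmulr_rgt0.
  have s0 : (0 < s)%R by move: ps; rewrite /pos/= in_itv/= andbT.
  rewrite [\1_pos x]indic_in// [\1_pos s]indic_in// !mul1e invfM muleCA; congr (_ * _).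
  rewrite muleA -EFinM mulrA divff ?gt_eqF// mul1r.
  by [].
rewrite (fubini_tonelli H)// restr//; apply: eq_integral => s _.
have [ps|nps] := pselect (pos s); last first.
  rewrite indic_notin// mul0e; apply: integral0_eq => x _.
  by rewrite /H/= [\1_ _ s]indic_notin// mule0 mul0e.
have s0 : (0 < s)%R by move: ps; rewrite /pos/= in_itv/= andbT.
transitivity (\int[lam]_x (((s^-1)%:E * g (s^-1)%R) * (\1_(`]0%R, (s^-1)%R]%classic : set mR) x)%:E)).
  apply: eq_integral => x _; rewrite /H/= [\1_pos s]indic_in// mule1 muleA muleC; congr (_ * _); rewrite !indicE.
  rewrite -EFinM; congr (_%:E); rewrite -natrM mulnb; congr (_%:R); congr nat_of_bool.
  apply/idP/idP.
    move=> /andP[]; rewrite !inE /pos /unit_itv/= !in_itv/= !andbT => x0 /andP[_ xs].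
    by rewrite x0 -[leRHS]mul1r ler_pdivlMr.
  rewrite !inE/= in_itv/= => /andP[x0 xs]; apply/andP; split.
    by rewrite inE /pos/= in_itv/= x0.
  by rewrite inE /unit_itv/= in_itv/= mulr_gt0//= -ler_pdivlMr// mul1r.
rewrite ge0_integralZl//; last 2 first.
- exact: mi.
- by rewrite mule_ge0// lee_fin invr_ge0 ltW.
rewrite -measure_int_indic// [X in _ * X](@lebesgue_measure_itv R `]0%R, (s^-1)%R])/=.
rewrite lte_fin invr_gt0 s0 -EFinB subr0 indic_in// mul1e.
by rewrite muleC muleA -EFinM expr2.
Qed.

(** Ball's inequality interpolates radii along harmonic means. In s = 1/r these are arithmetic
    means, to which the one-dimensional Brunn-Minkowski inequality applies. The exponent collects
    s^(-2) from the substitution and s^(1-q) from r^(q-1). *)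
Lemma pos_integral_inv (q : R) (f : mR -> R) : (1 <= q)%R -> measurable_fun setT f ->
  (forall r : R, 0 <= f r)%R ->
  \int[lam]_(r in pos) (r `^ (q - 1) * f r)%:E =
  \int[lam]_s ((\1_pos s : R) * (s `^ (- (q + 1)) * f s^-1))%:E.
Proof.
move=> q1 mf f0.
pose g (r : mR) := (r `^ (q - 1) * f r)%:E.
have mg : measurable_fun setT g.
  apply/measurable_EFinP; apply: measurable_funM => //.
rewrite (lebesgue_integral_inv mg); last first.
  by move=> r; rewrite lee_fin mulr_ge0 ?powR_ge0.
rewrite integral_mkcond; apply: eq_integral => s _; rewrite patchE.
case: ifPn => sp; last first.
  by rewrite indic_notin ?mul0r//; move: sp; rewrite notin_setE.
rewrite indic_in ?mul1r -?EFinM; last by rewrite inE in sp.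
have s0 : (0 < s)%R by move: sp; rewrite inE/pos/= in_itv/= andbT.
congr (_%:E); rewrite mulrA; congr (_ * _)%R.
rewrite -powR_inv1 ?ltW// -powR_mulrn ?powR_ge0// -!powRrM -powRD.
  by congr (_ `^ _)%R; ring.
by rewrite (gt_eqF s0) implybT.
Qed.

(** The conclusion is a Borell-Brascamp-Lieb condition with exponent -1, the exponent at which that
    inequality on the line yields the minimum of two integrals. It results from two applications of
    the arithmetic-geometric mean inequality with the same weight: one to s0^q / a and s1^q / b, the
    other to 1/s0 and 1/s1. *)
Lemma ball_pointwise (q t s0 s1 a b c : R) : (0 < q -> 0 < t < 1 -> 0 < s0 -> 0 < s1 ->
  0 < a -> 0 < b ->
  let s := t * s0 + (1 - t) * s1 in
  a `^ (t * s0 / s) * b `^ (1 - t * s0 / s) <= c ->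
  (t / (s0 `^ (- (q + 1)) * a) + (1 - t) / (s1 `^ (- (q + 1)) * b))^-1
    <= s `^ (- (q + 1)) * c)%R.
Proof.
move=> q0 /andP[t0 t1] s00 s10 a0 b0 s abc.
have t1' : (0 < 1 - t)%R by rewrite subr_gt0.
have s_gt0 : (0 < s)%R by rewrite addr_gt0// mulr_gt0.
(* With this weight mu/s0 + (1 - mu)/s1 = 1/s, whence s <= s0^mu s1^(1-mu). *)
pose mu := (t * s0 / s)%R.
have mu0 : (0 < mu)%R by rewrite !mulr_gt0// invr_gt0.
have mu1E : (1 - mu = (1 - t) * s1 / s)%R.
  by rewrite /mu -{1}(@divff _ s) ?gt_eqF// -mulrBl /s addrC addKr.
have mu1 : (mu < 1)%R by rewrite -subr_gt0 mu1E !mulr_gt0// invr_gt0.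
pose X := (s0 `^ q / a)%R; pose Y := (s1 `^ q / b)%R.
have X0 : (0 < X)%R by rewrite divr_gt0// powR_gt0.
have Y0 : (0 < Y)%R by rewrite divr_gt0// powR_gt0.
have pw (z : R) : (0 < z -> z `^ (- (q + 1)) = (z * z `^ q)^-1)%R.
  move=> z0; rewrite powRN addrC powRD ?powRr1 ?ltW//.
  by rewrite (gt_eqF z0) implybT.
have E : (t / (s0 `^ (- (q + 1)) * a) + (1 - t) / (s1 `^ (- (q + 1)) * b) =
          s * (mu * X + (1 - mu) * Y))%R.
  rewrite !pw// mu1E /mu /X /Y.
  have := powR_gt0 q s00; have := powR_gt0 q s10.
  move: (s0 `^ q)%R (s1 `^ q)%R => P Q Q0 P0.
  by field; rewrite ?gt_eqF//.
have W : (X `^ mu * Y `^ (1 - mu) <= mu * X + (1 - mu) * Y)%R.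
  by apply: amgm; rewrite ?ltW// mu0.
have S : (s `^ q <= (s0 `^ mu * s1 `^ (1 - mu)) `^ q)%R.
  have p0 : (0 < s0 `^ mu * s1 `^ (1 - mu))%R by rewrite mulr_gt0 ?powR_gt0.
  apply: ge0_ler_powR; [exact: ltW|by rewrite nnegrE ltW|by rewrite nnegrE ltW|].
  have h : (s0^-1 `^ mu * s1^-1 `^ (1 - mu) <= s^-1)%R.
    have -> : (s^-1 = mu / s0 + (1 - mu) / s1)%R.
      rewrite mu1E /mu; field; rewrite ?gt_eqF//.
    by apply: amgm; rewrite ?invr_ge0 ?ltW// mu0.
  rewrite -lef_pV2 ?posrE// ?mulr_gt0 ?powR_gt0//.
  by move: h; rewrite (powR_inv _ (ltW s00)) (powR_inv _ (ltW s10)) -invfM.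
rewrite E invfM (pw _ s_gt0) invfM -[leRHS]mulrA ler_pM2l ?invr_gt0//.
have XY0 : (0 < X `^ mu * Y `^ (1 - mu))%R by rewrite mulr_gt0// powR_gt0.
apply: (@le_trans _ _ (X `^ mu * Y `^ (1 - mu))^-1%R).
  by rewrite lef_pV2 ?posrE// addr_gt0// mulr_gt0// subr_gt0.
rewrite ler_pdivlMl ?powR_gt0//.
apply: le_trans abc; rewrite -/mu.
rewrite ler_pdivrMr//.
have -> : (X `^ mu * Y `^ (1 - mu) = (s0 `^ mu * s1 `^ (1 - mu)) `^ q
   / (a `^ mu * b `^ (1 - mu)))%R.
  rewrite /X /Y !powRM ?invr_ge0 ?powR_ge0 ?ltW// !powR_inv ?ltW// invfM.
  rewrite -!powRrM ![(_ * q)%R]mulrC; ring.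
rewrite mulrCA divff ?mulr1// gt_eqF// mulr_gt0// powR_gt0//.
Qed.

Local Close Scope ereal_scope.

(** Only a common lower bound [A] is propagated, that is, quasi-concavity of the ray integral.
    Homogeneity upgrades it to subadditivity of the norm in [ball_normD]. *)
Theorem ball_line (q t A B M : R) (f0 f1 h : mR -> R) :
  1 <= q -> 0 < t < 1 -> 0 < A -> 0 <= M ->
  measurable_fun setT f0 -> measurable_fun setT f1 -> measurable_fun setT h ->
  (forall r : R, 0 <= f0 r <= B) -> (forall r : R, 0 <= f1 r <= B) ->
  (forall r : R, 0 <= h r) ->
  (forall r : R, 0 < f0 r -> r <= M) -> (forall r : R, 0 < f1 r -> r <= M) ->
  (forall s0 s1 : R, 0 < s0 -> 0 < s1 -> let s := t * s0 + (1 - t) * s1 in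
    f0 s0^-1 `^ (t * s0 / s) * f1 s1^-1 `^ (1 - t * s0 / s) <= h s^-1) ->
  (A%:E <= \int[lam]_(r in pos) (r `^ (q - 1) * f0 r)%:E)%E ->
  (A%:E <= \int[lam]_(r in pos) (r `^ (q - 1) * f1 r)%:E)%E ->
  (A%:E <= \int[lam]_(r in pos) (r `^ (q - 1) * h r)%:E)%E.
Proof.
move=> q1 t01 A0 M0 mf0 mf1 mh b0 b1 h0 c0 c1 H.
have /andP[t0 t1] := t01; have t1' : 0 < 1 - t by rewrite subr_gt0.
have q0 : 0 < q by apply: lt_le_trans q1.
have f0ge (s : R) : 0 <= f0 s by case/andP: (b0 s).
have f1ge (s : R) : 0 <= f1 s by case/andP: (b1 s).
rewrite !pos_integral_inv//.
pose U (f : mR -> R) (s : mR) := \1_pos s * (s `^ (- (q + 1)) * f s^-1).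
rewrite -!/(U _ _).
have mU f : measurable_fun setT f -> measurable_fun setT (U f).
  move=> mf; apply: measurable_funM; first by apply: measurable_indic; exact: measurable_itv.
  apply: measurable_funM; first exact: measurable_powR.
  exact: (measurableT_comp mf (@measurable_inv R)).
have B0 : 0 <= B by have /andP[l1 l2] := b0 0; exact: le_trans l1 l2.
have U0 f s : (forall r : R, 0 <= f r) -> 0 <= U f s.
  by move=> fge; rewrite /U mulr_ge0// mulr_ge0// powR_ge0.
have Upos f s : 0 < U f s -> 0 < s.
  rewrite /U; have [|ns] := pselect (pos s); first by rewrite /pos/= in_itv/= andbT.
  by rewrite indic_notin// mul0r ltxx.
have UE f s : 0 < s -> U f s = s `^ (- (q + 1)) * f s^-1.
  by move=> s0; rewrite /U indic_in ?mul1r// /pos/= in_itv/= s0.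
(* The weight s^-(q+1) is unbounded near 0, but f(1/s) vanishes once 1/s exceeds M. *)
have Ub (f : mR -> R) : (forall r : R, 0 <= f r <= B) -> (forall r : R, 0 < f r -> r <= M) ->
    forall s : R, 0 <= U f s <= M `^ (q + 1) * B.
  move=> bf cf s; have fge r : 0 <= f r by case/andP: (bf r).
  rewrite U0//=; have [us|us] := ltP 0 (U f s); last first.
    by rewrite (le_trans us)// mulr_ge0// powR_ge0.
  have s0 := Upos _ _ us; rewrite UE// in us *.
  have fs : 0 < f s^-1 by move: us; rewrite pmulr_rgt0// powR_gt0.
  have /andP[_ fB] := bf s^-1.
  apply: ler_pM => //; rewrite ?powR_ge0//.
  rewrite -mulN1r powRrM (powR_inv1 (ltW s0)).
  apply: ge0_ler_powR; rewrite ?nnegrE ?invr_ge0 ?(ltW s0) ?(cf _ fs)//.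
  by rewrite addr_ge0 ?(ltW q0).
have Uex (f : mR -> R) : (forall r : R, 0 <= f r) ->
    (A%:E <= \int[lam]_s (U f s)%:E)%E -> exists s : R, 0 < U f s.
  move=> fge; apply: contraPP => nu; apply/negP; rewrite -ltNge.
  rewrite (_ : integral _ _ _ = 0%E); first by rewrite lte_fin.
  apply: integral0_eq => s _; congr (_%:E); apply/eqP; rewrite eq_le U0// andbT leNgt.
  by apply/negP => us; apply: nu; exists s.
(* The support in s is unbounded, but the superlevel sets are not: beyond 1 the weight is at most
   1/s. *)
have Ulev (f : mR -> R) c : 0 < c -> (forall r : R, 0 <= f r <= B) ->
    forall l : R, 0 < l -> exists N : R, forall s : R, l < U f s / c -> `|s| <= N.
  move=> cp bf l l0; exists (1 + B / (l * c)) => s ls.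
  have us : l * c < U f s by rewrite -ltr_pdivlMr.
  have lc : 0 < l * c by rewrite mulr_gt0.
  have s0 : 0 < s by apply: (Upos f); exact: lt_trans us.
  rewrite gtr0_norm//; have [s1|s1] := leP s 1.
    by rewrite (le_trans s1)// lerDl divr_ge0// ltW.
  rewrite UE// in us; rewrite ler_wpDl// ler_pdivlMr//.
  have /andP[f_ge0 fB] := bf s^-1.
  rewrite -ler_pdivlMl// (le_trans (ltW us))// mulrC.
  rewrite mulrC ler_pM ?powR_ge0// powRN lef_pV2 ?posrE ?powR_gt0//.
  by rewrite -[leLHS]powRr1 ?(ltW s0)// ler_powR ?(ltW s1)// lerDr ltW.
move=> I0 I1.
have [z0 uz0] := Uex _ f0ge I0; have [z1 uz1] := Uex _ f1ge I1.
have [a0 nb0 ex0] := sup_normalize (Ub _ b0 c0) uz0.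
have [a1 nb1 ex1] := sup_normalize (Ub _ b1 c1) uz1.
set A0' := sup (range (U f0)) in a0 nb0 ex0; set A1' := sup (range (U f1)) in a1 nb1 ex1.
(* The weighted harmonic mean of the two suprema, as dictated by [ball_pointwise]. Since both
   integrals are at least A, the weighted sum of the normalised ones is at least A / k, and k
   cancels. *)
pose k := (t / A0' + (1 - t) / A1')^-1.
have ki0 : 0 < t / A0' + (1 - t) / A1' by rewrite addr_gt0// divr_gt0.
have k0 : 0 < k by rewrite invr_gt0.
have mdiv (f : mR -> R) (c : R) : measurable_fun setT f -> measurable_fun setT (fun s => f s / c).
  by move=> mf; apply: measurable_funM.
have hyp (l s0 s1 : R) : 0 < l -> l < U f0 s0 / A0' -> l < U f1 s1 / A1' ->
    l < U h (t * s0 + (1 - t) * s1) / k.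
  move=> l0 u0 u1; rewrite ltr_pdivlMr// in u0; rewrite ltr_pdivlMr// in u1.
  have lA0 : 0 < l * A0' by rewrite mulr_gt0.
  have lA1 : 0 < l * A1' by rewrite mulr_gt0.
  have v0 := lt_trans lA0 u0; have v1 := lt_trans lA1 u1.
  have s00 := Upos _ _ v0; have s10 := Upos _ _ v1.
  have ss : 0 < t * s0 + (1 - t) * s1 by rewrite addr_gt0// mulr_gt0.
  rewrite ltr_pdivlMr// (UE h)//.
  rewrite UE// in u0 v0; rewrite UE// in u1 v1.
  have fs0 : 0 < f0 s0^-1 by move: v0; rewrite pmulr_rgt0// powR_gt0.
  have fs1 : 0 < f1 s1^-1 by move: v1; rewrite pmulr_rgt0// powR_gt0.
  apply: lt_le_trans (ball_pointwise q0 t01 s00 s10 fs0 fs1 (H _ _ s00 s10)).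
  rewrite /k -[l]invrK -invfM ltf_pV2 ?posrE; last 2 first.
  - by rewrite mulr_gt0// invr_gt0.
  - by rewrite addr_gt0// divr_gt0.
  rewrite mulrDr ltrD// mulrCA ltr_pM2l// -invfM ltf_pV2 ?posrE//.
have := @normalized_brunn_minkowski R t (fun s => U f0 s / A0') (fun s => U f1 s / A1')
  (fun s => U h s / k) t01 (mdiv _ _ (mU _ mf0)) (mdiv _ _ (mU _ mf1)) (mdiv _ _ (mU _ mh)) nb0 nb1.
move=> /(_ (fun s => divr_ge0 (U0 _ s h0) (ltW k0)) ex0 ex1 (Ulev _ _ a0 b0) (Ulev _ _ a1 b1) hyp).
have Idiv (f : mR -> R) (c : R) : 0 < c -> measurable_fun setT f -> (forall s : R, 0 <= f s) ->
    (\int[lam]_s (U f s / c)%:E = (c^-1)%:E * \int[lam]_s (U f s)%:E)%E.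
  move=> cp mf fge; rewrite -ge0_integralZl//.
  - by apply: eq_integral => s _; rewrite -EFinM mulrC.
  - by apply/measurable_EFinP; exact: mU.
  - by move=> s _; rewrite lee_fin U0.
  - by rewrite lee_fin invr_ge0 ltW.
rewrite !Idiv// => le1.
rewrite -(@lee_pmul2l _ (k^-1)%:E) ?lte_fin ?invr_gt0//.
apply: le_trans le1.
apply: (@le_trans _ _ (t%:E * ((A0'^-1)%:E * A%:E) + (1 - t)%:E * ((A1'^-1)%:E * A%:E))%E).
  rewrite -!EFinM -EFinD lee_fin /k invrK mulrDl !mulrA//.
by rewrite leeD// lee_pmul2l// lee_pmul2l// lte_fin invr_gt0.
Qed.

End ball_line.

Section ball_norm.
Context (R : realType) (V : lmodType R).
Local Notation mR := (measurableTypeR R).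
Local Notation lam := (@lebesgue_measure R).
Variables (q B : R) (f : V -> R).
Hypotheses (q1 : 1 <= q).
Hypothesis mf : forall x, measurable_fun setT (fun r : mR => f (r *: x)).
Hypothesis fB : forall x, 0 <= f x <= B.
Hypothesis f_supp : forall x, x != 0 ->
  exists2 M : R, 0 <= M & forall r : R, 0 < f (r *: x) -> `|r| <= M.
Hypothesis f_pos : forall x, exists e c : R,
  [/\ 0 < e, 0 < c & forall r : R, 0 < r <= e -> c <= f (r *: x)].
Hypothesis f_logc : forall (t : R) x y, 0 < t < 1 ->
  f x `^ t * f y `^ (1 - t) <= f (t *: x + (1 - t) *: y).

Let pos : set mR := `]0%R, +oo[%classic.

Definition ray_integral (x : V) : \bar R :=
  (\int[lam]_(r in pos) (r `^ (q - 1) * f (r *: x))%:E)%E.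

Let q0 : 0 < q. Proof. exact: lt_le_trans q1. Qed.

Let mpos : measurable pos. Proof. exact: measurable_itv. Qed.

Let mint x : measurable_fun setT (fun r : mR => (r `^ (q - 1) * f (r *: x))%:E).
Proof.
by apply/measurable_EFinP; apply: measurable_funM => //; exact: measurable_powR.
Qed.

Let int_ge0 x (r : R) : (0 <= (r `^ (q - 1) * f (r *: x))%:E)%E.
Proof. by rewrite lee_fin mulr_ge0 ?powR_ge0//; case/andP: (fB (r *: x)). Qed.

Lemma ray_integralZ (c : R) x : 0 < c ->
  ray_integral (c *: x) = ((c `^ (- q))%:E * ray_integral x)%E.
Proof.
move=> c0; pose G := (fun r : mR => (r `^ (q - 1) * f (r *: x))%:E) \_ pos.
have mG : measurable_fun setT G.
  by apply/(measurable_restrictT _ mpos)/measurable_funTS; exact: mint.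
have G0 r : (0 <= G r)%E.
  by rewrite /G patchE; case: ifP => // _; exact: int_ge0.
have mGc : measurable_fun setT (fun r : mR => G (c * r)).
  apply: (measurableT_comp mG).
  exact: (@measurable_funM _ R R setT (cst c) id).
have -> : ray_integral x = (c%:E * \int[lam]_r G (c * r)%R)%E.
  by rewrite -lebesgue_integral_scale_pos// /ray_integral integral_mkcond.
have cE : c `^ (- q) * c = c `^ (1 - q).
  by rewrite -{2}(powRr1 (ltW c0)) -powRD ?(gt_eqF c0) ?implybT// addrC.
rewrite muleA -EFinM cE -ge0_integralZl//; last by rewrite lee_fin powR_ge0.
rewrite /ray_integral [LHS]integral_mkcond; apply: eq_integral => r _.
rewrite /G !patchE.
have -> : (c * r \in pos) = (r \in pos).
  by apply/idP/idP; rewrite !inE /pos/= !in_itv/= !andbT pmulr_rgt0.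
case: ifPn => [|_]; last by rewrite mule0.
rewrite inE /pos/= in_itv/= andbT => r0.
rewrite -EFinM scalerA [r * c]mulrC mulrA; congr (_ * _)%:E.
rewrite powRM ?(ltW c0) ?(ltW r0)// mulrA -powRD; last by rewrite (gt_eqF c0) implybT.
by rewrite (_ : 1 - q + (q - 1) = 0); [rewrite powRr0 mul1r|ring].
Qed.

Lemma ray_integral_gt0 x : (0 < ray_integral x)%E.
Proof.
have [e [c [e0 c0 ec]]] := f_pos x.
have e2 : 0 < e / 2 by rewrite divr_gt0.
have e2e : e / 2 < e by rewrite gtr_pMr ?invf_lt1 ?ltr1n.
have step1 : (0 < \int[lam]_(r in (`[(e / 2)%R, e]%classic : set mR)) ((e / 2) `^ (q - 1) * c)%:E)%E.
  rewrite integral_cst//= [X in (_ * X)%E](@lebesgue_measure_itv R `[(e / 2)%R, e])/= lte_fin e2e.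
  rewrite -EFinB -EFinM lte_fin mulr_gt0 ?mulr_gt0 ?powR_gt0//.
  by rewrite subr_gt0.
apply: (lt_le_trans step1).
apply: (@le_trans _ _ (\int[lam]_(r in (`[(e / 2)%R, e]%classic : set mR)) (r `^ (q - 1) * f (r *: x))%:E)%E).
  apply: ge0_le_integral => //.
  - by move=> r _; rewrite lee_fin mulr_ge0 ?powR_ge0// ltW.
  - by apply: measurable_funTS; exact: mint.
  - move=> r /=; rewrite in_itv/= => /andP[er re].
    have r0 : 0 < r := lt_le_trans e2 er.
    rewrite lee_fin ler_pM ?powR_ge0 ?(ltW c0)//; last by rewrite ec ?r0.
    by apply: ge0_ler_powR; rewrite ?nnegrE ?subr_ge0 ?(ltW e2) ?(ltW r0).
apply: ge0_subset_integral => //.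
- by apply: measurable_funTS; exact: mint.
- move=> r; rewrite /pos/= !in_itv/= andbT => /andP[er _].
  by apply: lt_le_trans er; rewrite divr_gt0.
Qed.

Lemma ray_integral_lty x : x != 0 -> (ray_integral x < +oo)%E.
Proof.
move=> x0; have [M M0 fM] := f_supp x0.
have B0 : 0 <= B by have /andP[l1 l2] := fB 0; exact: le_trans l1 l2.
rewrite /ray_integral integral_mkcond.
pose g (r : mR) : R := \1_pos r * (r `^ (q - 1) * f (r *: x)).
have g0 (r : R) : 0 <= g r.
  by rewrite /g mulr_ge0// -lee_fin int_ge0.
under eq_integral do rewrite patchE.
rewrite (eq_integral (fun r => (g r)%:E)); last first.
  move=> r _; case: ifPn => [|]; first by rewrite inE => rp; rewrite /g indic_in// mul1r.
  by rewrite notin_setE => rp; rewrite /g indic_notin// mul0r.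
apply: (@le_lt_trans _ _ (2 * M * (M `^ (q - 1) * B))%:E); last by rewrite ltry.
have supp (r : R) : 0 < g r -> 0 < r /\ 0 < f (r *: x).
  rewrite /g; have [rp|rp] := pselect (pos r); last by rewrite indic_notin// mul0r ltxx.
  have r0 : 0 < r by move: rp; rewrite /pos/= in_itv/= andbT.
  by rewrite indic_in// mul1r pmulr_rgt0 ?powR_gt0.
apply: le_integral_bounded => //.
- by rewrite mulr_ge0// powR_ge0.
- apply: measurable_funM; first by apply: measurable_indic; exact: measurable_itv.
  by apply: measurable_funM => //; exact: measurable_powR.
- move=> r; rewrite g0/=; have [gr|gr] := ltP 0 (g r); last first.
    by rewrite (le_trans gr)// mulr_ge0// powR_ge0.
  have [r0 fr] := supp _ gr; rewrite /g indic_in ?mul1r; last by rewrite /pos/= in_itv/= r0.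
  have /andP[f1 f2] := fB (r *: x); rewrite ler_pM ?powR_ge0//.
  apply: ge0_ler_powR; rewrite ?nnegrE ?subr_ge0 ?(ltW r0)//.
  by rewrite -(gtr0_norm r0) fM.
- by move=> r /supp[r0 fr]; exact: fM.
Qed.

(** Ball's norm, sublinear but not symmetric unless f is even. At 0 the integrand is r^(q-1) f(0)
    with f(0) > 0, so the ray integral diverges; hence the separate case. *)
Definition ball_norm (x : V) : R :=
  if x == 0 then 0 else fine (ray_integral x) `^ (- q^-1).

Lemma ball_norm_ge0 x : 0 <= ball_norm x.
Proof. by rewrite /ball_norm; case: ifP => // _; exact: powR_ge0. Qed.

Lemma ball_norm0 : ball_norm 0 = 0.
Proof. by rewrite /ball_norm eqxx. Qed.

Lemma ball_norm_gt0 x : x != 0 -> 0 < ball_norm x.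
Proof.
move=> x0; rewrite /ball_norm (negbTE x0) powR_gt0//.
by rewrite fine_gt0// ray_integral_gt0 ray_integral_lty.
Qed.

Lemma ray_integral_fin x : x != 0 -> ray_integral x \is a fin_num.
Proof.
by move=> x0; rewrite ge0_fin_numE ?ray_integral_lty// ltW// ray_integral_gt0.
Qed.

Lemma ray_integralE x : x != 0 -> ray_integral x = (ball_norm x `^ (- q))%:E.
Proof.
move=> x0; rewrite /ball_norm (negbTE x0) -powRrM mulrNN mulVf ?gt_eqF//.
by rewrite powRr1 ?fineK ?ray_integral_fin// fine_ge0// ltW// ray_integral_gt0.
Qed.

Lemma ball_normZ (c : R) x : 0 <= c -> ball_norm (c *: x) = c * ball_norm x.
Proof.
rewrite le_eqVlt => /predU1P[<-|c0]; first by rewrite scale0r ball_norm0 mul0r.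
have [->|x0] := eqVneq x 0; first by rewrite scaler0 ball_norm0 mulr0.
rewrite /ball_norm scaler_eq0 (negbTE x0) (gt_eqF c0)/= ray_integralZ//.
rewrite fineM ?ray_integral_fin//= powRM ?powR_ge0//; last first.
  by rewrite fine_ge0// ltW// ray_integral_gt0.
by rewrite -powRrM mulrNN divff ?gt_eqF// powRr1// ltW.
Qed.

(** For s = t s0 + (1-t) s1 the point (t x + (1-t) y)/s is the convex combination of x/s0 and y/s1
    with weights t s0/s and (1-t) s1/s, so log-concavity of f is precisely the hypothesis of
    [ball_line]. *)
Lemma ray_integral_quasiconcave (t : R) x y : 0 < t < 1 -> x != 0 -> y != 0 ->
  (1 <= ray_integral x)%E -> (1 <= ray_integral y)%E ->
  (1 <= ray_integral (t *: x + (1 - t) *: y))%E.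
Proof.
move=> t01 x0 y0 Ix Iy; have /andP[t0 t1] := t01.
have [M M0 fM] := f_supp x0; have [N N0 fN] := f_supp y0.
apply: (@ball_line R q t 1 B (Num.max M N) (fun r => f (r *: x)) (fun r => f (r *: y))) => //.
- by rewrite le_max M0.
- by move=> r; case/andP: (fB (r *: (t *: x + (1 - t) *: y))).
- by move=> r /fM h; rewrite le_max (le_trans (ler_norm r) h).
- by move=> r /fN h; rewrite le_max (le_trans (ler_norm r) h) orbT.
move=> s0 s1 s00 s10 /=; set s := t * s0 + (1 - t) * s1.
have s_gt0 : 0 < s by rewrite addr_gt0// mulr_gt0// subr_gt0.
have mu1E : 1 - t * s0 / s = (1 - t) * s1 / s.
  by rewrite -{1}(@divff _ s) ?gt_eqF// -mulrBl /s addrC addKr.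
have -> : s^-1 *: (t *: x + (1 - t) *: y) =
    (t * s0 / s) *: (s0^-1 *: x) + (1 - t * s0 / s) *: (s1^-1 *: y).
  have d (a b : R) : 0 < b -> s^-1 * a = a * b / s / b.
    by move=> b0; field; rewrite !gt_eqF.
  by rewrite mu1E scalerDr !scalerA (d t s0)// (d (1 - t) s1).
apply: f_logc; rewrite !mulr_gt0 ?invr_gt0//= -subr_gt0 mu1E !mulr_gt0 ?invr_gt0//.
by rewrite subr_gt0.
Qed.

(** With a and b the norms of x and y, the vectors x/a and y/b have ray integral 1. Their
    combination with weights a/(a+b) and b/(a+b) is (x+y)/(a+b), whose ray integral is then at least
    1, so its norm is at most 1. *)
Lemma ball_normD x y : ball_norm (x + y) <= ball_norm x + ball_norm y.
Proof.
have [->|x0] := eqVneq x 0; first by rewrite add0r ball_norm0 add0r.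
have [->|y0] := eqVneq y 0; first by rewrite addr0 ball_norm0 addr0.
have [xy0|xy0] := eqVneq (x + y) 0.
  by rewrite xy0 ball_norm0 addr_ge0// ball_norm_ge0.
have unit z : z != 0 -> exists c : R, [/\ 0 < c, c = ball_norm z, c^-1 *: z != 0 &
    ray_integral (c^-1 *: z) = 1%E].
  move=> z0; have nz := ball_norm_gt0 z0.
  exists (ball_norm z); have z'0 : (ball_norm z)^-1 *: z != 0.
    by rewrite scaler_eq0 negb_or z0 invr_eq0 gt_eqF.
  split => //; rewrite ray_integralE// ball_normZ ?invr_ge0 ?(ltW nz)//.
  by rewrite mulVf ?gt_eqF// powR1.
have [a [a0 aE x'0 Ix]] := unit x x0.
have [b [b0 bE y'0 Iy]] := unit y y0.
have [c [c0 cE _ _]] := unit _ xy0.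
rewrite -aE -bE -cE.
have ab : 0 < a + b by rewrite addr_gt0.
have t01 : 0 < a / (a + b) < 1 by rewrite divr_gt0//= ltr_pdivrMr// mul1r ltrDl.
have := ray_integral_quasiconcave t01 x'0 y'0; rewrite Ix Iy lexx => /(_ isT isT).
have -> : (a / (a + b)) *: (a^-1 *: x) + (1 - a / (a + b)) *: (b^-1 *: y) =
    (a + b)^-1 *: (x + y).
  have h1 : a / (a + b) * a^-1 = (a + b)^-1 by field; rewrite !gt_eqF.
  have h2 : (1 - a / (a + b)) * b^-1 = (a + b)^-1 by field; rewrite !gt_eqF.
  by rewrite !scalerA h1 h2 scalerDr.
rewrite ray_integralE ?scaler_eq0 ?negb_or ?xy0 ?invr_eq0 ?(gt_eqF ab)//.
rewrite ball_normZ ?invr_ge0 ?(ltW ab)// -cE lee_fin => h.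
rewrite leNgt; apply/negP => abc.
move: h; rewrite leNgt => /negP; apply.
rewrite powRN invf_lt1 ?powR_gt0 ?mulr_gt0 ?invr_gt0//.
have := @gt0_ltr_powR R q q0 1 ((a + b)^-1 * c); rewrite powR1; apply.
- by rewrite nnegrE.
- by rewrite nnegrE mulr_ge0 ?invr_ge0 ?(ltW ab) ?(ltW c0).
- by rewrite ltr_pdivlMl// mulr1.
Qed.

End ball_norm.

(** * Supporting functionals of a sublinear function *)

Section hahn_banach.
Context (R : realType).

Section step.
Context (V : lmodType R).
Variable p : V -> R.
Hypothesis pD : forall x y, p (x + y) <= p x + p y.
Hypothesis pZ : forall (c : R) x, 0 <= c -> p (c *: x) = c * p x.

(* Forces equality in [- p y <= p (- y)] while staying sublinear and below [p]. *)
Definition sublinear_shrink (y x : V) : R :=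
  inf [set p (x + t *: y) - t * p y | t in [set t : R | 0 <= t]].

Let p0 : p 0 = 0. Proof. by rewrite -(scale0r 0) pZ// mul0r. Qed.

Let shrink_lb y x (t : R) : 0 <= t -> - p (- x) <= p (x + t *: y) - t * p y.
Proof.
move=> t0; rewrite lerBrDr -pZ// addrC lerBlDr.
by rewrite (le_trans _ (pD _ _))// [x + _]addrC addrK.
Qed.

Let shrink_has_inf y x :
  has_inf [set p (x + t *: y) - t * p y | t in [set t : R | 0 <= t]].
Proof.
split; first by exists (p (x + 0 *: y) - 0 * p y), 0 => /=.
by exists (- p (- x)) => _ [t /= t0 <-]; exact: shrink_lb.
Qed.

Lemma shrink_le y x (t : R) : 0 <= t -> sublinear_shrink y x <= p (x + t *: y) - t * p y.
Proof. by move=> t0; apply: ge_inf; [exact: (shrink_has_inf _ _).2|exists t]. Qed.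

Lemma shrink_le_id y x : sublinear_shrink y x <= p x.
Proof. by have := shrink_le y x (lexx 0); rewrite scale0r addr0 mul0r subr0. Qed.

Lemma shrinkD y x x' :
  sublinear_shrink y (x + x') <= sublinear_shrink y x + sublinear_shrink y x'.
Proof.
apply/ler_addgt0Pr => e e0; have e2 : 0 < e / 2 by rewrite divr_gt0.
have [_ [t /= t0 <-] ht] := inf_adherent e2 (shrink_has_inf y x).
have [_ [s /= s0 <-] hs] := inf_adherent e2 (shrink_has_inf y x').
apply: (@le_trans _ _ ((p (x + t *: y) - t * p y) + (p (x' + s *: y) - s * p y))).
  apply: (le_trans (shrink_le y (x + x') (addr_ge0 t0 s0))).
  have := pD (x + t *: y) (x' + s *: y).
  rewrite scalerDl addrACA mulrDl; lra.
rewrite -/(sublinear_shrink y x) in ht; rewrite -/(sublinear_shrink y x') in hs.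
lra.
Qed.

Lemma shrinkZ y (c : R) x : 0 <= c -> sublinear_shrink y (c *: x) = c * sublinear_shrink y x.
Proof.
have le (d : R) z : 0 < d -> sublinear_shrink y (d *: z) <= d * sublinear_shrink y z.
  move=> d0; rewrite -ler_pdivrMl//; apply: lb_le_inf; first exact: (shrink_has_inf _ _).1.
  move=> _ [t /= t0 <-]; rewrite ler_pdivrMl//.
  have -> : d * (p (z + t *: y) - t * p y) = p (d *: z + (d * t) *: y) - (d * t) * p y.
    by rewrite mulrBr -(pZ _ (ltW d0)) scalerDr scalerA mulrA.
  by apply: shrink_le; rewrite mulr_ge0// ltW.
rewrite le_eqVlt => /predU1P[<-|c0].
  rewrite scale0r mul0r; apply/eqP; rewrite eq_le; apply/andP; split.
    by rewrite (le_trans (shrink_le_id _ _))// p0.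
  apply: lb_le_inf; first exact: (shrink_has_inf _ _).1.
  by move=> _ [t /= t0 <-]; rewrite add0r pZ// subrr.
apply/eqP; rewrite eq_le le//= -ler_pdivlMl//.
have := le c^-1 (c *: x); rewrite scalerA mulVf ?gt_eqF// scale1r; apply.
by rewrite invr_gt0.
Qed.

Lemma shrink_opp y : sublinear_shrink y (- y) <= - p y.
Proof.
have := shrink_le y (- y) (ler01 : 0 <= (1 : R)).
by rewrite scale1r addNr p0 mul1r sub0r.
Qed.

End step.

(** In finite dimension finitely many shrinkings suffice: one at x0, then one at each basis vector.
    Shrinking only lowers the function, so g(-x0) <= -p(x0) survives the later ones. A sublinear
    function that is odd on the basis is bounded above by its linear interpolation there, and
    applying this to -x gives equality. *)
Lemma hahn_banach_rV k (p : 'rV[R]_k -> R) (x0 : 'rV[R]_k) :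
  (forall x y : 'rV[R]_k, p (x + y) <= p x + p y) ->
  (forall (c : R) (x : 'rV[R]_k), 0 <= c -> p (c *: x) = c * p x) ->
  exists2 l : 'rV[R]_k, (forall x : 'rV[R]_k, \sum_i l 0 i * x 0 i <= p x) &
    \sum_i l 0 i * x0 0 i = p x0.
Proof.
move=> pD pZ.
have [g [gD gZ gp godd]] : exists g : 'rV[R]_k -> R,
    [/\ forall x y : 'rV[R]_k, g (x + y) <= g x + g y,
        forall (c : R) (x : 'rV[R]_k), 0 <= c -> g (c *: x) = c * g x,
        forall x, g x <= p x &
        g (- x0) <= - p x0 /\ forall i, g (- delta_mx 0 i) <= - g (delta_mx 0 i)].
  suff [g [gD gZ gp godd gi]] : exists g : 'rV[R]_k -> R,
    [/\ forall x y : 'rV[R]_k, g (x + y) <= g x + g y,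
        forall (c : R) (x : 'rV[R]_k), 0 <= c -> g (c *: x) = c * g x,
        forall x, g x <= p x,
        g (- x0) <= - p x0 &
        forall i, i \in enum 'I_k -> g (- delta_mx 0 i) <= - g (delta_mx 0 i)].
    exists g; split => //; split => // i; apply: gi; exact: mem_enum.
  elim: (enum 'I_k) => [|j s [g [gD gZ gp godd gi]]].
    exists (sublinear_shrink p x0); split => //.
    - by move=> x y; exact: shrinkD.
    - by move=> c x c0; exact: shrinkZ.
    - by move=> x; exact: shrink_le_id.
    - exact: shrink_opp.
  exists (sublinear_shrink g (delta_mx 0 j)); split.
  - by move=> x y; exact: shrinkD.
  - by move=> c x c0; exact: shrinkZ.
  - by move=> x; rewrite (le_trans (shrink_le_id _ _ _ _)).
  - by rewrite (le_trans (shrink_le_id _ _ _ _)).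
  - move=> i; rewrite inE => /predU1P[->|/gi gi'].
      by rewrite (le_trans (shrink_opp _ _ _))// lerN2 shrink_le_id.
    by rewrite (le_trans (shrink_le_id _ _ _ _))// (le_trans gi')// lerN2 shrink_le_id.
have g0 : g 0 = 0 by rewrite -(scale0r 0) gZ// mul0r.
pose l : 'rV[R]_k := \row_i g (delta_mx 0 i).
have gsum (s : seq 'I_k) (F : 'I_k -> 'rV[R]_k) : g (\sum_(i <- s) F i) <= \sum_(i <- s) g (F i).
  elim: s => [|i s IH]; first by rewrite !big_nil g0.
  by rewrite !big_cons (le_trans (gD _ _))// lerD2l.
have [go1 go2] := godd.
have gi (c : R) i : g (c *: delta_mx 0 i) <= c * g (delta_mx 0 i).
  have [c0|c0] := leP 0 c; first by rewrite gZ.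
  rewrite -[c]opprK scaleNr -scalerN gZ ?oppr_ge0 ?(ltW c0)//.
  by rewrite [leRHS]mulNr -mulrN ler_wpM2l ?go2// oppr_ge0 ltW.
have gle (x : 'rV[R]_k) : g x <= \sum_i l 0 i * x 0 i.
  rewrite {1}[x]row_sum_delta (le_trans (gsum _ _))//.
  by apply: ler_sum => i _; rewrite mxE mulrC gi.
have lN (x : 'rV[R]_k) : \sum_i l 0 i * (- x) 0 i = - \sum_i l 0 i * x 0 i.
  by rewrite -sumrN; apply: eq_bigr => i _; rewrite [(- x) 0 i]mxE mulrN.
have lg (x : 'rV[R]_k) : \sum_i l 0 i * x 0 i <= g x.
  have := gle (- x); rewrite lN => h.
  have : 0 <= g x + g (- x) by rewrite -g0 -[X in g X](subrr x) gD.
  lra.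
exists l => [x|]; first by rewrite (le_trans (lg x)).
apply/eqP; rewrite eq_le (le_trans (lg x0))//=.
have := gle (- x0); have := lg (- x0); rewrite lN; lra.
Qed.

End hahn_banach.

(** * Linear coordinates and product measures *)

Section rows.
Context (R : realType).
Local Notation mR := (measurableTypeR R).
Local Notation lam := (@lebesgue_measure R).

(** Tuples carry the product sigma-algebra and the Haar measure, rows carry the linear algebra;
    [row_of] and [tuple_of] are the additive bijections between them. *)
Definition row_of k (t : k.-tuple mR) : 'rV[R]_k := \row_i (tnth t i : R).
Definition tuple_of k (x : 'rV[R]_k) : k.-tuple mR := [tuple (x 0 i : mR) | i < k].

Lemma row_ofK k : cancel (@row_of k) (@tuple_of k).
Proof. by move=> t; apply: eq_from_tnth => i; rewrite tnth_mktuple mxE. Qed.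

Lemma tuple_ofK k : cancel (@tuple_of k) (@row_of k).
Proof. by move=> x; apply/rowP => i; rewrite mxE tnth_mktuple. Qed.

Lemma row_ofD k (s t : k.-tuple mR) : row_of (tuple_add s t) = row_of s + row_of t.
Proof. by apply/rowP => i; rewrite !mxE tnth_mktuple. Qed.

Lemma tuple_ofD k (x y : 'rV[R]_k) : tuple_of (x + y) = tuple_add (tuple_of x) (tuple_of y).
Proof. by apply: eq_from_tnth => i; rewrite !tnth_mktuple mxE. Qed.

Lemma measurable_tuple_of d (X : measurableType d) k (f : X -> 'rV[R]_k) :
  (forall i, measurable_fun setT (fun x => f x 0 i)) ->
  measurable_fun setT (fun x => tuple_of (f x)).
Proof.
move=> mf; apply/measurable_fun_tnthP => i.
rewrite (_ : _ \o _ = (fun x => f x 0 i)); first exact: mf.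
by apply/funext => x /=; rewrite tnth_mktuple.
Qed.

Lemma measurable_row_mulmx d (X : measurableType d) k N (f : X -> 'rV[R]_k) (A : 'M[R]_(k, N)) i :
  (forall i, measurable_fun setT (fun x => f x 0 i)) ->
  measurable_fun setT (fun x => (f x *m A) 0 i).
Proof.
move=> mf; under eq_fun do rewrite mxE.
apply: measurable_sum => j; exact: measurable_funM.
Qed.

Lemma measurable_row_of d (X : measurableType d) k (f : X -> k.-tuple mR) i :
  measurable_fun setT f -> measurable_fun setT (fun x => row_of (f x) 0 i).
Proof.
move=> mf; under eq_fun do rewrite mxE.
exact: (measurableT_comp (measurable_tnth i) mf).
Qed.

Lemma integral_tuple_cons n (g : n.+1.-tuple mR -> \bar R) : measurable_fun setT g ->
  (forall t, 0 <= g t)%E ->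
  (\int[power_measure lam n.+1]_t g t =
   \int[lam]_s \int[power_measure lam n]_t g (tuple_cons (s, t)))%E.
Proof.
move=> mg g0.
have mc := @measurable_tuple_cons _ mR n.
rewrite /= /power_step.
rewrite (@ge0_integral_pushforward _ _ _ _ _ _ mc (lam \x power_measure lam n)%E setT)//.
rewrite preimage_setT fubini_tonelli1//.
- exact: measurableT_comp.
- by move=> z; exact: g0.
Qed.

Lemma integral_tuple0 (g : 0.-tuple mR -> \bar R) :
  (\int[power_measure lam 0]_t g t = g [tuple])%E.
Proof.
rewrite /= integral_dirac// ?diracT ?mul1e//.
move=> _ A mA; rewrite setTI; have [gA|gA] := pselect (A (g [tuple])).
  rewrite (_ : _ @^-1` _ = setT) //; apply/seteqP; split => // t _.
  by rewrite /= [t]tuple0.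
rewrite (_ : _ @^-1` _ = set0) //; apply/seteqP; split => // t.
by rewrite /= [t]tuple0.
Qed.

Definition cube m (d : R) : set (m.-tuple mR) :=
  [set y | forall i, `|tnth y i : R| <= d].
Arguments cube : clear implicits.

Lemma measurable_cube m d : measurable (cube m d).
Proof.
rewrite (_ : cube m d = \bigcap_(i in [set: 'I_m])
    ((fun y : m.-tuple mR => tnth y i) @^-1` `[(- d)%R, d])); last first.
  apply/seteqP; split => y h i; first by move=> _ /=; rewrite in_itv/= -ler_norml.
  by have := h i I; rewrite /= in_itv/= -ler_norml.
apply: fin_bigcap_measurable => // i _.
by apply: measurable_preimT => //; exact: measurable_tnth.
Qed.

Lemma cube_measure_gt0 m (d : R) : 0 < d -> (0 < power_measure lam m (cube m d))%E.
Proof.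
move=> d0; elim: m => [|m IHm].
  rewrite (_ : cube 0 d = setT) /=; first by rewrite diracT.
  by apply/seteqP; split => // y _ [].
rewrite /= /power_step /pushforward.
rewrite (_ : _ @^-1` _ = `[(- d)%R, d]%classic `*` cube m d).
  rewrite product_measure1E ?mule_gt0//; last exact: measurable_cube.
  rewrite [X in (_ < X)%E](@lebesgue_measure_itv R `[(- d)%R, d])/= lte_fin.
  by rewrite gtrN// -EFinB lte_fin opprK addr_gt0.
apply/seteqP; split => -[s y] /=.
  move=> h; split; first by have := h ord0; rewrite tnth0 in_itv/= -ler_norml.
  by move=> i; have := h (lift ord0 i); rewrite tnthS.
rewrite in_itv/= -ler_norml => -[hs hy] i.
by case: (unliftP ord0 i) => [j ->|->]; rewrite ?tnthS ?tnth0.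
Qed.

(** Since A Q = 1, the matrix D = 1 - Q A is a projection. Its full-rank factorisation D = P B
    supplies the missing coordinates, and the four identities are those of a decomposition into
    complementary subspaces. *)
Lemma frame_complement N k (A : 'M[R]_(k, N)) (Q : 'M[R]_(N, k)) : A *m Q = 1%:M ->
  exists m (B : 'M[R]_(m, N)) (P : 'M[R]_(N, m)),
  [/\ B *m Q = 0, A *m P = 0, B *m P = 1%:M & Q *m A + P *m B = 1%:M].
Proof.
move=> AQ; pose D := 1%:M - Q *m A.
have DD : D *m D = D.
  rewrite /D mulmxBl mul1mx mulmxBr mulmx1 mulmxA -(mulmxA Q A Q) AQ mulmx1.
  by rewrite subrr subr0.
exists (\rank D), (row_base D), (col_base D).
have PB : col_base D *m row_base D = D by exact: mulmx_base.
have injP := row_full_inj (col_base_full D).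
have injB := row_free_inj (row_base_free D).
split.
- apply: injP; rewrite mulmxA PB mulmx0 /D mulmxBl mul1mx -mulmxA AQ mulmx1 subrr//.
- apply: injB; rewrite -mulmxA PB mul0mx /D mulmxBr mulmx1 mulmxA AQ mul1mx subrr//.
- apply: injP; apply: injB; rewrite mulmx1 PB.
  by rewrite -mulmxA -[row_base D *m _ *m _]mulmxA PB mulmxA PB DD.
- by rewrite PB /D addrC subrK.
Qed.

(** The frame makes w -> (w Q, w P) an additive bijection, so [haar_transfer] and Tonelli apply; c
    absorbs the Jacobian. *)
Lemma frame_integral N k m (A : 'M[R]_(k, N)) (B : 'M[R]_(m, N)) (Q : 'M[R]_(N, k))
    (P : 'M[R]_(N, m)) : A *m Q = 1%:M -> B *m Q = 0 -> A *m P = 0 -> B *m P = 1%:M ->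
  Q *m A + P *m B = 1%:M ->
  exists2 c : R, 0 < c & forall h : N.-tuple mR -> \bar R,
    measurable_fun setT h -> (forall t, 0 <= h t)%E ->
    (\int[power_measure lam N]_t h t = c%:E * \int[power_measure lam k]_x
       \int[power_measure lam m]_y h (tuple_of (row_of x *m A + row_of y *m B)))%E.
Proof.
move=> AQ BQ AP BP QAPB.
pose L (z : k.-tuple mR * m.-tuple mR) : N.-tuple mR := tuple_of (row_of z.1 *m A + row_of z.2 *m B).
pose L' (t : N.-tuple mR) : k.-tuple mR * m.-tuple mR := (tuple_of (row_of t *m Q), tuple_of (row_of t *m P)).
have mL : measurable_fun setT L.
  apply: measurable_tuple_of => i; under eq_fun do rewrite mxE.
  by apply: measurable_funD; apply: measurable_row_mulmx => j; exact: measurable_row_of.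
have mL' : measurable_fun setT L'.
  by apply: measurable_fun_pair; apply: measurable_tuple_of => i;
    apply: measurable_row_mulmx => j; exact: measurable_row_of.
have LK : cancel L L'.
  move=> [x y]; rewrite /L /L' /= !tuple_ofK !mulmxDl -!mulmxA AQ BQ AP BP.
  by rewrite !mulmx0 !mulmx1 addr0 add0r !row_ofK.
have L'K : cancel L' L.
  by move=> t; rewrite /L /L'/= !tuple_ofK -!mulmxA -mulmxDr QAPB mulmx1 row_ofK.
have LD : {morph L : x y / (tuple_add x.1 y.1, tuple_add x.2 y.2) >-> tuple_add x y}.
  by move=> [x1 x2] [y1 y2]; rewrite /L/= !row_ofD !mulmxDl addrACA tuple_ofD.
have [c c0 cE] := haar_transfer mL mL' LK L'K LD
  (is_haar_prod (is_haar_tuple R k) (is_haar_tuple R m)) (is_haar_tuple R N).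
exists c => // h mh h0; rewrite cE//; congr (_ * _)%E.
rewrite -[RHS](fubini_tonelli1 (h \o L))//.
- exact: measurableT_comp.
- by move=> z; exact: h0.
Qed.

End rows.
Arguments cube {R} m d.
Arguments measurable_cube {R} m d.

(* Volume of the fibres [{y | x A + y B in K}] of a convex body in coordinates
   [x = w Q], [y = w P] adapted to the functionals given by the columns of Q. *)
Section section_volume.
Context (R : realType) (N k m : nat).
Local Notation mR := (measurableTypeR R).
Local Notation lam := (@lebesgue_measure R).
Variables (A : 'M[R]_(k, N)) (B : 'M[R]_(m, N)) (Q : 'M[R]_(N, k)) (P : 'M[R]_(N, m)).
Hypotheses (AQ : A *m Q = 1%:M) (BQ : B *m Q = 0) (AP : A *m P = 0)
  (BP : B *m P = 1%:M) (QAPB : Q *m A + P *m B = 1%:M).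
Variable K : set 'rV[R]_N.
Hypothesis mK : measurable (@row_of R N @^-1` K).
Hypothesis cK : forall (t : R) x y, 0 < t < 1 -> K x -> K y -> K (t *: x + (1 - t) *: y).
Variable M : R.
Hypothesis M0 : 0 <= M.
Hypothesis bK : forall x i, K x -> `|x 0 i| <= M.
Variable d : R.
Hypotheses (d0 : 0 < d) (iK : forall x : 'rV[R]_N, (forall i, `|x 0 i| <= d) -> K x).

Definition fibre (x : 'rV[R]_k) : set (m.-tuple mR) :=
  [set y | K (x *m A + row_of y *m B)].

Definition fibre_volume (x : 'rV[R]_k) : R := fine (power_measure lam m (fibre x)).

Let mfibre2 : measurable [set z : k.-tuple mR * m.-tuple mR | fibre (row_of z.1) z.2].
Proof.
rewrite (_ : [set _ | _] = (fun z : k.-tuple mR * m.-tuple mR =>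
  tuple_of (row_of z.1 *m A + row_of z.2 *m B)) @^-1` (@row_of R N @^-1` K)); last first.
  by apply/seteqP; split => -[x y]; rewrite /fibre/= tuple_ofK.
apply: measurable_preimT => //; apply: measurable_tuple_of => i; under eq_fun do rewrite mxE.
by apply: measurable_funD; apply: measurable_row_mulmx => j; exact: measurable_row_of.
Qed.

Lemma measurable_fibre x : measurable (fibre x).
Proof.
have := measurable_xsection (tuple_of x) mfibre2; congr measurable.
by apply/seteqP; split => y; rewrite /xsection/= inE/= tuple_ofK.
Qed.

Lemma measurable_fibre_volume :
  measurable_fun setT (fun t : k.-tuple mR => fibre_volume (row_of t)).
Proof.
apply: (measurableT_comp (@fine_measurable R setT measurableT)).
rewrite (_ : (fun t => _) = (fun t : k.-tuple mR => power_measure lam m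
    (xsection [set z : k.-tuple mR * m.-tuple mR | fibre (row_of z.1) z.2] t))).
  exact: measurable_fun_xsection.
apply/funext => t; congr (power_measure lam m _).
by apply/seteqP; split => y; rewrite /xsection/= inE.
Qed.

Let mulmx_bound a b (x : 'rV[R]_a) (T : 'M[R]_(a, b)) (c : R) j :
  (forall i, `|x 0 i| <= c) -> `|(x *m T) 0 j| <= c * \sum_i `|T i j|.
Proof.
move=> xc; rewrite mxE mulr_sumr (le_trans (ler_norm_sum _ _ _))//.
by apply: ler_sum => i _; rewrite normrM ler_wpM2r.
Qed.

Let norm1 a b (T : 'M[R]_(a, b)) : R := \sum_j \sum_i `|T i j|.

Let norm1_ge0 a b (T : 'M[R]_(a, b)) : 0 <= norm1 T.
Proof. by apply: sumr_ge0 => j _; apply: sumr_ge0. Qed.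

Let mulmx_bound1 a b (x : 'rV[R]_a) (T : 'M[R]_(a, b)) (c : R) j : 0 <= c ->
  (forall i, `|x 0 i| <= c) -> `|(x *m T) 0 j| <= c * norm1 T.
Proof.
move=> c0 xc; apply: (le_trans (mulmx_bound T j xc)); rewrite ler_wpM2l//.
by rewrite /norm1 (bigD1 j)//= lerDl sumr_ge0// => i _; apply: sumr_ge0.
Qed.

Let fibreQ x y : fibre x y -> x = (x *m A + row_of y *m B) *m Q.
Proof. by move=> _; rewrite mulmxDl -!mulmxA AQ BQ mulmx1 mulmx0 addr0. Qed.

Let fibreP x y : fibre x y -> row_of y = (x *m A + row_of y *m B) *m P.
Proof. by move=> _; rewrite mulmxDl -!mulmxA AP BP mulmx1 mulmx0 add0r. Qed.

Lemma fibre_bounded x y i : fibre x y -> `|tnth y i : R| <= M * norm1 P.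
Proof.
move=> h; have -> : (tnth y i : R) = row_of y 0 i by rewrite mxE.
by rewrite (fibreP h); apply: mulmx_bound1 => // j; exact: bK.
Qed.

Let Mb := M * norm1 P.
Let Mb0 : 0 <= Mb. Proof. by rewrite mulr_ge0. Qed.

Let fibre_conv (t : R) x0 x1 y0 y1 : 0 < t < 1 -> fibre x0 y0 -> fibre x1 y1 ->
  fibre (t *: x0 + (1 - t) *: x1) (tuple_conv t y0 y1).
Proof.
move=> t01 h0 h1; rewrite /fibre/=.
have -> : row_of (tuple_conv t y0 y1) = t *: row_of y0 + (1 - t) *: row_of y1.
  by apply/rowP => i; rewrite !mxE tnth_mktuple.
rewrite !mulmxDl -!scalemxAl addrACA -!scalerDr.
exact: cK.
Qed.

Let slc := @section_log_concave R m 'rV[R]_k (fun t x y => t *: x + (1 - t) *: y)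
  fibre Mb Mb0 measurable_fibre fibre_bounded fibre_conv.

Lemma fibre_volume_fin x : power_measure lam m (fibre x) \is a fin_num.
Proof. by rewrite ge0_fin_numE// (le_lt_trans (slc.1 x))// ltry. Qed.

Lemma fibre_volume_bound x : 0 <= fibre_volume x <= (2 * Mb) ^+ m.
Proof.
rewrite fine_ge0//= -lee_fin fineK ?fibre_volume_fin//; exact: slc.1.
Qed.

Lemma fibre_volume_log_concave (t : R) x y : 0 < t < 1 ->
  fibre_volume x `^ t * fibre_volume y `^ (1 - t) <= fibre_volume (t *: x + (1 - t) *: y).
Proof. exact: slc.2. Qed.

Lemma fibre_volume_supp x : x != 0 ->
  exists2 S : R, 0 <= S & forall r : R, 0 < fibre_volume (r *: x) -> `|r| <= S.
Proof.
move=> /rV0Pn[i xi]; exists (M * norm1 Q / `|x 0 i|).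
  by rewrite divr_ge0// mulr_ge0.
move=> r fr; have [y fy] : fibre (r *: x) !=set0.
  apply/set0P/negP => /eqP f0; move: fr.
  by rewrite /fibre_volume f0 measure0 ltxx.
rewrite ler_pdivlMr ?normr_gt0// -normrM.
have -> : r * x 0 i = (r *: x) 0 i by rewrite mxE.
by rewrite (fibreQ fy); apply: mulmx_bound1 => // j; exact: bK.
Qed.

Lemma fibre_volume_pos x : exists e c : R,
  [/\ 0 < e, 0 < c & forall r : R, 0 < r <= e -> c <= fibre_volume (r *: x)].
Proof.
have [b b0 xb] : exists2 b : R, 0 < b & forall i, `|x 0 i| <= b.
  exists (1 + \sum_i `|x 0 i|); first by rewrite ltr_wpDr// sumr_ge0.
  move=> i; rewrite (bigD1 i)//= addrCA lerDl addr_ge0// sumr_ge0//.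
(* The inner radius d is shared equally: e keeps the entries of r x A below d/2, and the cube radius
   s does the same for y B. Adding 1 to the matrix norms avoids division by zero. *)
pose e := d / 2 / (b * (1 + norm1 A)).
have nA : 0 < 1 + norm1 A by rewrite ltr_wpDr.
have nB : 0 < 1 + norm1 B by rewrite ltr_wpDr.
have d2 : 0 < d / 2 by rewrite divr_gt0.
have e0 : 0 < e by rewrite divr_gt0// mulr_gt0.
pose s := d / 2 / (1 + norm1 B).
have s0 : 0 < s by rewrite divr_gt0.
have sub (r : R) : 0 < r <= e -> cube m s `<=` fibre (r *: x).
  move=> /andP[r0 re] y ys; apply: iK => i; rewrite mxE (le_trans (ler_normD _ _))//.
  rewrite [leRHS]splitr lerD//.
    apply: (@le_trans _ _ (e * b * norm1 A)).
      apply: mulmx_bound1; first by rewrite mulr_ge0// ltW.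
      move=> j; rewrite mxE normrM ler_pM// gtr0_norm//.
    have -> : d / 2 = e * b * (1 + norm1 A) by rewrite /e; field; rewrite !gt_eqF.
    by rewrite ler_wpM2l ?lerDr// mulr_ge0 ?(ltW e0) ?(ltW b0).
  apply: (@le_trans _ _ (s * norm1 B)).
    apply: mulmx_bound1; first exact: ltW.
    by move=> j; rewrite mxE.
  have -> : d / 2 = s * (1 + norm1 B) by rewrite /s; field; rewrite !gt_eqF.
  by rewrite ler_wpM2l ?(ltW s0)// lerDr.
have mcube := measurable_cube m s.
have le r : 0 < r <= e -> (power_measure lam m (cube m s) <= power_measure lam m (fibre (r *: x)))%E.
  by move=> /sub h; apply: le_measure; rewrite ?inE//; exact: measurable_fibre.
have cfin : power_measure lam m (cube m s) \is a fin_num.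
  rewrite ge0_fin_numE// (le_lt_trans (le e _)) ?e0 ?lexx//.
  by rewrite -ge0_fin_numE// fibre_volume_fin.
exists e, (fine (power_measure lam m (cube m s))); split => //.
  by rewrite fine_gt0// cube_measure_gt0//= -ge0_fin_numE.
by move=> r re; rewrite -lee_fin !fineK ?fibre_volume_fin// le.
Qed.

Lemma fibre_volume0_gt0 : 0 < fibre_volume 0.
Proof.
have [e [c [e0 c0 ec]]] := fibre_volume_pos 0.
have := ec e; rewrite scaler0 e0 lexx => /(_ isT); exact: lt_le_trans.
Qed.

(** A symmetry J of K that acts on the base coordinates by I acts on the fibre coordinates by r = B
    J P, and the fibre over x I is the preimage of the fibre over x under the inverse of r. The
    transfer constant is the same for all x; at x = 0 the two fibres coincide and have positive
    volume, so it is 1. *)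
Lemma fibre_volume_invariant (J J' : 'M[R]_N) (I I' : 'M[R]_k) x :
  J *m J' = 1%:M -> J' *m J = 1%:M -> J *m Q = Q *m I -> J' *m Q = Q *m I' ->
  A *m J = I *m A -> A *m J' = I' *m A ->
  (forall w, K w -> K (w *m J)) -> (forall w, K w -> K (w *m J')) ->
  fibre_volume (x *m I) = fibre_volume x.
Proof.
move=> JJ' J'J JQ J'Q AJ AJ' KJ KJ'.
(* As B H Q = B Q G = 0, the rows of B H have no component along A. *)
have BPB (H : 'M[R]_N) (G : 'M[R]_k) : H *m Q = Q *m G -> A *m H = G *m A ->
    B *m H = B *m H *m P *m B.
  move=> HQ AH; rewrite -(mulmxA (B *m H)).
  have -> : P *m B = 1%:M - Q *m A by rewrite -QAPB addrC addKr.
  rewrite mulmxBr mulmx1 -mulmxA (mulmxA H) HQ -(mulmxA Q) (mulmxA B) BQ mul0mx.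
  by rewrite subr0.
pose r := B *m J *m P; pose r' := B *m J' *m P.
have rr' : r *m r' = 1%:M.
  rewrite /r /r' !mulmxA -(BPB _ _ JQ AJ) -(mulmxA B) JJ' mulmx1; exact: BP.
have r'r : r' *m r = 1%:M.
  rewrite /r /r' !mulmxA -(BPB _ _ J'Q AJ') -(mulmxA B) J'J mulmx1; exact: BP.
pose L (y : m.-tuple mR) : m.-tuple mR := tuple_of (row_of y *m r).
pose L' (y : m.-tuple mR) : m.-tuple mR := tuple_of (row_of y *m r').
have mL : measurable_fun setT L.
  by apply: measurable_tuple_of => i; apply: measurable_row_mulmx => j; exact: measurable_row_of.
have mL' : measurable_fun setT L'.
  by apply: measurable_tuple_of => i; apply: measurable_row_mulmx => j; exact: measurable_row_of.
have LK : cancel L L'.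
  by move=> y; rewrite /L /L' tuple_ofK -mulmxA rr' mulmx1 row_ofK.
have L'K : cancel L' L.
  by move=> y; rewrite /L /L' tuple_ofK -mulmxA r'r mulmx1 row_ofK.
have L'D : {morph L' : x y / tuple_add x y >-> tuple_add x y}.
  by move=> y z; rewrite /L' row_ofD mulmxDl tuple_ofD.
have [c c0 cE] := haar_transfer mL' mL L'K LK L'D (is_haar_tuple R m) (is_haar_tuple R m).
have key z : fibre (z *m I) = L' @^-1` fibre z.
  have E y : z *m I *m A + row_of y *m B =
      (z *m A + (row_of y *m r') *m B) *m J.
    rewrite mulmxDl -!mulmxA AJ; congr (_ + _ *m _).
    rewrite !mulmxA -(mulmxA B) -!mulmxA.
    have -> : B *m (J' *m (P *m (B *m J))) = r' *m r *m B.
      by rewrite /r' /r -!mulmxA; congr (_ *m (_ *m (_ *m _))); rewrite {1}(BPB _ _ JQ AJ) !mulmxA.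
    by rewrite r'r mul1mx.
  apply/seteqP; split => y; rewrite /fibre /L'/= tuple_ofK.
    by rewrite E => /KJ'; rewrite -mulmxA JJ' mulmx1.
  by move=> /KJ; rewrite -E.
have vE z : power_measure lam m (fibre z) = (c%:E * power_measure lam m (fibre (z *m I)))%E.
  have mz := measurable_fibre z; have mzI := measurable_fibre (z *m I).
  rewrite (measure_int_indic _ mz) (measure_int_indic _ mzI) cE//.
    by congr (_ * _)%E; apply: eq_integral => y _; rewrite key !indicE.
  exact: measurable_indicE.
have c1 : c = 1.
  have := vE 0; rewrite mul0mx -(fineK (fibre_volume_fin 0)) -EFinM => -[].
  have nz : fibre_volume 0 != 0 by rewrite gt_eqF// fibre_volume0_gt0.
  by rewrite -[LHS]mul1r => /(mulIf nz) <-.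
by rewrite /fibre_volume [in RHS]vE c1 mul1e.
Qed.

End section_volume.

Import Normc.
Local Open Scope complex_scope.
Local Open Scope ring_scope.

Section box_open.
Context (R : realType) (N : nat).
Local Notation mR := (measurableTypeR R).

Definition box_open (U : set 'rV[R]_N) := forall w, U w ->
  exists2 e : R, 0 < e & forall w' : 'rV[R]_N, (forall i, `|w' 0 i - w 0 i| < e) -> U w'.

Let box (w : 'rV[R]_N) (e : R) : set 'rV[R]_N := [set w' | forall i, `|w' 0 i - w 0 i| < e].

Let measurable_box w e : measurable (@row_of R N @^-1` box w e).
Proof.
rewrite (_ : _ @^-1` _ = \bigcap_(i in [set: 'I_N])
    ((fun y : N.-tuple mR => tnth y i) @^-1` `](w 0 i - e)%R, (w 0 i + e)%R[)); last first.
  apply/seteqP; split => y h i; first by move=> _ /=; have := h i; rewrite mxE in_itv/= ltr_distl.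
  by have := h i I; rewrite /= in_itv/= mxE ltr_distl.
apply: fin_bigcap_measurable => // i _.
by apply: measurable_preimT => //; exact: measurable_tnth.
Qed.

(** Countably many boxes suffice, those with rational centres and radii 1/(k+1) contained in U. A
    radius below e/2 and a centre within that radius keep the box inside the box of radius e about
    the given point. *)
Lemma measurable_box_open U : box_open U -> measurable (@row_of R N @^-1` U).
Proof.
move=> oU; pose q2R (q : 'rV[rat]_N) : 'rV[R]_N := \row_i ratr (q 0 i).
pose F (i : 'rV[rat]_N * nat) : set (N.-tuple mR) :=
  if `[< box (q2R i.1) i.2.+1%:R^-1 `<=` U >]
  then @row_of R N @^-1` box (q2R i.1) i.2.+1%:R^-1 else set0.
rewrite (_ : _ @^-1` _ = \bigcup_i F i).
  apply: countable_bigcupT_measurable; first exact: countableP.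
  by move=> i; rewrite /F; case: ifP => // _; exact: measurable_box.
apply/seteqP; split => t /=; last first.
  by case=> -[q k] _; rewrite /F/=; case: ifP => // /asboolP h; exact: h.
move=> /oU[e e0 eU].
have [k kE] : exists k : nat, k.+1%:R^-1 < e / 2.
  exists (Num.truncn (e / 2)^-1).
  by rewrite invf_plt ?posrE ?divr_gt0// truncnS_gt.
have k0 : (0 : R) < k.+1%:R^-1 by rewrite invr_gt0.
have /choice[q qE] (i : 'I_N) : exists q : rat, `|(tnth t i : R) - ratr q| < k.+1%:R^-1.
  have lt : (tnth t i : R) - k.+1%:R^-1 < tnth t i + k.+1%:R^-1.
    by rewrite ltrBlDr -addrA ltrDl addr_gt0.
  have [q] := rat_in_itvoo lt; rewrite in_itv/= -ltr_distl distrC => qi.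
  by exists q.
exists (\row_i q i, k) => //; rewrite /F/=.
case: ifPn => [_ i|/asboolPn[]]; first by rewrite !mxE.
move=> w' w'q; apply: eU => i; have := w'q i; rewrite !mxE => h.
rewrite (splitr e); apply: le_lt_trans (ltrD (lt_trans h kE) (lt_trans (qE i) kE)).
by rewrite (distrC (tnth t i : R)) (le_trans _ (ler_normD _ _))// addrA subrK.
Qed.

Lemma measurable_box_continuous (g : 'rV[R]_N -> R) :
  (forall (w : 'rV[R]_N) (e : R), 0 < e -> exists2 d : R, 0 < d &
     forall w' : 'rV[R]_N, (forall i, `|w' 0 i - w 0 i| < d) -> `|g w' - g w| < e) ->
  measurable_fun setT (fun t : N.-tuple mR => g (row_of t)).
Proof.
move=> gc; apply: (measurability _ (RGenOpens.measurableE R)) => //.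
move=> _ [_ [x [y ->]] <-]; rewrite setTI.
rewrite (_ : _ @^-1` _ = @row_of R N @^-1` [set w | x < g w < y]); last first.
  by apply/seteqP; split => t /=; rewrite in_itv.
apply: measurable_box_open => w /= /andP[xg gy].
have [d d0 dw] := gc w (Num.min (g w - x) (y - g w)) ltac:(by rewrite lt_min !subr_gt0 xg gy).
exists d => // w' /dw; rewrite lt_min !ltr_norml => /andP[/andP[h1 _] /andP[_ h2]].
by apply/andP; split; lra.
Qed.

End box_open.

(** * Planar integrals and circles *)

Section complex_measurability.
Context (R : realType).
Local Notation mR := (measurableTypeR R).
Local Notation lam := (@lebesgue_measure R).

Definition toC (z : mR * mR) : R[i] := (z.1 : R) +i* (z.2 : R).
Definition ofC (z : R[i]) : mR * mR := (complex.Re z : mR, complex.Im z : mR).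

Lemma toCK : cancel toC ofC. Proof. by case. Qed.
Lemma ofCK : cancel ofC toC. Proof. by case. Qed.

(** Measurability involving [R[i]] is read on the real plane: [cmeas] for maps into it, [planar] for
    maps out of it. *)
Definition cmeas d (X : measurableType d) (f : X -> R[i]) : Prop :=
  measurable_fun setT (fun x => complex.Re (f x)) /\
  measurable_fun setT (fun x => complex.Im (f x)).

Section cmeas.
Context d (X : measurableType d).
Implicit Types f g : X -> R[i].

Lemma cmeas_cst (c : R[i]) : cmeas (fun _ : X => c).
Proof. by split; exact: measurable_cst. Qed.

Lemma cmeasD f g : cmeas f -> cmeas g -> cmeas (fun x => f x + g x).
Proof.
move=> [f1 f2] [g1 g2]; split.
  by under eq_fun do rewrite raddfD; exact: measurable_funD.
by under eq_fun do rewrite raddfD; exact: measurable_funD.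
Qed.

Lemma cmeasM f g : cmeas f -> cmeas g -> cmeas (fun x => f x * g x).
Proof.
move=> [f1 f2] [g1 g2]; split.
  rewrite (_ : (fun x => _) = (fun x => complex.Re (f x) * complex.Re (g x) -
    complex.Im (f x) * complex.Im (g x))); last first.
    by apply/funext => x; case: (f x) (g x) => a b [].
  by apply: measurable_funB; exact: measurable_funM.
rewrite (_ : (fun x => _) = (fun x => complex.Re (f x) * complex.Im (g x) +
  complex.Im (f x) * complex.Re (g x))); last first.
  by apply/funext => x; case: (f x) (g x) => a b [].
by apply: measurable_funD; exact: measurable_funM.
Qed.

Lemma cmeas_ofC f : cmeas f -> measurable_fun setT (fun x => ofC (f x)).
Proof. by move=> [f1 f2]; exact: measurable_fun_pair. Qed.

Lemma cmeas_toC (f : X -> mR * mR) : measurable_fun setT f -> cmeas (fun x => toC (f x)).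
Proof.
move=> mf; split; first exact: (measurableT_comp measurable_fst mf).
exact: (measurableT_comp measurable_snd mf).
Qed.

Definition planar d' (Y : measurableType d') (h : R[i] -> Y) : Prop :=
  measurable_fun setT (h \o toC).

Lemma planar_comp d' (Y : measurableType d') (h : R[i] -> Y) f : planar h -> cmeas f ->
  measurable_fun setT (fun x => h (f x)).
Proof.
move=> ph mf; rewrite (_ : (fun x => _) = (h \o toC) \o (fun x => ofC (f x))).
  by apply: measurableT_comp => //; exact: cmeas_ofC.
by apply/funext => x /=; rewrite ofCK.
Qed.

End cmeas.

Lemma normc_real (a : R) : normc (a%:C)%C = `|a|.
Proof. by rewrite /= expr0n addr0 sqrtr_sqr. Qed.

Lemma normc_ge0 (z : R[i]) : 0 <= normc z.
Proof. by case: z => a b; exact: sqrtr_ge0. Qed.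

Lemma normc_gt0 (z : R[i]) : (0 < normc z) = (z != 0).
Proof.
rewrite lt_def normc_ge0 andbT; congr negb; apply/eqP/eqP => [/eq0_normc//|->].
exact: normc0.
Qed.

Lemma normc_leD (x y : R[i]) : normc (x + y) <= normc x + normc y.
Proof. exact: le_normcD. Qed.

Lemma normc_opp (x : R[i]) : normc (- x) = normc x.
Proof. exact: normcN. Qed.

Lemma normc_leB (x y : R[i]) : `|normc x - normc y| <= normc (x - y).
Proof.
have l (u v : R[i]) : normc u <= normc (u - v) + normc v.
  by rewrite -{1}(subrK v u) normc_leD.
rewrite ler_norml lerBlDr l andbT lerBrDr addrC lerBlDr.
by rewrite addrC -(normc_opp (x - y)) opprB l.
Qed.

Lemma normc_le_sum (z : R[i]) : normc z <= `|complex.Re z| + `|complex.Im z|.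
Proof.
case: z => a b /=; rewrite -(ler_pXn2r (ltn0Sn 1)) ?nnegrE ?sqrtr_ge0 ?addr_ge0//.
rewrite sqr_sqrtr ?addr_ge0 ?sqr_ge0// sqrrD !real_normK ?num_real//.
by rewrite addrAC lerDl mulrn_wge0// mulr_ge0.
Qed.

Lemma Re_le_normc (z : R[i]) : `|complex.Re z| <= normc z.
Proof. by case: z => a b /=; rewrite -sqrtr_sqr ler_wsqrtr// lerDl sqr_ge0. Qed.

Lemma Im_le_normc (z : R[i]) : `|complex.Im z| <= normc z.
Proof. by case: z => a b /=; rewrite -sqrtr_sqr ler_wsqrtr// lerDr sqr_ge0. Qed.

Lemma planar_continuous (h : R[i] -> R) :
  (forall (z : R[i]) (e : R), 0 < e -> exists2 d : R, 0 < d &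
     forall z' : R[i], normc (z' - z) < d -> `|h z' - h z| < e) -> planar h.
Proof.
move=> hc; pose g (w : 'rV[R]_2) := h (w 0 0 +i* w 0 1).
have mg : measurable_fun setT (fun t : 2.-tuple mR => g (row_of t)).
  apply: measurable_box_continuous => w e e0.
  have [d d0 dz] := hc (w 0 0 +i* w 0 1) e e0.
  exists (d / 2); first by rewrite divr_gt0.
  move=> w' w'd; apply: dz; apply: le_lt_trans (normc_le_sum _) _ => /=.
  by rewrite (splitr d) ltrD.
rewrite /planar (_ : h \o toC = (fun t : 2.-tuple mR => g (row_of t)) \o
    (fun z : mR * mR => tuple_of (\row_i [:: (z.1 : R); (z.2 : R)]`_i))); last first.
  by apply/funext => z /=; rewrite tuple_ofK /g !mxE.
apply: measurableT_comp => //; apply: measurable_tuple_of => i.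
under eq_fun do rewrite mxE.
by case: i => -[|[|]] //= _; [exact: measurable_fst|exact: measurable_snd].
Qed.

Lemma planar_normc : planar (@normc R).
Proof.
apply: planar_continuous => z e e0; exists e => // z' h.
exact: le_lt_trans (normc_leB _ _) h.
Qed.

Lemma cmeas_normc_powR d (X : measurableType d) (f : X -> R[i]) (p : R) : cmeas f ->
  measurable_fun setT (fun x => normc (f x) `^ p).
Proof.
move=> mf; apply: (measurableT_comp (@measurable_powR R p)).
exact: (planar_comp planar_normc).
Qed.

End complex_measurability.

Section null_sets.
Local Open Scope ereal_scope.

(** Exceptional points occur where a substitution a = b w has b = 0, and where z^p with p < 0 takes
    the default value 0 of [powR] at z = 0 instead of being infinite. *)
Lemma le_integral_off_null d (X : measurableType d) (R : realType)
    (mu : {measure set X -> \bar R}) (Z : set X) (f g : X -> \bar R) :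
  measurable Z -> mu Z = 0 -> measurable_fun setT f -> measurable_fun setT g ->
  (forall x, 0 <= f x) -> (forall x, 0 <= g x) -> (forall x, ~ Z x -> f x <= g x) ->
  \int[mu]_x f x <= \int[mu]_x g x.
Proof.
move=> mZ Z0 mf mg f0 g0 fg; apply: ae_ge0_le_integral => //.
exists Z; split => // x /= h; apply: contrapT => nZ; apply: h => _; exact: fg.
Qed.

Lemma eq_integral_off_null d (X : measurableType d) (R : realType)
    (mu : {measure set X -> \bar R}) (Z : set X) (f g : X -> \bar R) :
  measurable Z -> mu Z = 0 -> measurable_fun setT f -> measurable_fun setT g ->
  (forall x, 0 <= f x) -> (forall x, 0 <= g x) -> (forall x, ~ Z x -> f x = g x) ->
  \int[mu]_x f x = \int[mu]_x g x.
Proof.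
move=> mZ Z0 mf mg f0 g0 fg; apply/eqP; rewrite eq_le.
by apply/andP; split; apply: (@le_integral_off_null _ _ _ _ Z) => // x /fg ->.
Qed.

Lemma measurable_integral_snd d1 d2 (X : measurableType d1) (Y : measurableType d2)
    (R : realType) (nu : {sigma_finite_measure set Y -> \bar R}) (g : X * Y -> \bar R) :
  measurable_fun setT g -> (forall z, 0 <= g z) ->
  measurable_fun setT (fun x => \int[nu]_y g (x, y)).
Proof. by move=> mg g0; apply: (@measurable_fun_fubini_tonelli_F _ _ _ _ _ nu g). Qed.

Lemma measurable_integral_fst d1 d2 (X : measurableType d1) (Y : measurableType d2)
    (R : realType) (mu : {sigma_finite_measure set X -> \bar R}) (g : X * Y -> \bar R) :
  measurable_fun setT g -> (forall z, 0 <= g z) ->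
  measurable_fun setT (fun y => \int[mu]_x g (x, y)).
Proof. by move=> mg g0; apply: (@measurable_fun_fubini_tonelli_G _ _ _ _ _ mu g). Qed.

End null_sets.

Section planar_integrals.
Context (R : realType).
Local Notation mR := (measurableTypeR R).
Local Notation R2 := (mR * mR)%type.
Local Notation lam := (@lebesgue_measure R).
Local Open Scope ereal_scope.

Definition lam2 : {sigma_finite_measure set R2 -> \bar R} := sprod lam lam.

Lemma is_haar_lam2 : is_haar (fun x y : R2 => ((x.1 + y.1)%R : mR, (x.2 + y.2)%R : mR))
  (fun x y : R2 => ((x.1 - y.1)%R : mR, (x.2 - y.2)%R : mR))
  ((0%R : mR), (0%R : mR)) lam2.
Proof. exact: is_haar_prod (is_haar_R R) (is_haar_R R). Qed.

Lemma lam2E (g : R2 -> \bar R) : measurable_fun setT g -> (forall z, 0 <= g z) ->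
  \int[lam2]_z g z = \int[lam]_x \int[lam]_y g (x, y).
Proof. by move=> mg g0; rewrite -[RHS](fubini_tonelli1 g). Qed.

Lemma lam2E2 (g : R2 -> \bar R) : measurable_fun setT g -> (forall z, 0 <= g z) ->
  \int[lam2]_z g z = \int[lam]_y \int[lam]_x g (x, y).
Proof. by move=> mg g0; rewrite -[RHS](fubini_tonelli2 g). Qed.

Lemma lam2_set1 z : lam2 [set z] = 0.
Proof.
case: z => x y; rewrite (_ : [set _] = [set x] `*` [set y]); last first.
  by apply/seteqP; split => [[a b] [-> ->]|[a b] [/= -> ->]].
rewrite /lam2/= /sprod product_measure1E//.
by rewrite [X in X * _]lebesgue_measure_set1 mul0e.
Qed.

Lemma measurable_lam2_set1 z : measurable [set z : R2].
Proof.
case: z => x y; rewrite (_ : [set _] = [set x] `*` [set y]); last first.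
  by apply/seteqP; split => [[a b] [-> ->]|[a b] [/= -> ->]].
by apply: measurableX; exact: measurable_set1.
Qed.

Let lam2_scale (c : R) (g : R2 -> \bar R) : (0 < c)%R -> measurable_fun setT g ->
  (forall z, 0 <= g z) ->
  \int[lam2]_z g z = (c ^+ 2)%:E * \int[lam2]_z g ((c * z.1)%R : mR, (c * z.2)%R : mR).
Proof.
move=> c0 mg g0.
have mc : measurable_fun setT (fun x : mR => (c * x)%R : mR).
  exact: (@measurable_funM _ R R setT (cst c) id).
have mg2 : measurable_fun setT (fun z : R2 => g ((c * z.1)%R : mR, (c * z.2)%R : mR)).
  apply: measurableT_comp => //; apply: measurable_fun_pair.
    exact: (measurableT_comp mc measurable_fst).
  exact: (measurableT_comp mc measurable_snd).
have mg1 x : measurable_fun setT (fun y : mR => g (x, y)).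
  exact: (measurableT_comp mg (pair1_measurable x)).
rewrite lam2E// (lebesgue_integral_scale_pos c0); last first.
- by move=> x; apply: integral_ge0.
- exact: (measurable_integral_snd lam mg g0).
rewrite lam2E// expr2 EFinM -muleA; apply: (f_equal (fun X => c%:E * X)).
rewrite -ge0_integralZl//; last 3 first.
- exact: (measurable_integral_snd lam mg2 (fun z => g0 _)).
- by move=> x _; apply: integral_ge0.
- by rewrite lee_fin ltW.
by apply: eq_integral => x _; rewrite [LHS](lebesgue_integral_scale_pos c0).
Qed.

Lemma measurable_lam2_indic_disc :
  measurable_fun setT (fun z : R2 => if (normc (toC z) <= 1)%R then 1 else 0 : \bar R).
Proof.
apply: measurable_fun_ifT => //.
by apply: measurable_fun_ler => //; exact: (@planar_normc R).
Qed.

Let disc (z : R2) : \bar R := if (normc (toC z) <= 1)%R then 1 else 0.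

Let disc_ge0 z : 0 <= disc z. Proof. by rewrite /disc; case: ifP. Qed.

Let disc_int : 0 < \int[lam2]_z disc z < +oo.
Proof.
have mI d : measurable (`[(- d)%R, d]%classic : set mR) by exact: measurable_itv.
have mII d : measurable (`[(- d)%R, d]%classic `*` `[(- d)%R, d]%classic : set R2).
  exact: measurableX.
have II (d : R) : (0 < d)%R -> \int[lam2]_z (\1_(`[(- d)%R, d]%classic `*` `[(- d)%R, d]%classic : set R2) z)%:E = ((2 * d) * (2 * d))%:E.
  move=> d0; rewrite -(measure_int_indic lam2 (mII d)) /lam2/= /sprod product_measure1E//.
  rewrite [X in X * _](@lebesgue_measure_itv R `[(- d)%R, d])/= lte_fin.
  rewrite [X in _ * X](@lebesgue_measure_itv R `[(- d)%R, d])/= lte_fin.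
  by rewrite gtrN// -EFinD -EFinM opprK -mulr2n mulr_natl.
apply/andP; split.
  apply: (@lt_le_trans _ _ (((2 * 2^-1) * (2 * 2^-1))%:E)).
    by rewrite lte_fin !mulr_gt0// invr_gt0.
  rewrite -II ?invr_gt0//; apply: ge0_le_integral => //.
  - by apply: measurable_indicE; exact: mII.
  - exact: measurable_lam2_indic_disc.
  - move=> -[x y] _; have [|h] := pselect ((`[(- 2^-1)%R, 2^-1%R]%classic `*` `[(- 2^-1)%R, 2^-1%R]%classic) (x, y)); last first.
      by rewrite indic_notin//; exact: disc_ge0.
    move=> h; rewrite indic_in//; move: h => [/=]; rewrite !in_itv/= -!ler_norml => hx hy.
    rewrite /disc ifT//; apply: le_trans (normc_le_sum _) _ => /=.
    by apply: (le_trans (lerD hx hy)); lra.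
apply: (@le_lt_trans _ _ (((2 * 1) * (2 * 1))%:E)); last by rewrite ltry.
rewrite -II//; apply: ge0_le_integral => //.
- exact: measurable_lam2_indic_disc.
- by apply: measurable_indicE; exact: mII.
- move=> -[x y] _; rewrite /disc; case: ifPn => [h|_]; last by rewrite lee_fin.
  rewrite indic_in//; split; rewrite /= in_itv/= -ler_norml.
    exact: le_trans (Re_le_normc _) h.
  exact: le_trans (Im_le_normc _) h.
Qed.

(** [haar_transfer] gives some constant; the unit disc identifies it as |b|^2, because its indicator
    depends only on the modulus, so that multiplication by b and scaling by |b| have the same effect
    on its integral. *)
Lemma planar_mul (b : R[i]) (g : R[i] -> \bar R) : b != 0%R -> planar g ->
  (forall z, 0 <= g z) ->
  \int[lam2]_z g (toC z) = (normc b ^+ 2)%:E * \int[lam2]_z g (b * toC z)%R.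
Proof.
move=> b0 mg g0.
pose f (z : R2) := ofC (b * toC z)%R; pose f' (z : R2) := ofC (b^-1 * toC z)%R.
have mm (c : R[i]) : measurable_fun setT (fun z : R2 => ofC (c * toC z)%R).
  by apply: cmeas_ofC; apply: cmeasM; [exact: cmeas_cst|exact: cmeas_toC].
have fK : cancel f f' by move=> z; rewrite /f /f' ofCK mulKf// toCK.
have f'K : cancel f' f by move=> z; rewrite /f /f' ofCK mulVKf// toCK.
have fD : {morph f : x y / ((x.1 + y.1)%R : mR, (x.2 + y.2)%R : mR)}.
  move=> [x1 x2] [y1 y2]; rewrite /f /ofC/=; case: (b) => b1 b2 /=.
  by congr pair; ring.
have [c c0 cE] := haar_transfer (mm b) (mm b^-1%R) fK f'K fD is_haar_lam2 is_haar_lam2.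
have cE' (h : R[i] -> \bar R) : planar h -> (forall z, 0 <= h z) ->
    \int[lam2]_z h (toC z) = c%:E * \int[lam2]_z h (b * toC z)%R.
  move=> mh h0; rewrite (cE (fun z => h (toC z)))//; congr (_ * _).
  by apply: eq_integral => z _; rewrite /= /f ofCK.
rewrite cE'//; congr (_%:E * _).
have nb0 : (0 < normc b)%R by rewrite normc_gt0.
pose J := \int[lam2]_z disc (ofC (b * toC z)%R).
have E2 : \int[lam2]_z disc z = c%:E * J.
  rewrite -(cE' (fun z => disc (ofC z)) measurable_lam2_indic_disc (fun z => disc_ge0 _)).
  by apply: eq_integral => z _; rewrite toCK.
have E1 : \int[lam2]_z disc z = (normc b ^+ 2)%:E * J.
  rewrite (lam2_scale nb0 measurable_lam2_indic_disc disc_ge0); congr (_ * _).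
  apply: eq_integral => z _; rewrite /disc ofCK normcM.
  have -> : toC ((normc b * z.1)%R, (normc b * z.2)%R) = ((normc b)%:C%C * toC z)%R.
    by case: z => x y; apply/eqP; rewrite eq_complex /=; apply/andP; split; apply/eqP; ring.
  by rewrite normcM normc_real ger0_norm ?normc_ge0.
have := disc_int; rewrite {1 2}E1.
move: E2; rewrite E1.
(* The disc integral is positive and finite, so J can be neither zero nor infinite and may be
   cancelled. *)
case: (J) => [j| |].
- rewrite -!EFinM => -[E2]; rewrite !lte_fin ltry andbT => h.
  have jn0 : j != 0%R by apply: contraTneq h => ->; rewrite mulr0 ltxx.
  exact/esym/(mulIf jn0).
- by rewrite gt0_muley ?lte_fin ?exprn_gt0// ltxx andbF.
- by rewrite gt0_muleNy ?lte_fin ?exprn_gt0.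
Qed.

Lemma lam_integral_even (g : mR -> \bar R) : measurable_fun setT g -> (forall x, 0 <= g x) ->
  \int[lam]_y g `|y|%R = 2%:E * \int[lam]_(y in (`]0%R, +oo[%classic : set mR)) g y.
Proof.
move=> mg g0; have mpos : measurable (`]0%R, +oo[%classic : set mR) by exact: measurable_itv.
pose h := g \_ (`]0%R, +oo[%classic : set mR).
have mh : measurable_fun setT h.
  by apply/(measurable_restrictT _ mpos)/measurable_funTS.
have h0 x : 0 <= h x by rewrite /h patchE; case: ifP.
have mhN : measurable_fun setT (fun y : mR => h (- y)%R).
  apply: (measurableT_comp mh).
  exact: (@measurable_funN _ R R setT id).
have mgn : measurable_fun setT (fun y : mR => g `|y|%R).
  by apply: (measurableT_comp mg); exact: normr_measurable.
rewrite [X in _ * X]integral_mkcond -/h.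
rewrite (@eq_integral_off_null _ _ _ lam [set 0%R] _ (fun y => h y + h (- y)%R))//.
- rewrite ge0_integralD// lebesgue_integral_opp// -[X in X + _]mul1e -[X in _ + X]mul1e.
  by rewrite -ge0_muleDl// -EFinD.
- exact: lebesgue_measure_set1.
- exact: emeasurable_funD.
- by move=> y; rewrite adde_ge0.
- move=> y /= /eqP y0; rewrite /h !patchE.
  have E (x : R) : (x \in (`]0%R, +oo[%classic : set mR)) = (0 < x)%R.
    by apply/idP/idP; rewrite inE/= in_itv/= andbT.
  rewrite !E oppr_gt0; case: (ltgtP y 0%R) y0 => //= yy _.
    by rewrite add0e ltr0_norm.
  by rewrite adde0 gtr0_norm.
Qed.

Lemma planar_polar (g : mR -> \bar R) : measurable_fun setT g -> (forall x, 0 <= g x) ->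
  \int[lam2]_z g (normc (toC z)) = 2%:E * (\int[lam]_k ((1 + k ^+ 2)^-1)%:E) *
    \int[lam]_(r in (`]0%R, +oo[%classic : set mR)) (r%:E * g r).
Proof.
move=> mg g0.
pose s (k : R) : R := Num.sqrt (1 + k ^+ 2).
have s2 k : (0 < 1 + k ^+ 2 :> R)%R by rewrite ltr_pwDl// sqr_ge0.
have s0 k : (0 < s k)%R by rewrite sqrtr_gt0.
have ms : measurable_fun setT s.
  rewrite (_ : s = (@normc R) \o (@toC R) \o (fun k : mR => (1%R : mR, k))).
    have pn : measurable_fun setT (@normc R \o @toC R) := @planar_normc R.
    apply: (measurableT_comp pn).
    by exact: measurable_fun_pair.
  by apply/funext => k; rewrite /s/= expr1n.
have msz (f : R2 -> R) : measurable_fun setT f -> measurable_fun setT (fun z : R2 => (`|z.2| * f z)%R).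
  move=> mf; apply: measurable_funM => //.
  exact: (measurableT_comp (@normr_measurable R setT) measurable_snd).
have m2 : measurable_fun setT (fun z : R2 => (`|z.2|)%:E * g (`|z.2| * s z.1)%R).
  apply: emeasurable_funM.
    apply/measurable_EFinP.
    exact: (measurableT_comp (@normr_measurable R setT) measurable_snd).
  apply: (measurableT_comp mg); apply: msz.
  exact: (measurableT_comp ms measurable_fst).
have p2 (z : R2) : 0 <= (`|z.2|)%:E * g (`|z.2| * s z.1)%R.
  by rewrite mule_ge0// lee_fin.
have mgn : measurable_fun setT (fun z : R2 => g (normc (toC z))).
  exact: (measurableT_comp mg (@planar_normc R)).
rewrite lam2E2//.
rewrite (@eq_integral_off_null _ _ _ lam [set 0%R] _
  (fun y => \int[lam]_k ((`|y|)%:E * g (`|y| * s k)%R)))//; first last.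
- move=> y /= /eqP y0; rewrite (lebesgue_integral_scale y0)//; last first.
    exact: (measurableT_comp mgn (pair2_measurable y)).
  rewrite -ge0_integralZl//; last first.
    rewrite (_ : (fun x => _) = (fun z : R2 => g (normc (toC z))) \o
      (fun x : mR => ((y * x)%R : mR, y)))//.
    apply: (measurableT_comp mgn); apply: measurable_fun_pair => //.
  apply: eq_integral => k _; congr (_ * g _).
  rewrite /s /= -(sqrtr_sqr y) -sqrtrM ?sqr_ge0//; congr Num.sqrt.
  by ring.
- by move=> y; apply: integral_ge0 => k _; exact: (p2 (k, y)).
- by move=> y; apply: integral_ge0.
- exact: (measurable_integral_fst lam m2 p2).
- exact: (measurable_integral_fst lam mgn (fun z => g0 _)).
- exact: lebesgue_measure_set1.
rewrite -(lam2E2 m2 p2) (lam2E m2 p2)/=.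
pose G (y : mR) := (`|y|)%:E * g `|y|%R.
have mG : measurable_fun setT G.
  apply: emeasurable_funM; first by apply/measurable_EFinP; exact: normr_measurable.
  by apply: (measurableT_comp mg); exact: normr_measurable.
have G0 y : 0 <= G y by rewrite /G mule_ge0// lee_fin.
have -> : \int[lam]_(r in (`]0%R, +oo[%classic : set mR)) (r%:E * g r) =
    \int[lam]_(r in (`]0%R, +oo[%classic : set mR)) ((`|r|)%:E * g r).
  apply: eq_integral => r; rewrite inE/= in_itv/= andbT => r0.
  by rewrite gtr0_norm.
rewrite -muleA muleCA -(@lam_integral_even (fun r => (`|r|)%:E * g r)); last 2 first.
- by apply: emeasurable_funM => //; apply/measurable_EFinP; exact: normr_measurable.
- by move=> r; rewrite mule_ge0// lee_fin.
rewrite [X in _ * X](eq_integral G) => [|y _]; last by rewrite /G normr_id.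
rewrite -ge0_integralZr//; last 3 first.
- apply/measurable_EFinP; rewrite (_ : (fun k => _) = (fun k : mR => ((s k) ^+ 2)^-1%R)).
    apply: (measurableT_comp (@measurable_inv R)).
    exact: measurable_funX.
  by apply/funext => k; rewrite /s sqr_sqrtr// ltW.
- by move=> k _; rewrite lee_fin invr_ge0 ltW.
- exact: integral_ge0.
apply: eq_integral => k _.
have sk := s0 k; have sk1 : (0 < (s k)^-1)%R by rewrite invr_gt0.
have -> : \int[lam]_y ((`|y|)%:E * g (`|y| * s k)%R) = (s k)^-1%:E * \int[lam]_y G (s k * y)%R.
  rewrite -ge0_integralZl//; last 2 first.
  - by apply: (measurableT_comp mG); exact: (@measurable_funM _ R R setT (cst (s k)) id).
  - by rewrite lee_fin ltW.
  apply: eq_integral => y _; rewrite /G normrM (gtr0_norm sk) muleA -EFinM.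
  by rewrite mulrA mulVf ?gt_eqF// mul1r mulrC.
rewrite [X in _ * X = _](_ : _ = (s k)^-1%:E * \int[lam]_y G y); last first.
  rewrite (lebesgue_integral_scale_pos sk mG G0) muleA -EFinM mulVf ?gt_eqF//.
  by rewrite mul1e.
by rewrite muleA -EFinM -invfM -expr2 sqr_sqrtr// ltW.
Qed.

End planar_integrals.

(** * Integrals over the unit circle *)

Section circle.
Context (R : realType).
Local Notation mR := (measurableTypeR R).
Local Notation R2 := (mR * mR)%type.
Local Notation lam := (@lebesgue_measure R).
Local Notation tau := (2 * pi : R).

Definition expi (t : R) : R[i] := cos t +i* sin t.

Lemma expiD s t : expi (s + t) = expi s * expi t.
Proof. by apply/eqP; rewrite eq_complex /= cosD sinD eqxx addrC eqxx. Qed.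

Lemma normc_expi t : normc (expi t) = 1.
Proof. by rewrite /= cos2Dsin2 sqrtr1. Qed.

Lemma expi_2pi t : expi (t + tau) = expi t.
Proof. by rewrite /expi mulr_natl cosD2pi sinD2pi. Qed.

Lemma expi_surj (c : R[i]) : normc c = 1 -> exists2 s : R, 0 <= s <= tau & c = expi s.
Proof.
case: c => x y nc; have xy : x ^+ 2 + y ^+ 2 = 1.
  by rewrite -[LHS]sqr_sqrtr ?addr_ge0 ?sqr_ge0//; move: nc => /= ->; rewrite expr1n.
have x1 : -1 <= x <= 1.
  rewrite -ler_norml -(ler_pXn2r (ltn0Sn 1)) ?nnegrE// real_normK ?num_real// expr1n -xy.
  by rewrite lerDl sqr_ge0.
have p0 := acos_ge0 x1; have p1 := acos_lepi x1; have pp := pi_ge0 R.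
have ca : cos (acos x) = x by rewrite acosK// in_itv.
have sa : sin (acos x) = `|y| by rewrite sin_acos// -xy addrC addKr sqrtr_sqr.
have [y0|y0] := leP 0 y.
  by exists (acos x); [apply/andP; split; lra|rewrite /expi ca sa ger0_norm].
exists (tau - acos x); first by apply/andP; split; lra.
by rewrite addrC /expi mulr_natl cosD2pi sinD2pi cosN sinN ca sa ltr0_norm// opprK.
Qed.

Lemma cmeas_expi : cmeas (expi : mR -> R[i]).
Proof.
split.
  exact: (@continuous_measurable_fun R (@cos R) (@continuous_cos R)).
exact: (@continuous_measurable_fun R (@sin R) (@continuous_sin R)).
Qed.

Local Open Scope ereal_scope.

Lemma integral_indic_mul d (X : measurableType d) (mu : {measure set X -> \bar R})
    (A : set X) (f : X -> \bar R) :
  \int[mu]_(x in A) f x = \int[mu]_x ((\1_A x)%:E * f x).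
Proof.
rewrite integral_mkcond; apply: eq_integral => x _; rewrite patchE indicE.
by case: ifP; rewrite ?mul1e ?mul0e.
Qed.

Let measurable_seg (a b : R) : measurable (`[a, b]%classic : set mR).
Proof. exact: measurable_itv. Qed.

Let indic_seg (a b x : R) : \1_(`[a, b]%classic : set mR) x = (a <= x <= b)%R%:R :> R.
Proof. by rewrite indicE/=; congr (nat_of_bool _)%:R; apply/idP/idP; rewrite inE/= in_itv. Qed.

Section periodic.
Variable h : mR -> \bar R.
Hypothesis mh : measurable_fun setT h.
Hypothesis h0 : forall x, 0 <= h x.

Let seg (a b : R) := \int[lam]_t ((\1_(`[a, b]%classic : set mR) t)%:E * h t).

Let segE (a b : R) : \int[lam]_(t in `[a, b]%classic) h t = seg a b.
Proof. exact: integral_indic_mul. Qed.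

Let mseg a b (g : mR -> \bar R) : measurable_fun setT g ->
  measurable_fun setT (fun t => (\1_(`[a, b]%classic : set mR) t)%:E * g t).
Proof.
by move=> mg; apply: emeasurable_funM => //; apply: measurable_indicE.
Qed.

Let seg_split (a b c : R) : (a <= b <= c)%R -> seg a c = seg a b + seg b c.
Proof.
move=> /andP[ab bc]; rewrite /seg -ge0_integralD//; last 4 first.
- by move=> x _; rewrite mule_ge0// lee_fin.
- exact: mseg.
- by move=> x _; rewrite mule_ge0// lee_fin.
- exact: mseg.
apply: (@eq_integral_off_null _ _ R lam [set b]) => //.
- exact: lebesgue_measure_set1.
- exact: mseg.
- by apply: emeasurable_funD; exact: mseg.
- by move=> x; rewrite mule_ge0// lee_fin.
- by move=> x; rewrite adde_ge0// mule_ge0// lee_fin.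
- move=> x /= /eqP xb; rewrite -ge0_muleDl ?lee_fin// -EFinD; congr (_%:E * _).
  rewrite !indic_seg -natrD; congr (_%:R).
  case: (ltgtP x b) xb => [xb|xb|//] _; rewrite ?(ltW xb) ?andbT ?andbF ?addn0 ?add0n.
    by rewrite (le_trans (ltW xb) bc) andbT.
  by rewrite (le_trans ab (ltW xb)).
Qed.

Lemma integral_seg_shift (a b s : R) :
  \int[lam]_(t in `[a, b]%classic) h (t + s)%R =
  \int[lam]_(t in `[(a + s)%R, (b + s)%R]%classic) h t.
Proof.
rewrite segE integral_indic_mul /seg -[RHS](lebesgue_integral_shift s); last 2 first.
- exact: mseg.
- by move=> x; rewrite mule_ge0// lee_fin.
by apply: eq_integral => t _; rewrite !indic_seg !lerD2r.
Qed.

Hypothesis hper : forall t, h (t + tau)%R = h t.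

Lemma periodic_shift (s : R) : (0 <= s <= tau)%R ->
  \int[lam]_(t in `[0%R, tau]%classic) h (t + s)%R =
  \int[lam]_(t in `[0%R, tau]%classic) h t.
Proof.
move=> s01; have /andP[s0 s1] := s01; rewrite integral_seg_shift !segE.
rewrite add0r (seg_split (b := tau)); last by apply/andP; split; lra.
rewrite (seg_split s01) addeC; congr (_ + _).
have <- : \int[lam]_(t in `[0%R, s]%classic) h (t + tau)%R = seg tau (tau + s).
  by rewrite integral_seg_shift segE add0r addrC.
rewrite -segE; by apply: eq_integral => t _; rewrite hper.
Qed.

(** Compare the integral over two periods with its rescaling by 2. This is the invariance of circle
    means under z -> z^2, on which [circle_mean_sqr] rests. *)
Lemma periodic_double :
  \int[lam]_(t in `[0%R, tau]%classic) h (2 * t)%R =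
  \int[lam]_(t in `[0%R, tau]%classic) h t.
Proof.
have pp := pi_ge0 R.
have : seg 0 (tau + tau) = 2%:E * seg 0 tau.
  rewrite (seg_split (b := tau)); last by apply/andP; split; lra.
  rewrite -[X in _ + seg X _]add0r -[X in _ + X]segE -integral_seg_shift.
  rewrite (eq_integral (fun t : mR => h t)) => [|t _]; last by rewrite hper.
  by rewrite segE -mule2n -mule_natl.
have md : measurable_fun setT (fun t : mR => (2 * t)%R : mR).
  exact: (@measurable_funM _ R R setT (cst 2%R) id).
rewrite {1}/seg (@lebesgue_integral_scale_pos R 2); last 3 first.
- by [].
- exact: mseg.
- by move=> x; rewrite mule_ge0// lee_fin.
move=> /fin_muleI E; rewrite segE -E//.
rewrite integral_indic_mul; apply: eq_integral => t _.
rewrite !indic_seg; congr ((_%:R)%:E * _); congr nat_of_bool.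
by apply/idP/idP => /andP[t0 t1]; apply/andP; split; lra.
Qed.

End periodic.

Definition circle_integral (g : R[i] -> \bar R) : \bar R :=
  \int[lam]_(t in `[0%R, tau]%classic) g (expi t).

Section circle_integral.
Variable g : R[i] -> \bar R.
Hypotheses (mg : planar g) (g0 : forall z, 0 <= g z).

Let mge : measurable_fun setT (fun t : mR => g (expi t)).
Proof. exact: (planar_comp mg cmeas_expi). Qed.

Lemma circle_integral_rot (c : R[i]) : normc c = 1%R ->
  circle_integral (fun z => g (c * z)%R) = circle_integral g.
Proof.
move=> /expi_surj[s s01 ->]; rewrite /circle_integral.
rewrite -[RHS](periodic_shift mge _ _ s01)//; last by move=> t; rewrite expi_2pi.
by apply: eq_integral => t _; rewrite -expiD addrC.
Qed.

End circle_integral.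

End circle.

Section symmetrization.
Local Open Scope ereal_scope.

(** Since s preserves the measure, twice the integral of u is the integral of u + u o s; an
    inequality between the symmetrised integrands therefore suffices, even where u <= v fails
    pointwise. *)
Lemma le_integral_sym d (X : measurableType d) (R : realType)
    (mu : {measure set X -> \bar R}) (s : X -> X) (Z : set X) (u v : X -> \bar R) :
  (forall h : X -> \bar R, measurable_fun setT h -> (forall x, 0 <= h x) ->
     \int[mu]_x h (s x) = \int[mu]_x h x) ->
  measurable_fun setT s -> measurable Z -> mu Z = 0 ->
  measurable_fun setT u -> measurable_fun setT v ->
  (forall x, 0 <= u x) -> (forall x, 0 <= v x) ->
  (forall x, ~ Z x -> u x + u (s x) <= v x + v (s x)) ->
  \int[mu]_x u x <= \int[mu]_x v x.
Proof.
move=> hs ms mZ Z0 mu_ mv u0 v0 uv.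
have E (w : X -> \bar R) : measurable_fun setT w -> (forall x, 0 <= w x) ->
    2%:E * \int[mu]_x w x = \int[mu]_x (w x + w (s x)).
  move=> mw w0; rewrite ge0_integralD//; last exact: measurableT_comp.
  by rewrite hs// mule_natl mule2n.
rewrite -(@lee_pmul2l _ 2%:E)// !E//; apply: (@le_integral_off_null _ _ _ _ Z) => //.
- by apply: emeasurable_funD => //; exact: measurableT_comp.
- by apply: emeasurable_funD => //; exact: measurableT_comp.
- by move=> x; rewrite adde_ge0.
- by move=> x; rewrite adde_ge0.
Qed.

(** The rearrangement inequality (a - b)(x - y) >= 0. The entries x and y are extended reals because
    they will be integrals of ray integrals. *)
Lemma rearrange_ereal (R : realType) (a b : R) (x y : \bar R) :
  (0 <= b <= a)%R -> 0 <= y -> y <= x -> b%:E * x + a%:E * y <= a%:E * x + b%:E * y.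
Proof.
move=> /andP[b0 ba] y0 yx; case: x yx => [x| |].
- case: y y0 => [y| |] //; rewrite !lee_fin => y0 yx.
  rewrite -subr_ge0 (_ : _ - _ = (a - b) * (x - y))%R; last by ring.
  by rewrite mulr_ge0// subr_ge0.
- move=> _; have [a00|a0] := eqVneq a 0%R.
    have -> : b = 0%R by apply/eqP; rewrite eq_le b0 -a00 ba.
    by rewrite a00 !mul0e.
  rewrite [X in _ <= X + _]gt0_muley ?lte_fin ?lt_def ?a0 ?(le_trans b0)//.
  by rewrite addye ?leey// gt_eqF// (@lt_le_trans _ _ 0)// mule_ge0// lee_fin.
- by move=> /(le_trans y0); rewrite leNgt ltNy0.
Qed.

Lemma rearrange_ereal_sym (R : realType) (a b : R) (x y : \bar R) :
  (0 <= b <= a)%R -> 0 <= y -> y <= x -> a%:E * y + b%:E * x <= b%:E * y + a%:E * x.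
Proof. by move=> h1 h2 h3; rewrite addeC [leRHS]addeC rearrange_ereal. Qed.

Lemma tonelli d1 d2 (X : measurableType d1) (Y : measurableType d2) (R : realType)
    (mu : {sigma_finite_measure set X -> \bar R}) (nu : {sigma_finite_measure set Y -> \bar R})
    (h : X -> Y -> \bar R) : measurable_fun setT (fun z : X * Y => h z.1 z.2) ->
  (forall x y, 0 <= h x y) ->
  \int[mu]_x \int[nu]_y h x y = \int[nu]_y \int[mu]_x h x y.
Proof. by move=> mh h0; exact: (@fubini_tonelli _ _ _ _ _ mu nu (fun z => h z.1 z.2)). Qed.

End symmetrization.

Section complex_vectors.
Context (R : realType).
Local Notation mR := (measurableTypeR R).

Definition cvec (a b : R[i]) : 'rV[R]_4 :=
  \row_i [:: complex.Re a; complex.Im a; complex.Re b; complex.Im b]`_i.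

Lemma cvecZ (r : R) a b : r *: cvec a b = cvec (r%:C * a) (r%:C * b).
Proof.
apply/rowP => i; rewrite !mxE; case: a b => a1 a2 [b1 b2].
by case: i => -[|[|[|[|]]]] //= _; rewrite mul0r ?subr0 ?addr0.
Qed.

Lemma cvecD a b a' b' : cvec a b + cvec a' b' = cvec (a + a') (b + b').
Proof.
apply/rowP => i; rewrite !mxE; case: a b a' b' => a1 a2 [b1 b2] [a1' a2'] [b1' b2'].
by case: i => -[|[|[|[|]]]].
Qed.

Lemma cvec_eq0 a b : (cvec a b == 0) = (a == 0) && (b == 0).
Proof.
apply/eqP/andP => [/rowP h|[/eqP-> /eqP->]]; last first.
  by apply/rowP => i; rewrite !mxE; case: i => -[|[|[|[|]]]].
have h0 := h 0; have h1 := h 1; have h2 := h 2; have h3 := h 3.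
move: h0 h1 h2 h3; rewrite !mxE /=; case: a b {h} => a1 a2 [b1 b2] /= -> -> -> ->.
by rewrite !eqxx.
Qed.

Lemma cmeas_cvec d (X : measurableType d) (f : 'rV[R]_4 -> R) (a b : X -> R[i]) :
  measurable_fun setT (fun t : 4.-tuple mR => f (row_of t)) -> cmeas a -> cmeas b ->
  measurable_fun setT (fun x => f (cvec (a x) (b x))).
Proof.
move=> mf [ma1 ma2] [mb1 mb2].
rewrite (_ : (fun x => _) = (fun t : 4.-tuple mR => f (row_of t)) \o
   (fun x => tuple_of (cvec (a x) (b x)))); last first.
  by apply/funext => x /=; rewrite tuple_ofK.
apply: measurableT_comp => //; apply: measurable_tuple_of => i.
under eq_fun do rewrite mxE.
by case: i => -[|[|[|[|]]]] //=.
Qed.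

Lemma cmeasN d (X : measurableType d) (f : X -> R[i]) : cmeas f -> cmeas (fun x => - f x).
Proof.
move=> mf; rewrite (_ : (fun x => _) = (fun x => -1 * f x)).
  by apply: cmeasM => //; exact: cmeas_cst.
by apply/funext => x; rewrite mulN1r.
Qed.

Lemma cmeas_real d (X : measurableType d) (f : X -> R) : measurable_fun setT f ->
  cmeas (fun x => (f x)%:C).
Proof. by move=> mf; split => //=; exact: measurable_cst. Qed.

Lemma measurable_normc d (X : measurableType d) (f : X -> R[i]) : cmeas f ->
  measurable_fun setT (fun x => normc (f x)).
Proof. by move=> mf; exact: (planar_comp (@planar_normc R) mf). Qed.

Lemma cmeas_comp d1 d2 (X : measurableType d1) (Y : measurableType d2) (f : Y -> R[i])
    (g : X -> Y) : cmeas f -> measurable_fun setT g -> cmeas (fun x => f (g x)).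
Proof. by move=> [f1 f2] mg; split; [exact: (measurableT_comp f1)|exact: (measurableT_comp f2)]. Qed.

Lemma powR_mul_sqr (b p : R) : 0 < b -> b ^+ 2 * b `^ p = b `^ (p + 2).
Proof.
move=> b0; rewrite powRD ?(gt_eqF b0) ?implybT// [RHS]mulrC.
by rewrite -powR_mulrn// ltW.
Qed.

Lemma convex_comb_le (r G N : R) : 0 <= r -> r <= 1 -> G <= N -> r * N + (1 - r) * G <= N.
Proof. by move=> r0 r1 GN; nra. Qed.

Lemma ler_powRN (x y q : R) : 0 <= q -> 0 < x -> x <= y -> y `^ (- q) <= x `^ (- q).
Proof.
move=> q0 x0 xy; have y0 := lt_le_trans x0 xy.
rewrite !powRN lef_pV2 ?posrE ?powR_gt0//.
by apply: ge0_ler_powR => //; rewrite nnegrE ltW.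
Qed.

End complex_vectors.

Ltac cm := repeat first
  [ apply: cmeasD | apply: cmeasN | apply: cmeasM | exact: cmeas_cst
  | apply: cmeas_toC; first [exact: measurable_fst | exact: measurable_snd | exact: measurable_id]
  | apply: (cmeas_comp (@cmeas_expi _)); first [exact: measurable_fst | exact: measurable_snd | exact: measurable_id]
  | apply: cmeas_real | apply: measurable_normc ].

(** * Mean inequalities in the plane *)

Section complex_planar_key.
Context (R : realType).
Local Notation mR := (measurableTypeR R).
Local Notation R2 := (mR * mR)%type.
Local Notation lam := (@lebesgue_measure R).
Local Notation lam2 := (lam2 R).
Local Notation tau := (2 * pi : R).
Variables (p B : R) (f : 'rV[R]_4 -> R).
Hypotheses (p2 : -2 < p) (p0 : p < 0).
Hypothesis mf4 : measurable_fun setT (fun t : 4.-tuple mR => f (row_of t)).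
Hypothesis fB : forall x, 0 <= f x <= B.
Hypothesis f_supp : forall x, x != 0 ->
  exists2 M : R, 0 <= M & forall r : R, 0 < f (r *: x) -> `|r| <= M.
Hypothesis f_pos : forall x, exists e c : R,
  [/\ 0 < e, 0 < c & forall r : R, 0 < r <= e -> c <= f (r *: x)].
Hypothesis f_logc : forall (t : R) x y, 0 < t < 1 ->
  f x `^ t * f y `^ (1 - t) <= f (t *: x + (1 - t) *: y).
Hypothesis f_rot : forall (z a b : R[i]), normc z = 1 ->
  f (cvec (z * a) (z * b)) = f (cvec a b).

(** The substitution a = b w contributes |b|^2 to |b|^p, and polar coordinates in b contribute one
    more r: along a ray the weight is r^(p+3) = r^(q-1). *)
Let q := p + 4.

Let q1 : 1 <= q. Proof. by have := p2; rewrite /q => h; lra. Qed.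

Let f0 x : 0 <= f x. Proof. by case/andP: (fB x). Qed.

Let mf x : measurable_fun setT (fun r : mR => f (r *: x)).
Proof.
rewrite (_ : (fun r => _) = (fun t => f (row_of t)) \o (fun r : mR => tuple_of (r *: x))).
  apply: measurableT_comp => //; apply: measurable_tuple_of => i.
  under eq_fun do rewrite mxE.
  exact: (@measurable_funM _ R R setT id (cst _)).
by apply/funext => r /=; rewrite tuple_ofK.
Qed.

Let nn a b := ball_norm q f (cvec a b).

Let nnD a b a' b' : nn (a + a') (b + b') <= nn a b + nn a' b'.
Proof. by rewrite /nn -cvecD; exact: (ball_normD q1 mf fB f_supp f_pos f_logc). Qed.

Let nnZ (r : R) a b : 0 <= r -> nn (r%:C * a) (r%:C * b) = r * nn a b.
Proof. by rewrite /nn -cvecZ => r0; exact: (ball_normZ q1 mf fB f_supp f_pos). Qed.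

Local Open Scope ereal_scope.

(** The integral of |<x, u + z w>|^p for w = v + c u, in the coordinates a = <x,u> and b = <x,v> of
    the fibration. *)
Let D (z c : R[i]) : \bar R := \int[lam2]_a \int[lam2]_b
  (normc (toC a + z * (toC b + c * toC a))%R `^ p * f (cvec (toC a) (toC b)))%:E.

Let mV d (X : measurableType d) (x y z : X -> R[i]) : cmeas x -> cmeas y -> cmeas z ->
  measurable_fun setT (fun w => (normc (x w) `^ p * f (cvec (y w) (z w)))%:E).
Proof.
move=> mx my mz; apply/measurable_EFinP; apply: measurable_funM.
  exact: cmeas_normc_powR.
exact: cmeas_cvec.
Qed.

Let V0 x y : 0 <= (normc x `^ p * f y)%:E.
Proof. by rewrite lee_fin mulr_ge0// powR_ge0. Qed.

Let mfr d (X : measurableType d) (r : X -> R) (y z : X -> R[i]) : measurable_fun setT r ->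
  cmeas y -> cmeas z -> measurable_fun setT (fun w => f (r w *: cvec (y w) (z w))).
Proof.
move=> mr my mz; under eq_fun do rewrite cvecZ.
by apply: cmeas_cvec => //; apply: cmeasM => //; exact: cmeas_real.
Qed.

(** After the shear, b stands for b + c a. The direction (w, 1 - c w) is (a, b - c a) divided by b,
    where a = b w. *)
Let rho (c w : R[i]) := ray_integral q f (cvec w (1 - c * w)%R).

Let rho_ge0 c w : 0 <= rho c w.
Proof. by apply: integral_ge0 => r _; rewrite lee_fin mulr_ge0// powR_ge0. Qed.

Let mrho c : planar (rho c).
Proof.
rewrite /planar (_ : _ \o _ = fun w : R2 => \int[lam]_(r in (setT : set mR))
    ((\1_(`]0%R, +oo[%classic : set mR) r)%:E *
     (r `^ (q - 1) * f (r *: cvec (toC w) (1 - c * toC w)%R))%:E)); last first.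
  by apply/funext => w; rewrite /= -integral_indic_mul.
apply: (measurable_integral_snd lam (g := fun x : R2 * mR =>
  (\1_(`]0%R, +oo[%classic : set mR) x.2)%:E *
     (x.2 `^ (q - 1) * f (x.2 *: cvec (toC x.1) (1 - c * toC x.1)%R))%:E)).
  apply: emeasurable_funM.
    by apply: (measurableT_comp (f := fun r : mR => (\1_(`]0%R, +oo[%classic : set mR) r)%:E)) => //;
      apply: measurable_indicE; exact: measurable_itv.
  apply/measurable_EFinP; apply: measurable_funM.
    exact: (measurableT_comp (@measurable_powR R _) measurable_snd).
  by apply: mfr; [exact: measurable_snd|cm|cm].
by move=> x; rewrite mule_ge0// lee_fin// mulr_ge0// powR_ge0.
Qed.

Let kappa : \bar R := 2%:E * (\int[lam]_k ((1 + k ^+ 2)^-1)%:E).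

Let kappa0 : 0 <= kappa.
Proof.
rewrite /kappa mule_ge0//; apply: integral_ge0 => k _.
by rewrite lee_fin invr_ge0 addr_ge0// sqr_ge0.
Qed.

Let toCB (a b : R2) : toC ((a.1 + b.1)%R : mR, (a.2 + b.2)%R : mR) = (toC a + toC b)%R.
Proof. by []. Qed.

Let D_shear z c : D z c = \int[lam2]_b \int[lam2]_a
  (normc (toC a + z * toC b)%R `^ p * f (cvec (toC a) (toC b - c * toC a)%R))%:E.
Proof.
pose g (a b : R2) := (normc (toC a + z * toC b)%R `^ p *
  f (cvec (toC a) (toC b - c * toC a)%R))%:E.
have mg : measurable_fun setT (fun x : R2 * R2 => g x.1 x.2) by apply: mV; cm.
transitivity (\int[lam2]_a \int[lam2]_b g a b); last exact: (tonelli lam2 lam2 mg (fun a b => V0 _ _)).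
apply: eq_integral => a _.
rewrite -[LHS](haar_integral (ofC (- (c * toC a))%R) (is_haar_lam2 R))//; last first.
  by apply: mV; cm.
apply: eq_integral => b _; rewrite toCB ofCK; congr (normc (_ + z * _)%R `^ p * _)%:E.
by rewrite subrK.
Qed.

Let f_cvec_mul (b a' b' : R[i]) : f (cvec (b * a')%R (b * b')%R) = f (normc b *: cvec a' b').
Proof.
have [->|b0] := eqVneq b 0%R.
  by rewrite !mul0r normc0 scale0r; congr f; apply/eqP; rewrite cvec_eq0 eqxx.
have nb : normc b != 0%R by rewrite gt_eqF// normc_gt0.
have u : normc ((normc b)^-1%:C * b)%R = 1%R.
  by rewrite normcM normc_real ger0_norm ?invr_ge0 ?normc_ge0// mulVf.
rewrite cvecZ -[RHS](f_rot _ _ u) !mulrA; congr (f (cvec (_ * _)%R (_ * _)%R)).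
  by rewrite mulrAC -rmorphM mulVf// rmorph1 mul1r.
by rewrite mulrAC -rmorphM mulVf// rmorph1 mul1r.
Qed.

(** For b != 0 substitute a = b w. The modulus splits as |b| |w + z|, rotation invariance lets |b|
    replace b in the argument of f, and polar coordinates in b produce the ray integral. The shift z
    now appears only in |w + z|^p. *)
Let D_ray z c : D z c = kappa * \int[lam2]_w ((normc (toC w + z)%R `^ p)%:E * rho c (toC w)).
Proof.
rewrite D_shear.
pose h (b w : R2) := (normc (toC w + z)%R `^ p * (normc (toC b) `^ (p + 2) *
  f (normc (toC b) *: cvec (toC w) (1 - c * toC w)%R)))%:E.
have h0 b w : 0 <= h b w by rewrite lee_fin !mulr_ge0 ?powR_ge0.
have mh : measurable_fun setT (fun x : R2 * R2 => h x.1 x.2).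
  apply/measurable_EFinP; apply: measurable_funM; first by apply: cmeas_normc_powR; cm.
  apply: measurable_funM; first by apply: cmeas_normc_powR; cm.
  by apply: mfr; cm.
rewrite (@eq_integral_off_null _ _ _ lam2 [set (0%R, 0%R)] _ (fun b => \int[lam2]_w h b w)).
- rewrite (tonelli lam2 lam2 mh h0) -ge0_integralZl//.
  + apply: eq_integral => w _; rewrite muleCA.
    rewrite /h; under eq_integral do rewrite EFinM.
    rewrite ge0_integralZl//.
    * congr (_ * _).
      pose g (r : mR) := (r `^ (p + 2) * f (r *: cvec (toC w) (1 - c * toC w)%R))%:E.
      rewrite (planar_polar (g := g))//.
      - congr (_ * _); apply: eq_integral => r; rewrite inE/= in_itv/= andbT => r0.
        rewrite /g -EFinM mulrA; congr (_ * _)%:E.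
        rewrite -{1}(powRr1 (ltW r0)) -powRD ?(gt_eqF r0) ?implybT//.
        by congr (r `^ _)%R; rewrite /q; ring.
      - by apply/measurable_EFinP; apply: measurable_funM => //; exact: measurable_powR.
      - by move=> r; rewrite lee_fin mulr_ge0// powR_ge0.
    * apply/measurable_EFinP; apply: measurable_funM; first by apply: cmeas_normc_powR; cm.
      by apply: mfr; cm.
    * by move=> b _; rewrite lee_fin mulr_ge0 ?powR_ge0.
    * by rewrite lee_fin powR_ge0.
  + apply: emeasurable_funM; first by apply/measurable_EFinP; apply: cmeas_normc_powR; cm.
    exact: mrho.
  + by move=> w _; rewrite mule_ge0// lee_fin powR_ge0.
- exact: measurable_lam2_set1.
- exact: lam2_set1.
- apply: (measurable_integral_snd lam2 (g := fun x => (normc (toC x.2 + z * toC x.1)%R `^ p * f (cvec (toC x.2) (toC x.1 - c * toC x.2)%R))%:E)) => //.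
  by apply: mV; cm.
- exact: (measurable_integral_snd lam2 (g := fun x => h x.1 x.2)).
- by move=> b; apply: integral_ge0.
- by move=> b; apply: integral_ge0.
- move=> b /= b0; have bn0 : toC b != 0%R.
    apply/eqP => E; apply: b0; rewrite -[b]toCK E; done.
  rewrite [LHS](planar_mul (g := fun a => (normc (a + z * toC b)%R `^ p * f (cvec a (toC b - c * a)%R))%:E) bn0)//; last first.
    by apply: mV; cm.
  rewrite -ge0_integralZl//; last 2 first.
  + by apply: mV; cm.
  + by rewrite lee_fin sqr_ge0.
  apply: eq_integral => w _; rewrite /h -EFinM; congr _%:E.
  have -> : (toC b * toC w + z * toC b = toC b * (toC w + z))%R by rewrite mulrDr (mulrC z).
  have -> : (toC b - c * (toC b * toC w) = toC b * (1 - c * toC w))%R by rewrite mulrBr mulr1 mulrCA.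
  rewrite f_cvec_mul normcM powRM ?normc_ge0// !mulrA; congr (_ * _)%R.
  by rewrite powR_mul_sqr ?normc_gt0// mulrC.
Qed.

Let ray_rot (z a b : R[i]) : normc z = 1%R ->
  ray_integral q f (cvec (z * a)%R (z * b)%R) = ray_integral q f (cvec a b).
Proof.
move=> z1; apply: eq_integral => r _; congr (_ * _)%:E.
by rewrite !cvecZ (mulrCA _ z a) (mulrCA _ z b) (f_rot _ _ z1).
Qed.

Let nn_rot (z a b : R[i]) : normc z = 1%R -> nn (z * a)%R (z * b)%R = nn a b.
Proof.
move=> z1; have z0 : z != 0%R by rewrite -normc_gt0 z1.
by rewrite /nn /ball_norm ray_rot// !cvec_eq0 !mulf_eq0 (negbTE z0).
Qed.

(** A functional supporting the norm at (0,1) selects the complex line w -> (w, 1 - c w) on which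
    the norm is least at w = 0. By convexity the norm then increases along rays from 0 in that line,
    and [rho], its power with exponent -q, decreases. *)
Let shear : exists c : R[i], forall (l : R) w, (0 <= l <= 1)%R ->
  rho c w <= rho c (l%:C * w)%R.
Proof.
have [l lE l01] := hahn_banach_rV (cvec 0%R 1%R) (ball_normD q1 mf fB f_supp f_pos f_logc)
  (fun c x c0 => ball_normZ q1 mf fB f_supp f_pos x c0).
pose al : R[i] := l 0%R 0%R -i* l 0%R 1%R; pose be : R[i] := l 0%R 2%R -i* l 0%R 3%R.
have sumE a b : (\sum_i l 0 i * cvec a b 0 i = complex.Re (al * a + be * b))%R.
  rewrite !big_ord_recl big_ord0 !mxE /=; case: a b => a1 a2 [b1 b2] /=.
  have -> : lift ord0 (ord0 : 'I_3) = 1%R by exact/val_inj.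
  have -> : lift ord0 (lift ord0 (ord0 : 'I_2)) = 2%R by exact/val_inj.
  have -> : lift ord0 (lift ord0 (lift ord0 (ord0 : 'I_1))) = 3%R by exact/val_inj.
  by ring.
have bound a b : (normc (al * a + be * b) <= nn a b)%R.
  set S := (al * a + be * b)%R; have [S0|S0] := eqVneq S 0%R.
    by rewrite S0 normc0; exact: ball_norm_ge0.
  have nS : normc S != 0%R by rewrite gt_eqF// normc_gt0.
  (* This unit rotates S onto |S|. As the norm is rotation invariant, the bound on the real part of
     the functional becomes a bound on its modulus. *)
  pose z := (S^* * ((normc S)^-1)%:C)%R.
  have SS : (S * S^* = (normc S ^+ 2)%:C)%R.
    by rewrite -sqr_normc rmorphXn.
  have nSJ : normc (S^*)%C = normc S.
    by case: (S) => s1 s2 /=; rewrite sqrrN.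
  have z1 : normc z = 1%R.
    by rewrite normcM normc_real nSJ ger0_norm ?invr_ge0 ?normc_ge0// mulfV.
  have := lE (cvec (z * a)%R (z * b)%R); rewrite sumE -/(nn _ _) nn_rot//.
  have -> : (al * (z * a) + be * (z * b) = S * z)%R by rewrite /S; ring.
  by rewrite mulrA SS -rmorphM /= expr2 mulfK.
(* The real part of [be] is the norm of (0,1), which bounds |be|; so the imaginary part vanishes. *)
have be_real : be = ((nn 0%R 1%R)%:C)%R.
  have /eqP : (\sum_i l 0 i * cvec 0%R 1%R 0%R i = nn 0%R 1%R)%R by rewrite l01.
  rewrite sumE mulr0 add0r mulr1 => /eqP bR.
  have := bound 0%R 1%R; rewrite mulr0 add0r mulr1 => h.
  suff imbe : complex.Im be = 0%R by apply/eqP; rewrite eq_complex bR imbe !eqxx.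
  move: h; rewrite -bR; case: (be) => x y /= h.
  have x0 : (0 <= x)%R := le_trans (sqrtr_ge0 _) h.
  have : (x ^+ 2 + y ^+ 2 <= x ^+ 2)%R.
    rewrite -(ler_pXn2r (ltn0Sn 1)) ?nnegrE ?sqrtr_ge0// in h.
    by rewrite sqr_sqrtr ?addr_ge0 ?sqr_ge0// in h.
  rewrite gerDl => y2; have : (y ^+ 2 == 0)%R by rewrite eq_le y2 sqr_ge0.
  by rewrite expf_eq0 => /eqP.
have G0 : (0 < nn 0%R 1%R)%R.
  by apply: (ball_norm_gt0 q1 mf fB f_supp f_pos); rewrite cvec_eq0 oner_eq0 andbF.
(* With this c the functional is constantly G on the line w -> (w, 1 - c w), so the norm there is at
   least G, its value at w = 0. *)
pose G := nn 0%R 1%R; pose c := (al / G%:C)%R.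
have GC0 : (G%:C != 0)%R by rewrite (inj_eq (@complexI R)) gt_eqF.
have nnG w : (G <= nn w (1 - c * w))%R.
  apply: le_trans (bound w (1 - c * w)%R).
  have -> : (al * w + be * (1 - c * w) = G%:C)%R.
    by rewrite be_real -/G /c; field.
  by rewrite normc_real ler_norm.
exists c => r w /andP[r0 r1].
have cv x : cvec x (1 - c * x)%R != 0%R.
  rewrite cvec_eq0; have [->|//] := eqVneq x 0%R.
  by rewrite mulr0 subr0 oner_eq0.
have rhoR x : rho c x = (nn x (1 - c * x)%R `^ (- q))%:E.
  exact: (ray_integralE q1 mf fB f_supp f_pos (cv x)).
rewrite !rhoR lee_fin; apply: ler_powRN; first exact: le_trans q1.
  exact: (ball_norm_gt0 q1 mf fB f_supp f_pos).
have -> : nn (r%:C * w)%R (1 - c * (r%:C * w))%R =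
    nn (r%:C * w + (1 - r)%:C * 0)%R (r%:C * (1 - c * w) + (1 - r)%:C * 1)%R.
  by congr (nn _ _); rewrite rmorphB rmorph1; ring.
have r1' : (0 <= 1 - r)%R by rewrite subr_ge0.
have h1 := nnD (r%:C * w)%R (r%:C * (1 - c * w))%R ((1 - r)%:C * 0)%R ((1 - r)%:C * 1)%R.
have h2 := nnZ w (1 - c * w)%R r0; have h3 := nnZ 0%R 1%R r1'.
rewrite h2 h3 -/G in h1; apply: le_trans h1 _.
exact: convex_comb_le (nnG w).
Qed.

(** Averaging over the rotations of z makes [rho] radial as well. What is left is the integral of |w
    + r|^p against a radially decreasing function; since p < 0, both factors decrease with the
    modulus, and their overlap is largest at r = 0. *)
Theorem complex_planar_key : exists c : R[i], forall r : R, (0 <= r)%R ->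
  circle_integral (fun z => D (r%:C * z)%R c) <= tau%:E * D 0%R c.
Proof.
have [c rhoE] := shear; exists c => r r0.
pose M (z : R[i]) := \int[lam2]_w ((normc (toC w + z)%R `^ p)%:E * rho c (toC w)).
pose ph (w : R[i]) := circle_integral (fun z => rho c (z * w)%R).
have ph0 w : 0 <= ph w by apply: integral_ge0.
have mphi d (X : measurableType d) (x y : X -> R[i]) : cmeas x -> cmeas y ->
    measurable_fun setT (fun t => (normc (x t) `^ p)%:E * rho c (y t)).
  move=> mx my; apply: emeasurable_funM; first by apply/measurable_EFinP; exact: cmeas_normc_powR.
  exact: (planar_comp (@mrho c)).
have phE w : ph w = \int[lam]_t ((\1_(`[0%R, tau]%classic : set mR) t)%:E * rho c (expi t * w)%R).
  by rewrite /ph /circle_integral integral_indic_mul.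
have mI d (X : measurableType d) (s : X -> mR) : measurable_fun setT s ->
    measurable_fun setT (fun x => (\1_(`[0%R, tau]%classic : set mR) (s x))%:E : \bar R).
  move=> ms; apply: (measurableT_comp (f := fun r : mR => (\1_(`[0%R, tau]%classic : set mR) r)%:E)) => //.
  by apply: measurable_indicE; exact: measurable_itv.
have mph : planar ph.
  rewrite /planar (_ : ph \o _ = fun w => \int[lam]_t ((\1_(`[0%R, tau]%classic : set mR) t)%:E * rho c (expi t * toC w)%R)).
    apply: (measurable_integral_snd lam (g := fun x : R2 * mR =>
      (\1_(`[0%R, tau]%classic : set mR) x.2)%:E * rho c (expi x.2 * toC x.1)%R)).
      apply: emeasurable_funM; first by apply: mI; exact: measurable_snd.
      by apply: (planar_comp (@mrho c)); cm.
    by move=> x; rewrite mule_ge0// lee_fin.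
  by apply/funext => w; rewrite /= phE.
have ph_rot (z w : R[i]) : normc z = 1%R -> ph (z * w)%R = ph w.
  move=> z1; have mE : planar (fun e => rho c (e * w)%R).
    by apply: (planar_comp (@mrho c)); cm.
  transitivity (circle_integral (fun e => rho c (z * e * w)%R)).
    by apply: eq_integral => t _; congr (rho c _); rewrite mulrCA mulrA.
  exact: (circle_integral_rot mE (fun _ => rho_ge0 _ _) z1).
have ph_le w w' : (normc w <= normc w')%R -> ph w' <= ph w.
  have [->|w0] := eqVneq w' 0%R.
    by rewrite normc0 => h; rewrite (_ : w = 0%R)//; apply: eq0_normc; apply/eqP; rewrite eq_le h normc_ge0.
  move=> ww'; have nw : (0 < normc w')%R by rewrite normc_gt0.
  have [->|wn0] := eqVneq w 0%R.
    apply: ge0_le_integral => //.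
    - by apply: measurable_funTS; apply: (planar_comp (@mrho c)); cm.
    - by apply: measurable_funTS; apply: (planar_comp (@mrho c)); cm.
    - move=> t _; rewrite mulr0; have := rhoE 0%R (expi t * w')%R; rewrite lexx ler01 => /(_ isT).
      by rewrite rmorph0 mul0r.
  have nw0 : (0 < normc w)%R by rewrite normc_gt0.
  pose l := (normc w / normc w')%R.
  have l0 : (0 < l)%R by rewrite divr_gt0.
  pose z := (w / (w' * l%:C))%R.
  have z1 : normc z = 1%R.
    rewrite /z normcM normcV normcM normc_real gtr0_norm// /l mulrCA mulfV ?gt_eqF//.
    by rewrite mulr1 mulfV// gt_eqF.
  have -> : w = (z * (l%:C * w'))%R.
    by rewrite /z (mulrC w') mulrVK// unitfE mulf_neq0// (inj_eq (@complexI R)) gt_eqF.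
  rewrite (ph_rot _ _ z1); have mr x : planar (fun e => rho c (e * x)%R).
    by apply: (planar_comp (@mrho c)); cm.
  apply: ge0_le_integral.
  - exact: measurable_itv.
  - by move=> t _; exact: rho_ge0.
  - by apply: measurable_funTS; exact: (planar_comp (mr _) (@cmeas_expi R)).
  - by apply: measurable_funTS; exact: (planar_comp (mr _) (@cmeas_expi R)).
  - move=> t _; rewrite mulrCA; apply: rhoE.
    by rewrite (ltW l0)/= ler_pdivrMr// mul1r.
pose W (s : R) := \int[lam2]_w ((normc (toC w + s%:C)%R `^ p)%:E * ph (toC w)).
have mM : planar M.
  apply: (measurable_integral_snd lam2 (g := fun x : R2 * R2 =>
    (normc (toC x.2 + toC x.1)%R `^ p)%:E * rho c (toC x.2))).
    by apply: mphi; cm.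
  by move=> x; rewrite mule_ge0// lee_fin powR_ge0.
(* Rotating w by e^(it) takes the rotation out of |w + s e^(it)| and puts it into the argument of
   [rho], where integration over t produces [ph]. *)
have MW s : circle_integral (fun z => M (s%:C * z)%R) = W s.
  pose h (t : mR) (w : R2) := (\1_(`[0%R, tau]%classic : set mR) t)%:E *
    ((normc (toC w + s%:C)%R `^ p)%:E * rho c (expi t * toC w)%R).
  have h0 t w : 0 <= h t w by rewrite !mule_ge0// lee_fin// powR_ge0.
  have mh : measurable_fun setT (fun x : mR * R2 => h x.1 x.2).
    apply: emeasurable_funM; first by apply: mI; exact: measurable_fst.
    by apply: mphi; cm.
  rewrite /circle_integral integral_indic_mul.
  transitivity (\int[lam]_t \int[lam2]_w h t w).
    apply: eq_integral => t _.
    pose g (w : R2) := (normc (toC w + s%:C)%R `^ p)%:E * rho c (expi t * toC w)%R.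
    transitivity ((\1_(`[0%R, tau]%classic : set mR) t)%:E * \int[lam2]_w g w); last first.
      apply/esym/ge0_integralZl.
      - exact: measurableT.
      - by apply: mphi; cm.
      - by move=> w _; rewrite mule_ge0// lee_fin powR_ge0.
      - by rewrite lee_fin.
    have e0 : expi t != 0%R by rewrite -normc_gt0 normc_expi.
    suff -> : M (s%:C * expi t)%R = \int[lam2]_w g w by [].
    have mk : planar (fun w => (normc (w + s%:C * expi t)%R `^ p)%:E * rho c w).
      by apply: mphi; cm.
    have k0 w : 0 <= (normc (w + s%:C * expi t)%R `^ p)%:E * rho c w.
      by rewrite mule_ge0// lee_fin powR_ge0.
    rewrite [LHS](planar_mul e0 mk k0) normc_expi expr1n mul1e; apply: eq_integral => w _.
    by rewrite (mulrC s%:C) -mulrDr normcM normc_expi mul1r.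
  rewrite (tonelli lam lam2 mh h0); apply: eq_integral => w _.
  rewrite phE -ge0_integralZl//; last 3 first.
  - apply: emeasurable_funM; first by apply: mI; exact: measurable_id.
    by apply: (planar_comp (@mrho c)); cm.
  - by move=> t _; rewrite mule_ge0// lee_fin.
  - by rewrite lee_fin powR_ge0.
  by apply: eq_integral => t _; rewrite /h muleCA.
have M0 z : 0 <= M z by apply: integral_ge0 => w _; rewrite mule_ge0// lee_fin powR_ge0.
have -> : circle_integral (fun z => D (r%:C * z)%R c) = kappa * W r.
  rewrite -MW /circle_integral -ge0_integralZl//.
  - by apply: eq_integral => t _; rewrite D_ray.
  - apply: measurable_funTS; apply: (planar_comp mM); cm.
have -> : tau%:E * D 0%R c = kappa * W 0%R.
  rewrite D_ray muleCA; congr (_ * _); rewrite -MW /circle_integral.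
  rewrite [RHS](eq_integral (fun=> M 0%R)); last by move=> t _; rewrite (_ : 0%:C * expi t = 0)%R//; exact: mul0r.
  rewrite integral_cst// [X in _ = _ * X](@lebesgue_measure_itv R `[0%R, tau])/= lte_fin.
  by rewrite mulr_gt0 ?pi_gt0// oppr0 adde0 muleC.
suff WW : W r <= W 0%R by exact: (lee_wpmul2l kappa0 WW).
(* The reflection w -> -r - w exchanges |w| and |w + r|. On each pair of reflected points W 0
   matches larger values with larger ones and W r matches them crosswise, so the rearrangement
   inequality applies. *)
pose sg (w : R2) : R2 := ofC (- r%:C - toC w)%R.
have msg : measurable_fun setT sg by apply: cmeas_ofC; cm.
pose U (s : R) (w : R2) := (normc (toC w + s%:C)%R `^ p)%:E * ph (toC w).
have mU s : measurable_fun setT (U s).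
  apply: emeasurable_funM; first by apply/measurable_EFinP; apply: cmeas_normc_powR; cm.
  exact: mph.
have U0 s w : 0 <= U s w by rewrite /U mule_ge0// lee_fin powR_ge0.
(* At these two points a modulus vanishes and [powR] with negative exponent returns 0, which breaks
   monotonicity. *)
pose Z : set R2 := [set ((0%R : mR), (0%R : mR))] `|` [set ofC (- r%:C)%R].
have mZ : measurable Z by apply: measurableU; exact: measurable_lam2_set1.
have Z0 : lam2 Z = 0.
  by rewrite (null_set_setU (mu := lam2))//; solve [exact: measurable_lam2_set1 | exact: lam2_set1].
have hs (h : R2 -> \bar R) : measurable_fun setT h -> (forall w, 0 <= h w) ->
    \int[lam2]_w h (sg w) = \int[lam2]_w h w.
  move=> mh h0.
  have mh' : planar (fun z => h (ofC z)).
    rewrite /planar (_ : _ \o _ = h)//; apply/funext => w /=; exact: congr1 (toCK w).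
  have n1 : (-1 : R[i])%R != 0%R by rewrite oppr_eq0 oner_eq0.
  transitivity (\int[lam2]_w h (ofC (- toC w)%R)).
    rewrite -[RHS](haar_integral (ofC r%:C) (is_haar_lam2 R))//.
      apply: eq_integral => w _; rewrite /sg; congr (h (ofC _)).
      by rewrite toCB ofCK opprD addrC.
    by apply: (measurableT_comp mh); apply: cmeas_ofC; cm.
  transitivity (\int[lam2]_w h (ofC (toC w))); last by apply: eq_integral => w _; rewrite toCK.
  rewrite [RHS](planar_mul (g := fun z => h (ofC z)) n1)//.
  rewrite normcN normc1 expr1n mul1e; apply: eq_integral => w _.
  by rewrite mulN1r.
have key w : ~ Z w -> U r w + U r (sg w) <= U 0%R w + U 0%R (sg w).
  move=> /= /not_orP[w0 wr].
  have tw0 : toC w != 0%R by apply/eqP => E; apply: w0; rewrite -[w]toCK E.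
  have twr : (toC w + r%:C)%R != 0%R.
    by apply/eqP => E; apply: wr; rewrite -[w]toCK; congr ofC; apply/eqP; rewrite -addr_eq0 E.
  rewrite /U /sg !ofCK !addr0.
  have -> : (- r%:C - toC w + r%:C = - toC w)%R by ring.
  have -> : (- r%:C - toC w = - (toC w + r%:C))%R by ring.
  rewrite !normcN.
  have ar (x y : R) : (0 < x)%R -> (x <= y)%R -> (y `^ p <= x `^ p)%R.
    by move=> x0 xy; rewrite -(opprK p) ler_powRN// oppr_ge0 ltW.
  have [le|/ltW le] := leP (normc (toC w)) (normc (toC w + r%:C)%R).
  + have h1 : (0 <= normc (toC w + r%:C) `^ p <= normc (toC w) `^ p)%R.
      by rewrite powR_ge0 ar// normc_gt0.
    have h2 : ph (- (toC w + r%:C))%R <= ph (toC w) by apply: ph_le; rewrite normcN.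
    exact: (rearrange_ereal h1 (ph0 _) h2).
  + have h1 : (0 <= normc (toC w) `^ p <= normc (toC w + r%:C) `^ p)%R.
      by rewrite powR_ge0 ar// normc_gt0.
    have h2 : ph (toC w) <= ph (- (toC w + r%:C))%R by apply: ph_le; rewrite normcN.
    exact: (rearrange_ereal_sym h1 (ph0 _) h2).
exact: (le_integral_sym hs msg mZ Z0 (mU r) (mU 0%R) (U0 r) (U0 0%R) key).
Qed.

End complex_planar_key.

Section real_vectors.
Context (R : realType).
Local Notation mR := (measurableTypeR R).

Definition rvec (a b : R) : 'rV[R]_2 := \row_i [:: a; b]`_i.

Lemma rvecZ (r a b : R) : r *: rvec a b = rvec (r * a) (r * b).
Proof. by apply/rowP => i; rewrite !mxE; case: i => -[|[|]]. Qed.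

Lemma rvecD (a b a' b' : R) : rvec a b + rvec a' b' = rvec (a + a') (b + b').
Proof. by apply/rowP => i; rewrite !mxE; case: i => -[|[|]]. Qed.

Lemma rvec_eq0 (a b : R) : (rvec a b == 0) = (a == 0) && (b == 0).
Proof.
apply/eqP/andP => [/rowP h|[/eqP-> /eqP->]]; last first.
  by apply/rowP => i; rewrite !mxE; case: i => -[|[|]].
by have := h 0; have := h 1; rewrite !mxE/= => -> ->; rewrite !eqxx.
Qed.

Lemma measurable_rvec d (X : measurableType d) (f : 'rV[R]_2 -> R) (a b : X -> R) :
  measurable_fun setT (fun t : 2.-tuple mR => f (row_of t)) ->
  measurable_fun setT a -> measurable_fun setT b ->
  measurable_fun setT (fun x => f (rvec (a x) (b x))).
Proof.
move=> mf ma mb.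
rewrite (_ : (fun x => _) = (fun t : 2.-tuple mR => f (row_of t)) \o
   (fun x => tuple_of (rvec (a x) (b x)))); last first.
  by apply/funext => x /=; rewrite tuple_ofK.
apply: measurableT_comp => //; apply: measurable_tuple_of => i.
by under eq_fun do rewrite mxE; case: i => -[|[|]].
Qed.

Lemma ereal_double (x : \bar R) : (2%:E * x = x + x)%E.
Proof. by rewrite mule_natl mule2n. Qed.

Lemma lee_double (x y : \bar R) : (x <= y -> 2%:E * x <= 2%:E * y)%E.
Proof. by move=> xy; apply: lee_wpmul2l. Qed.

Lemma powR_mulr1 (x p : R) : 0 < x -> x * x `^ p = x `^ (p + 1).
Proof. by move=> x0; rewrite powRD ?(gt_eqF x0) ?implybT// powRr1 1?mulrC// ltW. Qed.

End real_vectors.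

Ltac rm := repeat first
  [ exact: measurable_fst | exact: measurable_snd | exact: measurable_id
  | exact: measurable_cst
  | apply: measurable_funB | apply: measurable_funD | apply: measurable_funM ].

(** * The two-point inequality in the real plane *)

Section real_planar_key.
Context (R : realType).
Local Notation mR := (measurableTypeR R).
Local Notation R2 := (mR * mR)%type.
Local Notation lam := (@lebesgue_measure R).
Variables (p B : R) (f : 'rV[R]_2 -> R).
Hypotheses (p1 : -1 < p).
Hypothesis mf2 : measurable_fun setT (fun t : 2.-tuple mR => f (row_of t)).
Hypothesis fB : forall x, 0 <= f x <= B.
Hypothesis f_supp : forall x, x != 0 ->
  exists2 M : R, 0 <= M & forall r : R, 0 < f (r *: x) -> `|r| <= M.
Hypothesis f_pos : forall x, exists e c : R,
  [/\ 0 < e, 0 < c & forall r : R, 0 < r <= e -> c <= f (r *: x)].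
Hypothesis f_logc : forall (t : R) x y, 0 < t < 1 ->
  f x `^ t * f y `^ (1 - t) <= f (t *: x + (1 - t) *: y).
Hypothesis f_even : forall a b : R, f (rvec (- a) (- b)) = f (rvec a b).

(** Over the reals the substitution a = b w contributes |b| to |b|^p and there is no polar factor,
    so the weight along a ray is r^(p+1) = r^(q-1). *)
Let q := p + 2.

Let q1 : 1 <= q. Proof. by have := p1; rewrite /q => h; lra. Qed.

Let f0 x : 0 <= f x. Proof. by case/andP: (fB x). Qed.

Let mf x : measurable_fun setT (fun r : mR => f (r *: x)).
Proof.
rewrite (_ : (fun r => _) = (fun t => f (row_of t)) \o (fun r : mR => tuple_of (r *: x))).
  apply: measurableT_comp => //; apply: measurable_tuple_of => i.
  under eq_fun do rewrite mxE.
  exact: (@measurable_funM _ R R setT id (cst _)).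
by apply/funext => r /=; rewrite tuple_ofK.
Qed.

Let nn a b := ball_norm q f (rvec a b).

Let nnD a b a' b' : nn (a + a') (b + b') <= nn a b + nn a' b'.
Proof. by rewrite /nn -rvecD; exact: (ball_normD q1 mf fB f_supp f_pos f_logc). Qed.

Let nnZ (r a b : R) : 0 <= r -> nn (r * a) (r * b) = r * nn a b.
Proof. by rewrite /nn -rvecZ => r0; exact: (ball_normZ q1 mf fB f_supp f_pos). Qed.

Local Open Scope ereal_scope.

Let D (z c : R) : \bar R := \int[lam]_(a in (setT : set mR)) \int[lam]_(b in (setT : set mR))
  (`|a + z * (b + c * a)| `^ p * f (rvec a b))%:E.

Let mabs d (X : measurableType d) (x : X -> R) : measurable_fun setT x ->
  measurable_fun setT (fun w => `|x w| `^ p)%R.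
Proof.
move=> mx; apply: (measurableT_comp (@measurable_powR R p)).
exact: (measurableT_comp (@normr_measurable R setT)).
Qed.

Let mV d (X : measurableType d) (x y z : X -> R) : measurable_fun setT x ->
  measurable_fun setT y -> measurable_fun setT z ->
  measurable_fun setT (fun w => (`|x w| `^ p * f (rvec (y w) (z w)))%:E).
Proof.
move=> mx my mz; apply/measurable_EFinP; apply: measurable_funM; first exact: mabs.
exact: measurable_rvec.
Qed.

Let V0 (x : R) y : 0 <= (`|x| `^ p * f y)%:E.
Proof. by rewrite lee_fin mulr_ge0// powR_ge0. Qed.

Let rho (c w : R) := ray_integral q f (rvec w (1 - c * w)%R).

Let rho_ge0 c w : 0 <= rho c w.
Proof. by apply: integral_ge0 => r _; rewrite lee_fin mulr_ge0// powR_ge0. Qed.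

Let mrho c : measurable_fun setT (rho c : mR -> \bar R).
Proof.
rewrite (_ : rho c = fun w : mR => \int[lam]_(r in (setT : set mR))
    ((\1_(`]0%R, +oo[%classic : set mR) r)%:E *
     (r `^ (q - 1) * f (r *: rvec w (1 - c * w)%R))%:E)); last first.
  by apply/funext => w; rewrite -integral_indic_mul.
apply: (measurable_integral_snd lam (g := fun x : R2 =>
  (\1_(`]0%R, +oo[%classic : set mR) x.2)%:E *
     (x.2 `^ (q - 1) * f (x.2 *: rvec x.1 (1 - c * x.1)%R))%:E)).
  apply: emeasurable_funM.
    by apply: (measurableT_comp (f := fun r : mR => (\1_(`]0%R, +oo[%classic : set mR) r)%:E)) => //;
      apply: measurable_indicE; exact: measurable_itv.
  apply/measurable_EFinP; apply: measurable_funM.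
    exact: (measurableT_comp (@measurable_powR R _) measurable_snd).
  by under eq_fun do rewrite rvecZ; apply: measurable_rvec => //; rm.
by move=> x; rewrite mule_ge0// lee_fin// mulr_ge0// powR_ge0.
Qed.

Let D_shear z c : D z c = \int[lam]_(b in (setT : set mR)) \int[lam]_(a in (setT : set mR))
  (`|a + z * b|%R `^ p * f (rvec a (b - c * a)%R))%:E.
Proof.
pose g (a b : mR) := (`|a + z * b|%R `^ p * f (rvec a (b - c * a)%R))%:E.
have mg : measurable_fun setT (fun x : R2 => g x.1 x.2) by apply: mV; rm.
transitivity (\int[lam]_a \int[lam]_b g a b); last exact: (tonelli lam lam mg (fun a b => V0 _ _)).
apply: eq_integral => a _.
have mb : measurable_fun setT (fun b : mR => (`|a + z * (b + c * a)|%R `^ p * f (rvec a b))%:E).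
  by apply: mV; rm.
rewrite -[LHS](lebesgue_integral_shift (- (c * a))%R mb (fun b => V0 _ _)).
by apply: eq_integral => b _; rewrite subrK.
Qed.

Let f_rvec_mul (b a' b' : R) : f (rvec (b * a')%R (b * b')%R) = f (`|b|%R *: rvec a' b').
Proof.
have [b0|b0] := leP 0%R b; first by rewrite rvecZ ger0_norm.
by rewrite rvecZ ltr0_norm// -[RHS]f_even !mulNr !opprK.
Qed.

(** As in the complex case; evenness of f replaces rotation invariance, and the factor 2 counts the
    two signs of b. *)
Let D_ray z c : D z c = 2%:E * \int[lam]_(w in (setT : set mR)) ((`|w + z|%R `^ p)%:E * rho c w).
Proof.
rewrite D_shear.
pose h (b w : mR) := (`|w + z|%R `^ p * (`|b|%R `^ (p + 1) *
  f (`|b|%R *: rvec w (1 - c * w)%R)))%:E.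
have h0 b w : 0 <= h b w by rewrite lee_fin !mulr_ge0 ?powR_ge0.
have mh : measurable_fun setT (fun x : R2 => h x.1 x.2).
  apply/measurable_EFinP; apply: measurable_funM; first by apply: mabs; rm.
  apply: measurable_funM.
    apply: (measurableT_comp (@measurable_powR R _)).
    exact: (measurableT_comp (@normr_measurable R setT) measurable_fst).
  have mn : measurable_fun setT (fun x : R2 => `|x.1 : R|%R).
    exact: (measurableT_comp (@normr_measurable R setT) measurable_fst).
  under eq_fun do rewrite rvecZ.
  by apply: measurable_rvec => //; apply: measurable_funM => //; rm.
have mg : measurable_fun setT (fun x : R2 => (`|x.2 + z * x.1|%R `^ p * f (rvec x.2 (x.1 - c * x.2)%R))%:E).
  by apply: mV; rm.
transitivity (\int[lam]_(b in (setT : set mR)) \int[lam]_(w in (setT : set mR)) h b w).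
  apply: (@eq_integral_off_null _ _ R lam [set 0%R]).
  - exact: measurable_set1.
  - exact: lebesgue_measure_set1.
  - exact: (measurable_integral_snd lam mg).
  - exact: (measurable_integral_snd lam mh).
  - by move=> b; apply: integral_ge0.
  - by move=> b; apply: integral_ge0.
  - move=> b /= /eqP b0.
    have mb : measurable_fun setT (fun a : mR => (`|a + z * b|%R `^ p * f (rvec a (b - c * a)%R))%:E).
      by apply: mV; rm.
    have mb' : measurable_fun setT (fun a : mR => (`|b * a + z * b|%R `^ p * f (rvec (b * a)%R (b - c * (b * a))%R))%:E).
      by apply: mV; rm.
    rewrite (lebesgue_integral_scale b0 mb (fun a => V0 _ _)).
    rewrite -(ge0_integralZl _ measurableT mb' (fun a _ => V0 _ _)) ?lee_fin//.
    apply: eq_integral => w _; rewrite /h -EFinM; congr _%:E.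
    have -> : (b * w + z * b = b * (w + z))%R by ring.
    have -> : (b - c * (b * w) = b * (1 - c * w))%R by ring.
    have nb : (0 < `|b|)%R by rewrite normr_gt0.
    rewrite f_rvec_mul normrM powRM// -(powR_mulr1 p nb).
    by move: (f _) (_ `^ p)%R (`|w + z| `^ p)%R => F x y; ring.
rewrite (tonelli lam lam mh h0) -ge0_integralZl//; last 2 first.
- apply: emeasurable_funM; first by apply/measurable_EFinP; apply: mabs; rm.
  exact: mrho.
- by move=> w _; rewrite mule_ge0// lee_fin powR_ge0.
apply: eq_integral => w _; rewrite muleCA.
pose g (r : mR) := (r `^ (p + 1) * f (r *: rvec w (1 - c * w)%R))%:E.
have mg1 : measurable_fun setT g.
  by apply/measurable_EFinP; apply: measurable_funM => //; exact: measurable_powR.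
have g0 r : 0 <= g r by rewrite lee_fin mulr_ge0// powR_ge0.
have mgn : measurable_fun setT (fun b : mR => g `|b|%R).
  by apply: (measurableT_comp mg1); exact: normr_measurable.
transitivity ((`|w + z|%R `^ p)%:E * \int[lam]_(b in (setT : set mR)) g `|b|%R).
  rewrite -(ge0_integralZl _ measurableT mgn (fun a _ => g0 _)) ?lee_fin ?powR_ge0//.
suff -> : \int[lam]_(b in (setT : set mR)) g `|b|%R = 2%:E * rho c w by [].
rewrite (lam_integral_even mg1 g0); apply: (f_equal (fun x => 2%:E * x)).
by apply: eq_integral => r _; rewrite /g (_ : q - 1 = p + 1)%R// /q; ring.
Qed.

Let nn_even (a b : R) : nn (- a)%R (- b)%R = nn a b.
Proof.
have E : ray_integral q f (rvec (- a)%R (- b)%R) = ray_integral q f (rvec a b).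
  by apply: eq_integral => r _; rewrite !rvecZ !mulrN f_even.
by rewrite /nn /ball_norm E !rvec_eq0 !oppr_eq0.
Qed.

(** The real counterpart of the supporting line: evenness of the norm turns the one-sided
    Hahn-Banach bound into a bound on the absolute value. *)
Let shear : exists c : R, forall (l w : R), (0 <= l <= 1)%R -> rho c w <= rho c (l * w)%R.
Proof.
have [l lE l01] := hahn_banach_rV (rvec 0%R 1%R) (ball_normD q1 mf fB f_supp f_pos f_logc)
  (fun c x c0 => ball_normZ q1 mf fB f_supp f_pos x c0).
pose al : R := l 0%R 0%R; pose be : R := l 0%R 1%R.
have sumE a b : (\sum_i l 0 i * rvec a b 0 i = al * a + be * b)%R.
  rewrite !big_ord_recl big_ord0 !mxE /=.
  have -> : lift ord0 (ord0 : 'I_1) = 1%R by exact/val_inj.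
  by rewrite addr0.
have bound a b : (`|al * a + be * b| <= nn a b)%R.
  rewrite ler_norml; apply/andP; split; last by rewrite -sumE; exact: lE.
  by have := lE (rvec (- a)%R (- b)%R); rewrite sumE -/(nn _ _) nn_even => h; lra.
have beE : be = nn 0%R 1%R.
  by have := l01; rewrite sumE mulr0 add0r mulr1.
have G0 : (0 < nn 0%R 1%R)%R.
  by apply: (ball_norm_gt0 q1 mf fB f_supp f_pos); rewrite rvec_eq0 oner_eq0 andbF.
pose G := nn 0%R 1%R; pose c := (al / G)%R.
have nnG w : (G <= nn w (1 - c * w))%R.
  apply: le_trans (bound w (1 - c * w)%R).
  have -> : (al * w + be * (1 - c * w) = G)%R.
    by rewrite beE -/G /c; field; rewrite gt_eqF.
  by rewrite ler_norm.
exists c => r w /andP[r0 r1].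
have cv x : rvec x (1 - c * x)%R != 0%R.
  rewrite rvec_eq0; have [->|//] := eqVneq x 0%R.
  by rewrite mulr0 subr0 oner_eq0.
have rhoR x : rho c x = (nn x (1 - c * x)%R `^ (- q))%:E.
  exact: (ray_integralE q1 mf fB f_supp f_pos (cv x)).
rewrite !rhoR lee_fin; apply: ler_powRN; first exact: le_trans q1.
  exact: (ball_norm_gt0 q1 mf fB f_supp f_pos).
have -> : nn (r * w)%R (1 - c * (r * w))%R =
    nn (r * w + (1 - r) * 0)%R (r * (1 - c * w) + (1 - r) * 1)%R.
  by congr (nn _ _); ring.
have r1' : (0 <= 1 - r)%R by rewrite subr_ge0.
have h1 := nnD (r * w)%R (r * (1 - c * w))%R ((1 - r) * 0)%R ((1 - r) * 1)%R.
have h2 := nnZ w (1 - c * w)%R r0; have h3 := nnZ 0%R 1%R r1'.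
rewrite h2 h3 -/G in h1; apply: le_trans h1 _.
exact: convex_comb_le (nnG w).
Qed.

(** The average over the signs of w leaves an even function decreasing in |w|. The direction of the
    inequality depends on the sign of p because |w|^p decreases in |w| for p < 0 and increases for p
    > 0; the reflection w -> -z - w pairs the points as in the complex case. *)
Theorem real_planar_key : exists c : R, forall z : R,
  ((p < 0)%R -> D z c + D (- z)%R c <= 2%:E * D 0%R c) /\
  ((0 < p)%R -> 2%:E * D 0%R c <= D z c + D (- z)%R c).
Proof.
have [c rhoE] := shear; exists c => z.
pose ph (w : R) := rho c w + rho c (- w)%R.
have ph0 w : 0 <= ph w by rewrite adde_ge0.
have mrhoN : measurable_fun setT (fun w : mR => rho c (- w)%R).
  apply: (measurableT_comp (mrho c)).
  exact: (@measurable_funN _ R R setT id).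
have mph : measurable_fun setT (ph : mR -> \bar R).
  by apply: emeasurable_funD => //; exact: mrho.
have phN w : ph (- w)%R = ph w by rewrite /ph opprK addeC.
have ph_le w w' : (`|w| <= `|w'|)%R -> ph w' <= ph w.
  move=> ww'; have [l l01 wE] : exists2 l : R, (0 <= l <= 1)%R & (`|w| = l * `|w'|)%R.
    have [w0|w0] := eqVneq w' 0%R.
      exists 0%R; first by rewrite lexx ler01.
      by rewrite mul0r; apply/eqP; rewrite eq_le normr_ge0 andbT; move: ww'; rewrite w0 normr0.
    exists (`|w| / `|w'|)%R; last by rewrite mulfVK// normr_eq0.
    by rewrite divr_ge0//= ler_pdivrMr ?normr_gt0// mul1r.
  have phabs x : ph `|x|%R = ph x.
    by have [x0|x0] := leP 0%R x; rewrite ?(ger0_norm x0)// ltr0_norm.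
  rewrite -(phabs w) -(phabs w') wE /ph -mulrN.
  by apply: leeD; exact: rhoE.
pose U (s w : R) := (`|w + s|%R `^ p)%:E * ph w.
have mpw s : measurable_fun setT (fun w : mR => (`|w + s|%R `^ p)%:E).
  by apply/measurable_EFinP; apply: mabs; rm.
have pw0 (s w : R) : 0 <= (`|w + s|%R `^ p)%:E by rewrite lee_fin powR_ge0.
have mU s : measurable_fun setT (U s : mR -> \bar R).
  exact: emeasurable_funM.
have U0 s w : 0 <= U s w by rewrite /U mule_ge0.
pose W s := \int[lam]_(w in (setT : set mR)) U s w.
have mr s : measurable_fun setT (fun w : mR => (`|w + s|%R `^ p)%:E * rho c w).
  by apply: emeasurable_funM => //; exact: mrho.
have mrN s : measurable_fun setT (fun w : mR => (`|w + s|%R `^ p)%:E * rho c (- w)%R).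
  exact: emeasurable_funM.
have WE s : W s = \int[lam]_(w in (setT : set mR)) ((`|w + s|%R `^ p)%:E * rho c w) +
    \int[lam]_(w in (setT : set mR)) ((`|w - s|%R `^ p)%:E * rho c w).
  have -> : \int[lam]_(w in (setT : set mR)) ((`|w - s|%R `^ p)%:E * rho c w) =
      \int[lam]_(w in (setT : set mR)) ((`|w + s|%R `^ p)%:E * rho c (- w)%R).
    rewrite -[LHS](lebesgue_integral_opp (mr _)); last by move=> w; rewrite mule_ge0.
    by apply: eq_integral => w _; rewrite -opprD normrN.
  transitivity (\int[lam]_(w in (setT : set mR)) ((`|w + s|%R `^ p)%:E * rho c w + (`|w + s|%R `^ p)%:E * rho c (- w)%R)).
    by apply: eq_integral => w _; rewrite /U /ph ge0_muleDr.
  by apply: (ge0_integralD lam measurableT) => // w _; rewrite mule_ge0.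
have DE s : D s c + D (- s)%R c = 2%:E * W s.
  rewrite !D_ray -ge0_muleDr; last 2 first.
  - by apply: integral_ge0 => w _; rewrite mule_ge0.
  - by apply: integral_ge0 => w _; rewrite mule_ge0.
  by rewrite WE.
have D0E : 2%:E * D 0%R c = 2%:E * W 0%R by have := DE 0%R; rewrite oppr0 (ereal_double (D 0%R c)).
rewrite DE D0E.
pose sg (w : mR) : mR := (- z - w)%R.
have msg : measurable_fun setT sg by exact: (@measurable_funB _ R R setT (cst (- z)%R) id).
have hs (h : mR -> \bar R) : measurable_fun setT h -> (forall w, 0 <= h w) ->
    \int[lam]_w h (sg w) = \int[lam]_w h w.
  move=> mh h0; rewrite -[RHS](lebesgue_integral_opp mh h0).
  rewrite -[RHS](lebesgue_integral_shift z)//.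
    by apply: eq_integral => w _; rewrite /sg opprD addrC.
  by apply: (measurableT_comp mh); exact: (@measurable_funN _ R R setT id).
pose Z : set mR := [set 0%R] `|` [set (- z)%R].
have mZ : measurable Z by apply: measurableU; exact: measurable_set1.
have Z0 : lam Z = 0.
  by rewrite (null_set_setU (mu := lam))//; solve [exact: measurable_set1 | exact: lebesgue_measure_set1].
have sgE w : U 0%R (sg w) = (`|w + z|%R `^ p)%:E * ph (w + z)%R.
  by rewrite /U addr0 /sg -opprD normrN phN addrC.
have sgEz w : U z (sg w) = (`|w|%R `^ p)%:E * ph (w + z)%R.
  have -> : U z (sg w) = (`|- z - w + z|%R `^ p)%:E * ph (- z - w)%R by [].
  have -> : (- z - w + z = - w)%R by ring.
  by rewrite normrN -opprD phN addrC.
have U0E w : U 0%R w = (`|w|%R `^ p)%:E * ph w by rewrite /U addr0.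
split=> p0.
  suff WW : W z <= W 0%R by exact: lee_double WW.
  apply: (le_integral_sym hs msg mZ Z0 (mU z) (mU 0%R) (U0 z) (U0 0%R)) => w /= /not_orP[w0 wz].
  have aw : (0 < `|w|)%R by rewrite normr_gt0; exact/eqP.
  have az : (0 < `|w + z|)%R by rewrite normr_gt0 addr_eq0; exact/eqP.
  have ar (x y : R) : (0 < x)%R -> (x <= y)%R -> (y `^ p <= x `^ p)%R.
    by move=> x0 xy; rewrite -(opprK p) ler_powRN// oppr_ge0 ltW.
  rewrite sgE sgEz U0E {1}/U.
  have [le|/ltW le] := leP (`|w|%R) (`|w + z|%R).
    have h1 : (0 <= `|w + z| `^ p <= `|w| `^ p)%R by rewrite powR_ge0 ar.
    exact: (rearrange_ereal h1 (ph0 _) (ph_le _ _ le)).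
  have h1 : (0 <= `|w| `^ p <= `|w + z| `^ p)%R by rewrite powR_ge0 ar.
  exact: (rearrange_ereal_sym h1 (ph0 _) (ph_le _ _ le)).
suff WW : W 0%R <= W z by exact: lee_double WW.
apply: (le_integral_sym hs msg mZ Z0 (mU 0%R) (mU z) (U0 0%R) (U0 z)) => w _.
have ar (x y : R) : (0 <= x)%R -> (x <= y)%R -> (x `^ p <= y `^ p)%R.
  by move=> x0 xy; apply: ge0_ler_powR => //; rewrite ?nnegrE ?(ltW p0)// (le_trans x0).
rewrite sgE sgEz U0E /U.
have [le|/ltW le] := leP (`|w|%R) (`|w + z|%R).
  have h1 : (0 <= `|w| `^ p <= `|w + z| `^ p)%R by rewrite powR_ge0 ar.
  exact: (rearrange_ereal h1 (ph0 _) (ph_le _ _ le)).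
have h1 : (0 <= `|w + z| `^ p <= `|w| `^ p)%R by rewrite powR_ge0 ar.
exact: (rearrange_ereal_sym h1 (ph0 _) (ph_le _ _ le)).
Qed.

End real_planar_key.

Section fibre_integral.
Context (R : realType) (N k m : nat).
Local Notation mR := (measurableTypeR R).
Local Notation lam := (@lebesgue_measure R).
Variables (A : 'M[R]_(k, N)) (B : 'M[R]_(m, N)) (Q : 'M[R]_(N, k)) (P : 'M[R]_(N, m)).
Hypotheses (AQ : A *m Q = 1%:M) (BQ : B *m Q = 0) (AP : A *m P = 0)
  (BP : B *m P = 1%:M) (QAPB : Q *m A + P *m B = 1%:M).
Variable K : set 'rV[R]_N.
Hypothesis mK : measurable (@row_of R N @^-1` K).
Hypothesis cK : forall (t : R) x y, 0 < t < 1 -> K x -> K y -> K (t *: x + (1 - t) *: y).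
Variable M : R.
Hypothesis M0 : 0 <= M.
Hypothesis bK : forall x i, K x -> `|x 0 i| <= M.

Lemma fibre_integral : exists2 c : R, 0 < c & forall g : 'rV[R]_k -> R,
  measurable_fun setT (fun t : k.-tuple mR => g (row_of t)) -> (forall x, 0 <= g x) ->
  (\int[power_measure lam N]_t (\1_K (row_of t) * g (row_of t *m Q))%:E =
   c%:E * \int[power_measure lam k]_t (g (row_of t) * fibre_volume A B K (row_of t))%:E)%E.
Proof.
have [c c0 cE] := frame_integral AQ BQ AP BP QAPB.
exists c => // g mg g0.
have mi : measurable_fun setT (fun t : N.-tuple mR => \1_K (row_of t) : R).
  exact: (@measurable_indic _ _ R setT (@row_of R N @^-1` K)).
have mgQ : measurable_fun setT (fun t : N.-tuple mR => g (row_of t *m Q)).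
  rewrite (_ : (fun t => _) = (fun t : k.-tuple mR => g (row_of t)) \o (fun t : N.-tuple mR => tuple_of (row_of t *m Q))).
    apply: measurableT_comp => //; apply: measurable_tuple_of => i.
    by apply: measurable_row_mulmx => j; exact: measurable_row_of.
  by apply/funext => t /=; rewrite tuple_ofK.
rewrite cE; last 2 first.
- by apply/measurable_EFinP; exact: measurable_funM.
- by move=> t; rewrite lee_fin mulr_ge0.
congr (_ * _)%E; apply: eq_integral => x _.
have mF := measurable_fibre A B mK (row_of x).
rewrite /fibre_volume EFinM fineK; last first.
  by apply: fibre_volume_fin; eassumption.
rewrite (measure_int_indic _ mF) -ge0_integralZl//; last 2 first.
- exact: measurable_indicE.
- by rewrite lee_fin.
apply: eq_integral => y _; rewrite -EFinM; congr _%:E.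
rewrite tuple_ofK mulmxDl -!mulmxA AQ BQ mulmx1 mulmx0 addr0 mulrC; congr (_ * _).
Qed.

End fibre_integral.

Section linear_matrix.
Context (R : realType).

Lemma linear_matrix a b (f : 'rV[R]_a -> 'rV[R]_b) :
  (forall x y, f (x + y) = f x + f y) -> (forall c x, f (c *: x) = c *: f x) ->
  exists M : 'M[R]_(a, b), forall x, x *m M = f x.
Proof.
move=> fD fZ; exists (\matrix_(i, j) f (delta_mx 0 i) 0 j) => x.
have f0 : f 0 = 0 by rewrite -(scale0r 0) fZ scale0r.
rewrite [in RHS](row_sum_delta x) (big_morph f fD f0).
apply/rowP => j; rewrite mxE summxE; apply: eq_bigr => i _.
by rewrite fZ !mxE.
Qed.

Lemma mulmx_ext a b (M N : 'M[R]_(a, b)) : (forall x : 'rV_a, x *m M = x *m N) -> M = N.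
Proof. by move=> h; apply/row_matrixP => i; rewrite !rowE h. Qed.

End linear_matrix.

Section small_tuples.
Context (R : realType).
Local Notation mR := (measurableTypeR R).
Local Notation R2 := (mR * mR)%type.
Local Notation lam := (@lebesgue_measure R).
Local Open Scope ereal_scope.

Let measurable_tuple_cons_l k (a : mR) :
  measurable_fun setT (fun t : k.-tuple mR => tuple_cons (a, t)).
Proof.
apply/measurable_fun_tnthP => i; case: (unliftP ord0 i) => [j ->|->].
  rewrite (_ : _ \o _ = fun t : k.-tuple mR => tnth t j); first exact: measurable_tnth.
  by apply/funext => t /=; rewrite tnthS.
rewrite (_ : _ \o _ = cst a); first exact: measurable_cst.
by apply/funext => t /=; rewrite tnth0.
Qed.

Lemma integral_rvec (g : 'rV[R]_2 -> \bar R) :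
  measurable_fun setT (fun t : 2.-tuple mR => g (row_of t)) -> (forall x, 0 <= g x) ->
  \int[power_measure lam 2]_t g (row_of t) = \int[lam]_(a in (setT : set mR)) \int[lam]_(b in (setT : set mR)) g (rvec a b).
Proof.
move=> mg g0; rewrite integral_tuple_cons//; apply: eq_integral => a _.
have ma : measurable_fun setT (fun t : 1.-tuple mR => g (row_of (tuple_cons (a, t)))).
  exact: (measurableT_comp mg (@measurable_tuple_cons_l 1 a)).
rewrite integral_tuple_cons//; apply: eq_integral => b _.
rewrite integral_tuple0; congr g; apply/rowP => i; rewrite !mxE.
by case: i => -[|[|]].
Qed.

Lemma integral_cvec (g : 'rV[R]_4 -> \bar R) :
  measurable_fun setT (fun t : 4.-tuple mR => g (row_of t)) -> (forall x, 0 <= g x) ->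
  \int[power_measure lam 4]_t g (row_of t) =
  \int[lam2 R]_a \int[lam2 R]_b g (cvec (toC a) (toC b)).
Proof.
move=> mg g0.
pose T4 (a b c d : mR) : 4.-tuple mR := tuple_cons (a, tuple_cons (b, tuple_cons (c, tuple_cons (d, [tuple] : 0.-tuple mR)))).
have TE a b : row_of (T4 a.1 a.2 b.1 b.2) = cvec (toC a) (toC b).
  by apply/rowP => i; rewrite !mxE; case: i => -[|[|[|[|]]]].
have mT : measurable_fun setT (fun z : R2 * R2 => g (cvec (toC z.1) (toC z.2))).
  rewrite (_ : (fun z => _) = (fun t : 4.-tuple mR => g (row_of t)) \o
     (fun z : R2 * R2 => tuple_of (cvec (toC z.1) (toC z.2)))); last first.
    by apply/funext => z /=; rewrite tuple_ofK.
  apply: measurableT_comp => //; apply: measurable_tuple_of => i.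
  under eq_fun do rewrite mxE.
  have mm1 := measurableT_comp (@measurable_fst _ _ mR mR) (@measurable_fst _ _ R2 R2).
  have mm2 := measurableT_comp (@measurable_snd _ _ mR mR) (@measurable_fst _ _ R2 R2).
  have mm3 := measurableT_comp (@measurable_fst _ _ mR mR) (@measurable_snd _ _ R2 R2).
  have mm4 := measurableT_comp (@measurable_snd _ _ mR mR) (@measurable_snd _ _ R2 R2).
  by case: i => -[|[|[|[|]]]].
have mr a b : measurable_fun setT (fun z : R2 => g (row_of (T4 a b z.1 z.2))).
  rewrite (_ : (fun z => _) = (fun z : R2 * R2 => g (cvec (toC z.1) (toC z.2))) \o (fun z => ((a, b), z))).
    by apply: (measurableT_comp mT); exact: pair1_measurable.
  by apply/funext => z /=; rewrite -TE.
rewrite lam2E; last 2 first.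
- exact: (measurable_integral_snd (lam2 R) mT).
- by move=> z; apply: integral_ge0.
rewrite integral_tuple_cons//; apply: eq_integral => a _.
have ma : measurable_fun setT (fun t : 3.-tuple mR => g (row_of (tuple_cons (a, t)))).
  exact: (measurableT_comp mg (@measurable_tuple_cons_l 3 a)).
rewrite integral_tuple_cons//; apply: eq_integral => b _.
have mb : measurable_fun setT (fun t : 2.-tuple mR => g (row_of (tuple_cons (a, tuple_cons (b, t))))).
  exact: (measurableT_comp ma (@measurable_tuple_cons_l 2 b)).
rewrite integral_tuple_cons//.
transitivity (\int[lam2 R]_z g (row_of (T4 a b z.1 z.2))); last first.
  by apply: eq_integral => z _; rewrite (TE (a, b)).
rewrite lam2E//; apply: eq_integral => c _.
have mc' : measurable_fun setT (fun t : 1.-tuple mR => g (row_of (tuple_cons (a, tuple_cons (b, tuple_cons (c, t)))))).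
  exact: (measurableT_comp mb (@measurable_tuple_cons_l 1 c)).
rewrite integral_tuple_cons//; apply: eq_integral => d _.
by rewrite integral_tuple0.
Qed.

End small_tuples.

(** * Integrals over a convex body in complex space *)

Section hermitian.
Context (R : realType) (n : nat).
Local Notation mR := (measurableTypeR R).
Local Notation Cn := 'rV[R[i]]_n.
Implicit Types (x y u v : Cn) (z : R[i]).

(* Linear in the second variable, so that [hdot x (u + z *: v)] is affine in [z]. *)
Definition hdot x u : R[i] := \sum_j conjc (x 0 j) * u 0 j.

Definition cplx (w : 'rV[R]_(n + n)) : Cn := \row_j (w 0 (lshift n j) +i* w 0 (rshift n j)).
Definition realify x : 'rV[R]_(n + n) :=
  row_mx (\row_j complex.Re (x 0 j)) (\row_j complex.Im (x 0 j)).

Lemma realifyK : cancel realify cplx.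
Proof. by move=> x; apply/rowP => j; rewrite mxE row_mxEl row_mxEr !mxE; case: (x 0 j). Qed.

Lemma cplxK : cancel cplx realify.
Proof.
move=> w; apply/rowP => i; case: (split_ordP i) => j ->.
  by rewrite row_mxEl !mxE.
by rewrite row_mxEr !mxE.
Qed.

Lemma cplxD w w' : cplx (w + w') = cplx w + cplx w'.
Proof. by apply/rowP => j; rewrite !mxE. Qed.

Lemma cplxZ (r : R) w : cplx (r *: w) = r%:C *: cplx w.
Proof.
apply/rowP => j; rewrite !mxE; apply/eqP; rewrite eq_complex /=.
by rewrite !mul0r subr0 addr0 !eqxx.
Qed.

Lemma realifyD x y : realify (x + y) = realify x + realify y.
Proof. by rewrite -[RHS]cplxK cplxD !realifyK. Qed.

Lemma realifyZ (r : R) x : realify (r%:C *: x) = r *: realify x.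
Proof. by rewrite -[RHS]cplxK cplxZ !realifyK. Qed.

Lemma hdotDl x y u : hdot (x + y) u = hdot x u + hdot y u.
Proof. by rewrite -big_split; apply: eq_bigr => j _; rewrite mxE rmorphD mulrDl. Qed.

Lemma hdotZl z x u : hdot (z *: x) u = conjc z * hdot x u.
Proof. by rewrite mulr_sumr; apply: eq_bigr => j _; rewrite mxE rmorphM mulrA. Qed.

Lemma hdotDr x u v : hdot x (u + v) = hdot x u + hdot x v.
Proof. by rewrite -big_split; apply: eq_bigr => j _; rewrite mxE mulrDr. Qed.

Lemma hdotZr z x u : hdot x (z *: u) = z * hdot x u.
Proof. by rewrite mulr_sumr; apply: eq_bigr => j _; rewrite mxE mulrCA. Qed.

Lemma conjcM z z' : conjc (z * z') = conjc z * conjc z'.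
Proof. exact: rmorphM. Qed.

Lemma hdotC x u : hdot u x = conjc (hdot x u).
Proof.
rewrite /hdot rmorph_sum; apply: eq_bigr => j _.
by rewrite rmorphM /= conjcK mulrC.
Qed.

Definition hnorm2 x : R := complex.Re (hdot x x).

Lemma hnorm2E x : hdot x x = (hnorm2 x)%:C.
Proof.
have := hdotC x x; rewrite /hnorm2; case: (hdot x x) => a b [] bb; congr (_ +i* _); lra.
Qed.

Lemma hnorm2_sum x : hnorm2 x = \sum_j normc (x 0 j) ^+ 2.
Proof.
rewrite /hnorm2 /hdot raddf_sum; apply: eq_bigr => j _.
case: (x 0 j) => a b /=; rewrite sqr_sqrtr ?addr_ge0 ?sqr_ge0//.
by ring.
Qed.

Lemma hnorm2_ge0 x : 0 <= hnorm2 x.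
Proof. by rewrite hnorm2_sum; apply: sumr_ge0 => j _; rewrite sqr_ge0. Qed.

Lemma hnorm2_gt0 x : x != 0 -> 0 < hnorm2 x.
Proof.
move=> x0; rewrite lt_def hnorm2_ge0 andbT; apply: contra x0.
rewrite hnorm2_sum psumr_eq0; last by move=> j _; rewrite sqr_ge0.
move=> /allP h; apply/eqP/rowP => j; rewrite mxE.
have := h j; rewrite mem_index_enum => /(_ isT); rewrite sqrf_eq0 => /eqP.
exact: eq0_normc.
Qed.

Lemma of_coordsE t : of_coords t = cplx (row_of t).
Proof. by apply/rowP => j; rewrite !mxE. Qed.

Lemma rdotE x u : rdot x u = complex.Re (hdot x u).
Proof.
rewrite /rdot /hdot raddf_sum; apply: eq_bigr => j _.
by case: (x 0 j) (u 0 j) => a b [c d] /=; ring.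
Qed.

Definition cfst (x : 'rV[R]_4) : R[i] := x 0 0 +i* x 0 1.
Definition csnd (x : 'rV[R]_4) : R[i] := x 0 2 +i* x 0 3.

Lemma cvec_surj (x : 'rV[R]_4) : cvec (cfst x) (csnd x) = x.
Proof.
apply/rowP => i; rewrite mxE; case: i => -[|[|[|[|]]]] //= h; congr (x _ _); exact/val_inj.
Qed.

Lemma cfst_cvec (a b : R[i]) : cfst (cvec a b) = a.
Proof. by rewrite /cfst !mxE; case: a. Qed.

Lemma csnd_cvec (a b : R[i]) : csnd (cvec a b) = b.
Proof. by rewrite /csnd !mxE; case: b. Qed.

Lemma conj_real (r : R) : conjc (r%:C) = r%:C :> R[i].
Proof. by apply/eqP; rewrite eq_complex /= oppr0 !eqxx. Qed.

Lemma normc_conj z : normc (conjc z) = normc z.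
Proof. by case: z => a b /=; rewrite sqrrN. Qed.

(** Orthogonality makes u/|u|^2 and v/|v|^2 dual to the two functionals; conjugates enter because
    [hdot] is conjugate-linear in its first variable. For the same reason multiplication by z on the
    vectors acts on the coordinates by its conjugate. The pairs J, I feed
    [fibre_volume_invariant]. *)
Lemma complex_frame u v : u != 0 -> v != 0 -> hdot u v = 0 ->
  exists (A : 'M[R]_(4, n + n)) (Q : 'M[R]_(n + n, 4)),
  [/\ A *m Q = 1%:M, forall w, w *m Q = cvec (hdot (cplx w) u) (hdot (cplx w) v) &
    forall (z : R[i]), normc z = 1 -> exists (J : 'M[R]_(n + n)) (I : 'M[R]_4),
    [/\ forall w, cplx (w *m J) = z *: cplx w,
        forall a b, cvec a b *m I = cvec (conjc z * a) (conjc z * b),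
        J *m Q = Q *m I & A *m J = I *m A]].
Proof.
move=> u0 v0 uv; have vu : hdot v u = 0 by rewrite hdotC uv rmorph0.
have nu : hnorm2 u != 0 by rewrite gt_eqF// hnorm2_gt0.
have nv : hnorm2 v != 0 by rewrite gt_eqF// hnorm2_gt0.
have [Q QE] : exists Q : 'M[R]_(n + n, 4), forall w, w *m Q = cvec (hdot (cplx w) u) (hdot (cplx w) v).
  apply: linear_matrix => [w w'|c w]; first by rewrite cplxD !hdotDl cvecD.
  by rewrite cplxZ !hdotZl !conj_real cvecZ.
pose fA (x : 'rV[R]_4) := realify ((conjc (cfst x) * ((hnorm2 u)^-1)%:C) *: u + (conjc (csnd x) * ((hnorm2 v)^-1)%:C) *: v).
have fstD (x y : 'rV[R]_4) : cfst (x + y) = cfst x + cfst y by rewrite /cfst !mxE.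
have sndD (x y : 'rV[R]_4) : csnd (x + y) = csnd x + csnd y by rewrite /csnd !mxE.
have fstZ (c : R) (x : 'rV[R]_4) : cfst (c *: x) = c%:C * cfst x.
  by rewrite -{1}(cvec_surj x) cvecZ cfst_cvec.
have sndZ (c : R) (x : 'rV[R]_4) : csnd (c *: x) = c%:C * csnd x.
  by rewrite -{1}(cvec_surj x) cvecZ csnd_cvec.
have [A AE] : exists A : 'M[R]_(4, n + n), forall x : 'rV[R]_4, x *m A = fA x.
  apply: linear_matrix => [x y|c x].
    rewrite /fA -realifyD fstD sndD !rmorphD !mulrDl !scalerDl; congr realify.
    by rewrite addrACA.
  rewrite /fA -realifyZ fstZ sndZ !conjcM conj_real; congr realify.
  by rewrite scalerDr !scalerA !mulrA.
have AQ : A *m Q = 1%:M.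
  apply: mulmx_ext => x; rewrite mulmxA AE QE mulmx1 realifyK !hdotDl !hdotZl uv vu.
  rewrite !mulr0 addr0 add0r !hnorm2E !conjcM !conjcK.
  rewrite -[in RHS](cvec_surj x); congr cvec.
    by rewrite conj_real -mulrA -rmorphM mulVf ?rmorph1 ?mulr1.
  by rewrite conj_real -mulrA -rmorphM mulVf ?rmorph1 ?mulr1.
exists A, Q; split => // z z1.
have [J JE] : exists J : 'M[R]_(n + n), forall w, w *m J = realify (z *: cplx w).
  apply: linear_matrix => [w w'|c w]; first by rewrite cplxD scalerDr realifyD.
  by rewrite cplxZ -realifyZ !scalerA mulrC.
have [I IE] : exists I : 'M[R]_4, forall x : 'rV[R]_4, x *m I = cvec (conjc z * cfst x) (conjc z * csnd x).
  apply: linear_matrix => [x y|c x]; first by rewrite fstD sndD !mulrDr cvecD.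
  by rewrite fstZ sndZ cvecZ; congr cvec; rewrite mulrCA.
exists J, I; split.
- by move=> w; rewrite JE realifyK.
- by move=> a b; rewrite IE cfst_cvec csnd_cvec.
- apply: mulmx_ext => w; rewrite !mulmxA JE !QE IE realifyK !hdotZl.
  by rewrite cfst_cvec csnd_cvec.
- apply: mulmx_ext => x; rewrite !mulmxA JE IE !AE /fA realifyK cfst_cvec csnd_cvec.
  by rewrite !conjcM !conjcK scalerDr !scalerA !mulrA.
Qed.

End hermitian.

(** * Integrability of a power singularity by self-similarity *)

Section power_singularity.
Context d (X : measurableType d) (R : realType) (mu : {measure set X -> \bar R}).
Variables (nu : X -> R) (half : X -> X) (s p S : R).
Hypotheses (mnu : measurable_fun setT nu) (nu0 : forall x, 0 <= nu x).
Hypothesis nu_half : forall x, nu (half x) = 2^-1 * nu x.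
Hypothesis half_int : forall h : X -> \bar R, measurable_fun setT h -> (forall x, 0 <= h x)%E ->
  (\int[mu]_x h x = s%:E * \int[mu]_x h (half x))%E.
Hypotheses (s0 : 0 < s) (p0 : p < 0) (sp : s * 2^-1 `^ p < 1) (S0 : 0 < S).
Hypothesis muS : (mu [set x | (nu x <= S)%R] < +oo)%E.

Let mS (t : R) : measurable [set x | nu x <= t].
Proof.
rewrite -[X in measurable X]setTI (_ : [set x | _] = nu @^-1` `]-oo, t]%classic).
  by apply: mnu => //; exact: measurable_itv.
by apply/seteqP; split => x /=; rewrite in_itv.
Qed.

Let g (m : nat) x : R := \1_[set x | (nu x <= S)%R] x * Num.min (nu x `^ p) m%:R.

Let mpow : measurable_fun setT (fun x => nu x `^ p).
Proof. exact: (measurableT_comp (@measurable_powR R p)). Qed.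

Let mg m : measurable_fun setT (g m).
Proof.
apply: measurable_funM; first exact: measurable_indic.
by apply: measurable_minr => //; exact: measurable_cst.
Qed.

Let g0 m x : 0 <= g m x.
Proof. by rewrite mulr_ge0// le_min powR_ge0/=. Qed.

Let C := (2^-1 * S) `^ p * fine (mu [set x | (nu x <= S)%R]) / (1 - s * 2^-1 `^ p).

(** Split the region at S/2. On the inner part the map [half] reproduces the whole integral with a
    factor s (1/2)^p < 1; on the outer shell the integrand is at most (S/2)^p. Solving the resulting
    inequality requires a finite integral, which is why the integrand is truncated at m; the bound C
    does not depend on m. *)
Let g_bound m : (\int[mu]_x (g m x)%:E <= C%:E)%E.
Proof.
pose I := (\int[mu]_x (g m x)%:E)%E.
have I0 : (0 <= I)%E by apply: integral_ge0 => x _; rewrite lee_fin.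
have mufin : mu [set x | (nu x <= S)%R] \is a fin_num by rewrite ge0_fin_numE.
have I1 : (I <= (m%:R)%:E * mu [set x | (nu x <= S)%R])%E.
  rewrite (measure_int_indic _ (mS S)) -ge0_integralZl//; last exact: measurable_indicE.
  apply: ge0_le_integral => //; [by move=> x _; rewrite lee_fin|exact/measurable_EFinP| |].
    by apply/measurable_EFinP; apply: measurable_funM; [exact: measurable_cst|exact: measurable_indic].
  by move=> x _; rewrite -EFinM lee_fin /g mulrC ler_wpM2r// ge_min lexx orbT.
have Ifin : I \is a fin_num.
  by rewrite ge0_fin_numE// (le_lt_trans I1)// -ge0_fin_numE ?fin_numM// mule_ge0// lee_fin.
pose h x : R := \1_[set x | (nu x <= 2^-1 * S)%R] x * Num.min (nu x `^ p) m%:R.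
have mh : measurable_fun setT h.
  apply: measurable_funM; first exact: measurable_indic.
  by apply: measurable_minr => //; exact: measurable_cst.
have h0 x : 0 <= h x by rewrite mulr_ge0// le_min powR_ge0/=.
have step1 : (I <= \int[mu]_x ((h x)%:E + ((2^-1 * S) `^ p * \1_[set x | (nu x <= S)%R] x)%:E))%E.
  apply: ge0_le_integral => //; [by move=> x _; rewrite lee_fin|exact/measurable_EFinP| |].
    apply: emeasurable_funD; first exact/measurable_EFinP.
    by apply/measurable_EFinP; apply: measurable_funM; [exact: measurable_cst|exact: measurable_indic].
  move=> x _; rewrite -EFinD lee_fin /g /h !indicE.
  have [xS|xS] := boolP (x \in [set x | (nu x <= S)%R]); last first.
    by rewrite mul0r mulr0 addr0 mulr_ge0// le_min powR_ge0/=.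
  have [xS2|xS2] := boolP (x \in [set x | (nu x <= 2^-1 * S)%R]).
    by rewrite !mul1r mulr1 lerDl powR_ge0.
  rewrite mul0r add0r mul1r mulr1 ge_min; apply/orP; left.
  have Sx : 2^-1 * S <= nu x.
    by rewrite notin_setE /= in xS2; move/negP: xS2; rewrite -ltNge => /ltW.
  by rewrite -(opprK p) ler_powRN ?oppr_ge0 ?(ltW p0)// mulr_gt0// invr_gt0.
have step2 : (\int[mu]_x (h x)%:E <= (s * 2^-1 `^ p)%:E * I)%E.
  rewrite (half_int (h := fun x => (h x)%:E)) ?EFinM; last 2 first.
  - exact/measurable_EFinP.
  - by move=> x; rewrite lee_fin.
  rewrite -muleA; apply: lee_wpmul2l; first by rewrite lee_fin ltW.
  rewrite -ge0_integralZl//; last 2 first.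
  - exact/measurable_EFinP.
  - by move=> x _; rewrite lee_fin.
  have hh x : h (half x) <= 2^-1 `^ p * g m x.
    rewrite /h /g !indicE nu_half mulrCA.
    have -> : (half x \in [set x | (nu x <= 2^-1 * S)%R]) = (x \in [set x | (nu x <= S)%R]).
      by apply/idP/idP; rewrite !inE/= nu_half ler_pM2l ?invr_gt0.
    apply: ler_wpM2l => //; rewrite powRM ?invr_ge0//.
    rewrite minr_pMr ?powR_ge0// le_min ge_min lexx/= ge_min; apply/orP; right.
    rewrite ler_peMl//; rewrite powR_inv// -powRN.
    apply: (@le_trans _ _ (1 `^ (- p))); first by rewrite powR1.
    by apply: ge0_ler_powR; rewrite ?nnegrE ?oppr_ge0 ?(ltW p0)// ler1n.
  apply: ge0_le_integral => //.
  - by move=> x _; rewrite lee_fin.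
  - apply/measurable_EFinP.
    have -> : (fun x => h (half x)) = (fun x => \1_[set x | (nu x <= S)%R] x * Num.min (2^-1 `^ p * nu x `^ p) m%:R).
      apply/funext => x; rewrite /h !indicE nu_half powRM ?invr_ge0//; congr ((nat_of_bool _)%:R * _).
      by apply/idP/idP; rewrite !inE/= nu_half ler_pM2l ?invr_gt0.
    apply: measurable_funM; first exact: measurable_indic.
    apply: measurable_minr; last exact: measurable_cst.
    by apply: measurable_funM => //; exact: measurable_cst.
  - by apply/measurable_EFinP; apply: measurable_funM => //; exact: measurable_cst.
  - by move=> x _; rewrite -EFinM lee_fin.
have step3 : (I <= (s * 2^-1 `^ p)%:E * I + ((2^-1 * S) `^ p)%:E * mu [set x | (nu x <= S)%R])%E.
  apply: (le_trans step1); rewrite ge0_integralD//; last 4 first.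
  - by move=> x _; rewrite lee_fin.
  - exact/measurable_EFinP.
  - by move=> x _; rewrite lee_fin mulr_ge0 ?powR_ge0.
  - by apply/measurable_EFinP; apply: measurable_funM; [exact: measurable_cst|exact: measurable_indic].
  apply: leeD => //; rewrite (measure_int_indic _ (mS S)) -ge0_integralZl//.
    exact: measurable_indicE.
  by rewrite lee_fin powR_ge0.
rewrite -/I; move: step3; rewrite -(fineK Ifin) -(fineK mufin) -!EFinM -EFinD !lee_fin => h3.
rewrite /C ler_pdivlMr ?subr_gt0//; lra.
Qed.

Lemma power_singularity_integrable :
  (\int[mu]_x (\1_[set x | (nu x <= S)%R] x * nu x `^ p)%:E < +oo)%E.
Proof.
apply: (@le_lt_trans _ _ C%:E); last by rewrite ltry.
have cg x : ((g m x)%:E @[m --> \oo] --> (\1_[set x | (nu x <= S)%R] x * nu x `^ p)%:E)%E.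
  apply/cvg_EFin; first exact: nearW.
  apply: cvgMr; apply: (@cvg_near_cst _ _ (nu x `^ p)).
  near=> m; apply/min_idPl; near: m; exact: nbhs_infty_ger.
have -> : (\int[mu]_x (\1_[set x | (nu x <= S)%R] x * nu x `^ p)%:E =
    \int[mu]_x limn (fun m => (g m x)%:E))%E.
  by apply: eq_integral => x _; apply/esym/cvg_lim => //; exact: cg.
rewrite monotone_convergence//.
- apply: lime_le; last by apply: nearW => m; exact: g_bound.
  apply: ereal_nondecreasing_is_cvgn => m m' mm'; apply: ge0_le_integral => //.
  + by move=> x _; rewrite lee_fin.
  + exact/measurable_EFinP.
  + exact/measurable_EFinP.
  + move=> x _; rewrite lee_fin ler_wpM2l// le_min ge_min lexx/= ge_min; apply/orP; right.
    by rewrite ler_nat.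
- by move=> m; exact/measurable_EFinP.
- by move=> m x _; rewrite lee_fin.
- move=> x _ m m' mm'; rewrite lee_fin ler_wpM2l// le_min ge_min lexx/= ge_min; apply/orP; right.
  by rewrite ler_nat.
Unshelve. all: by end_near. Qed.

End power_singularity.

Section real_frame.
Context (R : realType) (n : nat).
Implicit Types u v : 'rV[R[i]]_n.

Lemma real_frame u v : u != 0 -> v != 0 -> complex.Re (hdot u v) = 0 ->
  exists (A : 'M[R]_(2, n + n)) (Q : 'M[R]_(n + n, 2)),
  A *m Q = 1%:M /\
  forall w, w *m Q = rvec (complex.Re (hdot (cplx w) u)) (complex.Re (hdot (cplx w) v)).
Proof.
move=> u0 v0 uv; have vu : complex.Re (hdot v u) = 0 by rewrite hdotC; case: (hdot u v) uv.
have nu : hnorm2 u != 0 by rewrite gt_eqF// hnorm2_gt0.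
have nv : hnorm2 v != 0 by rewrite gt_eqF// hnorm2_gt0.
have ReZ (c : R) (z : R[i]) : complex.Re (c%:C * z) = c * complex.Re z.
  by case: z => a b /=; rewrite mul0r subr0.
have [Q QE] : exists Q : 'M[R]_(n + n, 2), forall w,
    w *m Q = rvec (complex.Re (hdot (cplx w) u)) (complex.Re (hdot (cplx w) v)).
  apply: linear_matrix => [w w'|c w]; first by rewrite cplxD !hdotDl !raddfD rvecD.
  by rewrite cplxZ !hdotZl !conj_real !ReZ rvecZ.
pose fA (x : 'rV[R]_2) := realify ((x 0 0 / hnorm2 u)%:C *: u + (x 0 1 / hnorm2 v)%:C *: v).
have [A AE] : exists A : 'M[R]_(2, n + n), forall x : 'rV[R]_2, x *m A = fA x.
  apply: linear_matrix => [x y|c x].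
    rewrite /fA -realifyD !mxE !mulrDl !rmorphD !scalerDl; congr realify.
    by rewrite addrACA.
  by rewrite /fA -realifyZ !mxE -!mulrA !rmorphM scalerDr !scalerA !mulrA.
exists A, Q; split => //; apply: mulmx_ext => x.
rewrite mulmxA AE QE mulmx1 realifyK !hdotDl !hdotZl !conj_real !raddfD /= !ReZ uv vu.
rewrite !hnorm2E /= !mulr0 addr0 add0r !mulfVK//.
by apply/rowP => i; rewrite mxE; case: i => -[|[|]] //= h; congr (x _ _); exact/val_inj.
Qed.

End real_frame.

Section convex_body.
Context (R : realType) (n : nat).
Local Notation Cn := 'rV[R[i]]_n.
Local Notation mR := (measurableTypeR R).
Local Notation lam := (@lebesgue_measure R).
Local Notation tau := (2 * pi : R).
Variable K : set Cn.
Hypothesis mK : measurable (@row_of R (n + n) @^-1` (@cplx R n @^-1` K)).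
Hypothesis cK : forall (t : R) x y, 0 < t < 1 -> K x -> K y ->
  K (t%:C *: x + (1 - t)%:C *: y).
Variable M : R.
Hypotheses (M0 : 0 <= M) (bK : forall x j, K x -> normc (x 0 j) <= M).
Variable d : R.
Hypotheses (d0 : 0 < d) (iK : forall x : Cn, (forall j, normc (x 0 j) <= d) -> K x).
Hypothesis rK : forall (z : R[i]) x, normc z = 1 -> K x -> K (z *: x).

Let K' := @cplx R n @^-1` K.

Let cK' (t : R) x y : 0 < t < 1 -> K' x -> K' y -> K' (t *: x + (1 - t) *: y).
Proof. by move=> t01 Kx Ky; rewrite /K' /= cplxD !cplxZ; exact: cK. Qed.

Let bK' x i : K' x -> `|x 0 i| <= M.
Proof.
move=> Kx; case: (split_ordP i) => j ->.
  by apply: le_trans (bK j Kx); rewrite mxE; exact: Re_le_normc (_ +i* _).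
by apply: le_trans (bK j Kx); rewrite mxE; exact: Im_le_normc (_ +i* _).
Qed.

Let d2 : 0 < d / 2. Proof. by rewrite divr_gt0. Qed.

Let iK' (x : 'rV[R]_(n + n)) : (forall i, `|x 0 i| <= d / 2) -> K' x.
Proof.
move=> xd; apply: iK => j; rewrite mxE; apply: le_trans (normc_le_sum _) _ => /=.
by rewrite (splitr d) lerD.
Qed.

Definition body_integral (h : R[i] -> R) (u : Cn) : \bar R :=
  (\int[lebesgue_measure2n R n]_t (\1_K (of_coords t) * h (hdot (of_coords t) u))%:E)%E.

Let cplx_inj : injective (@cplx R n). Proof. exact: (can_inj (@cplxK R n)). Qed.

(** In a frame adapted to u and v the body integral is a constant multiple of the planar integral
    against the fibre volume, with the same constant for all vectors in the span of u and v. Circle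
    invariance of K gives the rotation invariance of the fibre volume. *)
Theorem complex_key (p : R) (u v : Cn) : -2 < p -> p < 0 -> u != 0 ->
  exists c : R[i], forall r : R, 0 <= r ->
   (circle_integral (fun z => body_integral (fun z => (normc z `^ p)%R)
      (u + (r%:C * z) *: (v + c *: u))) <=
    tau%:E * body_integral (fun z => (normc z `^ p)%R) u)%E.
Proof.
move=> p2 p0 u0; have nu : hnorm2 u != 0 by rewrite gt_eqF// hnorm2_gt0.
(* The frame needs orthogonal vectors, so v is replaced by its component v0 orthogonal to u. *)
pose b := hdot u v * ((hnorm2 u)^-1)%:C; pose v0 := v - b *: u.
have uv0 : hdot u v0 = 0.
  rewrite /v0 hdotDr -scaleNr hdotZr hnorm2E /b mulNr -mulrA -rmorphM mulVf// rmorph1.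
  by rewrite mulr1 subrr.
(* If v is a multiple of u, the shear by -b annihilates the direction and the circle degenerates to
   the point u. *)
have [v00|v0n] := eqVneq v0 0.
  exists (- b) => r r0; rewrite scaleNr -/v0 v00.
  rewrite /circle_integral; under eq_integral do rewrite scaler0 addr0.
  rewrite integral_cst//= [X in (_ * X)%E](@lebesgue_measure_itv R `[0%R, tau])/= lte_fin.
  by rewrite mulr_gt0 ?pi_gt0// oppr0 adde0 muleC.
have [A [Q [AQ QE JI]]] := complex_frame u0 v0n uv0.
have [m [B [P [BQ AP BP QAPB]]]] := frame_complement AQ.
have [C C0 CE] := fibre_integral AQ BQ AP BP QAPB mK cK' M0 bK'.
pose f := fibre_volume A B K'.
have mf4 := measurable_fibre_volume A B mK.
have fB := fibre_volume_bound AP BP mK cK' M0 bK'.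
have f_supp x := fibre_volume_supp AQ BQ M0 bK' (x := x).
have f_pos := fibre_volume_pos AP BP mK cK' M0 bK' d2 iK'.
have f_logc := fibre_volume_log_concave AP BP mK cK' M0 bK'.
have f_rot (z a a' : R[i]) : normc z = 1 -> f (cvec (z * a) (z * a')) = f (cvec a a').
  move=> z1; have nz : normc (conjc z) = 1 by rewrite normc_conj.
  have [J [I [JE IE JQ AJ]]] := JI _ nz.
  have [J' [I' [JE' IE' JQ' AJ']]] := JI _ z1.
  have zz : z * conjc z = 1.
    by rewrite -sqr_normc -[`|z|]/((normc z)%:C) z1 rmorph1 expr1n.
  have JJ' : J *m J' = 1%:M.
    apply: mulmx_ext => w; apply: cplx_inj; rewrite mulmxA JE' JE mulmx1 scalerA zz.
    by rewrite scale1r.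
  have J'J : J' *m J = 1%:M.
    apply: mulmx_ext => w; apply: cplx_inj; rewrite mulmxA JE JE' mulmx1 scalerA mulrC zz.
    by rewrite scale1r.
  have KJ w : K' w -> K' (w *m J) by move=> Kw; rewrite /K' /= JE; exact: rK.
  have KJ' w : K' w -> K' (w *m J') by move=> Kw; rewrite /K' /= JE'; exact: rK.
  have := fibre_volume_invariant BQ AP BP QAPB mK cK' M0 bK' d2 iK' (cvec a a')
    JJ' J'J JQ JQ' AJ AJ' KJ KJ'.
  by rewrite IE conjcK.
have [c cE] := complex_planar_key p2 p0 mf4 fB f_supp f_pos f_logc f_rot.
have FE z : body_integral (fun z => (normc z `^ p)%R) (u + z *: (v0 + c *: u)) =
    (C%:E * \int[lam2 R]_a \int[lam2 R]_a'
      (normc (toC a + z * (toC a' + c * toC a)) `^ p * f (cvec (toC a) (toC a')))%:E)%E.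
  pose g (x : 'rV[R]_4) := normc (cfst x + z * (csnd x + c * cfst x)) `^ p.
  have mc0 i : measurable_fun setT (fun t : 4.-tuple mR => row_of t 0 i).
    by apply: measurable_row_of; exact: measurable_id.
  have mg : measurable_fun setT (fun t : 4.-tuple mR => g (row_of t)).
    apply: cmeas_normc_powR.
    have m1 : cmeas (fun t : 4.-tuple mR => cfst (row_of t)) by split; exact: mc0.
    have m2 : cmeas (fun t : 4.-tuple mR => csnd (row_of t)) by split; exact: mc0.
    by apply: cmeasD => //; apply: cmeasM; [exact: cmeas_cst|apply: cmeasD => //;
      apply: cmeasM => //; exact: cmeas_cst].
  have g0 x : 0 <= g x by exact: powR_ge0.
  transitivity (\int[power_measure lam (n + n)]_t (\1_K' (row_of t) * g (row_of t *m Q))%:E)%E.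
    apply: eq_integral => t _; rewrite of_coordsE; congr (_ * _)%:E.
    by rewrite /g QE cfst_cvec csnd_cvec hdotDr hdotZr hdotDr hdotZr.
  rewrite CE//; congr (_ * _)%E.
  rewrite (integral_cvec (g := fun x => (g x * f x)%:E)).
  - apply: eq_integral => a _; apply: eq_integral => a' _.
    by rewrite /g cfst_cvec csnd_cvec.
  - by apply/measurable_EFinP; exact: measurable_funM.
  - by move=> x; rewrite lee_fin mulr_ge0//; case/andP: (fB x).
(* A shear by c relative to v0 is a shear by c - b relative to v. *)
exists (c - b) => r r0.
have -> : v + (c - b) *: u = v0 + c *: u by rewrite /v0 scalerBl addrA addrAC.
have -> : body_integral (fun z => (normc z `^ p)%R) u =
    body_integral (fun z => (normc z `^ p)%R) (u + 0 *: (v0 + c *: u)).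
  by rewrite scale0r addr0.
rewrite FE muleCA; have {}cE := cE r r0.
have C0' : (0 <= C%:E)%E by rewrite lee_fin ltW.
apply: le_trans (lee_wpmul2l C0' cE).
rewrite /circle_integral; under eq_integral do rewrite FE.
pose G (x : (mR * (mR * mR)) * (mR * mR)) : \bar R :=
  (normc (toC x.1.2 + (r%:C * expi x.1.1) * (toC x.2 + c * toC x.1.2)) `^ p *
   f (cvec (toC x.1.2) (toC x.2)))%:E.
have G0 x : (0 <= G x)%E by rewrite lee_fin mulr_ge0 ?powR_ge0//; case/andP: (fB (cvec (toC x.1.2) (toC x.2))).
have mG : measurable_fun setT G.
  have m1 : cmeas (fun x : (mR * (mR * mR)) * (mR * mR) => toC x.1.2).
    by apply: cmeas_toC; exact: (measurableT_comp measurable_snd measurable_fst).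
  have m2 : cmeas (fun x : (mR * (mR * mR)) * (mR * mR) => expi (x.1.1 : R)).
    by apply: (cmeas_comp (@cmeas_expi R)); exact: (measurableT_comp measurable_fst measurable_fst).
  have m3 : cmeas (fun x : (mR * (mR * mR)) * (mR * mR) => toC x.2).
    by apply: cmeas_toC; exact: measurable_snd.
  apply/measurable_EFinP; apply: measurable_funM; last exact: cmeas_cvec.
  by apply: cmeas_normc_powR; cm.
have mG1 := measurable_integral_snd (lam2 R) mG G0.
have mG2 := measurable_integral_snd (lam2 R) mG1 (fun x => integral_ge0 _ (fun y _ => G0 (x, y))).
rewrite ge0_integralZl//; first exact: measurable_funTS.
by move=> t _; apply: integral_ge0 => a _; apply: integral_ge0 => a' _; exact: (G0 ((t, a), a')).
Qed.

(** Same reduction with the real parts of the two Hermitian products as coordinates; the only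
    symmetry needed is x -> -x, which makes the fibre volume even. *)
Theorem real_key (p : R) (u v : Cn) : -1 < p -> u != 0 ->
  exists c : R, forall t : R,
   let F := body_integral (fun z => (`|complex.Re z| `^ p)%R) in
   let w := v + c%:C *: u in
   ((p < 0)%R -> (F (u + t%:C *: w)%R + F (u - t%:C *: w)%R <= 2%:E * F u)%E) /\
   ((0 < p)%R -> (2%:E * F u <= F (u + t%:C *: w)%R + F (u - t%:C *: w)%R)%E).
Proof.
move=> p1 u0; have nu : hnorm2 u != 0 by rewrite gt_eqF// hnorm2_gt0.
pose b := complex.Re (hdot u v) / hnorm2 u; pose v0 := v - b%:C *: u.
have uv0 : complex.Re (hdot u v0) = 0.
  rewrite /v0 hdotDr -scaleNr hdotZr hnorm2E -rmorphN -rmorphM raddfD /=.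
  by rewrite /b mulNr mulfVK// subrr.
have [v00|v0n] := eqVneq v0 0.
  exists (- b) => t /=; rewrite rmorphN scaleNr -/v0 v00 scaler0 subr0 addr0.
  by rewrite ereal_double.
have [A [Q [AQ QE]]] := real_frame u0 v0n uv0.
have [m [B [P [BQ AP BP QAPB]]]] := frame_complement AQ.
have [C C0 CE] := fibre_integral AQ BQ AP BP QAPB mK cK' M0 bK'.
pose f := fibre_volume A B K'.
have mf2 := measurable_fibre_volume A B mK.
have fB := fibre_volume_bound AP BP mK cK' M0 bK'.
have f_supp x := fibre_volume_supp AQ BQ M0 bK' (x := x).
have f_pos := fibre_volume_pos AP BP mK cK' M0 bK' d2 iK'.
have f_logc := fibre_volume_log_concave AP BP mK cK' M0 bK'.
have f_even (a a' : R) : f (rvec (- a) (- a')) = f (rvec a a').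
  have N1 k : - 1%:M *m - 1%:M = 1%:M :> 'M[R]_k by rewrite mulNmx mulmxN opprK mulmx1.
  have NQ : - 1%:M *m Q = Q *m - 1%:M by rewrite mulNmx mulmxN mul1mx mulmx1.
  have NA : A *m - 1%:M = - 1%:M *m A by rewrite mulNmx mulmxN mul1mx mulmx1.
  have KN w : K' w -> K' (w *m - 1%:M).
    move=> Kw; rewrite /K' /= mulmxN mulmx1 -scaleN1r cplxZ; apply: rK => //.
    by rewrite normc_real normrN normr1.
  have := fibre_volume_invariant BQ AP BP QAPB mK cK' M0 bK' d2 iK' (rvec a a')
    (N1 _) (N1 _) NQ NQ NA NA KN KN.
  by rewrite mulmxN mulmx1 -scaleN1r rvecZ !mulN1r.
have [c cE] := real_planar_key p1 mf2 fB f_supp f_pos f_logc f_even.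
have ReZ (s : R) (z : R[i]) : complex.Re (s%:C * z) = s * complex.Re z.
  by case: z => x y /=; rewrite mul0r subr0.
have FE (z : R) : body_integral (fun z => (`|complex.Re z| `^ p)%R) (u + z%:C *: (v0 + c%:C *: u)) =
    (C%:E * \int[lam]_(a in (setT : set mR)) \int[lam]_(a' in (setT : set mR))
      (`|a + z * (a' + c * a)| `^ p * f (rvec a a'))%:E)%E.
  pose g (x : 'rV[R]_2) := `|x 0 0 + z * (x 0 1 + c * x 0 0)| `^ p.
  have mc0 i : measurable_fun setT (fun t : 2.-tuple mR => row_of t 0 i).
    by apply: measurable_row_of; exact: measurable_id.
  have mg : measurable_fun setT (fun t : 2.-tuple mR => g (row_of t)).
    apply: (measurableT_comp (@measurable_powR R p)).
    apply: (measurableT_comp (@normr_measurable R setT)).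
    by apply: measurable_funD => //; apply: measurable_funM => //; apply: measurable_funD => //;
      apply: measurable_funM.
  have g0 x : 0 <= g x by exact: powR_ge0.
  transitivity (\int[power_measure lam (n + n)]_t (\1_K' (row_of t) * g (row_of t *m Q))%:E)%E.
    apply: eq_integral => t _; rewrite of_coordsE; congr (_ * _)%:E.
    by rewrite /g QE !mxE/= hdotDr hdotZr hdotDr hdotZr !raddfD /= !ReZ !raddfD /= !ReZ.
  rewrite CE//; congr (_ * _)%E.
  rewrite (integral_rvec (g := fun x => (g x * f x)%:E)).
  - apply: eq_integral => a _; apply: eq_integral => a' _.
    by rewrite /g !mxE.
  - by apply/measurable_EFinP; exact: measurable_funM.
  - by move=> x; rewrite lee_fin mulr_ge0//; case/andP: (fB x).
exists (c - b) => t F w.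
have wE : w = v0 + c%:C *: u by rewrite /w /v0 rmorphB scalerBl addrA addrAC.
have F0 : F u = F (u + 0%:C *: (v0 + c%:C *: u)) by rewrite scale0r addr0.
have NE : u - t%:C *: w = u + (- t)%:C *: (v0 + c%:C *: u).
  by rewrite wE -scaleNr -rmorphN.
have FN := congr1 F NE.
have [c1 c2] := cE t.
have C0' : (0 <= C%:E)%E by rewrite lee_fin ltW.
have I0 z : (0 <= \int[lam]_(a in (setT : set mR)) \int[lam]_(a' in (setT : set mR))
      (`|a + z * (a' + c * a)| `^ p * f (rvec a a'))%:E)%E.
  apply: integral_ge0 => a _; apply: integral_ge0 => a' _.
  have /andP[f0 _] := fB (rvec a a'); rewrite lee_fin.
  exact: mulr_ge0 (powR_ge0 _ _) f0.
rewrite FN F0 wE /F !FE muleCA -(ge0_muleDr _ (I0 _) (I0 _)).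
split=> pp; [have h := c1 pp|have h := c2 pp]; exact: (lee_wpmul2l C0' h).
Qed.

End convex_body.

Section power_scale.
Context (R : realType).
Local Notation mR := (measurableTypeR R).
Local Notation lam := (@lebesgue_measure R).

Definition tuple_scale N (r : R) (t : N.-tuple mR) : N.-tuple mR := tuple_of (r *: row_of t).

Lemma row_of_scale N (r : R) (t : N.-tuple mR) : row_of (tuple_scale r t) = r *: row_of t.
Proof. by rewrite /tuple_scale tuple_ofK. Qed.

Lemma measurable_tuple_scale N (r : R) : measurable_fun setT (@tuple_scale N r).
Proof.
apply: measurable_tuple_of => i; under eq_fun do rewrite mxE.
by apply: measurable_funM; [exact: measurable_cst|apply: measurable_row_of; exact: measurable_id].
Qed.

Lemma measurable_tuple_consl N (a : mR) :
  measurable_fun setT (fun t : N.-tuple mR => tuple_cons (a, t)).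
Proof.
apply/measurable_fun_tnthP => i; case: (unliftP ord0 i) => [j ->|->].
  rewrite (_ : _ \o _ = fun t : N.-tuple mR => tnth t j); first exact: measurable_tnth.
  by apply/funext => t /=; rewrite tnthS.
rewrite (_ : _ \o _ = cst a); first exact: measurable_cst.
by apply/funext => t /=; rewrite tnth0.
Qed.

Lemma integral_tuple_scale N (r : R) (g : N.-tuple mR -> \bar R) : 0 < r ->
  measurable_fun setT g -> (forall t, 0 <= g t)%E ->
  (\int[power_measure lam N]_t g t = (r ^+ N)%:E * \int[power_measure lam N]_t g (tuple_scale r t))%E.
Proof.
move=> r0; elim: N g => [|N IH] g mg g0.
  rewrite !integral_tuple0 expr0 mul1e; congr g.
  by rewrite [tuple_scale _ _]tuple0.
have mgs : measurable_fun setT (fun t => g (tuple_scale r t)).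
  by apply: (measurableT_comp mg); exact: measurable_tuple_scale.
have consE (a : R) (t : N.-tuple mR) : tuple_scale r (tuple_cons (a : mR, t)) = tuple_cons ((r * a : R) : mR, tuple_scale r t).
  apply: eq_from_tnth => i; rewrite tnth_mktuple !mxE.
  by case: (unliftP ord0 i) => [j ->|->]; rewrite ?tnthS ?tnth0// tnth_mktuple !mxE.
rewrite !integral_tuple_cons//.
have m1 : measurable_fun setT (fun s : mR => \int[power_measure lam N]_t g (tuple_cons (s, t)))%E.
  have mgc : measurable_fun setT (fun z : mR * N.-tuple mR => g (tuple_cons z)).
    by apply: (measurableT_comp mg); exact: measurable_tuple_cons.
  exact: (measurable_integral_snd (power_measure lam N) mgc (fun z => g0 _)).
rewrite (lebesgue_integral_scale_pos r0 m1); last by move=> s; apply: integral_ge0.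
rewrite exprS EFinM -muleA; congr (_ * _)%E.
rewrite -ge0_integralZl//.
- apply: eq_integral => s _; rewrite IH//.
  + by congr (_ * _)%E; apply: eq_integral => t _; rewrite consE.
  + exact: (measurableT_comp mg (@measurable_tuple_consl N _)).
- have mgc : measurable_fun setT (fun z : mR * N.-tuple mR => g (tuple_scale r (tuple_cons z))).
    by apply: (measurableT_comp mgs); exact: measurable_tuple_cons.
  exact: (measurable_integral_snd (power_measure lam N) mgc (fun z => g0 _)).
- by move=> s _; apply: integral_ge0.
- by rewrite lee_fin exprn_ge0// ltW.
Qed.

Lemma cube_measure_lty m (d : R) : 0 < d -> (power_measure lam m (cube m d) < +oo)%E.
Proof.
move=> d0; elim: m => [|m IHm].
  rewrite (_ : cube 0 d = setT) /=; first by rewrite diracT ltry.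
  by apply/seteqP; split => // y _ [].
rewrite /= /power_step /pushforward.
rewrite (_ : _ @^-1` _ = `[(- d)%R, d]%classic `*` cube m d).
  rewrite product_measure1E//; last exact: measurable_cube.
  rewrite [X in (X * _)%E](@lebesgue_measure_itv R `[(- d)%R, d])/= lte_fin gtrN//.
  by rewrite -EFinB lte_mul_pinfty// lee_fin opprK addr_ge0// ltW.
apply/seteqP; split => -[s y] /=.
  move=> h; split; first by have := h ord0; rewrite tnth0 in_itv/= -ler_norml.
  by move=> i; have := h (lift ord0 i); rewrite tnthS.
rewrite in_itv/= -ler_norml => -[hs hy] i.
by case: (unliftP ord0 i) => [j ->|->]; rewrite ?tnthS ?tnth0.
Qed.

End power_scale.

(* What the proof uses of the convex body [K]: measurability and convexity, invariance
   under the unit circle, and inclusions between two sup-norm balls. *)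
Record round_body (R : realType) (n : nat) (K : set 'rV[R[i]]_n) (M d : R) : Prop :=
  RoundBody {
  rb_meas : measurable (@row_of R (n + n) @^-1` (@cplx R n @^-1` K)) ;
  rb_conv : forall (t : R) x y, 0 < t < 1 -> K x -> K y ->
    K (t%:C *: x + (1 - t)%:C *: y) ;
  rb_M0 : 0 <= M ;
  rb_bound : forall (x : 'rV[R[i]]_n) j, K x -> normc (x 0 j) <= M ;
  rb_d0 : 0 < d ;
  rb_inner : forall x : 'rV[R[i]]_n, (forall j, normc (x 0 j) <= d) -> K x ;
  rb_rot : forall (z : R[i]) x, normc z = 1 -> K x -> K (z *: x) }.

Section body_functional.
Context (R : realType) (n : nat).
Local Notation Cn := 'rV[R[i]]_n.
Local Notation mR := (measurableTypeR R).
Local Notation lam := (@lebesgue_measure R).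
Local Notation tau := (2 * pi : R).
Variables (K : set Cn) (M d : R).
Hypothesis hK : round_body K M d.

Let K' := @cplx R n @^-1` K.
Local Notation lN := (power_measure lam (n + n)).

Lemma measurable_body : measurable (@row_of R (n + n) @^-1` K').
Proof. exact: rb_meas hK. Qed.

Lemma body_volume : (0 < lN (@row_of R (n + n) @^-1` K') < +oo)%E.
Proof.
have d2 : 0 < d / 2 by rewrite divr_gt0// (rb_d0 hK).
apply/andP; split.
  apply: lt_le_trans (cube_measure_gt0 (n + n) d2) _; apply: le_measure; rewrite ?inE.
  - exact: measurable_cube.
  - exact: measurable_body.
  - move=> t td; apply: (rb_inner hK) => j; rewrite mxE; apply: le_trans (normc_le_sum _) _ => /=.
    by rewrite (splitr d) lerD// mxE.
have M1 : 0 < M + 1 by rewrite ltr_wpDl// (rb_M0 hK).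
apply: le_lt_trans (cube_measure_lty (n + n) M1); apply: le_measure; rewrite ?inE.
- exact: measurable_body.
- exact: measurable_cube.
- move=> t Kt i; apply: (@le_trans _ _ M); last by rewrite lerDl.
  have -> : (tnth t i : R) = row_of t 0 i by rewrite mxE.
  case: (split_ordP i) => j ->.
    by apply: le_trans (rb_bound hK j Kt); rewrite [X in normc X]mxE; exact: Re_le_normc (_ +i* _).
  by apply: le_trans (rb_bound hK j Kt); rewrite [X in normc X]mxE; exact: Im_le_normc (_ +i* _).
Qed.

Lemma measurable_body_indic : measurable_fun setT (fun t : (n + n).-tuple mR => \1_K' (row_of t) : R).
Proof. exact: (@measurable_indic _ _ R setT (@row_of R (n + n) @^-1` K') measurable_body). Qed.

Lemma cmeas_hdot u : cmeas (fun t : (n + n).-tuple mR => hdot (cplx (row_of t)) u).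
Proof.
have [Q QE] : exists Q : 'M[R]_(n + n, 2), forall w, w *m Q = rvec (complex.Re (hdot (cplx w) u)) (complex.Im (hdot (cplx w) u)).
  apply: linear_matrix => [w w'|c w]; first by rewrite cplxD !hdotDl !raddfD rvecD.
  rewrite cplxZ !hdotZl !conj_real rvecZ; case: (hdot _ _) => a b /=.
  by rewrite !mul0r subr0 addr0.
split.
  rewrite (_ : (fun t => _) = fun t => (row_of t *m Q) 0 0).
    by apply: measurable_row_mulmx => j; apply: measurable_row_of; exact: measurable_id.
  by apply/funext => t; rewrite QE mxE.
rewrite (_ : (fun t => _) = fun t => (row_of t *m Q) 0 1).
  by apply: measurable_row_mulmx => j; apply: measurable_row_of; exact: measurable_id.
by apply/funext => t; rewrite QE mxE.
Qed.

Lemma measurable_body_integrand (h : R[i] -> R) u : planar h ->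
  measurable_fun setT (fun t : (n + n).-tuple mR => (\1_K (of_coords t) * h (hdot (of_coords t) u))%:E).
Proof.
move=> mh; apply/measurable_EFinP.
rewrite (_ : (fun t => _) = fun t : (n + n).-tuple mR => \1_K' (row_of t) * h (hdot (cplx (row_of t)) u)).
  apply: measurable_funM; first exact: measurable_body_indic.
  exact: (planar_comp mh (cmeas_hdot u)).
by apply/funext => t; rewrite of_coordsE.
Qed.

(* By uniqueness of Haar measure, so that no determinant is computed. *)
Lemma linear_transfer (J J' : 'M[R]_(n + n)) : J *m J' = 1%:M -> J' *m J = 1%:M ->
  exists2 c : R, 0 < c & forall g : 'rV[R]_(n + n) -> \bar R,
    measurable_fun setT (fun t : (n + n).-tuple mR => g (row_of t)) -> (forall x, 0 <= g x)%E ->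
    (\int[lN]_t g (row_of t) = c%:E * \int[lN]_t g (row_of t *m J))%E.
Proof.
move=> JJ' J'J.
pose L (N : 'M[R]_(n + n)) (t : (n + n).-tuple mR) := tuple_of (row_of t *m N).
have mL N : measurable_fun setT (L N).
  by apply: measurable_tuple_of => i; apply: measurable_row_mulmx => j; apply: measurable_row_of; exact: measurable_id.
have LK : cancel (L J) (L J') by move=> t; rewrite /L tuple_ofK -mulmxA JJ' mulmx1 row_ofK.
have L'K : cancel (L J') (L J) by move=> t; rewrite /L tuple_ofK -mulmxA J'J mulmx1 row_ofK.
have LD : {morph L J : x y / tuple_add x y >-> tuple_add x y}.
  by move=> x y; rewrite /L row_ofD mulmxDl tuple_ofD.
have [c c0 cE] := haar_transfer (mL J) (mL J') LK L'K LD (is_haar_tuple R _) (is_haar_tuple R _).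
exists c => // g mg g0; rewrite (cE (fun t => g (row_of t)))//; congr (_ * _)%E.
by apply: eq_integral => t _; rewrite /L tuple_ofK.
Qed.

(** Substitute conj(z) x for x: [hdot] is conjugate-linear in x, so this multiplies it by z, and K
    is preserved. *)
Lemma body_integral_rot (h : R[i] -> R) u (z : R[i]) : planar h -> (forall z, 0 <= h z) ->
  normc z = 1 -> body_integral K (fun w => h (z * w)) u = body_integral K h u.
Proof.
move=> mh h0 z1.
have zz : z * conjc z = 1 by rewrite -sqr_normc -[`|z|]/((normc z)%:C) z1 rmorph1 expr1n.
have ex (s : R[i]) : exists J : 'M[R]_(n + n), forall w, w *m J = realify (s *: cplx w).
  apply: linear_matrix => [w w'|c w]; first by rewrite cplxD scalerDr realifyD.
  by rewrite cplxZ -realifyZ !scalerA mulrC.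
have [J JE] := ex (conjc z); have [J' JE'] := ex z.
have JJ' : J *m J' = 1%:M.
  by apply: mulmx_ext => w; rewrite mulmxA JE' JE mulmx1 realifyK scalerA zz scale1r cplxK.
have J'J : J' *m J = 1%:M.
  by apply: mulmx_ext => w; rewrite mulmxA JE JE' mulmx1 realifyK scalerA mulrC zz scale1r cplxK.
have [c c0 cE] := linear_transfer JJ' J'J.
have K'J w : \1_K' (w *m J) = \1_K' w :> R.
  rewrite !indicE; congr (nat_of_bool _)%:R; apply/idP/idP; rewrite !inE /K' /= JE realifyK.
    by move=> /(rb_rot hK z1); rewrite scalerA zz scale1r.
  by apply: (rb_rot hK); rewrite normc_conj.
(* The transfer constant is tested on the indicator of K, which is invariant and has positive finite
   integral. *)
have c1 : c = 1.
  have := cE (fun w => (\1_K' w)%:E); rewrite (eq_integral (fun t => (\1_(@row_of R (n + n) @^-1` K') t)%:E))//.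
  rewrite -(measure_int_indic _ measurable_body) => -/(_ _ _) E.
  have {E} : lN (@row_of R (n + n) @^-1` K') = (c%:E * lN (@row_of R (n + n) @^-1` K'))%E.
    rewrite [LHS]E; last 2 first.
    - by apply/measurable_EFinP; exact: measurable_body_indic.
    - by move=> w; rewrite lee_fin.
    congr (_ * _)%E; rewrite (measure_int_indic _ measurable_body).
    by apply: eq_integral => t _; rewrite K'J.
  have /andP[v0 voo] := body_volume.
  have vf : lN (@row_of R (n + n) @^-1` K') \is a fin_num by rewrite ge0_fin_numE// ltW.
  have vn : fine (lN (@row_of R (n + n) @^-1` K')) != 0 by rewrite gt_eqF// fine_gt0// v0.
  by rewrite -(fineK vf) -EFinM => -[]; rewrite -[LHS]mul1r => /(mulIf vn) <-.
pose g (w : 'rV[R]_(n + n)) := (\1_K' w * h (hdot (cplx w) u))%:E.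
have mg : measurable_fun setT (fun t : (n + n).-tuple mR => g (row_of t)).
  have := measurable_body_integrand u mh; congr measurable_fun.
  by apply/funext => t; rewrite of_coordsE.
have g0 w : (0 <= g w)%E by rewrite lee_fin mulr_ge0.
have := cE g mg g0; rewrite c1 mul1e => E.
transitivity (\int[lN]_t g (row_of t *m J))%E.
  apply: eq_integral => t _; rewrite of_coordsE /g K'J JE realifyK hdotZl conjcK.
  by [].
by rewrite -E; apply: eq_integral => t _; rewrite of_coordsE.
Qed.

Lemma body_integral_ge0 (h : R[i] -> R) u : (forall z, 0 <= h z) -> (0 <= body_integral K h u)%E.
Proof. by move=> h0; apply: integral_ge0 => t _; rewrite lee_fin mulr_ge0. Qed.

(** Rotation invariance allows h to be replaced by its average over the circle, and a rotation
    invariant function homogeneous of degree p is a multiple of |z|^p. As p is not 0, both sides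
    vanish at z = 0. *)
Lemma body_integral_average (h : R[i] -> R) (p : R) u : p != 0 -> planar h -> (forall z, 0 <= h z) ->
  (forall (r : R) z, 0 <= r -> h (r%:C * z) = r `^ p * h z) ->
  (tau%:E * body_integral K h u =
   circle_integral (fun z => (h z)%:E) * body_integral K (fun z => (normc z `^ p)%R) u)%E.
Proof.
move=> pn0 mh h0 hZ.
have pi2 : 0 < tau by rewrite mulr_gt0// pi_gt0.
have mhE : planar (fun z => (h z)%:E) by apply/measurable_EFinP; exact: mh.
transitivity (circle_integral (fun z => body_integral K (fun w => h (z * w)) u)).
  rewrite /circle_integral (eq_integral (fun=> body_integral K h u)); last first.
    by move=> t _; apply: body_integral_rot => //; exact: normc_expi.
  rewrite integral_cst//= [X in _ = (_ * X)%E](@lebesgue_measure_itv R `[0%R, tau])/= lte_fin.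
  by rewrite pi2 oppr0 adde0 muleC.
have mI : measurable_fun setT (fun x : mR * (n + n).-tuple mR => (\1_(`[0, tau]%classic : set mR) x.1)%:E : \bar R).
  apply: (measurableT_comp (f := fun r : mR => (\1_(`[0, tau]%classic : set mR) r)%:E)) => //.
  by apply: measurable_indicE; exact: measurable_itv.
pose G (s : mR) (t : (n + n).-tuple mR) : \bar R :=
  ((\1_(`[0, tau]%classic : set mR) s)%:E * (\1_K (of_coords t) * h (expi s * hdot (of_coords t) u))%:E)%E.
have G0 s t : (0 <= G s t)%E by rewrite /G mule_ge0// lee_fin// mulr_ge0.
have mG : measurable_fun setT (fun x : mR * (n + n).-tuple mR => G x.1 x.2).
  apply: emeasurable_funM => //; apply/measurable_EFinP.
  rewrite (_ : (fun x => _) = fun x : mR * (n + n).-tuple mR => \1_K' (row_of x.2) * h (expi x.1 * hdot (cplx (row_of x.2)) u)).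
    apply: measurable_funM; first exact: (measurableT_comp measurable_body_indic measurable_snd).
    apply: (planar_comp mh); apply: cmeasM.
      by apply: (cmeas_comp (@cmeas_expi R)); exact: measurable_fst.
    exact: (cmeas_comp (cmeas_hdot u) measurable_snd).
  by apply/funext => x; rewrite of_coordsE.
have mp : planar (fun z : R[i] => (normc z `^ p)%R).
  by apply: (measurableT_comp (@measurable_powR R p)); exact: (@planar_normc R).
transitivity (\int[lam]_s \int[lebesgue_measure2n R n]_t G s t)%E.
  rewrite /circle_integral integral_indic_mul; apply: eq_integral => s _.
  rewrite /G ge0_integralZl//.
  - have mhs : planar (fun w => h (expi s * w)) by apply: (planar_comp mh); cm.
    exact: (measurable_body_integrand u mhs).
  - by move=> t _; rewrite lee_fin mulr_ge0.
rewrite (tonelli lam (lebesgue_measure2n R n) mG G0).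
rewrite /body_integral -ge0_integralZl//; last 3 first.
- exact: (measurable_body_integrand u mp).
- by move=> t _; rewrite lee_fin mulr_ge0// powR_ge0.
- by apply: integral_ge0 => s _; rewrite lee_fin.
apply: eq_integral => t _; rewrite /G.
set k := \1_K _; set z := hdot _ _.
have k0 : 0 <= k by rewrite /k.
transitivity (\int[lam]_s (((k * normc z `^ p)%:E * ((\1_(`[0, tau]%classic : set mR) s)%:E * (h (expi s * (z * (normc z)^-1%:C)))%:E))))%E.
  apply: eq_integral => s _; rewrite -!EFinM; congr _%:E.
  have [z0|z0] := eqVneq z 0.
    rewrite z0 mulr0 normc0; have -> : h 0 = 0 `^ p * h 0 by rewrite -hZ// rmorph0 mul0r.
    by rewrite mul0r mulr0; ring.
  have nz : normc z != 0 by rewrite gt_eqF// normc_gt0.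
  have -> : expi s * z = (normc z)%:C * (expi s * (z * (normc z)^-1%:C)).
    have := mulfV nz => /(congr1 (real_complex R)); rewrite rmorphM rmorph1 => e.
    by rewrite mulrCA (mulrCA _ z) e mulr1.
  by rewrite hZ ?normc_ge0//; ring.
have mhz : planar (fun w => (h (w * (z * (normc z)^-1%:C)))%:E).
  by apply: (planar_comp mhE); cm.
rewrite ge0_integralZl//; last 3 first.
- apply: emeasurable_funM; first by apply: measurable_indicE; exact: measurable_itv.
  exact: (planar_comp mhz (@cmeas_expi R)).
- by move=> s _; rewrite mule_ge0// lee_fin.
- by rewrite lee_fin mulr_ge0// powR_ge0.
rewrite muleC -integral_indic_mul -/(circle_integral (fun w => (h (w * (z * (normc z)^-1%:C)))%:E)).
have [z0|z0] := eqVneq z 0.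
  by rewrite z0 normc0 powR0// mulr0 !mule0.
have nz : normc z != 0 by rewrite gt_eqF// normc_gt0.
have u1 : normc (z * (normc z)^-1%:C) = 1.
  by rewrite normcM normc_real ger0_norm ?invr_ge0 ?normc_ge0// mulfV.
congr (_ * _)%E; rewrite -[RHS](circle_integral_rot mhE _ u1)//.
by apply: eq_integral => s _; rewrite mulrC.
Qed.

Lemma hdot_bound (x u : Cn) : K x -> normc (hdot x u) <= M * \sum_j normc (u 0 j).
Proof.
move=> Kx; rewrite /hdot mulr_sumr; elim/big_ind2: _ => [||j _].
- by rewrite normc0.
- by move=> a b a' b' h1 h2; apply: le_trans (normc_leD _ _) (lerD h1 h2).
- by rewrite normcM normc_conj ler_wpM2r ?normc_ge0//; exact: (rb_bound hK).
Qed.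

Lemma body_integral_lty_bounded (h : R[i] -> R) (u : Cn) (B S : R) : planar h -> (forall z, 0 <= h z) ->
  M * \sum_j normc (u 0 j) <= S -> (forall z, normc z <= S -> h z <= B) ->
  (body_integral K h u < +oo)%E.
Proof.
move=> mh h0 uS hB; have S0 : 0 <= S.
  by apply: le_trans uS; rewrite mulr_ge0 ?(rb_M0 hK)// sumr_ge0// => j _; exact: normc_ge0.
have B0 : 0 <= B by apply: le_trans (h0 0) (hB _ _); rewrite normc0.
have /andP[_ voo] := body_volume.
apply: (@le_lt_trans _ _ (B%:E * lN (@row_of R (n + n) @^-1` K'))%E).
  rewrite (measure_int_indic _ measurable_body) -ge0_integralZl//; last exact: (measurable_indicE measurable_body).
  apply: ge0_le_integral => //.
  - by move=> t _; rewrite lee_fin mulr_ge0.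
  - exact: measurable_body_integrand.
  - by apply: emeasurable_funM => //; exact: (measurable_indicE measurable_body).
  - move=> t _; rewrite -EFinM lee_fin mulrC of_coordsE.
    have [Kt|Kt] := pselect (K' (row_of t)); last by rewrite !indic_notin// !mulr0.
    by rewrite !indic_in// !mulr1 hB// (le_trans _ uS)// hdot_bound.
by rewrite lte_mul_pinfty// lee_fin.
Qed.

(** Some box around a small multiple of u lies in K and keeps the real part of <x,u> away from 0, so
    h is bounded below there. *)
Lemma body_integral_gt0 (h : R[i] -> R) (u : Cn) : u != 0 -> planar h -> (forall z, 0 <= h z) ->
  (forall e S : R, 0 < e -> exists2 c : R, 0 < c & forall z, e <= complex.Re z -> normc z <= S -> c <= h z) ->
  (0 < body_integral K h u)%E.
Proof.
move=> u0 mh h0 hpos.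
have nu := hnorm2_gt0 u0.
pose U := 1 + \sum_j normc (u 0 j).
have U0 : 0 < U by rewrite ltr_wpDr// sumr_ge0// => j _; exact: normc_ge0.
have uU j : normc (u 0 j) <= U.
  by rewrite /U (bigD1 j)//= addrCA lerDl addr_ge0// sumr_ge0// => i _; exact: normc_ge0.
have dd := rb_d0 hK; have d2 : 0 < d / 2 by rewrite divr_gt0.
(* The entries of s u are at most d/2 in modulus. In [e] the first bound leaves room for the box
   inside K; the second keeps the real part of <x,u> above half of its value s |u|^2 at the
   centre. *)
pose s := d / 2 / U; have s0 : 0 < s by rewrite divr_gt0.
pose e := Num.min (d / 2 / 2) (s * hnorm2 u / 2 / (2 * U)).
have e0 : 0 < e by rewrite lt_min; apply/andP; split; repeat (apply: divr_gt0 || apply: mulr_gt0).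
pose a := tuple_of (realify (s%:C *: u)).
have [c c0 hc] := hpos (s * hnorm2 u / 2) (M * \sum_j normc (u 0 j)) ltac:(by rewrite divr_gt0// mulr_gt0).
pose Bx : set ((n + n).-tuple mR) := (fun t => tuple_sub t a) @^-1` cube (n + n) e.
have hh := is_haar_tuple R (n + n).
have mB : measurable Bx.
  apply: measurable_preimT; last exact: measurable_cube.
  by apply: (measurable_haar_sub hh) => //; exact: measurable_cst.
have BE : lN Bx = lN (cube (n + n) e).
  rewrite -(haar_inv hh a mB); congr (lN _); apply/seteqP; split => t; rewrite /Bx /=.
    by rewrite (haar_addK hh).
  by rewrite (haar_addK hh).
have Bsub t : Bx t -> exists w, [/\ cplx (row_of t) = s%:C *: u + w & forall j, normc (w 0 j) <= 2 * e].
  move=> Bt; exists (cplx (row_of (tuple_sub t a))); split.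
    rewrite -{1}(haar_subK hh t a) row_ofD cplxD /a tuple_ofK realifyK addrC.
    by [].
  move=> j; rewrite mxE; apply: le_trans (normc_le_sum _) _ => /=.
  by rewrite mulr_natl mulr2n lerD// mxE.
have BK t : Bx t -> K' (row_of t) /\ s * hnorm2 u / 2 <= complex.Re (hdot (cplx (row_of t)) u).
  move=> /Bsub[w [wE we]]; rewrite /K' /= wE; split.
    apply: (rb_inner hK) => j; rewrite !mxE (splitr d); apply: le_trans (normc_leD _ _) _.
    apply: lerD.
      rewrite normcM normc_real (gtr0_norm s0) /s mulrAC ler_pdivrMr//.
      by rewrite ler_wpM2l// ltW.
    apply: le_trans (we j) _; rewrite -ler_pdivlMl// mulrC.
    by rewrite /e ge_min lexx.
  rewrite hdotDl hdotZl conj_real hnorm2E -rmorphM raddfD /=.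
  have wb : `|complex.Re (hdot w u)| <= s * hnorm2 u / 2.
    apply: le_trans (Re_le_normc _) _.
    have : normc (hdot w u) <= 2 * e * U.
      apply: (@le_trans _ _ (2 * e * \sum_j normc (u 0 j))).
        rewrite /hdot mulr_sumr; elim/big_ind2: _ => [||j _].
        - by rewrite normc0.
        - by move=> x b x' b' h1 h2; apply: le_trans (normc_leD _ _) (lerD h1 h2).
        - by rewrite normcM normc_conj ler_wpM2r ?normc_ge0.
      by rewrite ler_wpM2l ?mulr_ge0 ?(ltW e0)// /U lerDr.
    move=> hb; apply: (le_trans hb); rewrite mulrAC -ler_pdivlMl ?mulr_gt0// mulrC.
    by rewrite /e ge_min lexx orbT.
  by move: wb; rewrite ler_norml => /andP[w1 _]; lra.
apply: (@lt_le_trans _ _ (c%:E * lN (cube (n + n) e))%E).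
  by rewrite mule_gt0// cube_measure_gt0.
rewrite -BE (measure_int_indic _ mB) -ge0_integralZl//; last 2 first.
- exact: (measurable_indicE mB).
- by rewrite lee_fin ltW.
apply: ge0_le_integral => //.
- by move=> t _; rewrite mule_ge0// lee_fin// ltW.
- by apply: emeasurable_funM => //; exact: (measurable_indicE mB).
- exact: measurable_body_integrand.
- move=> t _; rewrite -EFinM lee_fin of_coordsE.
  have [Bt|Bt] := pselect (Bx t); last by rewrite [X in _ * X]indic_notin// mulr0 mulr_ge0.
  have [Kt Ht] := BK t Bt; rewrite ![\1__ _]indic_in// mulr1 mul1r.
  by apply: hc => //; exact: hdot_bound.
Qed.

Lemma body_integralZ (p : R) u (z : R[i]) : z != 0 ->
  (body_integral K (fun z => (normc z `^ p)%R) (z *: u) =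
   (normc z `^ p)%:E * body_integral K (fun z => (normc z `^ p)%R) u)%E.
Proof.
move=> z0; have mp : planar (fun z : R[i] => (normc z `^ p)%R).
  by apply: (measurableT_comp (@measurable_powR R p)); exact: (@planar_normc R).
rewrite /body_integral -ge0_integralZl//; last 3 first.
- exact: (measurable_body_integrand u mp).
- by move=> t _; rewrite lee_fin mulr_ge0// powR_ge0.
- by rewrite lee_fin powR_ge0.
apply: eq_integral => t _; rewrite -EFinM hdotZr normcM powRM ?normc_ge0//.
by rewrite mulrCA.
Qed.

End body_functional.

(** * Continuity of the body integral *)

Section body_continuity.
Context (R : realType) (n : nat).
Local Notation Cn := 'rV[R[i]]_n.
Local Notation mR := (measurableTypeR R).
Local Notation lam := (@lebesgue_measure R).
Variables (K : set Cn) (M d : R).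
Hypothesis hK : round_body K M d.

Let K' := @cplx R n @^-1` K.
Local Notation lN := (power_measure lam (n + n)).

Let planar_pow (p : R) : planar (fun z : R[i] => (normc z `^ p)%R).
Proof. by apply: (measurableT_comp (@measurable_powR R p)); exact: (@planar_normc R). Qed.

Lemma hdot_le (w x : Cn) (a b : R) : 0 <= b -> \sum_j normc (w 0 j) <= a -> (forall j, normc (x 0 j) <= b) ->
  normc (hdot w x) <= a * b.
Proof.
move=> b0 wa xb; apply: (@le_trans _ _ (\sum_j normc (w 0 j) * normc (x 0 j))).
  rewrite /hdot; elim/big_ind2: _ => [||j _].
  - by rewrite normc0.
  - by move=> y c y' c' h1 h2; apply: le_trans (normc_leD _ _) (lerD h1 h2).
  - by rewrite normcM normc_conj.
apply: (@le_trans _ _ (\sum_j normc (w 0 j) * b)).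
  by apply: ler_sum => j _; rewrite ler_wpM2l ?normc_ge0.
by rewrite -mulr_suml ler_wpM2r.
Qed.

(** Dividing x + <w,x> u by 1 + eta gives a convex combination of x and (1/eta) <w,x> u, and the
    latter lies in the inner ball. *)
Lemma body_shear (w u : Cn) (eta : R) : 0 < eta ->
  (forall x j, K x -> normc (hdot w x * u 0 j) <= eta * d) ->
  forall x, K x -> K ((1 + eta)^-1%:C *: (x + hdot w x *: u)).
Proof.
move=> e0 hw x Kx; have e1 : 0 < 1 + eta by rewrite addr_gt0.
pose t := (1 + eta)^-1; have t01 : 0 < t < 1 by rewrite invr_gt0 e1 invf_lt1// ltrDl.
pose y := eta^-1%:C *: (hdot w x *: u).
have Ky : K y.
  apply: (rb_inner hK) => j; rewrite !mxE normcM normc_real gtr0_norm ?invr_gt0//.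
  by rewrite ler_pdivrMl//; exact: hw.
have := rb_conv hK t01 Kx Ky; congr K.
rewrite scalerDr /y scalerA -rmorphM; congr (_ + _%:C *: _).
rewrite /t; field; rewrite gt_eqF//=; exact: lt0r_neq0.
Qed.

(** Moving the vector from u to u + |u|^2 w has the effect of the rank-one shear x -> x + <w,x> u on
    the body, since <x + <w,x> u, u> = <x, u + |u|^2 w>. The shear maps K into (1 + eta) K, so the
    two integrals are compared by inclusion and scaling, with no limit taken under a singular
    integrand. *)
Lemma body_integral_shear (p : R) (w u : Cn) (eta : R) : 0 < eta -> 1 + hdot w u != 0 ->
  (forall x j, K x -> normc (hdot w x * u 0 j) <= eta * d) ->
  (forall x j, K x -> normc (hdot ((conjc (- (1 + hdot w u)^-1)) *: w) x * u 0 j) <= eta * d) ->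
  (body_integral K (fun z => (normc z `^ p)%R) (u + (hnorm2 u)%:C *: w) <=
   ((1 + eta) ^+ (n + n) * ((1 + eta) ^+ (n + n) * (1 + eta) `^ p))%:E *
   body_integral K (fun z => (normc z `^ p)%R) u)%E.
Proof.
move=> e0 wu0 S1 S2; have e1 : 0 < 1 + eta by rewrite addr_gt0.
(* The Sherman-Morrison formula: the inverse of the shear along w is the shear along this multiple
   of w. *)
set w' := _ *: w in S2.
have ex (s : Cn) : exists J : 'M[R]_(n + n), forall x, x *m J = realify (cplx x + hdot s (cplx x) *: u).
  apply: linear_matrix => [x y|c x].
    by rewrite -realifyD cplxD hdotDr scalerDl addrACA.
  by rewrite cplxZ hdotZr -scalerA -scalerDr realifyZ.
have [J JE] := ex w; have [J' JE'] := ex w'.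
have w'E x : hdot w' x = - (1 + hdot w u)^-1 * hdot w x by rewrite hdotZl conjcK.
have JJ' : J *m J' = 1%:M.
  apply: mulmx_ext => x; rewrite mulmxA JE' JE mulmx1 realifyK -[RHS]cplxK; congr realify.
  rewrite -addrA -scalerDl !w'E hdotDr hdotZr.
  move: (hdot w (cplx x)) (hdot w u) wu0 => a b ab.
  have -> : a + - (1 + b)^-1 * (a + a * b) = 0 by field.
  by rewrite scale0r addr0.
have J'J : J' *m J = 1%:M.
  apply: mulmx_ext => x; rewrite mulmxA JE JE' mulmx1 realifyK -[RHS]cplxK; congr realify.
  rewrite -addrA -scalerDl hdotDr hdotZr !w'E.
  move: (hdot w (cplx x)) (hdot w u) wu0 => a b ab.
  have -> : - (1 + b)^-1 * a + (a + - (1 + b)^-1 * a * b) = 0 by field.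
  by rewrite scale0r addr0.
have [c c0 cE] := linear_transfer JJ' J'J.
have mB := measurable_body hK.
pose r := (1 + eta)^-1; have r0 : 0 < r by rewrite invr_gt0.
have mKr (s : R) : measurable_fun setT (fun t : (n + n).-tuple mR => \1_K' (s *: row_of t) : R).
  rewrite (_ : (fun t => _) = (fun t : (n + n).-tuple mR => \1_K' (row_of t) : R) \o (fun t => tuple_scale s t)).
    by apply: measurableT_comp; [exact: (measurable_body_indic hK)|exact: measurable_tuple_scale].
  by apply/funext => t /=; rewrite row_of_scale.
have scaleE (g : 'rV[R]_(n + n) -> \bar R) : measurable_fun setT (fun t : (n + n).-tuple mR => g (row_of t)) ->
   (forall x, 0 <= g x)%E ->
   (\int[lN]_t g (row_of t) = ((1 + eta) ^+ (n + n))%:E * \int[lN]_t g ((1 + eta) *: row_of t))%E.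
  move=> mg g0; rewrite (integral_tuple_scale e1 mg)//; congr (_ * _)%E.
  by apply: eq_integral => t _; rewrite row_of_scale.
have rK x : r *: ((1 + eta) *: x) = x :> 'rV[R]_(n + n).
  by rewrite scalerA mulVf ?scale1r// gt_eqF.
(* The inverse shear also maps K into (1 + eta) K. Comparing volumes bounds the transfer constant c
   below by (1 + eta)^(-2n). *)
have vol_le : (lN (@row_of R (n + n) @^-1` K') <=
    (c * (1 + eta) ^+ (n + n))%:E * lN (@row_of R (n + n) @^-1` K'))%E.
  rewrite {1}(measure_int_indic _ mB) (cE (fun x => (\1_K' x)%:E)); last 2 first.
  - by apply/measurable_EFinP; exact: (measurable_body_indic hK).
  - by move=> x; rewrite lee_fin.
  rewrite EFinM -muleA; apply: lee_wpmul2l; first by rewrite lee_fin ltW.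
  apply: (@le_trans _ _ (\int[lN]_t (\1_K' (r *: row_of t))%:E)%E); last first.
    rewrite (scaleE (fun x => (\1_K' (r *: x))%:E)); last 2 first.
    - by apply/measurable_EFinP; exact: mKr.
    - by move=> x; rewrite lee_fin.
    rewrite lee_wpmul2l// ?lee_fin ?exprn_ge0 ?(ltW e1)// (measure_int_indic _ mB).
    have E : (\int[lN]_t (\1_K' (r *: ((1 + eta) *: row_of t)))%:E = \int[lN]_t (\1_K' (row_of t))%:E)%E.
      by apply: eq_integral => t _; rewrite rK.
    by rewrite E.
  apply: ge0_le_integral => //.
  - apply/measurable_EFinP.
    rewrite (_ : (fun t => _) = (fun t : (n + n).-tuple mR => \1_K' (row_of t) : R) \o (fun t => tuple_of (row_of t *m J))).
      apply: measurableT_comp; first exact: (measurable_body_indic hK).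
      by apply: measurable_tuple_of => i; apply: measurable_row_mulmx => j; apply: measurable_row_of; exact: measurable_id.
    by apply/funext => t /=; rewrite tuple_ofK.
  - by apply/measurable_EFinP; exact: mKr.
  - move=> t _; rewrite lee_fin.
    have [h|h] := pselect (K' (row_of t *m J)); last by rewrite indic_notin.
    rewrite !indic_in//; rewrite /K' /= cplxZ.
    have := body_shear e0 S2 h; congr (K (_ *: _)).
    have E : row_of t *m J *m J' = row_of t by rewrite -mulmxA JJ' mulmx1.
    by rewrite -[in RHS]E JE' realifyK.
have c1 : 1 <= c * (1 + eta) ^+ (n + n).
  have /andP[v0 voo] := body_volume hK.
  have vf : lN (@row_of R (n + n) @^-1` K') \is a fin_num by rewrite ge0_fin_numE// ltW.
  have vp : 0 < fine (lN (@row_of R (n + n) @^-1` K')) by rewrite fine_gt0// v0.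
  move: vol_le; rewrite -(fineK vf) -EFinM lee_fin -[leLHS]mul1r.
  by rewrite ler_pM2r.
pose g (x : 'rV[R]_(n + n)) := (\1_K' (r *: x) * normc (hdot (cplx x) u) `^ p)%:E.
have mg : measurable_fun setT (fun t : (n + n).-tuple mR => g (row_of t)).
  apply/measurable_EFinP; apply: measurable_funM; first exact: mKr.
  exact: (planar_comp (planar_pow p) (cmeas_hdot u)).
have g0 x : (0 <= g x)%E by rewrite lee_fin mulr_ge0// powR_ge0.
have step1 : (body_integral K (fun z => (normc z `^ p)%R) (u + (hnorm2 u)%:C *: w) <=
    \int[lN]_t g (row_of t *m J))%E.
  apply: ge0_le_integral => //.
  - by move=> t _; rewrite lee_fin mulr_ge0// powR_ge0.
  - exact: (measurable_body_integrand hK _ (planar_pow p)).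
  - rewrite (_ : (fun t => _) = (fun t : (n + n).-tuple mR => g (row_of t)) \o (fun t => tuple_of (row_of t *m J))).
      apply: measurableT_comp => //.
      by apply: measurable_tuple_of => i; apply: measurable_row_mulmx => j; apply: measurable_row_of; exact: measurable_id.
    by apply/funext => t /=; rewrite tuple_ofK.
  - move=> t _; rewrite /g lee_fin JE realifyK of_coordsE.
    have -> : hdot (cplx (row_of t) + hdot w (cplx (row_of t)) *: u) u =
       hdot (cplx (row_of t)) (u + (hnorm2 u)%:C *: w).
      by rewrite hdotDl hdotDr hdotZl hdotZr hnorm2E -hdotC mulrC.
    apply: ler_wpM2r; first exact: powR_ge0.
    have [h|h] := pselect (K (cplx (row_of t))); last by rewrite indic_notin.
    rewrite !indic_in//; rewrite /K' /= cplxZ realifyK.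
    exact: body_shear e0 S1 _ h.
apply: (le_trans step1).
have gE : (\int[lN]_t g (row_of t) = ((1 + eta) ^+ (n + n) * (1 + eta) `^ p)%:E *
    body_integral K (fun z => (normc z `^ p)%R) u)%E.
  rewrite (scaleE g mg g0) EFinM -muleA.
  suff -> : (\int[lN]_t g ((1 + eta) *: row_of t) = ((1 + eta) `^ p)%:E *
      body_integral K (fun z => (normc z `^ p)%R) u)%E by [].
  have pe : (0 <= ((1 + eta) `^ p)%:E :> \bar R)%E by rewrite lee_fin powR_ge0.
  rewrite /body_integral -(ge0_integralZl _ measurableT (measurable_body_integrand hK u (planar_pow p)) _ pe); last first.
    by move=> t _; rewrite lee_fin mulr_ge0// powR_ge0.
  apply: eq_integral => t _; rewrite /g rK cplxZ hdotZl conj_real normcM normc_real gtr0_norm//.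
  by rewrite powRM ?(ltW e1) ?normc_ge0// -EFinM mulrCA of_coordsE.
have F0 : (0 <= body_integral K (fun z => (normc z `^ p)%R) u)%E.
  by apply: body_integral_ge0 => z; exact: powR_ge0.
have gJ : (\int[lN]_t g (row_of t *m J) = (c^-1)%:E * \int[lN]_t g (row_of t))%E.
  by rewrite (cE g mg g0) muleA -EFinM mulVf ?mul1e// gt_eqF.
rewrite gJ gE muleA -EFinM; apply: lee_wpmul2r => //.
rewrite lee_fin ler_wpM2r//; first by rewrite mulr_ge0 ?exprn_ge0 ?powR_ge0// ltW.
by rewrite -[leLHS]mul1r ler_pdivrMr// mulrC.
Qed.

Let Fp (p : R) (u : Cn) := body_integral K (fun z => (normc z `^ p)%R) u.

(** For v' near v the vector w = (v' - v)/|v|^2 is small and v' = v + |v|^2 w, so the shear estimate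
    compares the values at v and v'. It is used in both directions, from u to u' and back. *)
Lemma body_integral_near (p : R) (u : Cn) (eta : R) : u != 0 -> 0 < eta ->
  exists2 rho : R, 0 < rho & forall u' : Cn, (forall j, normc (u' 0 j - u 0 j) < rho) ->
  let c := (1 + eta) ^+ (n + n) * ((1 + eta) ^+ (n + n) * (1 + eta) `^ p) in
  (Fp p u' <= c%:E * Fp p u)%E /\ (Fp p u <= c%:E * Fp p u')%E.
Proof.
move=> u0 e0.
have [j0 uj0] : exists j, u 0 j != 0.
  by have /rV0Pn[j] := u0; exists j.
pose m := normc (u 0 j0); have m0 : 0 < m by rewrite normc_gt0.
pose U := 1 + \sum_j normc (u 0 j).
have sum0 : 0 <= \sum_j normc (u 0 j) by apply: sumr_ge0 => j _; exact: normc_ge0.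
have U1 : 1 <= U by rewrite lerDl.
have U0 : 0 < U by apply: lt_le_trans U1.
have n0 : (0 : R) < n.+1%:R by rewrite ltr0n.
have dd := rb_d0 hK; have MM := rb_M0 hK; have M1 : 0 < M + 1 by rewrite ltr_wpDl.
(* The admissible size of w. From a U <= 1/2 follows |1 + <w,v>| >= 1/2, so the inverse shear is at
   most twice as large as the shear, and 2 a M U <= eta d is then the hypothesis for both. *)
pose a := Num.min (2 * U)^-1 (eta * d / (2 * (M + 1) * U)).
have a0 : 0 < a.
  by rewrite lt_min; apply/andP; split; rewrite ?invr_gt0; repeat (apply: divr_gt0 || apply: mulr_gt0).
have aU : a * U <= 2^-1.
  rewrite -ler_pdivlMr// /a ge_min; apply/orP; left.
  by rewrite invfM.
have aM : 2 * (a * M) * U <= eta * d.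
  apply: (@le_trans _ _ (a * (2 * (M + 1) * U))).
    by rewrite (_ : _ * U = a * (2 * M * U)); [rewrite ler_wpM2l ?(ltW a0)// ler_wpM2r ?(ltW U0)// ler_wpM2l// lerDl|ring].
  by rewrite -ler_pdivlMr ?mulr_gt0// /a ge_min lexx orbT.
(* The first two bounds ensure that u' keeps its coordinate j0 above m/2 and its norm below U; the
   last one, as |v|^2 >= m^2/4, makes w of size at most a. *)
pose rho := Num.min (Num.min (m / 2) n.+1%:R^-1) (a * (m ^+ 2 / 4) / n.+1%:R).
have rho0 : 0 < rho.
  by rewrite !lt_min; apply/andP; split; [apply/andP; split|]; rewrite ?invr_gt0//; repeat (apply: divr_gt0 || apply: mulr_gt0 || apply: exprn_gt0).
exists rho => // u' ud c.
have sumd (v v' : Cn) : (forall j, normc (v' 0 j - v 0 j) < rho) ->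
    \sum_j normc (v' 0 j - v 0 j) <= n.+1%:R * rho.
  move=> h; apply: (@le_trans _ _ (\sum_(j < n) rho)); first by apply: ler_sum => j _; rewrite ltW.
  by rewrite big_const_ord iter_addr addr0 -(mulr_natl rho n) ler_wpM2r ?(ltW rho0)// ler_nat.
(* These hypotheses on v hold for u and for u' alike, so one inequality gives both. *)
have main (v v' : Cn) : m / 2 <= normc (v 0 j0) -> (forall j, normc (v' 0 j - v 0 j) < rho) ->
    (\sum_j normc (v 0 j) <= U) -> (Fp p v' <= c%:E * Fp p v)%E.
  move=> vj vd vU.
  have vU' j : normc (v 0 j) <= U.
    by apply: le_trans vU; rewrite (bigD1 j)//= lerDl sumr_ge0// => i _; exact: normc_ge0.
  have hv : m ^+ 2 / 4 <= hnorm2 v.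
    rewrite hnorm2_sum (bigD1 j0)//= -[leLHS]addr0 lerD ?sumr_ge0//; last by move=> j _; rewrite sqr_ge0.
    rewrite (_ : m ^+ 2 / 4 = (m / 2) ^+ 2); last by field.
    by rewrite ler_pXn2r ?nnegrE ?normc_ge0 ?divr_ge0 ?(ltW m0).
  have hv0 : 0 < hnorm2 v by apply: lt_le_trans hv; rewrite divr_gt0// exprn_gt0.
  pose w := (hnorm2 v)^-1%:C *: (v' - v).
  have wa : \sum_j normc (w 0 j) <= a.
    rewrite (eq_bigr (fun j => (hnorm2 v)^-1 * normc (v' 0 j - v 0 j))); last first.
      by move=> j _; rewrite !mxE normcM normc_real gtr0_norm ?invr_gt0.
    rewrite -mulr_sumr ler_pdivrMl//; apply: (le_trans (sumd _ _ vd)).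
    apply: (@le_trans _ _ (m ^+ 2 / 4 * a)); last by rewrite ler_wpM2r// ltW.
    by rewrite [leRHS]mulrC [leLHS]mulrC -ler_pdivlMr// /rho ge_min lexx orbT.
  have wv : normc (hdot w v) <= 2^-1.
    by apply: le_trans aU; apply: hdot_le => //; exact: ltW.
  have wx x : K x -> normc (hdot w x) <= a * M.
    by move=> Kx; apply: hdot_le => // j; exact: (rb_bound hK).
  have n1 : 2^-1 <= normc (1 + hdot w v).
    have := normc_leD (1 + hdot w v) (- hdot w v); rewrite addrK normc1 normc_opp.
    by move=> h; lra.
  have wv0 : 1 + hdot w v != 0 by rewrite -normc_gt0; apply: lt_le_trans n1; rewrite invr_gt0.
  have v'E : v' = v + (hnorm2 v)%:C *: w.
    by rewrite /w scalerA -rmorphM mulfV ?gt_eqF// rmorph1 scale1r addrC subrK.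
  rewrite v'E; apply: body_integral_shear => // x j Kx; rewrite normcM.
    apply: (le_trans (ler_pM (normc_ge0 _) (normc_ge0 _) (wx x Kx) (vU' j))).
    apply: le_trans aM; rewrite ler_wpM2r ?(ltW U0)// ler_peMl ?mulr_ge0 ?(ltW a0)//.
    by rewrite ler1n.
  rewrite hdotZl conjcK normcM normc_opp normcV.
  have inv2 : (normc (1 + hdot w v))^-1 <= 2.
    by rewrite -(invrK 2) lef_pV2 ?posrE ?invr_gt0//; apply: lt_le_trans n1; rewrite invr_gt0.
  apply: le_trans aM; apply: ler_pM; rewrite ?mulr_ge0 ?invr_ge0 ?normc_ge0//.
  by apply: ler_pM; rewrite ?normc_ge0 ?invr_ge0 ?normc_ge0//; exact: wx.
have rho1 : rho <= m / 2 by rewrite /rho !ge_min lexx.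
have rho2 : n.+1%:R * rho <= 1.
  by rewrite mulrC -ler_pdivlMr// mul1r /rho !ge_min lexx orbT.
split; apply: main => //.
- by rewrite -/m; lra.
- by rewrite lerDr.
- have := normc_leB (u' 0 j0) (u 0 j0); have := ud j0 => h1 h2.
  have : `|normc (u' 0 j0) - m| <= m / 2 by apply: (le_trans h2); apply: le_trans rho1; exact: ltW.
  by rewrite ler_norml => /andP[h3 _]; lra.
- by move=> j; rewrite -normc_opp opprB.
- have : \sum_j normc (u' 0 j) <= \sum_j (normc (u' 0 j - u 0 j) + normc (u 0 j)).
    by apply: ler_sum => j _; rewrite -{1}(subrK (u 0 j) (u' 0 j)) normc_leD.
  rewrite big_split /= => h; apply: (le_trans h); rewrite /U lerD2r.
  exact: le_trans (sumd _ _ ud) rho2.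
Qed.

End body_continuity.

Section power_integrability.
Context (R : realType).
Local Notation mR := (measurableTypeR R).
Local Notation lam := (@lebesgue_measure R).

Lemma lam_ball_lty (S : R) : (lam [set x : mR | (`|x| <= S)%R] < +oo)%E.
Proof.
apply: (@le_lt_trans _ _ (lam (`[- S, S]%classic : set mR))).
  apply: le_measure; rewrite ?inE.
  - rewrite (_ : [set x | _] = `[- S, S]%classic); first exact: measurable_itv.
    by apply/seteqP; split => x /=; rewrite in_itv /= ler_norml.
  - exact: measurable_itv.
  - by move=> x /=; rewrite in_itv /= ler_norml.
rewrite [X in (X < _)%E](@lebesgue_measure_itv R `[- S, S])/=.
by case: ifP => _; rewrite ?ltry// -EFinN -EFinD ltry.
Qed.

Lemma powR_half_lt1 (q : R) : 0 < q -> 2^-1 `^ q < 1.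
Proof.
move=> q0; have E : 1 `^ q = 1 :> R by rewrite powR1.
rewrite -[ltRHS]E; apply: gt0_ltr_powR => //; rewrite ?nnegrE ?invr_ge0//.
by rewrite invf_lt1// ltr1n.
Qed.

(** Halving x multiplies length by 1/2 and |x|^p by (1/2)^p, and the product is below 1 exactly for
    p > -1. In the plane area is multiplied by 1/4, and the threshold becomes -2. *)
Lemma line_power_integrable (p S : R) : -1 < p -> p < 0 -> 0 < S ->
  (\int[lam]_x (\1_[set x : mR | (`|x| <= S)%R] x * `|x| `^ p)%:E < +oo)%E.
Proof.
move=> p1 p0 S0.
have half0 : (2^-1 : R) != 0 by rewrite invr_neq0.
apply: (@power_singularity_integrable _ _ R lam (fun x : mR => `|x : R|) (fun x : mR => (2^-1 * x : R) : mR) 2^-1) => //.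
- exact: (@normr_measurable R setT).
- by move=> x; rewrite normrM gtr0_norm// invr_gt0.
- by move=> h mh h0; rewrite (lebesgue_integral_scale half0 mh h0) gtr0_norm// invr_gt0.
- rewrite -[X in X * _]powRr1 ?invr_ge0// -powRD; last by rewrite half0 implybT.
  by apply: powR_half_lt1; lra.
- exact: lam_ball_lty.
Qed.

Lemma measurable_disc (S : R) : measurable [set z : mR * mR | normc (toC z) <= S].
Proof.
rewrite -[X in measurable X]setTI (_ : [set x | _] = (fun z : mR * mR => normc (toC z)) @^-1` `]-oo, S]%classic).
  by apply: (@planar_normc R) => //; exact: measurable_itv.
by apply/seteqP; split => x /=; rewrite in_itv.
Qed.

Lemma lam2_disc_lty (S : R) : (lam2 R [set z : mR * mR | (normc (toC z) <= S)%R] < +oo)%E.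
Proof.
have mB : measurable [set x : mR | (`|x| <= S)%R].
  rewrite (_ : [set x | _] = `[- S, S]%classic); first exact: measurable_itv.
  by apply/seteqP; split => x /=; rewrite in_itv /= ler_norml.
apply: (@le_lt_trans _ _ (lam2 R ([set x : mR | (`|x| <= S)%R] `*` [set x : mR | (`|x| <= S)%R]))).
  apply: le_measure; rewrite ?inE.
  - exact: measurable_disc.
  - exact: measurableX.
  - move=> [a b] /= h; split => /=; apply: le_trans h.
      exact: Re_le_normc (a +i* b).
    exact: Im_le_normc (a +i* b).
rewrite /lam2 /= /sprod product_measure1E//.
by rewrite lte_mul_pinfty ?lam_ball_lty// ge0_fin_numE// lam_ball_lty.
Qed.

Lemma disc_power_integrable (p S : R) : -2 < p -> p < 0 -> 0 < S ->
  (\int[lam2 R]_z (\1_[set z : mR * mR | (normc (toC z) <= S)%R] z * normc (toC z) `^ p)%:E < +oo)%E.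
Proof.
move=> p1 p0 S0.
have half0 : (2^-1 : R) != 0 by rewrite invr_neq0.
have half0' : ((2^-1)%:C : R[i]) != 0 by rewrite -(rmorph0 (real_complex R)) (inj_eq (@complexI R)).
apply: (@power_singularity_integrable _ _ R (lam2 R) (fun z => normc (toC z)) (fun z => ofC ((2^-1)%:C * toC z)) (2^-1 ^+ 2)) => //.
- exact: planar_normc.
- by move=> z; exact: normc_ge0.
- by move=> z; rewrite ofCK normcM normc_real gtr0_norm// invr_gt0.
- move=> h mh h0; pose g z := h (ofC z).
  have mg : planar g.
    rewrite /planar; have -> : g \o @toC R = h by apply/funext => z; rewrite /g /= toCK.
    exact: mh.
  have := planar_mul half0' mg (fun z => h0 _); rewrite normc_real gtr0_norm ?invr_gt0// => E.
  by rewrite -E; apply: eq_integral => z _; rewrite /g toCK.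
- rewrite -powR_mulrn ?invr_ge0// -powRD; last by rewrite half0 implybT.
  by apply: powR_half_lt1; lra.
- exact: lam2_disc_lty.
Qed.

Lemma strip_power_integrable (p S : R) : -1 < p -> p < 0 -> 0 < S ->
  (\int[lam2 R]_z (\1_[set z : mR * mR | (normc (toC z) <= S)%R] z * `|complex.Re (toC z)| `^ p)%:E < +oo)%E.
Proof.
move=> p1 p0 S0.
pose B : set mR := [set x : mR | (`|x| <= S)%R].
have mB : measurable B.
  rewrite (_ : B = `[- S, S]%classic); first exact: measurable_itv.
  by apply/seteqP; split => x /=; rewrite /B/= in_itv /= ler_norml.
have mp : measurable_fun setT (fun x : mR => `|x| `^ p).
  by apply: (measurableT_comp (@measurable_powR R p)); exact: (@normr_measurable R setT).
pose k (x : mR) : R := \1_B x * `|x| `^ p.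
have mk : measurable_fun setT k by apply: measurable_funM => //; exact: measurable_indic.
have k0 x : 0 <= k x by rewrite mulr_ge0// powR_ge0.
pose g (z : mR * mR) : \bar R := (k z.1 * \1_B z.2)%:E.
have mg : measurable_fun setT g.
  apply/measurable_EFinP; apply: measurable_funM.
    exact: (measurableT_comp mk measurable_fst).
  by apply: (measurableT_comp (f := \1_B : mR -> R)) => //; exact: measurable_indic.
have g0 z : (0 <= g z)%E by rewrite lee_fin mulr_ge0.
apply: (@le_lt_trans _ _ (\int[lam2 R]_z g z)%E).
  apply: ge0_le_integral.
  - exact: measurableT.
  - by move=> z _; rewrite lee_fin mulr_ge0// powR_ge0.
  - apply/measurable_EFinP; apply: measurable_funM; first exact: (@measurable_indic _ _ R setT _ (measurable_disc S)).
    exact: (measurableT_comp mp measurable_fst).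
  - exact: mg.
  - move=> [a b] _; rewrite lee_fin /g /k /= mulrAC ler_wpM2r ?powR_ge0//.
    have [h|h] := pselect (normc (toC (a, b)) <= S); last by rewrite [leLHS]indic_notin// mulr_ge0.
    rewrite !indic_in ?mulr1//.
      by apply: le_trans h; exact: Im_le_normc (a +i* b).
    by apply: le_trans h; exact: Re_le_normc (a +i* b).
rewrite lam2E//; have I1 := line_power_integrable p1 p0 S0.
have vB := lam_ball_lty S.
rewrite (eq_integral (fun x => lam B * (k x)%:E)%E); last first.
  move=> x _; rewrite /g /= (measure_int_indic lam mB) muleC -ge0_integralZl//.
  - exact: measurable_indicE.
  - by rewrite lee_fin.
have mkE : measurable_fun setT (fun x => (k x)%:E) by exact/measurable_EFinP.
have k0E x : setT x -> (0 <= (k x)%:E)%E by rewrite lee_fin.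
rewrite (ge0_integralZl _ measurableT mkE k0E)//.
by rewrite lte_mul_pinfty// ge0_fin_numE.
Qed.

End power_integrability.

Section body_finiteness.
Context (R : realType) (n : nat).
Local Notation Cn := 'rV[R[i]]_n.
Local Notation mR := (measurableTypeR R).
Local Notation lam := (@lebesgue_measure R).
Local Notation tau := (2 * pi : R).
Variables (K : set Cn) (M d : R).
Hypothesis hK : round_body K M d.

Let K' := @cplx R n @^-1` K.
Local Notation lN := (power_measure lam (n + n)).

(** The distribution of <x,u> for x in K has bounded support and a density bounded by a multiple of
    the largest fibre volume, so integrability is decided in the plane. *)
Lemma body_integral_le_planar (u : Cn) : u != 0 -> exists B S : R, [/\ 0 <= B, 0 < S &
  forall h : R[i] -> R, planar h -> (forall z, 0 <= h z) ->
  (body_integral K h u <= B%:E * \int[lam2 R]_z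
     (\1_[set z : mR * mR | (normc (toC z) <= S)%R] z * h (toC z))%:E)%E].
Proof.
move=> u0; pose v := - 'i *: u.
have v0 : v != 0 by rewrite scaler_eq0 negb_or u0 oppr_eq0 neq0Ci.
have ReN z : complex.Re (- 'i * z) = complex.Im z :> R by case: z => a b /=; ring.
have uv : complex.Re (hdot u v) = 0 by rewrite hdotZr ReN hnorm2E.
have [A [Q [AQ QE]]] := real_frame u0 v0 uv.
have [m [B [P [BQ AP BP QAPB]]]] := frame_complement AQ.
have cK' (t : R) x y : 0 < t < 1 -> K' x -> K' y -> K' (t *: x + (1 - t) *: y).
  by move=> t01 Kx Ky; rewrite /K' /= cplxD !cplxZ; exact: (rb_conv hK).
have bK' x i : K' x -> `|x 0 i| <= M.
  move=> Kx; case: (split_ordP i) => j ->.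
    by apply: le_trans (rb_bound hK j Kx); rewrite mxE; exact: Re_le_normc (_ +i* _).
  by apply: le_trans (rb_bound hK j Kx); rewrite mxE; exact: Im_le_normc (_ +i* _).
have [C C0 CE] := fibre_integral AQ BQ AP BP QAPB (rb_meas hK) cK' (rb_M0 hK) bK'.
have fB := fibre_volume_bound AP BP (rb_meas hK) cK' (rb_M0 hK) bK'.
have mf2 := measurable_fibre_volume A B (rb_meas hK).
set b := (2 * _) ^+ m in fB.
have b0 : 0 <= b by have /andP[h1 h2] := fB 0; exact: le_trans h2.
pose S := 1 + M * \sum_j normc (u 0 j).
have S0 : 0 < S by rewrite ltr_wpDr// mulr_ge0 ?(rb_M0 hK)// sumr_ge0// => j _; exact: normc_ge0.
exists (C * b), S; split; [by rewrite mulr_ge0// ltW|exact: S0|].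
move=> h mh h0.
pose D := [set z : mR * mR | normc (toC z) <= S].
pose g (x : 'rV[R]_2) := \1_D (x 0 0, x 0 1) * h (toC (x 0 0, x 0 1)).
have mD : measurable D := measurable_disc S.
have mgD : measurable_fun setT (fun z : mR * mR => \1_D z * h (toC z)).
  by apply: measurable_funM => //; exact: measurable_indic.
have mc i : measurable_fun setT (fun t : 2.-tuple mR => row_of t 0 i).
  by apply: measurable_row_of; exact: measurable_id.
have mg : measurable_fun setT (fun t : 2.-tuple mR => g (row_of t)).
  exact: (measurableT_comp mgD (measurable_fun_pair (mc 0) (mc 1))).
have g0 x : 0 <= g x by rewrite mulr_ge0.
have -> : (body_integral K h u = \int[lN]_t (\1_K' (row_of t) * g (row_of t *m Q))%:E)%E.
  apply: eq_integral => t _; rewrite of_coordsE; congr _%:E.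
  have [Kt|Kt] := pselect (K (cplx (row_of t))); last by rewrite !indic_notin// !mul0r.
  rewrite /g QE !mxE /= hdotZr ReN.
  have -> : toC (complex.Re (hdot (cplx (row_of t)) u) : mR, complex.Im (hdot (cplx (row_of t)) u) : mR) = hdot (cplx (row_of t)) u.
    exact: ofCK.
  rewrite (@indic_in _ R D); first by rewrite mul1r.
  suff: normc (toC (ofC (hdot (cplx (row_of t)) u))) <= S by [].
  rewrite ofCK; apply: le_trans (hdot_bound hK u Kt) _.
  by rewrite lerDr.
rewrite CE// EFinM -muleA; apply: lee_wpmul2l; first by rewrite lee_fin ltW.
have -> : (\int[lam2 R]_z (\1_D z * h (toC z))%:E = \int[power_measure lam 2]_t (g (row_of t))%:E)%E.
  rewrite (integral_rvec (g := fun x => (g x)%:E)); last 2 first.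
  - exact/measurable_EFinP.
  - by move=> x; rewrite lee_fin.
  rewrite lam2E; last 2 first.
  - exact/measurable_EFinP.
  - by move=> z; rewrite lee_fin mulr_ge0.
  by apply: eq_integral => a _; apply: eq_integral => a' _; rewrite /g !mxE.
have mgE : measurable_fun setT (fun t : 2.-tuple mR => (g (row_of t))%:E) by exact/measurable_EFinP.
have g0E (t : 2.-tuple mR) : setT t -> (0 <= (g (row_of t))%:E)%E by rewrite lee_fin.
have b0E : (0 <= b%:E)%E by rewrite lee_fin.
rewrite -(ge0_integralZl _ measurableT mgE g0E b0E).
apply: ge0_le_integral.
- exact: measurableT.
- by move=> x _; rewrite lee_fin mulr_ge0//; case/andP: (fB (row_of x)).
- by apply/measurable_EFinP; exact: measurable_funM.
- by apply/measurable_EFinP; apply: measurable_funM => //; exact: measurable_cst.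
- by move=> x _; rewrite -EFinM lee_fin mulrC ler_wpM2r//; case/andP: (fB (row_of x)).
Qed.

Let planar_pow (p : R) : planar (fun z : R[i] => (normc z `^ p)%R).
Proof. by apply: (measurableT_comp (@measurable_powR R p)); exact: (@planar_normc R). Qed.

Lemma planar_Re_pow (p : R) : planar (fun z : R[i] => (`|complex.Re z| `^ p)%R).
Proof.
apply: (measurableT_comp (@measurable_powR R p)).
apply: (measurableT_comp (@normr_measurable R setT)); exact: measurable_fst.
Qed.

Lemma body_integral_lty (p : R) (u : Cn) : -2 < p -> p != 0 -> u != 0 ->
  (body_integral K (fun z => (normc z `^ p)%R) u < +oo)%E.
Proof.
move=> p2 p00 u0; have [p0|p0] := ltP p 0.
  have [B [S [B0 S0 BE]]] := body_integral_le_planar u0.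
  apply: le_lt_trans (BE _ (planar_pow p) _) _; first by move=> z; exact: powR_ge0.
  by rewrite lte_mul_pinfty// disc_power_integrable.
pose S := M * \sum_j normc (u 0 j).
apply: (body_integral_lty_bounded hK (B := S `^ p) (S := S)) => //.
- by move=> z; exact: powR_ge0.
- move=> z zS; apply: ge0_ler_powR; rewrite ?nnegrE ?normc_ge0//.
  exact: le_trans (normc_ge0 _) zS.
Qed.

Lemma body_integral_Re_lty (p : R) (u : Cn) : -1 < p -> p != 0 -> u != 0 ->
  (body_integral K (fun z => (`|complex.Re z| `^ p)%R) u < +oo)%E.
Proof.
move=> p1 p00 u0; have [p0|p0] := ltP p 0.
  have [B [S [B0 S0 BE]]] := body_integral_le_planar u0.
  apply: le_lt_trans (BE _ (planar_Re_pow p) _) _; first by move=> z; exact: powR_ge0.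
  by rewrite lte_mul_pinfty// strip_power_integrable.
pose S := M * \sum_j normc (u 0 j).
apply: (body_integral_lty_bounded hK (B := S `^ p) (S := S) (planar_Re_pow p)) => [z||z zS]; first exact: powR_ge0.
  by [].
have zS' := le_trans (Re_le_normc z) zS.
apply: ge0_ler_powR; rewrite ?nnegrE//.
exact: le_trans (normr_ge0 _) zS'.
Qed.

Lemma body_integral_pow_gt0 (p : R) (u : Cn) : u != 0 ->
  (0 < body_integral K (fun z => (normc z `^ p)%R) u)%E.
Proof.
move=> u0; apply: (body_integral_gt0 hK u0 (planar_pow p)); first by move=> z; exact: powR_ge0.
(* The two powers serve p >= 0 and p < 0 respectively; the maximum with e keeps the base positive
   whatever S is. *)
move=> e S e0; exists (Num.min (e `^ p) ((Num.max e S) `^ p)).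
  by rewrite lt_min !powR_gt0// lt_max e0.
move=> z ez zS; have ez' : e <= normc z.
  by apply: le_trans (Re_le_normc z); apply: le_trans ez (ler_norm _).
rewrite ge_min; have [p0|p0] := leP 0 p; apply/orP; [left|right].
  by apply: ge0_ler_powR; rewrite ?nnegrE ?normc_ge0 ?(ltW e0).
rewrite -(opprK p) ler_powRN ?oppr_ge0 ?(ltW p0)//; last by rewrite le_max zS orbT.
exact: lt_le_trans ez'.
Qed.

End body_finiteness.

(** * Topology of complex row vectors *)

Section complex_topology.
Context (R : realType).

Lemma sum_fraction_lt n (e : R) : 0 < e -> \sum_(j < n) (e / n.+1%:R) < e.
Proof.
move=> e0; rewrite big_const_ord iter_addr addr0 -(mulr_natl (e / n.+1%:R) n) mulrCA gtr_pMr//.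
by rewrite ltr_pdivrMr// mul1r ltr_nat.
Qed.

Implicit Types z : R[i].

Lemma complex_gt0_real (e : R[i]) : 0 < e -> e = (complex.Re e)%:C /\ 0 < complex.Re e.
Proof. by case: e => a b; rewrite ltcE /= => /andP[/eqP -> ->]. Qed.

Lemma ltr_normc z (e : R) : (`|z| < e%:C) = (normc z < e).
Proof. by rewrite -[`|z|]/((normc z)%:C) ltcR. Qed.

Lemma nbhs_complexP z (A : set R[i]) :
  nbhs z A <-> exists2 e : R, 0 < e & forall z', normc (z' - z) < e -> A z'.
Proof.
split.
  move=> /nbhs_ballP[e /= /complex_gt0_real[eE e0] eA]; exists (complex.Re e) => // z' h.
  by apply: eA; rewrite -ball_normE /= eE ltr_normc -normc_opp opprB.
move=> [e e0 eA]; apply/nbhs_ballP; exists e%:C => /=; first by rewrite ltcR.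
by move=> z'; rewrite -ball_normE /= ltr_normc => h; apply: eA; rewrite -normc_opp opprB.
Qed.

Lemma nbhs_realP (x : R) (A : set R) :
  nbhs x A <-> exists2 e : R, 0 < e & forall y, `|y - x| < e -> A y.
Proof.
split.
  move=> /nbhs_ballP[e /= e0 eA]; exists e => // y h.
  by apply: eA; rewrite -ball_normE /= distrC.
move=> [e e0 eA]; apply/nbhs_ballP; exists e => //=.
by move=> y; rewrite -ball_normE /= => h; apply: eA; rewrite distrC.
Qed.

Lemma nbhs_rowP n (x : 'rV[R[i]]_n) (A : set 'rV[R[i]]_n) :
  nbhs x A <-> exists2 e : R, 0 < e & forall y : 'rV[R[i]]_n, (forall j, normc (y 0 j - x 0 j) < e) -> A y.
Proof.
split.
  move=> /nbhs_ballP[e /= /complex_gt0_real[eE e0] eA]; exists (complex.Re e) => // y h.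
  apply: eA; split => [|i j]; first by rewrite eE ltcR.
  by rewrite ord1 -ball_normE /= eE ltr_normc -normc_opp opprB.
move=> [e e0 eA]; apply/nbhs_ballP; exists e%:C => /=; first by rewrite ltcR.
move=> y [_ h]; apply: eA => j; have := h 0 j.
by rewrite -ball_normE /= ltr_normc -normc_opp opprB.
Qed.

Lemma continuous_at_realP (T : topologicalType) (f : T -> R) x :
  {for x, continuous f} <-> forall e : R, 0 < e -> \forall y \near x, `|f y - f x| < e.
Proof.
split => [cf e e0|cf A /nbhs_realP[e e0 eA]].
  by apply: (cf [set y | `|y - f x| < e]); apply/nbhs_realP; exists e.
by apply: filterS (cf _ e0) => y h; exact: eA.
Qed.

Lemma continuous_normc : continuous (@normc R).
Proof.
move=> z; apply/continuous_at_realP => e e0; apply/nbhs_complexP; exists e => // z' h.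
exact: le_lt_trans (normc_leB _ _) h.
Qed.

Lemma continuous_Re : continuous (@complex.Re R).
Proof.
move=> z; apply/continuous_at_realP => e e0; apply/nbhs_complexP; exists e => // z' h.
by rewrite -raddfB; exact: le_lt_trans (Re_le_normc _) h.
Qed.

Lemma continuous_at_complex (T : topologicalType) (f : T -> R[i]) x :
  {for x, continuous (fun y => complex.Re (f y))} ->
  {for x, continuous (fun y => complex.Im (f y))} -> {for x, continuous f}.
Proof.
move=> /continuous_at_realP cR /continuous_at_realP cI A /nbhs_complexP[e e0 eA].
have e2 : 0 < e / 2 by rewrite divr_gt0.
apply: filterS2 (cR _ e2) (cI _ e2) => y h1 h2; apply: eA.
apply: le_lt_trans (normc_le_sum _) _; rewrite !raddfB /= [ltRHS](splitr e).
exact: ltrD.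
Qed.

Lemma continuous_expi : continuous (@expi R).
Proof.
move=> t; apply: continuous_at_complex; first exact: continuous_cos.
exact: continuous_sin.
Qed.

Lemma compact_disc (r : R) : compact [set z | normc z <= r].
Proof.
have cT : continuous (@toC R : R * R -> R[i]).
  by move=> x; apply: continuous_at_complex; [exact: cvg_fst|exact: cvg_snd].
have cR := continuous_compact (continuous_subspaceT cT)
  (compact_setX (@segment_compact _ (- r) r) (@segment_compact _ (- r) r)).
apply: (subclosed_compact _ cR).
  rewrite (_ : [set _ | _] = @normc R @^-1` [set x | x <= r])//.
  by apply: preimage_closed; [move=> z _; exact: continuous_normc|exact: closed_le].
move=> z zr; exists (ofC z : R * R); last exact: ofCK.
split; rewrite /= in_itv /= -ler_norml; apply: le_trans zr.
  exact: Re_le_normc.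
exact: Im_le_normc.
Qed.

Section rows.
Variable n : nat.
Local Notation Cn := 'rV[R[i]]_n.
Implicit Types x y : Cn.

Lemma compact_polydisc (r : R) : compact [set x : Cn | forall j, normc (x 0 j) <= r].
Proof. exact: (@rV_compact _ n (fun=> [set z | normc z <= r]) (fun=> compact_disc (r := r))). Qed.

Definition norm1c x : R := \sum_j normc (x 0 j).

Lemma norm1c_ge0 x : 0 <= norm1c x.
Proof. by apply: sumr_ge0 => j _; exact: normc_ge0. Qed.

Lemma normc_le_norm1c x j : normc (x 0 j) <= norm1c x.
Proof. by rewrite /norm1c (bigD1 j)//= lerDl; apply: sumr_ge0 => i _; exact: normc_ge0. Qed.

Lemma norm1c_gt0 x : x != 0 -> 0 < norm1c x.
Proof.
by move=> /rV0Pn[j xj]; apply: lt_le_trans (normc_le_norm1c x j); rewrite normc_gt0.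
Qed.

Lemma norm1cZ (c : R[i]) x : norm1c (c *: x) = normc c * norm1c x.
Proof. by rewrite /norm1c mulr_sumr; apply: eq_bigr => j _; rewrite mxE normcM. Qed.

Lemma norm1cB x y : `|norm1c y - norm1c x| <= norm1c (y - x).
Proof.
rewrite /norm1c -sumrB; apply: le_trans (ler_norm_sum _ _ _) _.
by apply: ler_sum => j _; rewrite !mxE normc_leB.
Qed.

Lemma norm1c_near x (e : R) : 0 < e -> \forall y \near x, norm1c (y - x) < e.
Proof.
move=> e0; apply/nbhs_rowP; exists (e / n.+1%:R); first by rewrite divr_gt0.
move=> y h; apply: (le_lt_trans _ (sum_fraction_lt n e0)).
by apply: ler_sum => j _; rewrite !mxE; exact: ltW.
Qed.

Lemma continuous_norm1c : continuous norm1c.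
Proof.
move=> x; apply/continuous_at_realP => e e0.
by apply: filterS (norm1c_near x e0) => y; exact: le_lt_trans (norm1cB _ _).
Qed.

Lemma compact_norm1c_sphere : compact [set x : Cn | norm1c x = 1].
Proof.
apply: subclosed_compact (compact_polydisc (r := 1)) _.
  rewrite (_ : [set _ | _] = norm1c @^-1` [set x | x = 1])//.
  by apply: preimage_closed; [move=> z _; exact: continuous_norm1c|exact: closed_eq].
by move=> x /= x1 j; rewrite -x1; exact: normc_le_norm1c.
Qed.

Lemma norm1c_normalize x : x != 0 ->
  norm1c ((norm1c x)^-1%:C *: x) = 1.
Proof.
move=> x0; have := norm1c_gt0 x0 => nx.
by rewrite norm1cZ normc_real gtr0_norm ?invr_gt0// mulVf// gt_eqF.
Qed.

Lemma row_1_neq0 : (0 < n)%N -> exists x : Cn, x != 0.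
Proof.
move=> n0; exists (const_mx 1); apply/rV0Pn; exists (Ordinal n0).
by rewrite mxE oner_neq0.
Qed.

Lemma sphere_nonempty : (0 < n)%N -> [set x : Cn | norm1c x = 1] !=set0.
Proof. by move=> /row_1_neq0[x x0]; exists ((norm1c x)^-1%:C *: x); exact: norm1c_normalize. Qed.

End rows.

Lemma convex_setP (M : lmodType R[i]) (A : set M) :
  convex_set (A : set (convex_lmodType M)) <->
  forall (t : R) x y, 0 < t < 1 -> A x -> A y -> A (t%:C *: x + (1 - t)%:C *: y).
Proof.
split.
  move=> cA t x y /andP[t0 t1] Ax Ay.
  have h0 : (0 : R[i]) <= t%:C by rewrite lecR ltW.
  have h1 : t%:C <= (1 : R[i]) by rewrite lecR ltW.
  have := cA x y (Itv01 h0 h1); rewrite !inE => /(_ Ax Ay).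
  by rewrite rmorphB rmorph1.
move=> cA; apply/convex_setW => x y; rewrite !inE => Ax Ay k k0 k1.
have [kE kp] := complex_gt0_real k0.
rewrite inE; have := cA (complex.Re k%:num) x y; rewrite kp /=.
have -> : complex.Re k%:num < 1 by move: k1; rewrite kE ltcR.
move=> /(_ isT Ax Ay).
have -> : (1 - complex.Re k%:num)%:C = 1 - (complex.Re k%:num)%:C :> R[i] by rewrite rmorphB rmorph1.
by move=> h; suff -> : conv k x y = (complex.Re k%:num)%:C *: x + (1 - (complex.Re k%:num)%:C) *: y by []; rewrite -kE.
Qed.

(** The radial function is continuous and positive on the compact unit sphere of [norm1c], so it has
    a positive minimum there, and star-shapedness fills the ball of that radius. The outer bound M
    is the maximum of [norm1c] on K. *)
Lemma star_body_round n (K : set 'rV[R[i]]_n) : (0 < n)%N -> star_body K -> convex_set K ->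
  circle_invariant K -> exists M d : R, round_body K M d.
Proof.
move=> n0 [cptK sK radK cradK] cvK circK.
have clK : closed K by apply: compact_closed => //; exact: norm_hausdorff.
have [u0 u00] := row_1_neq0 n0.
have K0 : K !=set0.
  (* The supremum of an empty set is 0 by convention, so positivity of the radial function produces
     a point of K. *)
  have := radK _ u00; rewrite /radial => h.
  case: (pselect ([set l : R | 0 <= l /\ K (l%:C *: u0)] !=set0)) => [[l [_ Kl]]|ne]; first by exists (l%:C *: u0).
  by move: h; rewrite sup_out ?ltxx// => -[].
have [xM xMK maxM] := compact_EVT_max K0 cptK (continuous_subspaceT (@continuous_norm1c n)).
have S0 := sphere_nonempty n0.
have cS : {within [set x : 'rV[R[i]]_n | norm1c x = 1], continuous (radial K)}.
  apply: continuous_subspaceW cradK => x /= x1 x0; move: x1.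
  by rewrite x0 /norm1c big1 => [/eqP|j _]; rewrite ?mxE ?normc0// eq_sym oner_eq0.
have [um umS minm] := compact_EVT_min S0 (@compact_norm1c_sphere n) cS.
have rm : 0 < radial K um.
  apply: radK; apply/negP => /eqP um0; move: umS; rewrite inE /= um0.
  by rewrite /norm1c big1 => [/eqP|j _]; rewrite ?mxE ?normc0// eq_sym oner_eq0.
set rho := radial K um in rm minm.
have inner x : norm1c x < rho -> K x.
  have [->|x0] := eqVneq x 0.
    move=> _; have [k Kk] := K0; have := sK k 0 Kk; rewrite lexx ler01 rmorph0 scale0r.
    by apply.
  move=> xr; have nx := norm1c_gt0 x0.
  pose u := (norm1c x)^-1%:C *: x.
  have u1 : norm1c u = 1 by exact: norm1c_normalize.
  have := minm u; rewrite inE /= u1 => /(_ erefl) ru.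
  have : norm1c x < radial K u by exact: lt_le_trans ru.
  rewrite /radial => /sup_gt[|l [l0 Kl] xl].
    apply/set0P/negP => /eqP h; move: (lt_le_trans rm ru); rewrite /radial h.
    by rewrite sup0 ltxx.
  have lp : 0 < l by exact: lt_trans xl.
  have -> : x = (norm1c x / l)%:C *: (l%:C *: u).
    by rewrite /u !scalerA -!rmorphM mulfVK ?gt_eqF// mulfV ?gt_eqF// rmorph1 scale1r.
  by apply: sK => //; rewrite divr_ge0 ?(ltW nx)// ?(ltW lp)// ler_pdivrMr// mul1r ltW.
exists (norm1c xM), (rho / 2 / n.+1%:R); split.
- rewrite -[X in measurable X]setCK; apply: measurableC.
  apply: (@measurable_box_open _ _ (~` (@cplx R n @^-1` K))) => w nKw.
  have : nbhs (cplx w) (~` K) by apply: open_nbhs_nbhs; split => //; exact: closed_openC.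
  move=> /nbhs_rowP[e e0 eK]; exists (e / 2); first by rewrite divr_gt0.
  move=> w' h; apply: eK => j.
  apply: le_lt_trans (normc_le_sum _) _; rewrite !mxE /= [ltRHS](splitr e).
  by apply: ltrD; exact: h.
- exact/convex_setP.
- exact: norm1c_ge0.
- move=> x j Kx; apply: le_trans (normc_le_norm1c x j) _.
  by apply: maxM; rewrite inE.
- by rewrite !divr_gt0.
- move=> x h; apply: inner.
  apply: (@le_lt_trans _ _ (rho / 2)); last by rewrite ltr_pdivrMr// ltr_pMr// ltr1n.
  apply: (@le_trans _ _ (\sum_(j < n) (rho / 2 / n.+1%:R))).
    by apply: ler_sum => j _; exact: h.
  by apply: ltW; apply: sum_fraction_lt; rewrite divr_gt0.
- move=> z x z1 Kx; rewrite -(circK z); first by exists x.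
  by rewrite -[`|z|]/((normc z)%:C) z1.
Qed.

End complex_topology.

Section power_continuity.
Context (R : realType).

Lemma powR_continuous_at (a x : R) : 0 < x -> {for x, continuous (fun y : R => y `^ a)}.
Proof.
move=> x0; have [d _] := @is_derive1_powR R a x x0.
exact/differentiable_continuous/derivable1_diffP.
Qed.

Lemma near_shear_factor (k : nat) (p e : R) : 0 < e -> exists2 eta : R, 0 < eta &
  (1 + eta) ^+ k * ((1 + eta) ^+ k * (1 + eta) `^ p) < 1 + e.
Proof.
move=> e0; pose f (x : R) := x ^+ k * (x ^+ k * x `^ p).
have cf : {for 1, continuous f}.
  apply: (@continuousM R R); first exact: exprn_continuous.
  apply: (@continuousM R R); first exact: exprn_continuous.
  exact: powR_continuous_at.
have /continuous_at_realP/(_ _ e0)/nbhs_realP[d d0 df] := cf.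
exists (d / 2); first by rewrite divr_gt0.
have := df (1 + d / 2); rewrite addrAC subrr add0r gtr0_norm ?divr_gt0// => H.
have {H} := H (ltac:(by rewrite ltr_pdivrMr// ltr_pMr// ltr1n)).
rewrite /f !expr1n powR1 !mulr1 => h; rewrite -ltrBlDl.
by apply: le_lt_trans h; exact: ler_norm.
Qed.

Lemma ratio_close (a b c e : R) : 0 < a -> 0 <= b -> 0 < e ->
  c < 1 + Num.min 1 (e / (2 * a)) -> b <= c * a -> a <= c * b -> `|b - a| < e.
Proof.
move=> a0 b0 e0; set e' := Num.min _ _ => cE h1 h2.
have e'0 : 0 < e' by rewrite lt_min ltr01 divr_gt0// mulr_gt0.
have e'1 : e' <= 1 by rewrite ge_min lexx.
have e'2 : e' * (2 * a) <= e by rewrite -ler_pdivlMr ?mulr_gt0// ge_min lexx orbT.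
have h3 : b < (1 + e') * a by apply: le_lt_trans h1 _; rewrite ltr_pM2r.
have h4 : a <= (1 + e') * b by apply: le_trans h2 _; rewrite ler_wpM2r// ltW.
rewrite ltr_norml; apply/andP; split; nra.
Qed.

End power_continuity.

Lemma integralCnE (R : realType) (n : nat) (K : set 'rV[R[i]]_n) (f : 'rV[R[i]]_n -> R) :
  integralCn K f =
  fine (\int[lebesgue_measure2n R n]_t (\1_K (of_coords t) * f (of_coords t))%:E)%E.
Proof. by rewrite /integralCn /Rintegral integral_indic_mul. Qed.

(** * The gauge of the intersection body *)

Section body_gauge.
Context (R : realType) (n : nat).
Local Notation Cn := 'rV[R[i]]_n.
Local Notation tau := (2 * pi : R).
Variables (K : set Cn) (M d : R).
Hypothesis hK : round_body K M d.
Variable p : R.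
Hypotheses (p2 : -2 < p) (p0 : p != 0).
Local Notation lN := (lebesgue_measure2n R n).

(** For q < 0 the integral at u = 0 should be infinite, but [powR] makes the integrand 0 there.
    After the root both conventions give gauge 0 at the origin. *)
Definition body_power (q : R) (u : Cn) : R := fine (body_integral K (fun z => (normc z `^ q)%R) u).
Definition body_gauge (q : R) (u : Cn) : R := body_power q u `^ q^-1.
Local Notation F := (body_power p).
Local Notation N := (body_gauge p).

Lemma norm1c0 : norm1c (0 : Cn) = 0.
Proof. by rewrite /norm1c big1// => j _; rewrite mxE normc0. Qed.

Lemma body_integral0 (h : R[i] -> R) : h 0 = 0 -> body_integral K h 0 = 0%E.
Proof.
move=> h0; rewrite /body_integral (eq_integral (fun=> 0%E)) ?integral0// => t _.
have -> : hdot (of_coords t) (0 : Cn) = 0 by rewrite /hdot big1// => j _; rewrite [X in _ * X]mxE mulr0.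
by rewrite h0 mulr0.
Qed.

Let pow0 : normc (0 : R[i]) `^ p = 0. Proof. by rewrite normc0 powR0. Qed.

Lemma body_powerE u : body_integral K (fun z => (normc z `^ p)%R) u = (F u)%:E.
Proof.
have [->|u0] := eqVneq u 0; first by rewrite /body_power body_integral0.
rewrite /body_power fineK// ge0_fin_numE; first exact: (body_integral_lty hK).
by apply: body_integral_ge0 => z; exact: powR_ge0.
Qed.

Lemma body_power_le (c : R) u v :
  (body_integral K (fun z => (normc z `^ p)%R) u <=
   c%:E * body_integral K (fun z => (normc z `^ p)%R) v)%E -> F u <= c * F v.
Proof. by move: (body_powerE u) (body_powerE v) => -> ->; rewrite -EFinM lee_fin. Qed.

Lemma body_power0 : F 0 = 0.
Proof. by rewrite /body_power body_integral0. Qed.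

Lemma body_power_gt0 u : u != 0 -> 0 < F u.
Proof. by move=> u0; rewrite -lte_fin -body_powerE; exact: (body_integral_pow_gt0 hK). Qed.

Lemma body_power_ge0 u : 0 <= F u.
Proof. by have [->|/body_power_gt0/ltW//] := eqVneq u 0; rewrite body_power0. Qed.

Lemma body_powerZ z u : F (z *: u) = normc z `^ p * F u.
Proof.
have [->|z0] := eqVneq z 0; first by rewrite scale0r body_power0 pow0 mul0r.
by have := body_integralZ hK p u z0; rewrite !body_powerE -EFinM => -[].
Qed.

Lemma body_gauge0 : N 0 = 0.
Proof. by rewrite /body_gauge body_power0 powR0// invr_neq0. Qed.

Lemma body_gauge_ge0 u : 0 <= N u. Proof. exact: powR_ge0. Qed.

Lemma body_gauge_gt0 u : u != 0 -> 0 < N u.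
Proof. by move=> /body_power_gt0 h; exact: powR_gt0. Qed.

Lemma body_gaugeZ z u : N (z *: u) = normc z * N u.
Proof.
rewrite /body_gauge body_powerZ powRM ?powR_ge0 ?body_power_ge0// -powRrM mulfV//.
by rewrite powRr1 ?normc_ge0.
Qed.

Lemma body_gauge_powR u : N u `^ p = F u.
Proof. by rewrite /body_gauge -powRrM mulVf// powRr1 ?body_power_ge0. Qed.

Lemma body_power_continuous u : u != 0 -> {for u, continuous F}.
Proof.
move=> u0; have Fu := body_power_gt0 u0; apply/continuous_at_realP => e e0.
pose e' := Num.min 1 (e / (2 * F u)).
have e'0 : 0 < e' by rewrite lt_min ltr01 divr_gt0// mulr_gt0.
have [eta eta0 he] := near_shear_factor (n + n) p e'0.
have [rho rho0 hrho] := body_integral_near hK p u0 eta0.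
apply/nbhs_rowP; exists rho => // u' /hrho.
pose c := (1 + eta) ^+ (n + n) * ((1 + eta) ^+ (n + n) * (1 + eta) `^ p).
have cE : c < 1 + e' by exact: he.
rewrite -[X in let c := X in _]/c; move: (c) cE => {}c cE [].
move=> /body_power_le h1 /body_power_le h2.
exact: ratio_close Fu (body_power_ge0 u') e0 cE h1 h2.
Qed.

Lemma body_gauge_continuous_neq0 u : u != 0 -> {for u, continuous N}.
Proof.
move=> u0; apply/continuous_at_realP => e e0.
have /continuous_at_realP/(_ _ e0)/nbhs_realP[r r0 hr] := @powR_continuous_at R p^-1 _ (body_power_gt0 u0).
have /continuous_at_realP/(_ _ r0) := body_power_continuous u0.
by apply: filterS => y; exact: hr.
Qed.

Lemma body_gauge_bounds : (0 < n)%N -> exists a b : R, [/\ 0 < a, 0 < b &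
  forall u, a * norm1c u <= N u <= b * norm1c u].
Proof.
move=> n0; have S0 := sphere_nonempty R n0.
have sn0 (u : Cn) : norm1c u = 1 -> u != 0.
  move=> u1; apply/eqP => u0; move: u1; rewrite u0 norm1c0.
  by move=> /eqP; rewrite eq_sym oner_eq0.
have cN : {within [set x : Cn | norm1c x = 1], continuous N}.
  by apply: continuous_in_subspaceT => u; rewrite inE /= => /sn0; exact: body_gauge_continuous_neq0.
have [ua uaS mina] := compact_EVT_min S0 (@compact_norm1c_sphere _ n) cN.
have [ub ubS maxb] := compact_EVT_max S0 (@compact_norm1c_sphere _ n) cN.
move: uaS ubS; rewrite !inE /= => /sn0 ua0 /sn0 ub0.
exists (N ua), (N ub); split; [exact: body_gauge_gt0|exact: body_gauge_gt0|].
move=> u; have [->|u0] := eqVneq u 0.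
  by move: (N ua) (N ub) => a b; rewrite norm1c0 !mulr0 body_gauge0 lexx.
have nu := norm1c_gt0 u0; pose v := (norm1c u)^-1%:C *: u.
have v1 : v \in [set x : Cn | norm1c x = 1] by rewrite inE; exact: norm1c_normalize.
have -> : u = (norm1c u)%:C *: v.
  by rewrite /v scalerA -rmorphM mulfV ?gt_eqF// rmorph1 scale1r.
rewrite body_gaugeZ norm1cZ normc_real gtr0_norm//; have /eqP := v1; rewrite inE /= in v1.
rewrite v1 mulr1 => _; have vS : v \in [set x : Cn | norm1c x = 1] by rewrite inE.
have ha := mina v vS; have hb := maxb v vS.
move: (norm1c u) (N v) (N ua) (N ub) nu ha hb => x y a b x0 ha hb.
by rewrite (mulrC x) !ler_wpM2r// ltW.
Qed.

Lemma body_gauge_continuous : (0 < n)%N -> continuous N.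
Proof.
move=> n0 u; have [->|u0] := eqVneq u 0; last exact: body_gauge_continuous_neq0.
have [a [b [a0 b0 ab]]] := body_gauge_bounds n0.
apply/continuous_at_realP => e e0.
have := norm1c_near (0 : Cn) (divr_gt0 e0 b0); apply: filterS => y; rewrite subr0 => h.
rewrite body_gauge0 subr0 ger0_norm ?body_gauge_ge0//.
have /andP[_ h'] := ab y; apply: le_lt_trans h' _.
by rewrite mulrC -ltr_pdivlMr.
Qed.

(** The constant is the circle integral of h divided by 2 pi. That it is positive and finite is read
    off from the averaging identity at a single nonzero vector. *)
Lemma homogeneous_body_integral (h : R[i] -> R) : (0 < n)%N -> planar h -> (forall z, 0 <= h z) ->
  (forall (r : R) z, 0 <= r -> h (r%:C * z) = r `^ p * h z) ->
  (forall u : Cn, u != 0 -> (0 < body_integral K h u < +oo)%E) ->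
  exists2 c : R, 0 < c & forall u : Cn, body_integral K h u = (c * F u)%:E.
Proof.
move=> n0 mh h0 hZ hb; have [u0 u00] := row_1_neq0 R n0.
have tau0 : 0 < tau by rewrite mulr_gt0// pi_gt0.
have avg u := body_integral_average hK u p0 mh h0 hZ.
set m := circle_integral _ in avg.
have Fu0 := body_power_gt0 u00.
have m0 : (0 <= m)%E by apply: integral_ge0 => t _; rewrite lee_fin.
have /andP[B0 Boo] := hb _ u00.
have Bf : body_integral K h u0 \is a fin_num by rewrite ge0_fin_numE// ltW.
have := avg u0; rewrite body_powerE -(fineK Bf) -EFinM.
set B := fine _; have {}B0 : 0 < B by rewrite fine_gt0// B0.
case: m m0 avg => [m||]//= m0 avg.
  move=> [mE]; have mp : 0 < m by rewrite -(pmulr_lgt0 _ Fu0) -mE mulr_gt0.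
  exists (m / tau); first by rewrite divr_gt0.
  move=> u; have := avg u; rewrite body_powerE.
  case: (body_integral K h u) => [b||]/=.
  - by rewrite -!EFinM => -[e]; congr _%:E; rewrite mulrAC -e mulrAC mulfV ?mul1r// gt_eqF.
  - rewrite muleC mulyr gtr0_sg// mul1e -EFinM => e; discriminate e.
  - rewrite muleC mulNyr gtr0_sg// mul1e -EFinM => e; discriminate e.
by rewrite mulyr gtr0_sg// mul1e.
Qed.

Section support.
Variable C : set R[i].
Hypothesis hC : convex_body0 C.

(** The support function of Cu at x is this function at <x,u>, so it depends on one complex variable
    only. *)
Definition planar_support (w : R[i]) : R := sup [set complex.Re (c * w) | c in C].
Local Notation hs := planar_support.

Let bounds : exists r S : R, [/\ 0 < r, 0 < S, forall c, normc c <= r -> C c &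
  forall c, C c -> normc c <= S].
Proof.
have [cptC _ int0] := hC; have /nbhs_complexP[e e0 eC] := int0.
have C0 : C !=set0 by exists 0; apply: eC; rewrite subrr normc0.
have [cM cMC maxM] := compact_EVT_max C0 cptC (continuous_subspaceT (@continuous_normc R)).
exists (e / 2), (normc cM + 1); split; [by rewrite divr_gt0|by rewrite ltr_wpDl// normc_ge0| |].
  by move=> c h; apply: eC; rewrite subr0; apply: le_lt_trans h _; rewrite ltr_pdivrMr// ltr_pMr// ltr1n.
by move=> c Cc; apply: le_trans (maxM c _) _; rewrite ?inE// lerDl.
Qed.

Let ReM (c w : R[i]) : complex.Re (c * w) <= normc c * normc w.
Proof. by rewrite -normcM; apply: le_trans (Re_le_normc _); exact: ler_norm. Qed.

Lemma planar_support_bounds : exists r S : R, [/\ 0 < r, 0 < S,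
  forall w, r * normc w <= hs w <= S * normc w &
  forall w w', `|hs w' - hs w| <= S * normc (w' - w)].
Proof.
have [r [S [r0 S0 rC CS]]] := bounds.
have ub w : has_ubound [set complex.Re (c * w) | c in C].
  exists (S * normc w) => _ [c Cc <-]; apply: le_trans (ReM _ _) _.
  by rewrite ler_wpM2r ?normc_ge0// CS.
have ne w : [set complex.Re (c * w) | c in C] !=set0.
  by exists (complex.Re (0 * w)), 0 => //; apply: rC; rewrite normc0 ltW.
have lip w w' : hs w' <= hs w + S * normc (w' - w).
  apply: ge_sup => // _ [c Cc <-]; have -> : c * w' = c * w + c * (w' - w) by ring.
  rewrite raddfD /=; apply: lerD; first by apply: ub_le_sup => //; exists c.
  by apply: le_trans (ReM _ _) _; rewrite ler_wpM2r ?normc_ge0// CS.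
exists r, S; split => // [w|w w'].
  apply/andP; split; last first.
    apply: ge_sup => // _ [c Cc <-]; apply: le_trans (ReM _ _) _.
    by rewrite ler_wpM2r ?normc_ge0// CS.
  have [->|w0] := eqVneq w 0.
    rewrite normc0 mulr0; apply: ub_le_sup => //; exists 0; last by rewrite mul0r.
    by apply: rC; rewrite normc0 ltW.
  have nw : normc w != 0 by rewrite gt_eqF// normc_gt0.
  apply: ub_le_sup => //; exists ((r / normc w)%:C * conjc w).
    apply: rC; rewrite normcM normc_real normc_conj gtr0_norm ?divr_gt0 ?normc_gt0//.
    by rewrite mulfVK.
  have -> : (r / normc w)%:C * conjc w * w = (r / normc w * normc w ^+ 2)%:C.
    rewrite -mulrA (mulrC (conjc w)) -sqr_normc -[`|w|]/((normc w)%:C).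
    by rewrite !expr2 !rmorphM.
  by rewrite /= expr2 mulrA mulfVK.
rewrite ler_norml; have := lip w' w; have := lip w w'.
rewrite -(normc_opp (w - w')) opprB => h1 h2; apply/andP; split; lra.
Qed.

Lemma planar_support_homogeneous (s : R) w : 0 <= s -> hs (s%:C * w) = s * hs w.
Proof.
have ReZ (z : R[i]) : complex.Re (s%:C * z) = s * complex.Re z.
  by case: z => a b /=; rewrite mul0r subr0.
have [r [S [r0 S0 rC CS]]] := bounds.
have ub w' : has_ubound [set complex.Re (c * w') | c in C].
  exists (S * normc w') => _ [c Cc <-]; apply: le_trans (ReM _ _) _.
  by rewrite ler_wpM2r ?normc_ge0// CS.
have ne w' : [set complex.Re (c * w') | c in C] !=set0.
  by exists (complex.Re (0 * w')), 0 => //; apply: rC; rewrite normc0 ltW.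
rewrite le_eqVlt => /predU1P[<-|s0].
  have [r' [S' [_ _ h _]]] := planar_support_bounds.
  have := h (0%:C * w); rewrite rmorph0 mul0r normc0 !mulr0 -eq_le mul0r eq_sym.
  by move=> /eqP.
apply/eqP; rewrite eq_le; apply/andP; split.
  apply: ge_sup => // _ [c Cc <-]; rewrite mulrCA ReZ ler_pM2l//.
  by apply: ub_le_sup => //; exists c.
rewrite mulrC -ler_pdivlMr//; apply: ge_sup => // _ [c Cc <-]; rewrite ler_pdivlMr// mulrC -ReZ mulrCA.
by apply: ub_le_sup => //; exists c.
Qed.

(** The support function of C lies between two positive multiples of the modulus, so its p-th power
    has positive finite body integrals and, being homogeneous, is covered by
    [homogeneous_body_integral]. The radial function is then a constant divided by the gauge. *)
Lemma Lp_intersection_bodyE : (0 < n)%N ->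
  exists2 c : R, 0 < c & Lp_intersection_body C p K = [set x | N x <= c].
Proof.
move=> n0; have [r [S [r0 S0 rS lip]]] := planar_support_bounds.
have hs0 w : 0 <= hs w.
  by have /andP[h _] := rS w; apply: le_trans h; rewrite mulr_ge0 ?normc_ge0// ltW.
pose h w := hs w `^ p.
have mh : planar h.
  apply: (measurableT_comp (@measurable_powR R p)); apply: planar_continuous => z e e0.
  exists (e / S); first by rewrite divr_gt0.
  by move=> z' hz; apply: le_lt_trans (lip _ _) _; rewrite mulrC -ltr_pdivlMr.
have h0 w : 0 <= h w by exact: powR_ge0.
have hZ (s : R) z : 0 <= s -> h (s%:C * z) = s `^ p * h z.
  by move=> s0; rewrite /h planar_support_homogeneous// powRM.
(* Minimum and maximum make the two-sided estimate valid for either sign of p. *)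
have powle (a b x y : R) : 0 < a -> 0 < b -> 0 <= x -> 0 <= y -> a * y <= x -> x <= b * y ->
    (Num.min (a `^ p) (b `^ p)) * y `^ p <= x `^ p <= (Num.max (a `^ p) (b `^ p)) * y `^ p.
  move=> a0 b0 x0; rewrite le_eqVlt => /predU1P[<-|y0] h1 h2.
    have -> : x = 0 by apply/eqP; rewrite eq_le x0 andbT; move: h2; rewrite mulr0.
    by rewrite powR0// !mulr0 lexx.
  have yp : 0 < y `^ p by exact: powR_gt0.
  have xp : 0 < x by apply: lt_le_trans h1; rewrite mulr_gt0.
  have {}h1 : a <= x / y by rewrite ler_pdivlMr.
  have {}h2 : x / y <= b by rewrite ler_pdivrMr.
  have xE : x `^ p = (x / y) `^ p * y `^ p.
    by rewrite -powRM ?ltW ?divr_gt0// mulfVK// gt_eqF.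
  have xy0 : 0 < x / y by rewrite divr_gt0.
  rewrite xE !ler_pM2r// ge_min le_max; have [pp|pp] := leP 0 p.
    have xyn : x / y \is Num.nneg by rewrite nnegrE ltW.
    have an : a \is Num.nneg by rewrite nnegrE ltW.
    have bn : b \is Num.nneg by rewrite nnegrE ltW.
    by rewrite (ge0_ler_powR pp an xyn h1) (ge0_ler_powR pp xyn bn h2) orbT.
  have np : 0 <= - p by rewrite oppr_ge0 ltW.
  have := ler_powRN np a0 h1; have := ler_powRN np xy0 h2; rewrite !opprK => -> ->.
  by rewrite orbT.
set mn := Num.min (r `^ p) (S `^ p) in powle *; set mx := Num.max (r `^ p) (S `^ p).
have mn0 : 0 < mn by rewrite lt_min !powR_gt0.
have mx0 : 0 < mx by rewrite lt_max powR_gt0.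
have hb w : mn * normc w `^ p <= h w <= mx * normc w `^ p.
  by have /andP[h1 h2] := rS w; apply: powle => //; exact: normc_ge0.
have mp : planar (fun z : R[i] => (normc z `^ p)%R).
  by apply: (measurableT_comp (@measurable_powR R p)); exact: (@planar_normc R).
have BZ (m : R) u : 0 <= m -> body_integral K (fun z => (m * normc z `^ p)%R) u = (m * F u)%:E.
  move=> m0; rewrite EFinM -body_powerE /body_integral -ge0_integralZl//.
  - by apply: eq_integral => t _; rewrite -EFinM mulrCA.
  - exact: (measurable_body_integrand hK u mp).
  - by move=> t _; rewrite lee_fin mulr_ge0// powR_ge0.
have le_body (h1 h2 : R[i] -> R) u : planar h1 -> planar h2 -> (forall z, 0 <= h1 z) ->
    (forall z, h1 z <= h2 z) -> (body_integral K h1 u <= body_integral K h2 u)%E.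
  move=> m1 m2 h10 h12; apply: ge0_le_integral.
  - exact: measurableT.
  - by move=> t _; rewrite lee_fin mulr_ge0.
  - exact: (measurable_body_integrand hK u m1).
  - exact: (measurable_body_integrand hK u m2).
  - by move=> t _; rewrite lee_fin ler_wpM2l.
have mZ (m : R) : planar (fun z : R[i] => (m * normc z `^ p)%R).
  by apply: measurable_funM => //; exact: measurable_cst.
have hB u : u != 0 -> (0 < body_integral K h u < +oo)%E.
  move=> u0; have Fu := body_power_gt0 u0; apply/andP; split.
    apply: (@lt_le_trans _ _ (mn * F u)%:E); first by rewrite lte_fin mulr_gt0.
    rewrite -(BZ _ _ (ltW mn0)); apply: (le_body (fun z => mn * normc z `^ p) h u (mZ mn) mh) => z.
      by rewrite mulr_ge0 ?powR_ge0// ltW.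
    by case/andP: (hb z).
  apply: (@le_lt_trans _ _ (mx * F u)%:E); last by rewrite ltry.
  by rewrite -(BZ _ _ (ltW mx0)); apply: (le_body h (fun z => mx * normc z `^ p) u mh (mZ mx) h0) => z; case/andP: (hb z).
have [kappa kappa0 kE] := homogeneous_body_integral n0 mh h0 hZ hB.
have supp u (x : Cn) : support_fun [set c *: u | c in C] x = hs (hdot x u).
  rewrite /support_fun /planar_support; congr sup; apply/seteqP; split => y /=.
    by move=> [_ [c Cc <-] <-]; exists c => //; rewrite rdotE hdotZr.
  by move=> [c Cc <-]; exists (c *: u); [exists c|rewrite rdotE hdotZr].
have radE u : Lp_intersection_radial C p K u = (kappa * F u) `^ (- p^-1).
  rewrite /Lp_intersection_radial.
  have -> : kappa * F u = fine (body_integral K h u) by rewrite kE.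
  have -> : (fun x : Cn => support_fun [set c *: u | c in C] x `^ p) = (fun x => h (hdot x u)).
    by apply/funext => x; rewrite supp.
  by rewrite integralCnE.
exists (kappa `^ (- p^-1)); first exact: powR_gt0.
have rad u : u != 0 -> Lp_intersection_radial C p K u = kappa `^ (- p^-1) / N u.
  by move=> u0; rewrite radE powRM ?body_power_ge0 ?ltW// (powRN (F u)).
have sph0 (u : Cn) : unit_sphere u -> u != 0.
  rewrite /unit_sphere /= => u1; apply/eqP => u0; move: u1; rewrite u0 rdotE /hdot big1 => [|j _]; last by rewrite mxE mulr0.
  by move=> /eqP; rewrite eq_sym oner_eq0.
apply/seteqP; split => x /=.
  move=> [u [l [u1 /andP[l0 lr] ->]]]; have u0 := sph0 _ u1.
  rewrite body_gaugeZ normc_real ger0_norm// -ler_pdivlMr ?body_gauge_gt0//.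
  by rewrite -rad.
have [x0|x0] := eqVneq x 0.
  have [v v0] := row_1_neq0 R n0; move=> _.
  exists ((Num.sqrt (hnorm2 v))^-1%:C *: v), 0; split; last by rewrite x0 rmorph0 scale0r.
    rewrite /unit_sphere /= rdotE hdotZl hdotZr conj_real hnorm2E mulrA -!rmorphM /=.
    rewrite -expr2 exprVn sqr_sqrtr ?ltW ?hnorm2_gt0// mulVf// gt_eqF// hnorm2_gt0//.
  by rewrite lexx /= powR_ge0.
move=> Nx; have hx := hnorm2_gt0 x0; pose l := Num.sqrt (hnorm2 x).
have l0 : 0 < l by rewrite sqrtr_gt0.
have l2 : l ^+ 2 = hnorm2 x by rewrite sqr_sqrtr// ltW.
have ln0 : l != 0 by rewrite gt_eqF.
exists (l^-1%:C *: x), l.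
have v1 : unit_sphere (l^-1%:C *: x).
  rewrite /unit_sphere /= rdotE hdotZl hdotZr conj_real hnorm2E mulrA -!rmorphM /=.
  by rewrite -expr2 exprVn l2 mulVf// gt_eqF.
split => //; last by rewrite scalerA -rmorphM mulfV// rmorph1 scale1r.
rewrite (ltW l0) /= rad ?sph0// ler_pdivlMr ?body_gauge_gt0 ?sph0//.
by rewrite body_gaugeZ normc_real gtr0_norm ?invr_gt0// mulVKf.
Qed.

End support.

End body_gauge.

(** * Elementary inequalities for powers *)

Section power_mean.
Context (R : realType).

Lemma powR_convex_comb (q t x y : R) : 1 <= q -> 0 <= t <= 1 -> 0 <= x -> 0 <= y ->
  (t * x + (1 - t) * y) `^ q <= t * x `^ q + (1 - t) * y `^ q.
Proof.
move=> q1 /andP[t0 t1] x0 y0.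
have := @convex_powR R q q1 (Itv01 t0 t1) x y.
by rewrite !inE /= !in_itv /= !andbT => /(_ x0 y0).
Qed.

Lemma powR_pair_le2 (p a : R) : 0 < p -> p < 1 -> `|a| <= 2^-1 -> (1 + a) `^ p + (1 - a) `^ p <= 2.
Proof.
move=> p0 p1; rewrite ler_norml => /andP[a1 a2].
have ap : 0 <= 1 + a by lra.
have an : 0 <= 1 - a by lra.
have q1 : 1 <= p^-1 by rewrite invf_ge1// ltW.
have h2 : 0 <= (2^-1 : R) <= 1.
  by apply/andP; split; [rewrite invr_ge0|rewrite invf_le1// ler1n].
have := powR_convex_comb q1 h2 (powR_ge0 (1 + a) p) (powR_ge0 (1 - a) p).
rewrite -!powRrM !mulfV ?gt_eqF// !powRr1//.
set X := (1 + a) `^ p; set Y := (1 - a) `^ p => h.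
have X0 : 0 <= X := powR_ge0 _ _.
have Y0 : 0 <= Y := powR_ge0 _ _.
have XY : 0 <= 2^-1 * X + (1 - 2^-1) * Y by lra.
rewrite leNgt; apply/negP => h3.
have : 1 `^ p^-1 < (2^-1 * X + (1 - 2^-1) * Y) `^ p^-1.
  by apply: gt0_ltr_powR; rewrite ?invr_gt0 ?nnegrE ?ler01//; lra.
by rewrite powR1; lra.
Qed.

(** Apply e^x >= 1 + x to both powers: the sum of the exponents is p ln(1 - a^2), which is
    nonnegative for p < 0. *)
Lemma powR_pair_ge2 (p a : R) : p < 0 -> `|a| <= 2^-1 -> 2 <= (1 + a) `^ p + (1 - a) `^ p.
Proof.
move=> p0; rewrite ler_norml => /andP[a1 a2].
have ap : 0 < 1 + a by lra.
have an : 0 < 1 - a by lra.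
rewrite /powR !gt_eqF//.
have l : ln (1 + a) + ln (1 - a) <= 0.
  rewrite -lnM ?posrE// ln_le0//; nra.
have := expR_ge1Dx (p * ln (1 + a)); have := expR_ge1Dx (p * ln (1 - a)).
have : 0 <= p * (ln (1 + a) + ln (1 - a)) by rewrite mulr_le0// ltW.
by rewrite mulrDr; lra.
Qed.

Lemma eventually_gt (f : nat -> R) (a l : R) : f k @[k --> \oo] --> l -> a < l ->
  \forall k \near \oo, a < f k.
Proof. by move=> fl al; exact: (cvgr_gt _ fl _ al). Qed.

Lemma powR_anti (r x y : R) : r < 0 -> 0 < x -> x < y -> y `^ r^-1 < x `^ r^-1.
Proof.
move=> r0 x0 xy; have y0 := lt_trans x0 xy.
have E z : z `^ r^-1 = (z `^ (- r^-1))^-1 by rewrite -powRN opprK.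
rewrite (E x) (E y) ltf_pV2 ?posrE ?powR_gt0//; apply: gt0_ltr_powR; rewrite ?nnegrE ?(ltW x0) ?(ltW y0)//.
by rewrite oppr_gt0 invr_lt0.
Qed.

(** The signed steps s and -s of a mean inequality become steps s/(1 + s c) and s/(1 - s c) after
    reparametrisation; both must stay below b while |s c| <= 1/2. *)
Lemma small_step (b c : R) : 0 < b -> exists s : R, [/\ 0 < s /\ `|s * c| <= 2^-1, 0 < 1 + s * c, 0 < 1 - s * c,
  0 < s / (1 + s * c) < b & 0 < s / (1 - s * c) < b].
Proof.
move=> b0; have c1 : 0 < 1 + `|c| by rewrite ltr_pwDl.
exists (Num.min (b / 3) (2^-1 / (1 + `|c|))); set s := Num.min _ _.
have s0 : 0 < s by rewrite !lt_min !divr_gt0.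
have s1 : s <= b / 3 by rewrite /s ge_min lexx.
have s4 : `|s * c| <= 2^-1.
  have : s <= 2^-1 / (1 + `|c|) by rewrite /s ge_min lexx orbT.
  rewrite ler_pdivlMr// => h; rewrite normrM gtr0_norm//; apply: le_trans h.
  by rewrite ler_pM2l// lerDr.
clearbody s; have /andP[s4a s4b] : - 2^-1 <= s * c <= 2^-1 by rewrite -ler_norml.
have p1 : 0 < 1 + s * c by lra.
have p2 : 0 < 1 - s * c by lra.
by split=> //; rewrite divr_gt0//= ltr_pdivrMr//; nra.
Qed.

(** Since p < 0, values x <= m and y < m have powers at least m^p, the second one strictly, and the
    factors (1 + a)^p and (1 - a)^p add up to at least 2. *)
Lemma power_mean_contra_lt0 (p a m x y : R) : p < 0 -> `|a| <= 2^-1 -> 0 < m ->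
  0 < x <= m -> 0 < y < m -> ~ (((1 + a) * x) `^ p + ((1 - a) * y) `^ p <= 2 * m `^ p).
Proof.
move=> p0 a2 m0 /andP[x0 xm] /andP[y0 ym].
have h2 := powR_pair_ge2 p0 a2; move: a2; rewrite ler_norml => /andP[a1 a2].
have ap : 0 < 1 + a by lra.
have an : 0 < 1 - a by lra.
rewrite !powRM ?(ltW ap) ?(ltW an) ?(ltW x0) ?(ltW y0)//; have A0 := powR_gt0 p ap; have B0 := powR_gt0 p an.
have np : 0 < - p by lra.
have k1 : m `^ p <= x `^ p by have := ler_powRN (ltW np) x0 xm; rewrite opprK.
have k2 : m `^ p < y `^ p.
  have E z : z `^ p = (z `^ (- p))^-1 by rewrite -powRN opprK.
  rewrite (E m) (E y) ltf_pV2 ?posrE ?powR_gt0//.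
  by apply: gt0_ltr_powR => //; rewrite nnegrE ltW.
have mp0 := powR_gt0 p m0; move: h2 A0 B0 k1 k2 mp0.
move: (m `^ p) (x `^ p) (y `^ p) ((1 + a) `^ p) ((1 - a) `^ p) => X Y Z A B; nra.
Qed.

Lemma power_mean_contra_gt0 (p a m x y : R) : 0 < p -> p < 1 -> `|a| <= 2^-1 -> 0 < m ->
  0 < x <= m -> 0 < y < m -> ~ (2 * m `^ p <= ((1 + a) * x) `^ p + ((1 - a) * y) `^ p).
Proof.
move=> p0 p1 a2 m0 /andP[x0 xm] /andP[y0 ym].
have h2 := powR_pair_le2 p0 p1 a2; move: a2; rewrite ler_norml => /andP[a1 a2].
have ap : 0 < 1 + a by lra.
have an : 0 < 1 - a by lra.
rewrite !powRM ?(ltW ap) ?(ltW an) ?(ltW x0) ?(ltW y0)//; have A0 := powR_gt0 p ap; have B0 := powR_gt0 p an.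
have k1 : x `^ p <= m `^ p.
  by apply: ge0_ler_powR; rewrite ?nnegrE ?(ltW p0) ?(ltW x0) ?(ltW m0).
have k2 : y `^ p < m `^ p by apply: gt0_ltr_powR; rewrite ?nnegrE// ltW.
have mp0 := powR_gt0 p m0; move: h2 A0 B0 k1 k2 mp0.
move: (m `^ p) (x `^ p) (y `^ p) ((1 + a) `^ p) ((1 - a) `^ p) => X Y Z A B; nra.
Qed.

End power_mean.

(** Adding a multiple of the base point to the direction does not leave the plane of the line. Up to
    a scalar, which homogeneity of the gauge absorbs, it is a projective change of parameter, a
    Moebius map for complex scalars; this undoes the uncontrolled shear c. *)
Lemma line_reparam (k : fieldType) (V : lmodType k) (v D : V) (t e c : k) : 1 + e * c != 0 ->
  v + t *: D + e *: (D + c *: (v + t *: D)) = (1 + e * c) *: (v + (t + e / (1 + e * c)) *: D).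
Proof.
move=> h; rewrite [RHS]scalerDr scalerA mulrDr mulrCA mulfV// mulr1.
set X := v + t *: D.
have -> : X + e *: (D + c *: X) = (1 + e * c) *: X + e *: D.
  by rewrite scalerDr scalerA scalerDl scale1r addrCA addrC.
by rewrite /X scalerDr scalerA -addrA -scalerDl.
Qed.

Section complex_lines.
Context (R : realType) (n : nat).
Local Notation Cn := 'rV[R[i]]_n.

Lemma complex_line_continuous (u v : Cn) : continuous (fun z : R[i] => u + z *: v).
Proof.
move=> z A /nbhs_rowP[e e0 eA]; apply/nbhs_complexP.
have D0 : 0 < 1 + norm1c v by rewrite ltr_pwDl// norm1c_ge0.
exists (e / (1 + norm1c v)); first by rewrite divr_gt0.
move=> z' h; apply: eA => j; rewrite !mxE.
have -> : u 0 j + z' * v 0 j - (u 0 j + z * v 0 j) = (z' - z) * v 0 j by ring.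
rewrite normcM; apply: (@le_lt_trans _ _ (normc (z' - z) * (1 + norm1c v))).
  rewrite ler_wpM2l ?normc_ge0//; apply: (le_trans (normc_le_norm1c v j)).
  by rewrite lerDr.
by rewrite -ltr_pdivlMr.
Qed.

Lemma real_line_reparam (v D : Cn) (t e c : R) : 1 + e * c != 0 ->
  v + t%:C *: D + e%:C *: (D + c%:C *: (v + t%:C *: D)) =
  (1 + e * c)%:C *: (v + (t + e / (1 + e * c))%:C *: D).
Proof.
move=> h; have E : (1 + e * c)%:C = 1 + e%:C * c%:C :> R[i] by rewrite rmorphD rmorphM rmorph1.
have h' : 1 + e%:C * c%:C != 0 :> R[i].
  by rewrite -E -(rmorph0 (real_complex R)) (inj_eq (@complexI R)).
have E2 : (t + e / (1 + e * c))%:C = t%:C + e%:C / (1 + e%:C * c%:C) :> R[i].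
  by rewrite -E -fmorphV -rmorphM -rmorphD.
by rewrite E2 E; exact: line_reparam.
Qed.

Lemma real_complex_continuous : continuous (fun t : R => t%:C : R[i]).
Proof.
move=> t; apply: continuous_at_complex => /=; first by move=> A.
exact: cst_continuous.
Qed.

Lemma real_line_continuous (f : Cn -> R) (u v : Cn) : continuous f ->
  continuous (fun t : R => f (u + t%:C *: v)).
Proof.
move=> cf t A hA.
exact: (real_complex_continuous (complex_line_continuous (cf (u + t%:C *: v) A hA))).
Qed.

End complex_lines.

Opaque body_power body_gauge.

(** * Convexity *)

Section body_convexity.
Context (R : realType) (n : nat).
Local Notation Cn := 'rV[R[i]]_n.
Variables (K : set Cn) (M d : R).
Hypothesis hK : round_body K M d.
Hypothesis n0 : (0 < n)%N.
Local Notation F := (body_power K).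
Local Notation N := (body_gauge K).

Lemma body_gauge_le_pos (p c : R) (u : Cn) : 0 < p -> 0 <= c -> N p u <= c -> F p u <= c `^ p.
Proof.
move=> p0 c0 h; have p2 : -2 < p by lra.
have pn : p != 0 by rewrite gt_eqF.
by rewrite -(body_gauge_powR hK p2 pn); apply: ge0_ler_powR; rewrite ?nnegrE ?powR_ge0// ltW.
Qed.

Lemma body_power_le_pos (p c : R) (u : Cn) : 0 < p -> 0 <= c -> F p u <= c `^ p -> N p u <= c.
Proof.
move=> p0 c0 h; have p2 : -2 < p by lra.
have pn : p != 0 by rewrite gt_eqF.
have F0 := body_power_ge0 hK p2 pn u.
have -> : c = (c `^ p) `^ p^-1 by rewrite -powRrM mulfV// powRr1.
by apply: ge0_ler_powR; rewrite ?nnegrE ?powR_ge0 ?invr_ge0// ltW.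
Qed.

Lemma body_gauge_le_neg (p c : R) (u : Cn) : -2 < p -> p < 0 -> u != 0 ->
  N p u <= c -> c `^ p <= F p u.
Proof.
move=> p2 p0 u0 h; have pn : p != 0 by rewrite lt_eqF.
have N0 := body_gauge_gt0 hK p2 pn u0.
have np : 0 <= - p by rewrite oppr_ge0 ltW.
by rewrite -(body_gauge_powR hK p2 pn); have := ler_powRN np N0 h; rewrite opprK.
Qed.

Lemma body_power_le_neg (p c : R) (u : Cn) : -2 < p -> p < 0 -> 0 < c ->
  c `^ p <= F p u -> N p u <= c.
Proof.
move=> p2 p0 c0 h; have pn : p != 0 by rewrite lt_eqF.
have npi : 0 <= - p^-1 by rewrite oppr_ge0 invr_le0 ltW.
have -> : c = (c `^ p) `^ p^-1 by rewrite -powRrM mulfV// powRr1// ltW.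
by have := ler_powRN npi (powR_gt0 p c0) h; rewrite opprK.
Qed.

Lemma body_gauge_convex_ge1 (p c t : R) (u v : Cn) : 1 <= p -> 0 < t < 1 -> 0 <= c ->
  N p u <= c -> N p v <= c -> N p (t%:C *: u + (1 - t)%:C *: v) <= c.
Proof.
move=> p1 /andP[t0 t1] c0; have p0 : 0 < p by lra.
have p2 : -2 < p by lra.
have pn : p != 0 by rewrite gt_eqF.
move=> /(body_gauge_le_pos p0 c0) hu /(body_gauge_le_pos p0 c0) hv.
apply: (body_power_le_pos p0 c0).
have t01 : 0 <= t <= 1 by rewrite !ltW.
have mp : planar (fun z : R[i] => (normc z `^ p)%R).
  by apply: (measurableT_comp (@measurable_powR R p)); exact: (@planar_normc R).
have [w wE] : exists w, w = t%:C *: u + (1 - t)%:C *: v by exists (t%:C *: u + (1 - t)%:C *: v).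
rewrite -wE.
pose I w := body_integral K (fun z => (normc z `^ p)%R) w.
have hF : (I w <= t%:E * I u + (1 - t)%:E * I v)%E.
  have mi x := measurable_body_integrand hK x mp.
  have i0 x s : setT s -> (0 <= (\1_K (of_coords s) * normc (hdot (of_coords s) x) `^ p)%:E)%E.
    by move=> _; rewrite lee_fin mulr_ge0// powR_ge0.
  have tE : (0 <= t%:E)%E by rewrite lee_fin ltW.
  have tE' : (0 <= (1 - t)%:E)%E by rewrite lee_fin subr_ge0 ltW.
  rewrite /I /body_integral -(ge0_integralZl _ measurableT (mi u) (i0 u) tE).
  rewrite -(ge0_integralZl _ measurableT (mi v) (i0 v) tE').
  rewrite -ge0_integralD; last 5 first.
  - exact: measurableT.
  - by move=> s _; rewrite mule_ge0// i0.
  - exact: measurable_funeM.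
  - by move=> s _; rewrite mule_ge0// i0.
  - exact: measurable_funeM.
  apply: ge0_le_integral.
  - exact: measurableT.
  - exact: i0.
  - exact: mi.
  - by apply: emeasurable_funD; exact: measurable_funeM.
  move=> s _; rewrite -!EFinM -EFinD lee_fin mulrCA (mulrCA (1 - t)) -mulrDr ler_wpM2l//.
  apply: le_trans (powR_convex_comb p1 t01 (normc_ge0 _) (normc_ge0 _)).
  apply: ge0_ler_powR; rewrite ?nnegrE ?normc_ge0 ?(ltW p0)//.
    by rewrite addr_ge0// mulr_ge0 ?normc_ge0 ?subr_ge0// ltW.
  rewrite wE hdotDr !hdotZr; apply: le_trans (normc_leD _ _) _.
  by rewrite !normcM !normc_real !ger0_norm ?subr_ge0// ltW.
have E x : I x = (F p x)%:E := body_powerE hK p2 pn x.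
move: hF; rewrite (E u) (E v) (E w) -!EFinM -EFinD lee_fin => hF.
apply: le_trans hF _; move: hu hv; move: (F p u) (F p v) (c `^ p) => a b r ha hb; nra.
Qed.

(** For p > -1 the function |Re z|^p may be used in place of |z|^p: the two body integrals are
    proportional, and the first involves only the real inner product, as [real_key] requires. *)
Lemma body_Re_integral (p : R) : -1 < p -> p != 0 -> exists2 c : R, 0 < c &
  forall u : Cn, body_integral K (fun z => (`|complex.Re z| `^ p)%R) u = (c * F p u)%:E.
Proof.
move=> p1 pn; have p2 : -2 < p by lra.
apply: (homogeneous_body_integral hK p2 pn n0).
- exact: planar_Re_pow.
- by move=> z; exact: powR_ge0.
- move=> r z r0; have -> : complex.Re (r%:C * z) = r * complex.Re z.
    by case: z => x y /=; rewrite mul0r subr0.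
  by rewrite normrM (ger0_norm r0) powRM.
move=> u u0; apply/andP; split; last exact: (body_integral_Re_lty hK p1 pn u0).
apply: (body_integral_gt0 hK u0 (planar_Re_pow p)); first by move=> z; exact: powR_ge0.
move=> e S e0; exists (Num.min (e `^ p) ((Num.max e S) `^ p)).
  by rewrite lt_min !powR_gt0// lt_max e0.
move=> z ez zS; have ez' : e <= `|complex.Re z| by apply: le_trans ez (ler_norm _).
have zS' := le_trans (Re_le_normc z) zS.
rewrite ge_min; have [p0|p0] := leP 0 p; apply/orP; [left|right].
  by apply: ge0_ler_powR; rewrite ?nnegrE ?(ltW e0).
have np : 0 <= - p by rewrite oppr_ge0 ltW.
have zm : `|complex.Re z| <= Num.max e S by rewrite le_max zS' orbT.
by have := ler_powRN np (lt_le_trans e0 ez') zm; rewrite opprK.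
Qed.

Lemma body_power_real_mean (p : R) (u v : Cn) : -1 < p -> p != 0 -> u != 0 -> exists c : R, forall t : R,
  let w := v + c%:C *: u in
  (p < 0 -> F p (u + t%:C *: w) + F p (u - t%:C *: w) <= 2 * F p u) /\
  (0 < p -> 2 * F p u <= F p (u + t%:C *: w) + F p (u - t%:C *: w)).
Proof.
move=> p1 pn u0; have [k k0 kE] := body_Re_integral p1 pn.
have [c cE] := real_key (rb_meas hK) (rb_conv hK) (rb_M0 hK) (rb_bound hK) (rb_d0 hK)
  (rb_inner hK) (rb_rot hK) v p1 u0.
exists c => t w; have [c1 c2] := cE t; rewrite -/w in c1 c2.
split=> pp; [have {c1 c2} := c1 pp|have {c1 c2} := c2 pp];
  rewrite (kE u) (kE (u + t%:C *: w)) (kE (u - t%:C *: w)) -EFinD -EFinM lee_fin => h.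
  by move: h; move: (F p u) (F p _) (F p _) => x y z h; nra.
by move: h; move: (F p u) (F p _) (F p _) => x y z h; nra.
Qed.

(* At the leftmost maximum of the gauge on a segment the mean inequality, rewritten on the
   segment through [w = v + c u], would be violated. *)
Lemma body_gauge_convex_lt1 (p c0 t1 : R) (u v : Cn) : -1 < p -> p < 1 -> p != 0 -> 0 < t1 < 1 ->
  0 <= c0 -> N p u <= c0 -> N p v <= c0 -> N p (t1%:C *: u + (1 - t1)%:C *: v) <= c0.
Proof.
move=> p1; have p2 : -2 < p by lra.
move=> p1' pn /andP[t10 t11] c00 Nu Nv.
have [g gN] : exists g : R -> R, forall t, g t = N p (v + t%:C *: (u - v)).
  by exists (fun t => N p (v + t%:C *: (u - v))).
have gE t : N p (t%:C *: u + (1 - t)%:C *: v) = g t.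
  rewrite gN rmorphB rmorph1 scalerBl scale1r scalerBr; congr (N p _).
  by rewrite addrCA.
rewrite gE leNgt; apply/negP => gt1.
have cg : continuous g.
  rewrite (_ : g = fun t => N p (v + t%:C *: (u - v))); last exact/funext.
  exact: (@real_line_continuous R n (N p) v (u - v) (body_gauge_continuous hK p2 pn n0)).
have [tM tM01 maxM] := EVT_max ler01 (continuous_subspaceT cg).
have [m mE] : exists m, m = g tM by exists (g tM).
have c0m : c0 < m.
  by rewrite mE; apply: (lt_le_trans gt1); apply: maxM; rewrite in_itv /= !ltW.
have m0 : 0 < m by exact: le_lt_trans c0m.
(* The maximum points form a compact set, so a leftmost one exists; to its left the gauge is
   strictly below m. *)
have cptA : compact [set t : R | t \in `[0, 1] /\ g t = m].
  apply: (subclosed_compact _ (@segment_compact _ 0 1)); last by move=> t [].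
  apply: (@closedI R `[0, 1]%classic (g @^-1` [set x | x = m])); first exact: interval_closed.
  by apply: preimage_closed; [move=> t _; exact: cg|exact: closed_eq].
have [t0 t0A mint0] := compact_EVT_min (ex_intro _ tM (conj tM01 (esym mE))) cptA
  (continuous_subspaceT (fun x => @cvg_id _ (nbhs x))).
move: t0A; rewrite inE /= in_itv /= => -[/andP[t0g t0l] gt0].
have g0 : g 0 <= c0 by rewrite gN rmorph0 scale0r addr0.
have g1 : g 1 <= c0 by rewrite gN rmorph1 scale1r addrC subrK.
have t0p : 0 < t0 by rewrite lt_neqAle t0g andbT; apply: contraTneq g0 => ->; rewrite gt0 -ltNge.
have t0s : t0 < 1 by rewrite lt_neqAle t0l andbT; apply: contraTneq g1 => <-; rewrite gt0 -ltNge.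
have glt t : 0 <= t -> t < t0 -> g t < m.
  move=> tp tt; have t01 : 0 <= t <= 1 by rewrite tp (ltW (lt_trans tt t0s)).
  rewrite lt_neqAle mE (maxM t) ?in_itv// andbT -mE.
  apply/negP => /eqP gm; have := mint0 t; rewrite inE /= in_itv /= t01.
  by move=> /(_ (conj isT gm)); rewrite leNgt tt.
have gle t : 0 <= t -> t <= 1 -> g t <= m by move=> h1 h2; rewrite mE; apply: maxM; rewrite in_itv /= h1.
(* Within dl of t0 the gauge stays positive, as the power inequalities demand. *)
have /continuous_at_realP/(_ _ m0)/nbhs_realP[dl dl0 gdl] := cg t0.
have [P PE] : exists P, P = v + t0%:C *: (u - v) by exists (v + t0%:C *: (u - v)).
have NP : N p P = m by rewrite PE -gN.
have P0 : P != 0.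
  by apply/eqP => h; move: m0; rewrite -NP h (body_gauge0 K pn) ltxx.
have [c cE] := body_power_real_mean (u - v) p1 pn P0.
have b0 : 0 < Num.min t0 (Num.min (1 - t0) dl) by rewrite !lt_min t0p subr_gt0 t0s.
have [s [[s0 sc] a1 a2 q1 q2]] := small_step c b0.
move: q1 q2; rewrite !lt_min => /andP[q1 /andP[_ /andP[q1' q1'']]] /andP[q2 /andP[q2' /andP[_ q2'']]].
have ne1 : 1 + s * c != 0 by rewrite gt_eqF.
have ne2 : 1 + - s * c != 0 by rewrite mulNr gt_eqF.
have {}a1 := ltW a1; have {}a2 := ltW a2.
have E1 : N p (P + s%:C *: (u - v + c%:C *: P)) = (1 + s * c) * g (t0 + s / (1 + s * c)).
  by rewrite PE (real_line_reparam v (u - v) t0 ne1) (body_gaugeZ hK p2 pn) normc_real -gN ger0_norm.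
have E2 : N p (P - s%:C *: (u - v + c%:C *: P)) = (1 - s * c) * g (t0 - s / (1 - s * c)).
  rewrite PE -scaleNr -rmorphN (real_line_reparam v (u - v) t0 ne2) (body_gaugeZ hK p2 pn).
  by rewrite normc_real -gN !mulNr ger0_norm.
have := cE s; rewrite /= -!(body_gauge_powR hK p2 pn) E1 E2 NP {cE E1 E2}.
move: (s / (1 + s * c)) (s / (1 - s * c)) q1 q1' q1'' q2 q2' q2'' => e1 e2 q1 q1' q1'' q2 q2' q2''.
have gp : 0 < g (t0 + e1) <= m.
  rewrite gle ?andbT; last 2 first.
  - by rewrite addr_ge0// ltW.
  - by rewrite -lerBrDl ltW.
  have : `|g (t0 + e1) - g t0| < m by apply: gdl; rewrite addrAC subrr add0r gtr0_norm.
  by rewrite gt0 ltr_norml => /andP[h _]; move: h; rewrite ltrBrDl subrr.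
have gm : 0 < g (t0 - e2) < m.
  rewrite glt ?andbT ?gtrDl ?oppr_lt0 ?subr_ge0 ?(ltW q2')//.
  have : `|g (t0 - e2) - g t0| < m by apply: gdl; rewrite addrAC subrr add0r normrN gtr0_norm.
  by rewrite gt0 ltr_norml => /andP[h _]; move: h; rewrite ltrBrDl subrr.
move=> [h1 h2]; have [pp|pp] := ltP p 0.
  exact: (power_mean_contra_lt0 pp sc m0 gp gm (h1 pp)).
have {}pp : 0 < p by rewrite lt_neqAle eq_sym pn.
exact: (power_mean_contra_gt0 pp p1' sc m0 gp gm (h2 pp)).
Qed.

(** * The endpoint p = -1 *)

Section minus_one.

(** The index k + 2 keeps q k strictly between -1 and 0, also for k = 0. *)
Let q (k : nat) : R := -1 + k.+2%:R^-1.

Let q_gt k : -1 < q k. Proof. by rewrite ltrDl invr_gt0. Qed.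

Let q_lt0 k : q k < 0.
Proof. by rewrite /q addrC subr_lt0 invf_lt1// ltr1n. Qed.

Let cvg_q : q k @[k --> \oo] --> (-1 : R).
Proof.
rewrite -[X in _ --> X](addr0 (-1)); apply: cvgD; first exact: cvg_cst.
by have h := @cvg_harmonic R; rewrite -cvg_shiftS in h.
Qed.

Let pow_mono (b r s : R) : 0 <= b -> b <= 1 -> s <= r -> r < 0 -> b `^ r <= b `^ s.
Proof.
rewrite le_eqVlt => /predU1P[<- _ sr r0|b0 b1 sr r0].
  by rewrite !powR0// lt_eqF// (le_lt_trans sr).
rewrite /powR gt_eqF// ler_expR; have : ln b <= 0 by exact: ln_le0.
by move: (ln b) => l l0; nra.
Qed.

Let cvg_pow (b : R) : 0 <= b -> b `^ q k @[k --> \oo] --> b `^ (-1).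
Proof.
rewrite le_eqVlt => /predU1P[<-|b0].
  rewrite powR0 ?oppr_eq0 ?oner_eq0//; apply: cvg_near_cst; apply: nearW => k.
  by rewrite powR0// lt_eqF.
rewrite /powR gt_eqF//; apply: (@cvg_comp _ _ _ (fun k => q k * ln b) expR _ (nbhs (-1 * ln b))).
  by apply: cvgMl; exact: cvg_q.
exact: continuous_expR.
Qed.

Let pN1 : -2 < -1 :> R. Proof. by rewrite ltrN2 ltr1n. Qed.
Let nN1 : -1 != 0 :> R. Proof. by rewrite oppr_eq0 oner_eq0. Qed.
Let q2 k : -2 < q k. Proof. exact: lt_trans pN1 (q_gt k). Qed.
Let qn k : q k != 0. Proof. by rewrite lt_eqF. Qed.

(** For |<x,u>| <= 1 the powers increase as the exponent decreases to -1, so monotone convergence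
    applies. Homogeneity reduces the general case to this one. *)
Let bounded_on_body (u : Cn) := forall x, K x -> normc (hdot x u) <= 1.

Let power_le (u : Cn) k : bounded_on_body u -> F (q k) u <= F (-1) u.
Proof.
move=> bu; rewrite -lee_fin -(body_powerE hK (q2 k) (qn k)) -(body_powerE hK pN1 nN1).
have mp r : planar (fun z : R[i] => (normc z `^ r)%R).
  by apply: (measurableT_comp (@measurable_powR R r)); exact: (@planar_normc R).
apply: ge0_le_integral.
- exact: measurableT.
- by move=> s _; rewrite lee_fin mulr_ge0// powR_ge0.
- exact: (measurable_body_integrand hK u (mp _)).
- exact: (measurable_body_integrand hK u (mp _)).
move=> s _; rewrite lee_fin.
have [Ks|Ks] := pselect (K (of_coords s)); last by rewrite !indic_notin// !mul0r.
rewrite ler_wpM2l//; apply: pow_mono; [exact: normc_ge0|exact: bu|exact: ltW|exact: q_lt0].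
Qed.

Let power_cvg (u : Cn) : bounded_on_body u -> F (q k) u @[k --> \oo] --> F (-1) u.
Proof.
move=> bu; suff h : ((F (q k) u)%:E @[k --> \oo] --> (F (-1) u)%:E)%E by exact: (fine_cvg h).
have mp r : planar (fun z : R[i] => (normc z `^ r)%R).
  by apply: (measurableT_comp (@measurable_powR R r)); exact: (@planar_normc R).
pose g k s : \bar R := (\1_K (of_coords s) * normc (hdot (of_coords s) u) `^ q k)%:E.
have cg s : (g k s @[k --> \oo] --> (\1_K (of_coords s) * normc (hdot (of_coords s) u) `^ (-1))%:E)%E.
  by apply/cvg_EFin; [exact: nearW|apply: cvgMr; exact: cvg_pow (normc_ge0 _)].
have -> : (F (-1) u)%:E = (\int[lebesgue_measure2n R n]_s limn (g ^~ s))%E.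
  rewrite -(body_powerE hK pN1 nN1); apply: eq_integral => s _.
  by apply/esym/cvg_lim => //; exact: cg.
have -> : (fun k => (F (q k) u)%:E) = (fun k => \int[lebesgue_measure2n R n]_s g k s)%E.
  by apply/funext => k; rewrite /= -(body_powerE hK (q2 k) (qn k)).
apply: cvg_monotone_convergence.
- exact: measurableT.
- by move=> k; exact: (measurable_body_integrand hK u (mp _)).
- by move=> k s _; rewrite lee_fin mulr_ge0// powR_ge0.
move=> s _ k l kl; rewrite lee_fin.
have [Ks|Ks] := pselect (K (of_coords s)); last by rewrite !indic_notin// !mul0r.
rewrite ler_wpM2l//; apply: pow_mono; [exact: normc_ge0|exact: bu| |exact: q_lt0].
by rewrite lerD2l lef_pV2 ?posrE// ler_nat.
Qed.

(** The limit is taken in strict inequalities: convergence transfers them at u and v to some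
    exponent q k, and at w monotonicity gives F (q k) w <= F (-1) w. Convexity for q k is then
    violated. *)
Let power_min (t : R) (u v w : Cn) : 0 < t < 1 -> u != 0 -> v != 0 -> w != 0 ->
  w = t%:C *: u + (1 - t)%:C *: v -> bounded_on_body u -> bounded_on_body v -> bounded_on_body w ->
  F (-1) w < F (-1) u -> F (-1) w < F (-1) v -> False.
Proof.
move=> t01 u0 v0 w0 wE bu bv bw hu hv.
have [Fw [FwE]] : exists Fw, F (-1) w = Fw by exists (F (-1) w).
rewrite FwE in hu hv.
have nu : \forall k \near \oo, Fw < F (q k) u by exact: (eventually_gt (power_cvg bu) hu).
have nv : \forall k \near \oo, Fw < F (q k) v by exact: (eventually_gt (power_cvg bv) hv).
have [k _ hk] : \forall k \near \oo, Fw < F (q k) u /\ Fw < F (q k) v.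
  exact: (filterI nu nv).
have {hk} [ku kv] := hk k (leqnn k).
have hw := power_le k bw; rewrite FwE in hw.
have Fw0 : 0 < F (q k) w := body_power_gt0 hK (q2 k) (qn k) w0.
have N0 := body_gauge_gt0 hK (q2 k) (qn k).
have lt_of (x : Cn) : F (q k) w < F (q k) x -> N (q k) x < N (q k) w.
  have NE y : N (q k) y = F (q k) y `^ (q k)^-1 by [].
  rewrite (NE x) (NE w); exact: (powR_anti (q_lt0 k) Fw0).
have h1 := lt_of _ (le_lt_trans hw ku); have h2 := lt_of _ (le_lt_trans hw kv).
have q1 : q k < 1 by exact: lt_trans (q_lt0 k) ltr01.
have Q c : 0 <= c -> N (q k) u <= c -> N (q k) v <= c -> N (q k) w <= c.
  by rewrite wE; exact: body_gauge_convex_lt1 (q_gt k) q1 (qn k) t01.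
have := N0 _ u0; move: Q h1 h2; move: (N (q k) u) (N (q k) v) (N (q k) w) => a b e Q h1 h2 a0.
have := Q (Num.max a b); rewrite !le_max (ltW a0) !lexx orbT => /(_ isT isT isT).
by case/orP => h; [move: h1|move: h2]; rewrite ltNge h.
Qed.

Lemma body_gauge_convex_minus1 (c t : R) (u v : Cn) : 0 < t < 1 -> 0 < c ->
  N (-1) u <= c -> N (-1) v <= c -> N (-1) (t%:C *: u + (1 - t)%:C *: v) <= c.
Proof.
move=> t01; have /andP[t0 t1] := t01 => c0 hu hv.
have Z := body_gaugeZ hK pN1 nN1.
have tn : normc (t%:C : R[i]) <= 1 by rewrite normc_real gtr0_norm ?ltW.
have tn' : normc ((1 - t)%:C : R[i]) <= 1 by rewrite normc_real gtr0_norm ?subr_gt0// lerBlDr lerDl ltW.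
have small (s : R[i]) x : normc s <= 1 -> N (-1) x <= c -> N (-1) (s *: x) <= c.
  move=> s1 xc; rewrite Z; apply: le_trans xc; rewrite ler_piMl//.
  exact: body_gauge_ge0.
have [->|u0] := eqVneq u 0; first by rewrite scaler0 add0r small.
have [->|v0] := eqVneq v 0; first by rewrite scaler0 addr0 small.
have [w wE] : exists w, w = t%:C *: u + (1 - t)%:C *: v by exists (t%:C *: u + (1 - t)%:C *: v).
rewrite -wE; have [->|w0] := eqVneq w 0; first by rewrite (body_gauge0 K nN1) ltW.
apply: (body_power_le_neg pN1 _ c0); first by rewrite ltrN10.
have {}hu := body_gauge_le_neg pN1 (ltrN10 R) u0 hu.
have {}hv := body_gauge_le_neg pN1 (ltrN10 R) v0 hv.
rewrite leNgt; apply/negP => hw.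
(* Dividing by S makes u, v and w simultaneously bounded by 1 on K, and multiplies all three values
   of F by the same factor. *)
pose S := 1 + M * (norm1c u + norm1c v + norm1c w).
have nn x := norm1c_ge0 (x : Cn); have M0 := rb_M0 hK.
have S0 : 0 < S by rewrite ltr_pwDl// mulr_ge0// !addr_ge0.
have lam0 : S^-1%:C != 0 :> R[i].
  by rewrite -(rmorph0 (real_complex R)) (inj_eq (@complexI R)) invr_neq0// gt_eqF.
have bd x : M * norm1c x <= S -> bounded_on_body (S^-1%:C *: x).
  move=> xS y Ky; rewrite hdotZr normcM normc_real gtr0_norm ?invr_gt0//.
  by rewrite ler_pdivrMl// mulr1; apply: le_trans (hdot_bound hK x Ky) xS.
have FZ x : F (-1) (S^-1%:C *: x) = normc (S^-1%:C : R[i]) `^ (-1) * F (-1) x := body_powerZ hK pN1 nN1 _ x.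
have k0 : 0 < normc (S^-1%:C : R[i]) `^ (-1) by rewrite powR_gt0// normc_gt0.
have lt_scale x y : F (-1) x < F (-1) y -> F (-1) (S^-1%:C *: x) < F (-1) (S^-1%:C *: y).
  by rewrite (FZ x) (FZ y) (ltr_pM2l k0).
have nz (x : Cn) : x != 0 -> S^-1%:C *: x != 0 by move=> x0; rewrite scaler_eq0 negb_or lam0.
apply: (power_min t01 (nz _ u0) (nz _ v0) (nz _ w0)).
- by rewrite wE scalerDr !scalerA ![_ * S^-1%:C]mulrC.
- by apply: bd; rewrite -[leLHS]add0r lerD// ler_wpM2l// -addrA lerDl addr_ge0.
- by apply: bd; rewrite -[leLHS]add0r lerD// ler_wpM2l// (addrC (norm1c u)) -addrA lerDl addr_ge0.
- by apply: bd; rewrite -[leLHS]add0r lerD// ler_wpM2l// lerDr addr_ge0.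
- exact: (lt_scale w u (lt_le_trans hw hu)).
- exact: (lt_scale w v (lt_le_trans hw hv)).
Qed.

End minus_one.

Lemma body_gauge_convex (p c t : R) (u v : Cn) : -1 <= p -> p != 0 -> 0 < t < 1 -> 0 < c ->
  N p u <= c -> N p v <= c -> N p (t%:C *: u + (1 - t)%:C *: v) <= c.
Proof.
rewrite le_eqVlt => /predU1P[<- _|p1 pn] t01 c0; first exact: body_gauge_convex_minus1.
have [p1'|p1'] := leP 1 p; first exact: (body_gauge_convex_ge1 p1' t01 (ltW c0)).
exact: (body_gauge_convex_lt1 p1 p1' pn t01 (ltW c0)).
Qed.

End body_convexity.

(** * Circle means and the Poisson kernel *)

Section circle_mean.
Context (R : realType).
Local Notation mR := (measurableTypeR R).
Local Notation lam := (@lebesgue_measure R).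
Local Notation tau := (2 * pi : R).
Implicit Types (g h : R[i] -> R).

Lemma cmeasV d (X : measurableType d) (f : X -> R[i]) : cmeas f -> cmeas (fun x => (f x)^-1).
Proof.
move=> mf; pose k x : R := (normc (f x) ^+ 2) `^ (-1).
have -> : (fun x => (f x)^-1) = (fun x => (k x)%:C * conjc (f x)).
  apply/funext => x; rewrite /k powR_inv1 ?sqr_ge0//.
  have [->|fx] := eqVneq (f x) 0; first by rewrite invr0 conjc0 mulr0.
  have nf : normc (f x) != 0 by rewrite gt_eqF// normc_gt0.
  apply: (mulfI fx); rewrite mulfV// mulrCA -sqr_normc -[`|f x|]/((normc (f x))%:C).
  by rewrite -rmorphXn -rmorphM mulVf ?rmorph1// expf_neq0.
have mk : measurable_fun setT k.
  apply: (measurableT_comp (@measurable_powR R (-1))).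
  by apply: measurable_funX; exact: measurable_normc.
have [f1 f2] := mf.
apply: cmeasM; first exact: cmeas_real.
have -> : (fun x => conjc (f x)) = (fun x => complex.Re (f x) +i* - complex.Im (f x)).
  by apply/funext => x; case: (f x).
by split => //=; exact: measurable_funN.
Qed.

Definition circle_continuous g : Prop := continuous (fun t : R => g (expi t)).

Definition circle_mean g : R := tau^-1 * (\int[lam]_(t in `[0, tau]) g (expi t))%R.

Let tau0 : 0 < tau. Proof. by rewrite mulr_gt0// pi_gt0. Qed.
Let tau_neq0 : tau != 0. Proof. by rewrite gt_eqF. Qed.
Let mseg : measurable (`[0, tau]%classic : set mR). Proof. exact: measurable_itv. Qed.

Lemma circle_integrable g : circle_continuous g ->
  lam.-integrable `[0, tau] (EFin \o (fun t => g (expi t))).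
Proof.
move=> cg; apply: continuous_compact_integrable; first exact: segment_compact.
exact: continuous_subspaceT.
Qed.

Lemma circle_integralE g : circle_continuous g ->
  circle_integral (fun z => (g z)%:E) = (tau * circle_mean g)%:E.
Proof.
move=> cg; rewrite /circle_mean mulrA mulfV// mul1r /Rintegral fineK//.
by apply: integrable_fin_num => //; exact: circle_integrable.
Qed.

Lemma eq_circle_mean g h : (forall z, normc z = 1 -> g z = h z) -> circle_mean g = circle_mean h.
Proof.
by move=> gh; congr (_ * _); apply: eq_Rintegral => t _; apply: gh; exact: normc_expi.
Qed.

Lemma circle_mean_cst (c : R) : circle_mean (fun=> c) = c.
Proof.
rewrite /circle_mean Rintegral_cst//.
rewrite [X in c * fine X](@lebesgue_measure_itv R `[0, tau])/= lte_fin tau0 oppr0 adde0 /=.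
by rewrite mulrCA mulVf// mulr1.
Qed.

Lemma circle_continuous_cst (c : R) : circle_continuous (fun=> c).
Proof. by move=> t; exact: cst_continuous. Qed.

Lemma circle_continuousD g h : circle_continuous g -> circle_continuous h ->
  circle_continuous (fun z => g z + h z).
Proof. by move=> cg ch t; apply: (@continuousD R R^o); [exact: cg|exact: ch]. Qed.

Lemma circle_continuousM g h : circle_continuous g -> circle_continuous h ->
  circle_continuous (fun z => g z * h z).
Proof. by move=> cg ch t; apply: (@continuousM R); [exact: cg|exact: ch]. Qed.

Lemma circle_continuousZ (c : R) g : circle_continuous g -> circle_continuous (fun z => c * g z).
Proof. by move=> cg; apply: circle_continuousM => //; exact: circle_continuous_cst. Qed.

Lemma circle_meanD g h : circle_continuous g -> circle_continuous h ->
  circle_mean (fun z => g z + h z) = circle_mean g + circle_mean h.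
Proof.
by move=> cg ch; rewrite /circle_mean (RintegralD mseg (circle_integrable cg) (circle_integrable ch)) mulrDr.
Qed.

Lemma circle_meanZ (c : R) g : circle_continuous g ->
  circle_mean (fun z => c * g z) = c * circle_mean g.
Proof.
by move=> cg; rewrite /circle_mean (RintegralZl c mseg (circle_integrable cg)) mulrCA.
Qed.

Lemma le_circle_mean g h : circle_continuous g -> circle_continuous h ->
  (forall z, normc z = 1 -> g z <= h z) -> circle_mean g <= circle_mean h.
Proof.
move=> cg ch gh; rewrite /circle_mean ler_wpM2l ?invr_ge0 ?(ltW tau0)//.
apply: le_Rintegral => //; [exact: circle_integrable|exact: circle_integrable|].
by move=> t _; apply: gh; exact: normc_expi.
Qed.

Lemma circle_bounded g : circle_continuous g -> exists2 B : R, 0 < B &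
  forall z, normc z = 1 -> `|g z| <= B.
Proof.
move=> cg; have [cM _ hM] := EVT_max (ltW tau0) (continuous_subspaceT cg).
have [cm _ hm] := EVT_min (ltW tau0) (continuous_subspaceT cg).
exists (1 + `|g (expi cM)| + `|g (expi cm)|); first by rewrite -addrA ltr_pwDl// addr_ge0.
move=> _ /expi_surj[s s01 ->]; rewrite ler_norml.
have h1 := hM s; have h2 := hm s; rewrite !in_itv /= s01 in h1 h2.
have {}h1 := h1 isT; have {}h2 := h2 isT.
have a1 := ler_norm (g (expi cM)); have a2 := ler_norm (- g (expi cm)).
rewrite normrN in a2; have b1 := normr_ge0 (g (expi cM)); have b2 := normr_ge0 (g (expi cm)).
by apply/andP; split; lra.
Qed.

(** Adding a bound of g makes it nonnegative, so that the periodicity lemmas for nonnegative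
    integrands apply; the constant is subtracted again afterwards. *)
Let shifted g (B : R) (t : mR) : \bar R := (g (expi t) + B)%:E.

Let measurable_shifted g B : circle_continuous g -> measurable_fun setT (shifted g B).
Proof.
move=> cg; apply/measurable_EFinP; apply: measurable_funD => //.
exact: (@continuous_measurable_fun R (fun t : R => g (expi t)) cg).
Qed.

Let shifted_ge0 g B t : (forall z, normc z = 1 -> `|g z| <= B) -> (0 <= shifted g B t)%E.
Proof.
move=> gB; rewrite lee_fin; have := gB _ (normc_expi t); rewrite ler_norml => /andP[h _].
by rewrite -lerBlDr sub0r.
Qed.

Let shifted_per g B t : shifted g B (t + tau)%R = shifted g B t.
Proof. by rewrite /shifted expi_2pi. Qed.

Let mean_shifted g (B : R) : circle_continuous g ->
  circle_mean g = circle_mean (fun z => g z + B) - B.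
Proof.
move=> cg; rewrite circle_meanD//; last exact: circle_continuous_cst.
by rewrite circle_mean_cst addrK.
Qed.

Lemma expi_pi : expi (pi : R) = -1.
Proof. by apply/eqP; rewrite eq_complex /= cospi sinpi oppr0 !eqxx. Qed.

Lemma circle_continuous_opp g : circle_continuous g -> circle_continuous (fun z => g (- z)).
Proof.
move=> cg t; rewrite (_ : (fun t => _) = (fun s => g (expi s)) \o (fun s : R => s + pi)).
  apply: continuous_comp; last exact: cg.
  by apply: (@continuousD R R^o); [move=> A|exact: cst_continuous].
by apply/funext => s /=; rewrite expiD expi_pi mulrN1.
Qed.

Lemma circle_continuous_sqr g : circle_continuous g -> circle_continuous (fun z => g (z ^+ 2)).
Proof.
move=> cg t; rewrite (_ : (fun t => _) = (fun s => g (expi s)) \o (fun s : R => s + s)).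
  apply: continuous_comp; last exact: cg.
  by apply: (@continuousD R R^o); move=> A.
by apply/funext => s /=; rewrite expr2 expiD.
Qed.

Lemma circle_mean_opp g : circle_continuous g -> circle_mean (fun z => g (- z)) = circle_mean g.
Proof.
move=> cg; have [B B0 gB] := circle_bounded cg.
have cg' := circle_continuous_opp cg.
rewrite (mean_shifted B cg) (mean_shifted B cg'); congr (_ * fine _ - _).
have pi01 : 0 <= (pi : R) <= tau by have := pi_ge0 R => h; apply/andP; split; lra.
rewrite -[RHS](periodic_shift (measurable_shifted B cg) _ (shifted_per g B) pi01).
  by apply: eq_integral => t _; rewrite /shifted expiD expi_pi mulrN1.
by move=> t; exact: shifted_ge0.
Qed.

Lemma circle_mean_sqr g : circle_continuous g -> circle_mean (fun z => g (z ^+ 2)) = circle_mean g.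
Proof.
move=> cg; have [B B0 gB] := circle_bounded cg.
have cg' := circle_continuous_sqr cg.
rewrite (mean_shifted B cg) (mean_shifted B cg'); congr (_ * fine _ - _).
rewrite -[RHS](periodic_double (measurable_shifted B cg) _ (shifted_per g B)).
  by apply: eq_integral => t _; rewrite /shifted expr2 -expiD -mulr2n mulr_natl.
by move=> t; exact: shifted_ge0.
Qed.

(** Averaging over z and -z leaves a function of z^2, and squaring preserves circle means. Iterated,
    this takes the place of power series below. *)
Lemma circle_mean_double g h : circle_continuous g -> circle_continuous h ->
  (forall z, normc z = 1 -> g z + g (- z) = 2 * h (z ^+ 2)) -> circle_mean g = circle_mean h.
Proof.
move=> cg ch gh; have cg' := circle_continuous_opp cg; have ch' := circle_continuous_sqr ch.
have : circle_mean g + circle_mean g = 2 * circle_mean h.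
  rewrite -{2}(circle_mean_opp cg) -(circle_mean_sqr ch) -circle_meanD// -circle_meanZ//.
  exact: eq_circle_mean.
by move=> h2; lra.
Qed.

Lemma circle_continuous_comp g (f : R[i] -> R[i]) :
  (forall z, normc z = 1 -> {for z, continuous f}) ->
  (forall z, normc z = 1 -> {for f z, continuous g}) -> circle_continuous (fun z => g (f z)).
Proof.
move=> cf cg t A hA; have e1 := normc_expi t.
exact: (@continuous_expi R t _ (cf _ e1 _ (cg _ e1 _ hA))).
Qed.

Lemma normc_one_sub (k z : R[i]) : 1 - normc k * normc z <= normc (1 - k * z).
Proof.
have := normc_leD (1 - k * z) (k * z); rewrite subrK normcM normc1.
by move=> h; rewrite lerBlDr.
Qed.

Lemma one_sub_neq0 (k z : R[i]) : normc k * normc z < 1 -> 1 - k * z != 0.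
Proof.
move=> h; rewrite -normc_gt0; apply: lt_le_trans (normc_one_sub k z).
by rewrite subr_gt0.
Qed.

Lemma locally_lipschitz_continuous (f : R[i] -> R[i]) (z : R[i]) (L r : R) : 0 < r -> 0 <= L ->
  (forall w, normc (w - z) < r -> normc (f w - f z) <= L * normc (w - z)) ->
  {for z, continuous f}.
Proof.
move=> r0 L0 fL A /nbhs_complexP[e e0 eA]; apply/nbhs_complexP.
have L1 : 0 < L + 1 by rewrite ltr_wpDl.
exists (Num.min r (e / (L + 1))); first by rewrite lt_min r0 divr_gt0.
move=> w; rewrite lt_min ltr_pdivlMr// => /andP[wr we]; apply: eA.
apply: le_lt_trans (fL w wr) _; apply: le_lt_trans we.
by rewrite mulrC ler_wpM2l ?normc_ge0// lerDl.
Qed.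

Lemma one_sub_continuous (k : R[i]) : continuous (fun z : R[i] => 1 - k * z).
Proof.
move=> z; apply: (locally_lipschitz_continuous ltr01 (normc_ge0 k)) => w _.
have -> : 1 - k * w - (1 - k * z) = - (k * (w - z)) by ring.
by rewrite normc_opp normcM.
Qed.

Lemma mobius_continuous (a k z : R[i]) : normc k * normc z < 1 ->
  {for z, continuous (fun z : R[i] => a * z / (1 - k * z))}.
Proof.
move=> k1; pose eta := 1 - normc k * normc z; have eta0 : 0 < eta by rewrite subr_gt0.
have k0 : 0 < 1 + normc k by rewrite ltr_pwDl// normc_ge0.
have n1 : eta <= normc (1 - k * z) := normc_one_sub k z.
have z0 : 1 - k * z != 0 := one_sub_neq0 k1.
apply: (@locally_lipschitz_continuous _ z (normc a / (eta / 2 * eta)) (eta / 2 / (1 + normc k))).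
- by rewrite !divr_gt0.
- by rewrite divr_ge0 ?normc_ge0// mulr_ge0 ?divr_ge0// ltW.
move=> w; rewrite ltr_pdivlMr// => wz.
have n2 : eta / 2 <= normc (1 - k * w).
  have -> : 1 - k * w = (1 - k * z) - k * (w - z) by ring.
  have := normc_leD (1 - k * z - k * (w - z)) (k * (w - z)); rewrite subrK normcM.
  have : normc k * normc (w - z) <= eta / 2.
    apply: le_trans (ltW wz); rewrite mulrC ler_wpM2l ?normc_ge0// lerDr//.
  by move: n1; move: (normc (1 - k * z)) (normc (_ - _)) (normc k * _) => x y b h1 h2 h3; lra.
have w0 : 1 - k * w != 0 by rewrite -normc_gt0; apply: lt_le_trans n2; rewrite divr_gt0.
have -> : a * w / (1 - k * w) - a * z / (1 - k * z) = a * (w - z) / ((1 - k * w) * (1 - k * z)).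
  by field; rewrite z0 w0.
rewrite !normcM normcV normcM mulrAC ler_wpM2r ?normc_ge0// ler_wpM2l ?normc_ge0//.
rewrite lef_pV2 ?posrE ?mulr_gt0 ?divr_gt0 ?normc_gt0//.
by apply: ler_pM => //; rewrite ?divr_ge0// ltW.
Qed.

Let re_mob (a k z : R[i]) : R := complex.Re (a * z / (1 - k * z)).

Lemma circle_continuous_Re_mobius (a k : R[i]) : normc k < 1 -> circle_continuous (re_mob a k).
Proof.
move=> k1; apply: (@circle_continuous_comp (@complex.Re R) (fun z => a * z / (1 - k * z))).
  by move=> z z1; apply: mobius_continuous; rewrite z1 mulr1.
by move=> z _; exact: continuous_Re.
Qed.

Let mob_step (a k : R[i]) : normc k < 1 ->
  circle_mean (re_mob a k) = circle_mean (re_mob (a * k) (k ^+ 2)).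
Proof.
move=> k1; have k2 : normc (k ^+ 2) < 1.
  by rewrite expr2 normcM -[ltRHS](mulr1 1) ltr_pM ?normc_ge0.
apply: circle_mean_double; try exact: circle_continuous_Re_mobius.
move=> z z1; rewrite /re_mob -raddfD.
have n1 : 1 - k * z != 0 by apply: one_sub_neq0; rewrite z1 mulr1.
have n2 : 1 + k * z != 0.
  by have := @one_sub_neq0 k (- z); rewrite normc_opp z1 mulr1 mulrN opprK; apply.
have n3 : 1 - k ^+ 2 * z ^+ 2 != 0.
  by apply: one_sub_neq0; rewrite [normc (z ^+ 2)]normcM z1 !mulr1.
have -> : a * z / (1 - k * z) + a * - z / (1 - k * - z) =
    2 * (a * k * z ^+ 2 / (1 - k ^+ 2 * z ^+ 2)).
  rewrite !mulrN opprK; field.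
  by rewrite exprMn n3 n2 n1.
have -> : (2 : R[i]) = 2%:C by rewrite rmorphMn rmorph1.
by case: (a * k * z ^+ 2 / _) => x y /=; rewrite mul0r subr0.
Qed.

Let mob_bound (a k : R[i]) (s : R) : normc k <= s -> s < 1 ->
  `|circle_mean (re_mob a k)| <= normc a / (1 - s).
Proof.
move=> ks s1; have k1 := le_lt_trans ks s1; have cm := circle_continuous_Re_mobius (a := a) k1.
have hz z : normc z = 1 -> `|re_mob a k z| <= normc a / (1 - s).
  move=> z1; apply: le_trans (Re_le_normc _) _; rewrite !normcM normcV z1 mulr1.
  rewrite ler_wpM2l ?normc_ge0// lef_pV2 ?posrE ?subr_gt0//.
    by apply: le_trans (normc_one_sub k z); rewrite z1 mulr1 lerB.
  by rewrite normc_gt0 one_sub_neq0// z1 mulr1.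
rewrite ler_norml -[leLHS]circle_mean_cst -[X in _ && (_ <= X)]circle_mean_cst.
apply/andP; split; apply: le_circle_mean => //; try exact: circle_continuous_cst.
  by move=> z /hz; rewrite ler_norml => /andP[].
by move=> z /hz; rewrite ler_norml => /andP[].
Qed.

(** Averaging over z and -z replaces (a, k) by (a k, k^2) without changing the mean. The coefficient
    tends to 0 geometrically while the denominator stays away from 0, so the mean is 0. *)
Lemma circle_mean_Re_mobius (a k : R[i]) : normc k < 1 ->
  circle_mean (fun z => complex.Re (a * z / (1 - k * z))) = 0.
Proof.
move=> k1; have it j : exists a' k', [/\ normc k' <= normc k,
    normc a' <= normc a * normc k ^+ j & circle_mean (re_mob a k) = circle_mean (re_mob a' k')].
  elim: j => [|j [a' [k' [h1 h2 h3]]]]; first by exists a, k; rewrite expr0 mulr1.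
  have k'1 := le_lt_trans h1 k1.
  exists (a' * k'), (k' ^+ 2); split.
  - rewrite expr2 normcM; apply: le_trans h1; rewrite ler_piMr ?normc_ge0// ltW//.
  - by rewrite normcM exprSr mulrA ler_pM ?normc_ge0.
  - by rewrite h3 mob_step.
apply/eqP; rewrite -normr_le0; apply/ler_addgt0Pr => e e0; rewrite add0r.
pose D := normc a / (1 - normc k) + 1.
have D0 : 0 < D by rewrite ltr_wpDl// divr_ge0 ?normc_ge0// subr_ge0 ltW.
have cv : normc k ^+ j @[j --> \oo] --> (0 : R) by apply: cvg_expr; rewrite ger0_norm ?normc_ge0.
have [j _ /(_ j (leqnn j)) hj] := cvgr_lt _ cv _ (divr_gt0 e0 D0).
have [a' [k' [h1 h2 h3]]] := it j.
rewrite -/(re_mob a k) h3; apply: le_trans (mob_bound _ h1 k1) _.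
rewrite ltr_pdivlMr// in hj; apply: le_trans (ltW hj).
have k0 : 0 <= normc k ^+ j by rewrite exprn_ge0// normc_ge0.
apply: (@le_trans _ _ (normc a * normc k ^+ j / (1 - normc k))).
  by rewrite ler_pM2r// invr_gt0 subr_gt0.
rewrite mulrAC mulrC ler_wpM2l// /D lerDl//.
Qed.

Let ln_mob (k z : R[i]) : R := ln (normc (1 - k * z)).

Let ln_mob_continuous (k : R[i]) : normc k < 1 -> circle_continuous (ln_mob k).
Proof.
move=> k1; apply: (@circle_continuous_comp (fun w => ln (normc w)) (fun z => 1 - k * z)).
  by move=> z _; exact: one_sub_continuous.
move=> z z1; apply: (@continuous_comp _ _ _ (@normc R) (@ln R)); first exact: continuous_normc.
by apply: continuous_ln; rewrite normc_gt0 one_sub_neq0// z1 mulr1.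
Qed.

(** As (1 - k z)(1 + k z) = 1 - k^2 z^2, the mean for k is half the mean for k^2. For |k| <= 1/2 all
    these means are bounded by ln 2, so repeated halving forces the value 0. *)
Lemma circle_mean_ln_mobius (k : R[i]) : normc k <= 2^-1 ->
  circle_mean (fun z => ln (normc (1 - k * z))) = 0.
Proof.
move=> kh; have h1 : (2^-1 : R) < 1 by rewrite invf_lt1// ltr1n.
pose B : R := ln 2.
have bound k' : normc k' <= 2^-1 -> `|circle_mean (ln_mob k')| <= B.
  move=> k'h; have k'1 := le_lt_trans k'h h1; have cm := ln_mob_continuous k'1.
  have hz z : normc z = 1 -> - B <= ln_mob k' z <= B.
    move=> z1; have n0 : 0 < normc (1 - k' * z) by rewrite normc_gt0 one_sub_neq0// z1 mulr1.
    rewrite /B -lnV ?posrE// !ler_ln ?posrE ?invr_gt0//; apply/andP; split.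
      apply: le_trans (normc_one_sub k' z); rewrite z1 mulr1.
      by rewrite lerBrDr -lerBrDl; apply: le_trans k'h _; lra.
    apply: le_trans (normc_leD _ _) _; rewrite normc1 normc_opp normcM z1 mulr1.
    by apply: (@le_trans _ _ (1 + 2^-1)); rewrite ?lerD2l//; lra.
  rewrite ler_norml -[leLHS]circle_mean_cst -[X in _ && (_ <= X)]circle_mean_cst.
  apply/andP; split; apply: le_circle_mean => //; try exact: circle_continuous_cst.
    by move=> z /hz /andP[].
  by move=> z /hz /andP[].
have it j : exists2 k', normc k' <= 2^-1 & circle_mean (ln_mob k) = 2^-1 ^+ j * circle_mean (ln_mob k').
  elim: j => [|j [k' k'h E]]; first by exists k; rewrite ?expr0 ?mul1r.
  have k'1 := le_lt_trans k'h h1.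
  have k2 : normc (k' ^+ 2) <= 2^-1.
    by rewrite expr2 normcM; apply: le_trans k'h; rewrite ler_piMr ?normc_ge0// ltW.
  exists (k' ^+ 2) => //; rewrite E exprSr -mulrA; congr (_ * _).
  have c2 := ln_mob_continuous (le_lt_trans k2 h1).
  rewrite -circle_meanZ//; apply: circle_mean_double.
  - exact: ln_mob_continuous.
  - exact: circle_continuousZ.
  move=> z z1; rewrite mulrA mulfV ?mul1r// /ln_mob -lnM ?posrE -?normcM; last 2 first.
  - by rewrite normc_gt0 one_sub_neq0// z1 mulr1.
  - by rewrite normc_gt0 one_sub_neq0// normc_opp z1 mulr1.
  by congr (ln (normc _)); ring.
apply/eqP; rewrite -normr_le0; apply/ler_addgt0Pr => e e0; rewrite add0r.
have B0 : 0 < B by rewrite ln_gt0// ltr1n.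
have cv : 2^-1 ^+ j @[j --> \oo] --> (0 : R) by apply: cvg_expr; rewrite ger0_norm ?invr_ge0.
have [j _ /(_ j (leqnn j)) hj] := cvgr_lt _ cv _ (divr_gt0 e0 B0).
have [k' k'h E] := it j; rewrite -/(ln_mob k) E normrM ger0_norm ?exprn_ge0 ?invr_ge0//.
rewrite ltr_pdivlMr// in hj; apply: le_trans (ltW hj).
by rewrite ler_wpM2l ?exprn_ge0 ?invr_ge0// bound.
Qed.

End circle_mean.

(** * The Poisson kernel and the mean inequality on a disc *)

Section poisson.
Context (R : realType).
Local Notation mR := (measurableTypeR R).
Local Notation lam := (@lebesgue_measure R).
Local Notation tau := (2 * pi : R).
Implicit Types (f : R[i] -> R) (x y z : R[i]).

Lemma cmeas_conj d (X : measurableType d) (f : X -> R[i]) : cmeas f -> cmeas (fun t => conjc (f t)).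
Proof.
move=> [f1 f2]; have -> : (fun t => conjc (f t)) = (fun t => complex.Re (f t) +i* - complex.Im (f t)).
  by apply/funext => t; case: (f t).
by split => //=; exact: measurable_funN.
Qed.

Lemma circle_integral_swap (G : R[i] -> R[i] -> \bar R) :
  measurable_fun setT (fun t : mR * mR => G (expi t.1) (expi t.2)) ->
  (forall x y, normc x = 1 -> normc y = 1 -> (0 <= G x y)%E) ->
  circle_integral (fun x => circle_integral (G x)) =
  circle_integral (fun y => circle_integral (fun x => G x y)).
Proof.
move=> mG G0; pose I (t : mR) : \bar R := (\1_(`[0, tau]%classic : set mR) t)%:E.
have mI : measurable_fun setT I by apply: measurable_indicE; exact: measurable_itv.
have I0 t : (0 <= I t)%E by rewrite lee_fin.
pose H (s t : mR) : \bar R := (I s * (I t * G (expi s) (expi t)))%E.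
have G0' s t : (0 <= G (expi s) (expi t))%E by apply: G0; exact: normc_expi.
have H0 s t : (0 <= H s t)%E by rewrite /H !mule_ge0.
have mH : measurable_fun setT (fun z : mR * mR => H z.1 z.2).
  apply: emeasurable_funM; first exact: (measurableT_comp mI measurable_fst).
  by apply: emeasurable_funM => //; exact: (measurableT_comp mI measurable_snd).
have mG1 s : measurable_fun setT (fun t : mR => I t * G (expi s) (expi t))%E.
  by apply: emeasurable_funM => //; exact: (measurableT_comp mG (measurable_pair1 s)).
have mG2 t : measurable_fun setT (fun s : mR => I s * G (expi s) (expi t))%E.
  by apply: emeasurable_funM => //; exact: (measurableT_comp mG (measurable_pair2 t)).
transitivity (\int[lam]_s \int[lam]_t H s t)%E.
  rewrite /circle_integral integral_indic_mul; apply: eq_integral => s _.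
  rewrite integral_indic_mul -/(I s) -ge0_integralZl//.
  by move=> t _; rewrite mule_ge0.
rewrite (tonelli lam lam mH H0).
rewrite [RHS]/circle_integral [RHS]integral_indic_mul; apply: eq_integral => t _.
rewrite [in RHS]/circle_integral [in RHS]integral_indic_mul -/(I t) -ge0_integralZl//.
  by apply: eq_integral => s _; rewrite /H muleCA.
by move=> s _; rewrite mule_ge0.
Qed.

Lemma continuous_at_complexP (f : R[i] -> R[i]) z :
  {for z, continuous f} <-> forall e : R, 0 < e -> \forall w \near z, normc (f w - f z) < e.
Proof.
split => [cf e e0|cf A /nbhs_complexP[e e0 eA]].
  by apply: (cf [set w | normc (w - f z) < e]); apply/nbhs_complexP; exists e.
by apply: filterS (cf _ e0) => w h; exact: eA.
Qed.

Lemma complex_continuous_addl (c : R[i]) (f : R[i] -> R[i]) z :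
  {for z, continuous f} -> {for z, continuous (fun z => c + f z)}.
Proof.
move=> /continuous_at_complexP cf; apply/continuous_at_complexP => e e0.
by apply: filterS (cf _ e0) => w; rewrite opprD addrACA subrr add0r.
Qed.

Lemma complex_continuous_mull (c : R[i]) (f : R[i] -> R[i]) z :
  {for z, continuous f} -> {for z, continuous (fun z => c * f z)}.
Proof.
move=> /continuous_at_complexP cf; apply/continuous_at_complexP => e e0.
have c0 : 0 < normc c + 1 by rewrite ltr_wpDl// normc_ge0.
apply: filterS (cf _ (divr_gt0 e0 c0)) => w; rewrite ltr_pdivlMr// -mulrBr normcM => h.
by apply: le_lt_trans h; rewrite mulrC ler_wpM2l ?normc_ge0// lerDl.
Qed.

(** With q = conj(y) x this is the real part of (1 + q)/(1 - q), the Poisson kernel of the disc,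
    written as a constant plus the real part of a Moebius function so that its mean follows from
    [circle_mean_Re_mobius]. *)
Definition poisson y x : R := 1 + 2 * complex.Re (conjc y * x / (1 - conjc y * x)).

Lemma Re_div (u v : R[i]) : complex.Re (u / v) = complex.Re (u * conjc v) / normc v ^+ 2.
Proof.
have [->|v0] := eqVneq v 0.
  by rewrite invr0 mulr0 conjc0 mulr0 /= mul0r.
have nv : normc v != 0 by rewrite gt_eqF// normc_gt0.
have -> : u / v = ((normc v ^+ 2)^-1)%:C * (u * conjc v).
  apply: (mulIf v0); rewrite mulfVK// -mulrA -(mulrA u) (mulrC (conjc v)) -sqr_normc.
  rewrite -[`|v|]/((normc v)%:C) mulrCA -rmorphXn -rmorphM mulVf ?rmorph1 ?mulr1//.
  by rewrite expf_neq0.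
by rewrite mulrC; case: (u * conjc v) => a b /=; rewrite mulr0 subr0.
Qed.

Lemma poissonE y x : normc x = 1 -> normc y < 1 ->
  poisson y x = (1 - normc y ^+ 2) / normc (x - y) ^+ 2.
Proof.
move=> x1 y1; pose q := conjc y * x.
have q1 : normc q = normc y by rewrite normcM normc_conj x1 mulr1.
have xx : x * conjc x = 1 by rewrite -sqr_normc -[`|x|]/((normc x)%:C) x1 rmorph1 expr1n.
have nq : normc (x - y) = normc (1 - q).
  have -> : x - y = x * conjc (1 - q).
    have -> : conjc (1 - q) = 1 - y * conjc x.
      by rewrite rmorphB rmorph1 /q -[y in RHS]conjcK -conjcM.
    by rewrite mulrBr mulr1 mulrCA xx mulr1.
  by rewrite normcM x1 mul1r normc_conj.
have q0 : 1 - q != 0 by rewrite one_sub_neq0// normc_conj x1 mulr1.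
have nq0 : normc (1 - q) ^+ 2 != 0 by rewrite expf_neq0// gt_eqF// normc_gt0.
rewrite /poisson -/q Re_div nq -q1; apply: (mulIf nq0); rewrite mulfVK// mulrDl mul1r mulrA mulfVK//.
have sq z : normc z ^+ 2 = complex.Re z ^+ 2 + complex.Im z ^+ 2.
  by case: z => a b /=; rewrite sqr_sqrtr// addr_ge0// sqr_ge0.
by rewrite !sq; case: (q) => a b /=; ring.
Qed.

Lemma poisson_ge0 y x : normc x = 1 -> normc y < 1 -> 0 <= poisson y x.
Proof.
move=> x1 y1; rewrite poissonE// divr_ge0 ?sqr_ge0// subr_ge0 expr_le1 ?normc_ge0// ltW//.
Qed.

(** Since 1 - s <= |z - s x|, the triangle inequality gives |z - x| <= 2 |z - s x|, whose square is
    the denominator of the kernel. *)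
Lemma poisson_concentrated (s : R) x z : 0 <= s -> s < 1 -> normc x = 1 -> normc z = 1 ->
  poisson (s%:C * x) z * normc (z - x) ^+ 2 <= 4 * (1 - s ^+ 2).
Proof.
move=> s0 s1 x1 z1.
have sx : normc (s%:C * x) = s by rewrite normcM normc_real ger0_norm// x1 mulr1.
rewrite poissonE ?sx// mulrAC -mulrA mulrC.
have n1 : 1 - s <= normc (z - s%:C * x).
  by have := normc_leB z (s%:C * x); rewrite z1 sx; apply: le_trans; exact: ler_norm.
have n2 : normc (z - x) <= normc (z - s%:C * x) + (1 - s).
  have -> : z - x = (z - s%:C * x) + (s - 1)%:C * x by rewrite rmorphB rmorph1; ring.
  apply: le_trans (normc_leD _ _) _; rewrite lerD2l normcM normc_real x1 mulr1.
  by rewrite distrC ger0_norm// subr_ge0 ltW.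
have n0 : 0 < normc (z - s%:C * x) by apply: lt_le_trans n1; rewrite subr_gt0.
rewrite ler_wpM2r//; first by rewrite subr_ge0 expr_le1// ltW.
rewrite ler_pdivrMr ?exprn_gt0//.
have := normc_ge0 (z - x); move: n1 n2 n0.
move: (normc (z - x)) (normc (z - _)) => a b; nra.
Qed.

Lemma poisson_continuous y : normc y < 1 -> circle_continuous (poisson y).
Proof.
move=> y1; apply: circle_continuousD; first exact: circle_continuous_cst.
by apply/circle_continuousZ/circle_continuous_Re_mobius; rewrite normc_conj.
Qed.

Lemma circle_mean_poisson y : normc y < 1 -> circle_mean (poisson y) = 1.
Proof.
move=> y1; have y1' : normc (conjc y) < 1 by rewrite normc_conj.
have c1 := circle_continuous_Re_mobius (a := conjc y) y1'.
rewrite /poisson circle_meanD; last 2 first.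
- exact: circle_continuous_cst.
- exact: circle_continuousZ.
by rewrite circle_mean_cst circle_meanZ// circle_mean_Re_mobius// mulr0 addr0.
Qed.

Lemma poisson_sym y x : poisson y x = 1 + 2 * complex.Re (conjc x * y / (1 - conjc x * y)).
Proof.
have Rec (z : R[i]) : complex.Re (conjc z) = complex.Re z by case: z.
have -> : conjc x * y = conjc (conjc y * x) by rewrite conjcM conjcK mulrC.
rewrite /poisson; move: (conjc y * x) => q; congr (1 + 2 * _).
have -> : conjc q / (1 - conjc q) = conjc (q / (1 - q)) by rewrite fmorph_div rmorphB rmorph1.
by rewrite Rec.
Qed.

(* In the variable [y] the Poisson kernel is, up to a constant, the real part of a Moebius
   function; composed with another Moebius function it keeps this form. *)
Lemma circle_mean_poisson_mobius y0 x (a k : R[i]) : normc x = 1 -> normc y0 < 1 ->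
  normc k <= 2^-1 -> normc a <= (1 - normc y0) / 4 ->
  circle_mean (fun z => poisson (y0 + a * z / (1 - k * z)) x) = poisson y0 x.
Proof.
move=> x1 y1 kh ah; pose b := conjc x; have b1 : normc b = 1 by rewrite normc_conj.
have d0 : 0 < 1 - normc y0 by rewrite subr_gt0.
have y00 : 1 - b * y0 != 0 by rewrite one_sub_neq0// b1 mul1r.
have n1 : 1 - normc y0 <= normc (1 - b * y0) by have := normc_one_sub b y0; rewrite b1 mul1r.
pose g := b * a / (1 - b * y0) ^+ 2; pose h := b * a / (1 - b * y0) + k.
have h1 : normc h < 1.
  apply: le_lt_trans (normc_leD _ _) _; rewrite !normcM b1 mul1r normcV.
  have h4 : normc a / normc (1 - b * y0) <= 4^-1.
    rewrite ler_pdivrMr ?normc_gt0//; apply: le_trans ah _.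
    by rewrite mulrC ler_pM2l// invr_gt0.
  by apply: (@le_lt_trans _ _ (4^-1 + 2^-1)); [exact: lerD|lra].
have E z : normc z = 1 -> poisson (y0 + a * z / (1 - k * z)) x =
    poisson y0 x + 2 * complex.Re (g * z / (1 - h * z)).
  move=> z1; rewrite !poisson_sym -addrA -mulrDr -raddfD; congr (1 + 2 * complex.Re _).
  have k0 : 1 - k * z != 0.
    by rewrite one_sub_neq0// z1 mulr1; apply: le_lt_trans kh _; rewrite invf_lt1// ltr1n.
  have h0 : 1 - h * z != 0 by rewrite one_sub_neq0// z1 mulr1.
  have hE : 1 - h * z = ((1 - b * y0) * (1 - k * z) - b * a * z) / (1 - b * y0).
    by rewrite /h; field.
  have n0 : (1 - b * y0) * (1 - k * z) - b * a * z != 0.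
    by move: h0; rewrite hE mulf_eq0 invr_eq0 negb_or => /andP[].
  have yE : 1 - b * (y0 + a * z / (1 - k * z)) =
      ((1 - b * y0) * (1 - k * z) - b * a * z) / (1 - k * z) by field.
  rewrite -/b yE hE /g; move: y00 k0 n0.
  move: (b) (y0) => b' y0' y00 k0 n0; field.
  by rewrite y00 k0 n0.
rewrite (eq_circle_mean E) circle_meanD; last 2 first.
- exact: circle_continuous_cst.
- exact/circle_continuousZ/circle_continuous_Re_mobius.
rewrite circle_mean_cst circle_meanZ; last exact: circle_continuous_Re_mobius.
by rewrite circle_mean_Re_mobius// mulr0 addr0.
Qed.

Lemma poisson_lipschitz (s : R) y y' x : normc x = 1 -> s < 1 -> normc y <= s -> normc y' <= s ->
  `|poisson y' x - poisson y x| <= 2 / (1 - s) ^+ 2 * normc (y' - y).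
Proof.
move=> x1 s1 ys ys'; pose b := conjc x; have b1 : normc b = 1 by rewrite normc_conj.
have d0 : 0 < 1 - s by rewrite subr_gt0.
have nn z : normc z <= s -> 1 - s <= normc (1 - b * z).
  move=> zs; have := normc_one_sub b z; rewrite b1 mul1r; apply: le_trans.
  by rewrite lerB.
have n0 z : normc z <= s -> 1 - b * z != 0.
  by move=> zs; rewrite one_sub_neq0// b1 mul1r; exact: le_lt_trans s1.
have -> : poisson y' x - poisson y x =
    2 * complex.Re (b * (y' - y) / ((1 - b * y') * (1 - b * y))).
  rewrite !poisson_sym -/b opprD addrACA subrr add0r -mulrBr -raddfB; congr (2 * complex.Re _).
  by field; rewrite !n0.
rewrite normrM ger0_norm// -!mulrA ler_wpM2l//; apply: le_trans (Re_le_normc _) _.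
rewrite !normcM normcV normcM b1 mul1r mulrC ler_wpM2r ?normc_ge0//.
rewrite lef_pV2 ?posrE ?exprn_gt0 ?mulr_gt0 ?normc_gt0 ?n0//.
by rewrite expr2 ler_pM ?nn// ltW.
Qed.

Section harmonic_extension.
Variables (g : R[i] -> R) (s : R).
Hypotheses (cg : circle_continuous g) (s0 : 0 < s) (s1 : s < 1).
Hypothesis g0 : forall z, normc z = 1 -> 0 <= g z.

Definition poisson_extension x : R := circle_mean (fun z => poisson (s%:C * x) z * g z).
Local Notation T := poisson_extension.

Let nsx x : normc (s%:C * x) = s * normc x.
Proof. by rewrite normcM normc_real gtr0_norm. Qed.

Let cPg x : normc (s%:C * x) < 1 -> circle_continuous (fun z => poisson (s%:C * x) z * g z).
Proof. by move=> h; apply: circle_continuousM => //; exact: poisson_continuous. Qed.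

Lemma poisson_extension0 : T 0 = circle_mean g.
Proof.
apply: eq_circle_mean => z _; rewrite mulr0 /poisson conjc0 !mul0r /= mulr0 addr0 mul1r.
by [].
Qed.

Lemma poisson_extension_continuous x : normc x <= 1 -> {for x, continuous T}.
Proof.
move=> x1; have [B B0 gB] := circle_bounded cg; have h0 := s0; have h1 := s1.
pose s' := (1 + s) / 2; have s'1 : s' < 1 by rewrite /s'; lra.
have r0 : 0 < (1 - s) / 2 by rewrite divr_gt0// subr_gt0.
have lt1 : s <= s' by rewrite /s'; lra.
have near_x x' : normc (x' - x) < (1 - s) / 2 -> normc (s%:C * x') <= s'.
  move=> h; rewrite nsx; have := normc_leD (x' - x) x; rewrite subrK => h2.
  have := normc_ge0 x'; move: h h2 x1; rewrite /s'.
  move: (normc x') (normc x) (normc _) => a b c; nra.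
have nx : normc (s%:C * x) <= s'.
  by apply: near_x; rewrite subrr normc0.
pose L := 2 / (1 - s') ^+ 2 * B.
have L0 : 0 <= L by rewrite mulr_ge0 ?(ltW B0)// divr_ge0 ?sqr_ge0.
have Lip x' : normc (x' - x) < (1 - s) / 2 -> `|T x' - T x| <= L * normc (x' - x).
  move=> h; have nx' := near_x _ h.
  have lx := le_lt_trans nx s'1; have lx' := le_lt_trans nx' s'1.
  have cx := cPg lx; have cx' := cPg lx'.
  have cN : circle_continuous (fun z => -1 * (poisson (s%:C * x) z * g z)) by exact: circle_continuousZ.
  have -> : T x' - T x = circle_mean (fun z => poisson (s%:C * x') z * g z + -1 * (poisson (s%:C * x) z * g z)).
    by rewrite circle_meanD// circle_meanZ// mulN1r.
  have pt z : normc z = 1 -> `|poisson (s%:C * x') z * g z + -1 * (poisson (s%:C * x) z * g z)| <= L * normc (x' - x).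
    move=> z1; rewrite mulN1r -mulrBl normrM.
    have := poisson_lipschitz z1 s'1 nx nx'; rewrite -mulrBr nsx => h2.
    apply: (@le_trans _ _ (2 / (1 - s') ^+ 2 * (s * normc (x' - x)) * B)).
      by apply: ler_pM => //; exact: gB.
    rewrite /L -!mulrA ler_wpM2l// ler_wpM2l ?invr_ge0 ?sqr_ge0//.
    by rewrite mulrA (mulrC B) ler_wpM2r ?(ltW B0)// ler_piMl ?normc_ge0// ltW.
  have cD := circle_continuousD cx' cN.
  rewrite ler_norml -[leLHS]circle_mean_cst -[X in _ && (_ <= X)]circle_mean_cst.
  apply/andP; split; apply: le_circle_mean => //; try exact: circle_continuous_cst.
    by move=> z /pt; rewrite ler_norml => /andP[].
  by move=> z /pt; rewrite ler_norml => /andP[].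
apply/continuous_at_realP => e e0; apply/nbhs_complexP.
have L1 : 0 < L + 1 by rewrite ltr_wpDl.
exists (Num.min ((1 - s) / 2) (e / (L + 1))); first by rewrite lt_min r0 divr_gt0.
move=> x'; rewrite lt_min => /andP[h he]; rewrite (ltr_pdivlMr _ _ L1) in he.
apply: le_lt_trans (Lip _ h) _; apply: le_lt_trans he.
by rewrite mulrC ler_wpM2l ?normc_ge0// lerDl.
Qed.

(** Tonelli exchanges the Moebius circle with the Poisson integral, and [circle_mean_poisson_mobius]
    evaluates the inner mean. The bounds on a and k keep the image circle in the closed unit disc; g
    >= 0 makes the integrand nonnegative. *)
Lemma poisson_extension_mobius x0 (a k : R[i]) : normc k <= 2^-1 -> 2 * normc a <= 1 - normc x0 ->
  normc a <= (1 - s) / 4 -> normc x0 <= 1 ->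
  circle_continuous (fun z => T (x0 + a * z / (1 - k * z))) /\
  circle_mean (fun z => T (x0 + a * z / (1 - k * z))) = T x0.
Proof.
move=> kh ax as4 x01; have k1 : normc k < 1.
  by apply: le_lt_trans kh _; rewrite invf_lt1// ltr1n.
pose m z := x0 + a * z / (1 - k * z).
have m1 z : normc z = 1 -> normc (m z) <= 1.
  move=> z1; apply: le_trans (normc_leD _ _) _; rewrite -lerBrDl; apply: le_trans ax.
  rewrite !normcM normcV z1 mulr1 mulrC ler_wpM2r ?normc_ge0//.
  have h := normc_one_sub k z; rewrite z1 mulr1 in h.
  rewrite -(invrK 2) lef_pV2 ?posrE ?invr_gt0//; first by lra.
  by rewrite normc_gt0 one_sub_neq0// z1 mulr1.
have cm z : normc z = 1 -> {for z, continuous m}.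
  move=> z1; apply: (@complex_continuous_addl x0 (fun z => a * z / (1 - k * z))).
  by apply: mobius_continuous; rewrite z1 mulr1.
have cT : circle_continuous (fun z => T (m z)).
  apply: circle_continuous_comp cm _ => z z1; apply: poisson_extension_continuous.
  exact: m1.
split => //.
have tau0 : 0 < tau by rewrite mulr_gt0// pi_gt0.
have sm z : normc z = 1 -> normc (s%:C * m z) < 1.
  by move=> z1; rewrite nsx; apply: le_lt_trans s1; rewrite ler_piMr ?(ltW s0)// m1.
have sx0 : normc (s%:C * x0) < 1 by rewrite nsx; apply: le_lt_trans s1; rewrite ler_piMr ?(ltW s0).
have mG : measurable_fun setT (fun t : mR * mR => (poisson (s%:C * m (expi t.1)) (expi t.2) * g (expi t.2))%:E).
  apply/measurable_EFinP; apply: measurable_funM; last first.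
    apply: (measurableT_comp _ measurable_snd (f := fun t : mR => g (expi t))).
    exact: (@continuous_measurable_fun R (fun t : R => g (expi t)) cg).
  apply: measurable_funD => //; apply: measurable_funM => //.
  have c1 : cmeas (fun t : mR * mR => m (expi t.1)).
    apply: cmeasD; first exact: cmeas_cst.
    by apply: cmeasM; [cm|apply: cmeasV; cm].
  have c2 : cmeas (fun t : mR * mR => conjc (s%:C * m (expi t.1)) * expi t.2).
    by apply: cmeasM; [apply: cmeas_conj; apply: cmeasM => //; exact: cmeas_cst|cm].
  have [] // : cmeas (fun t : mR * mR => conjc (s%:C * m (expi t.1)) * expi t.2 /
      (1 - conjc (s%:C * m (expi t.1)) * expi t.2)).
  by apply: cmeasM => //; apply: cmeasV; apply: cmeasD; [exact: cmeas_cst|exact: cmeasN].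
have swap : circle_integral (fun x => circle_integral (fun z => (poisson (s%:C * m x) z * g z)%:E)) =
    circle_integral (fun z => circle_integral (fun x => (poisson (s%:C * m x) z * g z)%:E)).
  apply: (circle_integral_swap (G := fun x z => (poisson (s%:C * m x) z * g z)%:E) mG) => x y x1 y1.
  by rewrite lee_fin mulr_ge0 ?g0// poisson_ge0// sm.
have LE : circle_integral (fun x => circle_integral (fun z => (poisson (s%:C * m x) z * g z)%:E)) =
    (tau * (tau * circle_mean (fun z => T (m z))))%:E.
  rewrite -circle_meanZ// -circle_integralE; last exact: circle_continuousZ.
  apply: eq_integral => t _; rewrite circle_integralE//; apply: cPg.
  by apply: sm; exact: normc_expi.
have RE : circle_integral (fun z => circle_integral (fun x => (poisson (s%:C * m x) z * g z)%:E)) =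
    (tau * (tau * T x0))%:E.
  rewrite /T -circle_meanZ; last exact: cPg.
  rewrite -circle_integralE; last by apply: circle_continuousZ; exact: cPg.
  apply: eq_integral => t _; have e1 := normc_expi t.
  pose mp := fun x => g (expi t) * poisson (s%:C * m x) (expi t).
  have E x : s%:C * m x = s%:C * x0 + s%:C * a * x / (1 - k * x) by rewrite /m mulrDr !mulrA.
  have sa : normc (s%:C * a) <= (1 - normc (s%:C * x0)) / 4.
    rewrite !nsx; have := normc_ge0 a; have h0 := s0; have h1 := s1; move: as4 x01 (normc_ge0 x0).
    by move: (normc a) (normc x0) => u v; nra.
  have cP : circle_continuous (fun x => poisson (s%:C * m x) (expi t)).
    apply: (@circle_continuous_comp R (fun y => poisson y (expi t)) (fun x => s%:C * m x)) => [z z1|z z1].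
      by apply: (@complex_continuous_mull s%:C m); exact: cm.
    apply/continuous_at_realP => e e0; apply/nbhs_complexP.
    pose s2 := (1 + normc (s%:C * m z)) / 2.
    have mz := sm _ z1; have s21 : s2 < 1 by rewrite /s2; lra.
    have d2 : 0 < (1 - normc (s%:C * m z)) / 2 by rewrite divr_gt0// subr_gt0.
    have L0 : 0 < 2 / (1 - s2) ^+ 2 by rewrite divr_gt0// exprn_gt0// subr_gt0.
    exists (Num.min ((1 - normc (s%:C * m z)) / 2) (e / (2 / (1 - s2) ^+ 2))); first by rewrite lt_min d2 divr_gt0.
    move=> w; rewrite lt_min => /andP[w1 w2]; rewrite (ltr_pdivlMr _ _ L0) in w2.
    apply: le_lt_trans (poisson_lipschitz (s := s2) e1 s21 _ _) _.
    - by rewrite /s2; lra.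
    - by have := normc_leD (w - s%:C * m z) (s%:C * m z); rewrite subrK /s2; lra.
    - by rewrite mulrC.
  transitivity (circle_integral (fun x => (g (expi t) * poisson (s%:C * m x) (expi t))%:E)).
    by apply: eq_integral => t' _; rewrite mulrC.
  rewrite circle_integralE; last exact: circle_continuousZ.
  rewrite circle_meanZ//.
  have -> : circle_mean (fun x => poisson (s%:C * m x) (expi t)) = poisson (s%:C * x0) (expi t).
    rewrite -(circle_mean_poisson_mobius e1 sx0 kh sa); apply: eq_circle_mean => x _.
    by rewrite E.
  by rewrite (mulrC (g _)).
move: swap; rewrite LE RE => -[] /(mulfI (lt0r_neq0 tau0)) /(mulfI (lt0r_neq0 tau0)).
by [].
Qed.

End harmonic_extension.

Lemma circle_uniform_continuity (f : R[i] -> R) (e : R) : 0 < e ->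
  (forall z, normc z = 1 -> {for z, continuous f}) -> exists2 dl : R, 0 < dl &
  forall x z, normc x = 1 -> normc z = 1 -> normc (z - x) < dl -> `|f z - f x| <= e.
Proof.
move=> e0 cf; pose S := [set z : R[i] | normc z = 1].
have cptS : compact S.
  apply: (subclosed_compact _ (compact_disc (r := 1))); last by move=> z /= ->.
  rewrite (_ : S = @normc R @^-1` [set x | x = 1])//.
  by apply: preimage_closed; [move=> z _; exact: continuous_normc|exact: closed_eq].
have e2 : 0 < e / 2 by rewrite divr_gt0.
pose P (dl : R) (x : R[i]) := forall z, normc (z - x) < dl -> `|f z - f x| <= e.
have ev : \forall dl \near (0 : R)^'+, S `<=` P dl.
  apply: ((compact_near_coveringP S).1 cptS R (0 : R)^'+ P) => x Sx.
  have /continuous_at_realP/(_ _ e2)/nbhs_complexP[r r0 hr] := cf x Sx.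
  have r2 : 0 < r / 2 by rewrite divr_gt0.
  exists ([set x' | normc (x' - x) < r / 2], [set dl | dl < r / 2]) => /=.
    by split; [apply/nbhs_complexP; exists (r / 2)|exact: nbhs_right_lt].
  move=> [x' dl] /= [h1 h2] z h3.
  have hz : normc (z - x) < r.
    rewrite (_ : z - x = (z - x') + (x' - x)); last by ring.
    by apply: le_lt_trans (normc_leD _ _) _; move: h1 h2 h3; move: (normc _) (normc _) => u v; lra.
  have hx' : normc (x' - x) < r by apply: lt_trans h1 _; rewrite ltr_pdivrMr// ltr_pMr// ltr1n.
  have := ler_distD (f x) (f z) (f x'); have := hr _ hz; have := hr _ hx'.
  by rewrite (distrC (f x)); lra.
have [dl [/= d0 hd]] := (filter_ex (filterI (nbhs_right_gt (0 : R)) ev)).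
by exists dl => // x z x1 z1; exact: hd.
Qed.

(* Compare [f] with the Poisson extension [T] of its boundary values, taken on the slightly
   smaller radius [s] so that [T] is continuous up to the boundary; the term [e |x|^2] makes
   the mean inequality for [f - T + e |x|^2] strict, which excludes interior maxima. *)
Lemma unit_disc_submean (f : R[i] -> R) :
  (forall z, normc z <= 1 -> {for z, continuous f}) ->
  (forall x, normc x < 1 -> exists c : R[i], exists2 r0 : R, 0 < r0 & forall r : R, 0 < r < r0 ->
     f x <= circle_mean (fun z => f (x + r%:C * z / (1 - c * r%:C * z)))) ->
  f 0 <= circle_mean f.
Proof.
move=> cf loc.
have ccf : circle_continuous f.
  apply: (@circle_continuous_comp R f id) => [z _|z z1]; first by move=> A.
  by apply: cf; rewrite z1.
have [B B0 fB] := circle_bounded ccf.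
apply/ler_addgt0Pr => e3 e30; pose e := e3 / 3; have e0 : 0 < e by rewrite divr_gt0.
have cf1 z : normc z = 1 -> {for z, continuous f} by move=> z1; apply: cf; rewrite z1.
have [dl dl0 hdl] := circle_uniform_continuity e0 cf1.
(* At distance dl or more, the quadratic term with this constant exceeds the largest possible
   oscillation 2 B of f on the circle; closer than dl, uniform continuity suffices. *)
pose C := 2 * B / dl ^+ 2; have C0 : 0 < C by rewrite divr_gt0 ?mulr_gt0 ?exprn_gt0.
have fC x z : normc x = 1 -> normc z = 1 -> f x - e - C * normc (z - x) ^+ 2 <= f z.
  move=> x1 z1; have [h|h] := ltP (normc (z - x)) dl.
    have := hdl x z x1 z1 h; rewrite ler_norml => /andP[h1 _].
    have : 0 <= C * normc (z - x) ^+ 2 by rewrite mulr_ge0 ?sqr_ge0// ltW.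
    by move: h1; move: (f x) (f z) (C * _) => u v w h1 h2; lra.
  have h2 : 2 * B <= C * normc (z - x) ^+ 2.
    rewrite /C mulrAC ler_pdivlMr ?exprn_gt0// ler_pM2l ?mulr_gt0//.
    by rewrite ler_pXn2r ?nnegrE ?normc_ge0// ltW.
  have := fB x x1; have := fB z z1; rewrite !ler_norml => /andP[h3 _] /andP[_ h4].
  by move: h2 h3 h4 e0; move: (f x) (f z) (C * _) => u v w; clearbody e; lra.
(* For s = 1 - eta one has 4 C (1 - s^2) <= 8 C eta <= e, so the kernel concentrates enough. *)
pose eta := Num.min 2^-1 (e / (8 * C)).
have eta0 : 0 < eta by rewrite lt_min invr_gt0 ltr0n divr_gt0// mulr_gt0.
have [s [s0 s1 sC]] : exists s : R, [/\ 0 < s, s < 1 & C * (4 * (1 - s ^+ 2)) <= e].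
  have eta2 : eta <= 2^-1 by rewrite /eta ge_min lexx.
  have eta3 : eta * (8 * C) <= e.
    have h : eta <= e / (8 * C) by rewrite /eta ge_min lexx orbT.
    by move: h; rewrite ler_pdivlMr// mulr_gt0.
  exists (1 - eta); clearbody eta e C; split; [lra|lra|nra].
(* The shift makes the boundary values nonnegative; it passes through T unchanged because the kernel
   has mean 1. *)
pose g z := f z + B.
have cg : circle_continuous g by apply: circle_continuousD => //; exact: circle_continuous_cst.
have g0 z : normc z = 1 -> 0 <= g z.
  by move=> z1; have := fB z z1; rewrite ler_norml /g => /andP[h _]; rewrite -lerBlDr sub0r.
pose T := poisson_extension g s.
have cT x : normc x <= 1 -> {for x, continuous T} := poisson_extension_continuous cg s0 s1 (x := x).
have T0 : T 0 = circle_mean f + B.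
  by rewrite /T poisson_extension0// circle_meanD ?circle_mean_cst//; exact: circle_continuous_cst.
have bd x : normc x = 1 -> g x <= T x + 2 * e.
  move=> x1; have sx : normc (s%:C * x) < 1 by rewrite normcM normc_real gtr0_norm// x1 mulr1.
  have cP := poisson_continuous sx.
  have cPg : circle_continuous (fun z => poisson (s%:C * x) z * g z) by exact: circle_continuousM.
  have cR : circle_continuous (fun z => (g x - e) * poisson (s%:C * x) z + - e).
    by apply: circle_continuousD; [exact: circle_continuousZ|exact: circle_continuous_cst].
  have : circle_mean (fun z => (g x - e) * poisson (s%:C * x) z + - e) <= T x.
    apply: le_circle_mean => // z z1.
    have P0 := poisson_ge0 z1 sx; have h1 := fC x z x1 z1.
    have h2 := poisson_concentrated (ltW s0) s1 x1 z1.
    have {}h2 : C * (poisson (s%:C * x) z * normc (z - x) ^+ 2) <= e.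
      by apply: le_trans sC; rewrite ler_wpM2l// ltW.
    have h3 : poisson (s%:C * x) z * (f x - e - C * normc (z - x) ^+ 2) <= poisson (s%:C * x) z * f z.
      by rewrite ler_wpM2l.
    rewrite /g; move: h2 h3; move: (poisson _ _) (f x) (f z) (normc _ ^+ 2) => p u v w h2 h3.
    by clearbody e C; nra.
  rewrite circle_meanD; last 2 first.
  - exact: circle_continuousZ.
  - exact: circle_continuous_cst.
  rewrite circle_meanZ// circle_mean_cst circle_mean_poisson// mulr1.
  by move: (g x) (T x) => u v h; lra.
pose H x := f x + B - T x + e * normc x ^+ 2.
have cH x : normc x <= 1 -> {for x, continuous H}.
  move=> x1; have c1 := cf x x1; have c2 := cT x x1.
  have c3 := @continuous_normc R x.
  have c4 := @continuous_comp _ _ _ (@normc R) (fun y : R => y ^+ 2) x c3 (@exprn_continuous R 2 _).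
  have c5 := @continuousM R _ (fun=> e) _ x (@cst_continuous _ _ e x) c4.
  have c6 := @continuousD R R^o _ f (fun=> B) x c1 (@cst_continuous _ _ B x).
  have c7 := @continuousB R R^o _ _ T x c6 c2.
  exact: (@continuousD R R^o _ _ _ x c7 c5).
have H0 : H 0 = f 0 - circle_mean f.
  by rewrite /H T0 normc0 expr0n mulr0 addr0 opprD addrACA subrr addr0.
have [x0 x0D maxH] := @compact_EVT_max _ R H [set z : R[i] | normc z <= 1]
  (ex_intro _ 0 (eq_ind_r (fun u => u <= 1) ler01 (normc0 R))) (compact_disc (r := 1))
  (continuous_in_subspaceT (fun x xD => cH x (set_mem xD))).
rewrite inE /= in x0D.
have D0 : normc (0 : R[i]) <= 1 by rewrite normc0.
have HH0 : H 0 <= H x0 by apply: maxH; rewrite inE; exact: D0.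
(* On the boundary H is at most 3 e: 2 e from the approximation of g by T and e from the quadratic
   term. An interior maximum is refuted below. *)
move: x0D; rewrite le_eqVlt => /predU1P[x01|x01].
  have hb := bd _ x01; rewrite -lerBlDl -H0; move: HH0 hb; rewrite {2}/H x01 expr1n mulr1 /g.
  by rewrite /e; move: (H 0) (f x0) (T x0) => u v w; lra.
exfalso.
have [c [r0 r00 hc]] := loc x0 x01.
have d0 : 0 < 1 - normc x0 by rewrite subr_gt0.
have c1 : 0 < normc c + 1 by rewrite ltr_wpDl// normc_ge0.
have [r [rp rr0 rx rs rc]] : exists r : R, [/\ 0 < r, r < r0, 2 * r <= 1 - normc x0, r <= (1 - s) / 4
    & normc c * r <= 2^-1].
  have s1' : 0 < (1 - s) / 4 by rewrite divr_gt0// subr_gt0.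
  exists (Num.min (Num.min (r0 / 2) ((1 - normc x0) / 2)) (Num.min ((1 - s) / 4) (2^-1 / (normc c + 1)))).
  split.
  - by rewrite !lt_min s1' !divr_gt0// invr_gt0.
  - by rewrite !gt_min ltr_pdivrMr// ltr_pMr// ltr1n.
  - by rewrite mulrC -ler_pdivlMr// !ge_min lexx orbT.
  - by rewrite !ge_min lexx !orbT.
  - apply: (@le_trans _ _ (normc c * (2^-1 / (normc c + 1)))).
      by rewrite ler_wpM2l ?normc_ge0// !ge_min lexx !orbT.
    by rewrite mulrA ler_pdivrMr// mulrC ler_pM2l ?invr_gt0// lerDl.
have nr : normc (r%:C : R[i]) = r by rewrite normc_real gtr0_norm.
pose k := c * r%:C; have kh : normc k <= 2^-1 by rewrite normcM nr.
have k1 : normc k < 1 by apply: le_lt_trans kh _; rewrite invf_lt1// ltr1n.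
pose w z := r%:C * z / (1 - k * z); pose m z := x0 + w z.
have wz z : normc z = 1 -> r / 2 <= normc (w z) <= 2 * r.
  move=> z1; rewrite !normcM normcV nr z1 mulr1.
  have h1 := normc_one_sub k z; rewrite z1 mulr1 in h1.
  have h2 : normc (1 - k * z) <= 2.
    by apply: le_trans (normc_leD _ _) _; rewrite normc1 normc_opp normcM z1 mulr1; lra.
  have h3 : 2^-1 <= normc (1 - k * z) by lra.
  have h4 : 0 < normc (1 - k * z) by apply: lt_le_trans h3; rewrite invr_gt0.
  rewrite (mulrC 2) ler_pM2l// ler_pM2l// -[X in _ && (_ <= X)]invrK.
  by rewrite !lef_pV2 ?posrE ?invr_gt0// h2.
have m1 z : normc z = 1 -> normc (m z) <= 1.
  move=> z1; apply: le_trans (normc_leD _ _) _; rewrite -lerBrDl; apply: le_trans rx.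
  by case/andP: (wz z z1).
have [cTm TmE] := poisson_extension_mobius cg s0 s1 g0 (x0 := x0) (a := r%:C) kh
  (eq_ind_r (fun u => 2 * u <= _) rx nr) (eq_ind_r (fun u => u <= _) rs nr) (ltW x01).
(* Half the cross term in |x0 + w z|^2; its circle mean is 0, so only the square of w
   contributes. *)
pose q z := complex.Re (conjc x0 * r%:C * z / (1 - k * z)).
have cq : circle_continuous q by exact: circle_continuous_Re_mobius.
have q0 : circle_mean q = 0 by exact: circle_mean_Re_mobius.
have cfm : circle_continuous (fun z => f (m z)).
  apply: circle_continuous_comp => z z1; last by apply: cf; exact: m1.
  by apply: complex_continuous_addl; apply: mobius_continuous; rewrite z1 mulr1.
(* Since |w z| >= r/2 on the circle, the mean of |x0 + w z|^2 exceeds |x0|^2 by at least r^2/4, and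
   this strict gain gives the contradiction. *)
pose A := H x0 - B - e * (normc x0 ^+ 2 + r ^+ 2 / 4).
have pt z : normc z = 1 -> f (m z) <= A + (T (m z) + (- (2 * e)) * q z).
  move=> z1; have : H (m z) <= H x0 by apply: maxH; rewrite inE; exact: m1.
  have sq : normc x0 ^+ 2 + r ^+ 2 / 4 + 2 * q z <= normc (m z) ^+ 2.
    have E : normc (m z) ^+ 2 = normc x0 ^+ 2 + 2 * complex.Re (conjc x0 * w z) + normc (w z) ^+ 2.
      have sqE u : normc u ^+ 2 = complex.Re u ^+ 2 + complex.Im u ^+ 2.
        by case: u => a b /=; rewrite sqr_sqrtr// addr_ge0// sqr_ge0.
      by rewrite !sqE /m; case: (x0) (w z) => a b [a' b'] /=; ring.
    have qE : q z = complex.Re (conjc x0 * w z) by rewrite /q /w !mulrA.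
    have /andP[h _] := wz z z1.
    have {}h : r ^+ 2 / 4 <= normc (w z) ^+ 2.
      have -> : r ^+ 2 / 4 = (r / 2) ^+ 2 by field.
      by rewrite ler_pXn2r// nnegrE ?normc_ge0// divr_ge0// ltW.
    rewrite E qE; move: h; move: (r ^+ 2 / 4) (normc (w z) ^+ 2) (normc x0 ^+ 2) (complex.Re _) => a b cc hh h.
    by lra.
  rewrite /A {1}/H; move: sq; move: (q z) (normc (m z) ^+ 2) (f (m z)) (T (m z)) (H x0) => q' b f' t h.
  by move: (normc x0 ^+ 2 + _) => y h1 h2; clearbody e; nra.
have cqe : circle_continuous (fun z => - (2 * e) * q z) by exact: circle_continuousZ.
have cTq : circle_continuous (fun z => T (m z) + (- (2 * e)) * q z) by exact: circle_continuousD.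
have rr : 0 < r < r0 by rewrite rp.
have := le_trans (hc r rr) (le_circle_mean cfm (circle_continuousD (@circle_continuous_cst R A) cTq) pt).
rewrite (circle_meanD (@circle_continuous_cst R A) cTq) circle_mean_cst (circle_meanD cTm cqe).
rewrite (circle_meanZ (- (2 * e)) cq) q0 mulr0 addr0 [X in _ + X]TmE /A /H -/T.
have : 0 < e * (r ^+ 2 / 4) by rewrite mulr_gt0// divr_gt0// exprn_gt0.
rewrite mulrDr; move: (e * (r ^+ 2 / 4)) (e * normc x0 ^+ 2) (f x0) (T x0) => a b u v; lra.
Qed.

End poisson.

(** * Pseudo-convexity *)

Section log_exhaustion.
Context (R : realType).
Implicit Types (g p : R).

(** For 0 < g < 1 this is a convex increasing function of ln g that blows up as g tends to 1. The
    truncation at 1/2 keeps it continuous where the gauge vanishes. *)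
Definition log_exhaustion g : R := - (ln (Num.max g 2^-1))^-1.

Let half1 : (2^-1 : R) < 1. Proof. by rewrite invf_lt1// ltr1n. Qed.

Let max_in g : g < 1 -> 0 < Num.max g 2^-1 < 1.
Proof. by move=> g1; rewrite lt_max gt_max g1 half1 invr_gt0 ltr0n orbT. Qed.

Let ln_max_lt0 g : g < 1 -> ln (Num.max g 2^-1) < 0.
Proof. by move=> /max_in; exact: ln_lt0. Qed.

Lemma log_exhaustion_min g g' : g <= 2^-1 -> g' < 1 -> log_exhaustion g <= log_exhaustion g'.
Proof.
move=> g2 g'1; rewrite /log_exhaustion (max_idPr g2) lerN2 lef_nV2 ?negrE ?ln_max_lt0//.
  by rewrite ler_ln ?posrE ?invr_gt0// ?le_max ?lexx ?orbT//; have /andP[] := max_in g'1.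
by apply: ln_lt0; rewrite invr_gt0 ltr0n.
Qed.

(** Two tangent estimates: -1/y lies above its tangent at y = ln g0, of slope y^(-2), and ln X >=
    (X^p - 1)/p for p < 0, applied to X = A g/g0. The powers X^p are what the mean inequality
    controls, and ln A has mean zero when A is |1 - k z|. *)
Lemma log_exhaustion_tangent (g0 g A p : R) : 2^-1 < g0 -> g0 < 1 -> 0 < g -> g < 1 -> 0 < A -> p < 0 ->
  log_exhaustion g0 + (ln g0) ^- 2 * (((A * g / g0) `^ p - 1) / p - ln A) <= log_exhaustion g.
Proof.
move=> g0h g01 gp g1 A0 p0; have g0p : 0 < g0 by apply: lt_trans g0h; rewrite invr_gt0.
have s0 : ln g0 < 0 by apply: ln_lt0; rewrite g0p.
have s1 := ln_max_lt0 g1.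
have sle : ln g <= ln (Num.max g 2^-1).
  by rewrite ler_ln ?posrE ?le_max ?lexx//; have /andP[] := max_in g1.
have b : ((A * g / g0) `^ p - 1) / p - ln A <= ln g - ln g0.
  have X0 : 0 < A * g / g0 by rewrite divr_gt0// mulr_gt0.
  have := expR_ge1Dx (p * ln (A * g / g0)); rewrite -[expR _]/(expR (p * ln (A * g / g0))).
  have -> : expR (p * ln (A * g / g0)) = (A * g / g0) `^ p by rewrite /powR gt_eqF.
  rewrite ln_div ?posrE ?mulr_gt0// lnM ?posrE// => h.
  rewrite lerBlDr ler_ndivrMr//; move: h; move: (_ `^ p) (ln A) (ln g) (ln g0) => X a x y; nra.
rewrite /log_exhaustion (max_idPl (ltW g0h)).
move: s0 s1 sle b; move: (ln g0) (ln (Num.max g _)) (ln g) (_ - ln A) => y x x' z y0 x0 xx' b.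
have yn : y != 0 by rewrite lt_eqF.
have y2 : 0 < y ^- 2 by rewrite invr_gt0 exprn_even_gt0.
have {}b : y ^- 2 * z <= y ^- 2 * (x - y) by rewrite ler_pM2l//; lra.
apply: (@le_trans _ _ (- y^-1 + y ^- 2 * (x - y))); first by rewrite lerD2l.
have xn : x != 0 by rewrite lt_eqF.
rewrite -subr_ge0; have -> : - x^-1 - (- y^-1 + y ^- 2 * (x - y)) = (x - y) ^+ 2 * y ^- 2 * - x^-1.
  by field; rewrite xn yn.
by rewrite mulr_ge0 ?oppr_ge0 ?invr_le0 ?(ltW x0)// mulr_ge0 ?sqr_ge0// ltW.
Qed.

Lemma log_exhaustion_continuous g : g < 1 -> {for g, continuous log_exhaustion}.
Proof.
move=> g1; have cmax : {for g, continuous (fun x : R => Num.max x 2^-1)}.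
  apply/continuous_at_realP => e e0; apply/nbhs_realP; exists e => // y.
  rewrite !ltr_norml => /andP[h1 h2]; rewrite /Num.max.
  by case: ifPn => [|]; case: ifPn => [|]; rewrite -?leNgt => h3 h4; apply/andP; split; lra.
have /andP[m0 m1] := max_in g1.
have cln := @continuous_comp _ _ _ _ (@ln R) g cmax (continuous_ln m0).
have nz : ln (Num.max g 2^-1) != 0 by rewrite lt_eqF// ln_max_lt0.
exact: (@continuousN R R^o _ _ g (@continuousV R _ _ g nz cln)).
Qed.

Lemma log_exhaustion_lt g (c : R) : 0 < c -> g < 1 -> log_exhaustion g < c -> g <= expR (- c^-1).
Proof.
move=> c0 g1 h; have /andP[m0 m1] := max_in g1; have l0 := ln_max_lt0 g1.
apply: (@le_trans _ _ (Num.max g 2^-1)); first by rewrite le_max lexx.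
rewrite -[leLHS]lnK ?posrE// ler_expR.
move: h l0; rewrite /log_exhaustion; move: (ln _) => l h l0.
have l1 : 0 < - l by rewrite oppr_gt0.
rewrite -invrN in h; rewrite lerNr; rewrite -(invrK (- l)).
by rewrite lef_pV2 ?posrE ?invr_gt0// ltW.
Qed.

End log_exhaustion.

Lemma continuous_along_line (R : realType) (n : nat) (f : 'rV[R[i]]_n -> R) (U V : 'rV[R[i]]_n)
    (z : R[i]) :
  {for U + z *: V, continuous f} -> {for z, continuous (fun z : R[i] => f (U + z *: V))}.
Proof.
move=> /continuous_at_realP cf; apply/continuous_at_realP => e e0.
exact: (@complex_line_continuous R n U V z _ (cf e e0)).
Qed.

Lemma positive_near_on_line (R : realType) (n : nat) (f : 'rV[R[i]]_n -> R) (U V : 'rV[R[i]]_n)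
    (x : R[i]) :
  {for U + x *: V, continuous f} -> 0 < f (U + x *: V) -> exists2 dl : R, 0 < dl &
  forall w : R[i], normc (w - x) < dl -> 0 < f (U + w *: V).
Proof.
move=> /continuous_along_line/continuous_at_realP cf f0.
have /nbhs_complexP[dl dl0 hdl] := cf _ f0; exists dl => // w /hdl.
by rewrite ltr_norml ltrBrDl subrr => /andP[].
Qed.

Lemma continuous_EFin (R : realType) (T : topologicalType) (f : T -> R) (x : T) :
  {for x, continuous f} -> {for x, continuous (fun y => (f y)%:E)}.
Proof. by move=> cf; apply/cvg_EFin; [exact: nearW|exact: cf]. Qed.

Section body_pseudoconvexity.
Context (R : realType) (n : nat).
Local Notation Cn := 'rV[R[i]]_n.
Local Notation tau := (2 * pi : R).
Variables (K : set Cn) (M d : R).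
Hypothesis hK : round_body K M d.
Hypothesis n0 : (0 < n)%N.
Variables (p c : R).
Hypotheses (p2 : -2 < p) (p0 : p < 0) (c0 : 0 < c).
Local Notation F := (body_power K p).
Local Notation N := (body_gauge K p).

Let pn : p != 0. Proof. by rewrite lt_eqF. Qed.
Let Ncont : continuous N := body_gauge_continuous hK p2 pn n0.
Let Nge0 x : 0 <= N x := body_gauge_ge0 K p x.

Definition open_body : set Cn := [set x | N x < c].

Lemma open_body_open : open open_body.
Proof.
by apply: (@open_comp _ _ N [set t | t < c]); [move=> x _; exact: Ncont|exact: open_lt].
Qed.

(** A point with gauge exactly c leaves the body under multiplication by 1 + s, for arbitrarily
    small s > 0. *)
Lemma interior_body : [set x | N x <= c]° = open_body.
Proof.
apply/seteqP; split; last first.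
  rewrite -open_subsetE; last exact: open_body_open.
  by move=> y /ltW.
move=> x hx; have Nx := interior_subset hx; rewrite /= in Nx.
rewrite /open_body /= lt_neqAle Nx andbT; apply/negP => /eqP NE.
move: hx => /nbhs_rowP[e e0 he].
have D0 : 0 < 1 + norm1c x by rewrite ltr_pwDl// norm1c_ge0.
pose s := e / (1 + norm1c x) / 2; have s0 : 0 < s by rewrite !divr_gt0.
have : N ((1 + s)%:C *: x) <= c.
  apply: he => j; rewrite mxE.
  have -> : (1 + s)%:C * x 0 j - x 0 j = s%:C * x 0 j by rewrite rmorphD rmorph1 mulrDl mul1r addrAC subrr add0r.
  rewrite normcM normc_real gtr0_norm//; apply: (@le_lt_trans _ _ (s * (1 + norm1c x))).
    rewrite ler_pM2l//; apply: (le_trans (normc_le_norm1c x j)); by rewrite lerDr.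
  by rewrite /s mulrAC divfK ?gt_eqF// ltr_pdivrMr// ltr_pMr// ltr1n.
rewrite (body_gaugeZ hK p2 pn) normc_real gtr0_norm ?addr_gt0// NE => h.
have : s * c <= 0 by move: h; rewrite mulrDl mul1r gerDl.
by rewrite leNgt mulr_gt0.
Qed.

Lemma open_body_connected : connected open_body.
Proof.
pose seg (x : Cn) : set Cn := [set 0 + t%:C *: x | t in `[0, 1]%classic].
have -> : open_body = \bigcup_(x in open_body) seg x.
  apply/seteqP; split => x.
    move=> xO; exists x => //; exists 1; first by rewrite /= in_itv /= ler01 lexx.
    by rewrite rmorph1 scale1r add0r.
  move=> [y yO [t /=]]; rewrite in_itv /= => /andP[t0 t1] <-; rewrite add0r.
  rewrite /open_body /= (body_gaugeZ hK p2 pn) normc_real ger0_norm//.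
  by apply: le_lt_trans yO; rewrite ler_piMl.
apply: bigcup_connected.
  exists 0 => x _; exists 0; first by rewrite /= in_itv /= lexx ler01.
  by rewrite rmorph0 scale0r addr0.
move=> x _; apply: connected_continuous_connected; first exact: segment_connected.
apply: continuous_subspaceT => t A hA.
exact: (@real_complex_continuous R t _ (@complex_line_continuous R n 0 x t%:C _ hA)).
Qed.

Definition body_exhaustion (x : Cn) : R := log_exhaustion (N x / c).
Local Notation phi := body_exhaustion.

Let Nc_lt1 x : open_body x -> N x / c < 1.
Proof. by move=> xO; rewrite ltr_pdivrMr// mul1r. Qed.

Lemma body_exhaustion_continuous x : open_body x -> {for x, continuous phi}.
Proof.
move=> xO A hA.
have h1 := @log_exhaustion_continuous R _ (Nc_lt1 xO) A hA.
have h2 := @continuousM R R (fun y => y) (fun=> c^-1) (N x) (fun B h => h) (@cst_continuous _ _ c^-1 (N x)) _ h1.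
exact: (Ncont h2).
Qed.

Lemma body_exhaustion_line_continuous (U V : Cn) (z : R[i]) : open_body (U + z *: V) ->
  {for z, continuous (fun z : R[i] => phi (U + z *: V))}.
Proof.
by move=> zO; exact: continuous_along_line (body_exhaustion_continuous zO).
Qed.

Lemma body_exhaustion_relatively_compact (a : R) :
  relatively_compact_in open_body (open_body `&` [set x | ((phi x)%:E < a%:E)%E]).
Proof.
pose b := Num.max a 1; have b0 : 0 < b by rewrite lt_max ltr01 orbT.
pose s := expR (- b^-1).
have s1 : s < 1 by rewrite -expR0 ltr_expR oppr_lt0 invr_gt0.
pose S := [set x : Cn | N x <= s * c].
have sub : open_body `&` [set x | ((phi x)%:E < a%:E)%E] `<=` S.
  move=> x [xO]; rewrite /= lte_fin => h; rewrite /S /= -ler_pdivrMr//.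
  apply: (log_exhaustion_lt b0 (Nc_lt1 xO)); apply: lt_le_trans h _.
  by rewrite le_max lexx.
have clS : closed S.
  rewrite (_ : S = N @^-1` [set t | t <= s * c])//.
  by apply: preimage_closed; [move=> z _; exact: Ncont|exact: closed_le].
have clsub : closure (open_body `&` [set x | ((phi x)%:E < a%:E)%E]) `<=` S.
  by rewrite [X in _ `<=` X]((closure_id S).1 clS); exact: closureS.
have [a' [b' [a'0 b'0 ab]]] := body_gauge_bounds hK p2 pn n0.
have cptS : compact S.
  apply: (subclosed_compact clS (@compact_polydisc R n (s * c / a'))) => x xS j.
  apply: le_trans (normc_le_norm1c x j) _; rewrite ler_pdivlMr// mulrC.
  by have /andP[h _] := ab x; apply: le_trans h xS.
split; first by apply: subclosed_compact clsub => //; exact: closed_closure.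
move=> x /clsub xS; apply: (le_lt_trans xS).
by rewrite gtr_pMl.
Qed.

Let disc_image x (k : R[i]) (r : R) z : normc z = 1 -> 0 < r -> normc k <= 2^-1 ->
  normc (r%:C * z / (1 - k * z) : R[i]) <= 2 * r /\ 0 < normc (1 - k * z) /\
  (normc x + 2 * r <= 1 -> normc (x + r%:C * z / (1 - k * z)) <= 1).
Proof.
move=> z1 r0 kh; have h1 := normc_one_sub k z; rewrite z1 mulr1 in h1.
have h3 : 2^-1 <= normc (1 - k * z).
  by apply: le_trans h1; rewrite lerBrDl; apply: (@le_trans _ _ (2^-1 + 2^-1)); [exact: lerD|lra].
have h4 : 0 < normc (1 - k * z) by apply: lt_le_trans h3; rewrite invr_gt0.
have h5 : normc (r%:C * z / (1 - k * z)) <= 2 * r.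
  rewrite !normcM normcV normc_real z1 mulr1 gtr0_norm// mulrC ler_pM2r//.
  by rewrite -[leRHS]invrK lef_pV2 ?posrE ?invr_gt0.
split => //; split => // h; apply: le_trans (normc_leD _ _) _.
by apply: le_trans h; rewrite lerD2l.
Qed.

Let powR_mul_div (a b e : R) : 0 <= a -> 0 <= b -> 0 < e ->
  a `^ p * b `^ p / e `^ p = (a * b / e) `^ p.
Proof.
move=> a0 b0 e0; have ei : 0 <= e^-1 by rewrite invr_ge0 ltW.
rewrite (powRM p (mulr_ge0 a0 b0) ei) (powRM p a0 b0); congr (_ * _).
by rewrite -powRN -powR_inv1 ?ltW// -powRrM mulN1r.
Qed.

Let body_power_circle_continuous (P W : Cn) :
  (forall z, normc z = 1 -> P + z *: W != 0) -> circle_continuous (fun z => F (P + z *: W)).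
Proof.
move=> h; apply: (@circle_continuous_comp R (fun z => F (P + z *: W)) id) => [z _|z z1].
  by move=> A.
exact: continuous_along_line (body_power_continuous hK p2 pn (h z z1)).
Qed.

(** The shear furnished by [complex_key] at the given point determines k; [line_reparam] turns the
    circle in the sheared direction into a Moebius circle in the given line, at the price of the
    factor |1 - k r z|, whose logarithm has mean zero. *)
Lemma body_exhaustion_local (U V : Cn) (x : R[i]) :
  (forall z, normc z <= 1 -> open_body (U + z *: V)) -> normc x < 1 ->
  exists k : R[i], exists2 r0 : R, 0 < r0 & forall r : R, 0 < r < r0 ->
    phi (U + x *: V) <= circle_mean (fun z => phi (U + (x + r%:C * z / (1 - k * r%:C * z)) *: V)).
Proof.
move=> UV x1; have d0 : 0 < 1 - normc x by rewrite subr_gt0.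
have cphi (z : R[i]) : normc z <= 1 -> {for z, continuous (fun z : R[i] => phi (U + z *: V))}.
  by move=> z1; exact: body_exhaustion_line_continuous (UV z z1).
have nr (r : R) : 0 < r -> normc (r%:C : R[i]) = r by move=> r0; rewrite normc_real gtr0_norm.
have cphim (k : R[i]) r : 0 < r -> normc (k * r%:C) <= 2^-1 -> normc x + 2 * r <= 1 ->
    circle_continuous (fun z => phi (U + (x + r%:C * z / (1 - k * r%:C * z)) *: V)).
  move=> rp kh xr; apply: (@circle_continuous_comp R (fun z => phi (U + z *: V))
    (fun z => x + r%:C * z / (1 - k * r%:C * z))) => z z1.
    apply: complex_continuous_addl; apply: mobius_continuous; rewrite z1 mulr1.
    by apply: le_lt_trans kh _; rewrite invf_lt1// ltr1n.
  by apply: cphi; have [_ [_ h]] := disc_image x z1 rp kh; exact: h.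
have [P PE] : exists P, P = U + x *: V by exists (U + x *: V).
have Pc : N P < c by rewrite PE; exact: UV (ltW x1).
(* Where the gauge is at most c/2 the truncated function attains its minimum, so every small circle
   will do and k = 0. *)
have [Ph|Ph] := leP (N P / c) 2^-1.
  exists 0, ((1 - normc x) / 2); first by rewrite divr_gt0.
  move=> r /andP[rp rr]; rewrite ltr_pdivlMr// in rr.
  have xr : normc x + 2 * r <= 1 by move: rr; move: (normc x) => y h; lra.
  have kh : normc (0 * r%:C : R[i]) <= 2^-1 by rewrite mul0r normc0 invr_ge0.
  rewrite -[leLHS]circle_mean_cst; apply: le_circle_mean => [||z z1].
  - exact: circle_continuous_cst.
  - exact: cphim.
  - rewrite /phi -PE; apply: log_exhaustion_min => //; apply: Nc_lt1; apply: UV.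
    by have [_ [_ h]] := disc_image x z1 rp kh; exact: h.
have P0 : P != 0.
  apply/eqP => P0; move: Ph; rewrite P0 (body_gauge0 K pn) mul0r.
  by rewrite ltNge invr_ge0 ler0n.
have [k0 hk0] := complex_key (rb_meas hK) (rb_conv hK) (rb_M0 hK) (rb_bound hK) (rb_d0 hK)
  (rb_inner hK) (rb_rot hK) V p2 p0 P0.
pose k := - k0.
have NP0 : 0 < N P := body_gauge_gt0 hK p2 pn P0.
have NU0 : 0 < N (U + x *: V) by rewrite -PE.
have [dl dl0 hdl] := positive_near_on_line (@Ncont (U + x *: V)) NU0.
have k1 : 0 < normc k + 1 by rewrite ltr_wpDl// normc_ge0.
(* The three bounds keep the Moebius circle inside the unit disc, keep the gauge positive on it, and
   give |k r| <= 1/2. *)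
exists k, (Num.min (Num.min ((1 - normc x) / 2) (dl / 2)) (2^-1 / (normc k + 1))).
  by rewrite !lt_min !divr_gt0// invr_gt0.
move=> r /andP[rp]; rewrite !lt_min !ltr_pdivlMr// => /andP[/andP[r1 r2] r3].
have xr : normc x + 2 * r <= 1 by rewrite -lerBrDl mulrC; exact: ltW.
have kh : normc (k * r%:C) <= 2^-1.
  by rewrite normcM nr// mulrC; apply: le_trans (ltW r3); rewrite ler_pM2l// lerDl.
pose m z := x + r%:C * z / (1 - k * r%:C * z).
pose A z := normc (1 - k * r%:C * z).
(* The p-th power of A g/g0 in [log_exhaustion_tangent]; by [complex_key] its circle mean is at most
   1. *)
pose X z := F (P + (r%:C * z) *: (V + k0 *: P)) / F P.
have FP : 0 < F P := body_power_gt0 hK p2 pn P0.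
have QE z : normc z = 1 -> P + (r%:C * z) *: (V + k0 *: P) = (1 - k * r%:C * z) *: (U + m z *: V).
  move=> z1; have [_ [h _]] := disc_image x z1 rp kh.
  have E : 1 + r%:C * z * k0 = 1 - k * r%:C * z by rewrite /k; ring.
  have nz : 1 + r%:C * z * k0 != 0 by rewrite E -normc_gt0.
  have := line_reparam P V 0 nz; rewrite scale0r addr0 add0r E => ->.
  suff -> : U + m z *: V = P + (r%:C * z / (1 - k * r%:C * z)) *: V by [].
  by rewrite PE /m [in LHS]scalerDl addrA.
have mP z : normc z = 1 -> [/\ 0 < A z, 0 < N (U + m z *: V) & open_body (U + m z *: V)].
  move=> z1; have [h1 [h2 h3]] := disc_image x z1 rp kh.
  split; first exact: h2.
    apply: hdl; rewrite /m addrAC subrr add0r; apply: le_lt_trans h1 _.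
    by rewrite mulrC.
  by apply: UV; exact: h3.
have XE z : normc z = 1 -> X z = (A z * (N (U + m z *: V) / c) / (N P / c)) `^ p.
  move=> z1; have [A0 NQ _] := mP z z1.
  have cn : c != 0 := lt0r_neq0 c0.
  have NPn : N P != 0 := lt0r_neq0 NP0.
  have -> : A z * (N (U + m z *: V) / c) / (N P / c) = (A z * N (U + m z *: V)) * (N P)^-1.
    by move: (A z) (N (U + _)) (N P) NPn => a b e en; field; rewrite en cn.
  rewrite /X QE// (body_powerZ hK p2 pn) -!(body_gauge_powR hK p2 pn) -/(A z).
  exact: powR_mul_div (ltW A0) (ltW NQ) NP0.
have cX : circle_continuous X.
  apply: (@circle_continuousM R _ (fun=> (F P)^-1)); last exact: circle_continuous_cst.
  have cs z : (r%:C * z) *: (V + k0 *: P) = z *: (r%:C *: (V + k0 *: P)).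
    by rewrite scalerA (mulrC z).
  rewrite (_ : (fun z => _) = (fun z => F (P + z *: (r%:C *: (V + k0 *: P))))); last first.
    by apply/funext => z; rewrite cs.
  apply: body_power_circle_continuous => z z1; rewrite -cs.
  have [A0 NQ _] := mP z z1.
  rewrite (QE z z1) scaler_eq0 negb_or -normc_gt0 A0; apply/eqP => Q0.
  by move: NQ; rewrite Q0 (body_gauge0 K pn) ltxx.
have mX : circle_mean X <= 1.
  have := hk0 r (ltW rp).
  have -> : circle_integral (fun z => body_integral K (fun z => (normc z `^ p)%R) (P + (r%:C * z) *: (V + k0 *: P))) =
      circle_integral (fun z => (F P * X z)%:E).
    apply: eq_integral => t _; rewrite (body_powerE hK p2 pn); congr EFin.
    by rewrite /X [RHS]mulrC divfK//; exact: lt0r_neq0 FP.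
  rewrite (body_powerE hK p2 pn) circle_integralE; last exact: circle_continuousZ.
  rewrite (circle_meanZ (F P) cX) -EFinM lee_fin ler_pM2l ?mulr_gt0 ?pi_gt0//.
  by rewrite -[leRHS]mulr1 ler_pM2l.
have cA : circle_continuous (fun z => ln (A z)).
  apply: (@circle_continuous_comp R (fun w => ln (normc w)) (fun z => 1 - k * r%:C * z)) => z z1.
    exact: one_sub_continuous.
  have [A0 _ _] := mP z z1.
  apply: (@continuous_comp _ _ _ (@normc R) (@ln R)); first exact: continuous_normc.
  exact: continuous_ln.
have mA : circle_mean (fun z => ln (A z)) = 0 by exact: circle_mean_ln_mobius.
pose l := (ln (N P / c)) ^- 2.
have l0 : 0 <= l by rewrite /l invr_ge0 sqr_ge0.
pose e1 := phi P - l / p.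
have pt z : normc z = 1 -> e1 + (l / p * X z + - l * ln (A z)) <= phi (U + m z *: V).
  move=> z1; have [A0 NQ QO] := mP z z1.
  have NQc : 0 < N (U + m z *: V) / c by rewrite divr_gt0.
  have := log_exhaustion_tangent Ph (Nc_lt1 (x := P) Pc) NQc (Nc_lt1 QO) A0 p0.
  rewrite -(XE z z1) => h; apply: le_trans h; rewrite /e1 -/(phi P) -/l.
  by move: (phi P) (X z) (ln (A z)) => a b e; rewrite le_eqVlt; apply/orP; left; apply/eqP; field.
have cX' : circle_continuous (fun z => l / p * X z) by exact: circle_continuousZ.
have cA' : circle_continuous (fun z => - l * ln (A z)) by exact: circle_continuousZ.
have cs := circle_continuousD cX' cA'.
rewrite -PE; apply: le_trans (le_circle_mean (circle_continuousD (@circle_continuous_cst R e1) cs) (cphim k r rp kh xr) pt).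
rewrite (circle_meanD (@circle_continuous_cst R e1) cs) circle_mean_cst (circle_meanD cX' cA').
rewrite (circle_meanZ (l / p) cX) (circle_meanZ (- l) cA) mA mulr0 addr0 /e1.
rewrite -addrA lerDl.
(* As l / p is nonpositive, a mean of X at most 1 gives the lower bound l / p, which cancels the
   constant in [e1]. *)
have lp : l / p <= 0 by rewrite mulr_ge0_le0// invr_le0 ltW.
by rewrite addrC subr_ge0 -[leLHS]mulr1; exact: ler_wnM2l lp _ _ mX.
Qed.

Lemma body_exhaustion_psh : plurisubharmonic open_body (fun x => (phi x)%:E).
Proof.
have usc (T : topologicalType) (D : set T) (f : T -> R) :
    (forall x, D x -> {for x, continuous f}) -> usc_on D (fun x => (f x)%:E).
  move=> cf x a Dx; rewrite lte_fin => fa.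
  have fa0 : 0 < a - f x by rewrite subr_gt0.
  have /continuous_at_realP/(_ _ fa0) := cf x Dx; apply: filterS => y h _.
  by rewrite lte_fin; move: h; rewrite ltr_norml => /andP[_]; rewrite ltrBlDr subrK.
split; [exact/usc/body_exhaustion_continuous|by move=> z _; rewrite ltry|].
move=> u v; split; [|by move=> z _; rewrite ltry|].
  by apply: usc => z zO; exact: body_exhaustion_line_continuous.
(* An affine change of parameter carries the closed disc of centre a and radius r to the unit
   disc. *)
move=> a r r0 disc; pose U := u + a *: v; pose V := r%:C *: v.
have UVE z : u + (a + r%:C * z) *: v = U + z *: V.
  by rewrite /U /V scalerA scalerDl addrA (mulrC z).
have UV z : normc z <= 1 -> open_body (U + z *: V).
  move=> z1; rewrite -UVE; apply: disc => /=.
  rewrite addrAC subrr add0r -[`|_|]/((normc (r%:C * z))%:C) lecR normcM normc_real gtr0_norm//.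
  by rewrite ler_piMr// ltW.
have cf (z : R[i]) : normc z <= 1 -> {for z, continuous (fun z : R[i] => phi (U + z *: V))}.
  by move=> z1; exact: body_exhaustion_line_continuous (UV z z1).
have h := unit_disc_submean cf (fun x x1 => body_exhaustion_local UV x1).
rewrite scale0r addr0 in h.
have ccf : circle_continuous (fun z => phi (U + z *: V)).
  apply: (@circle_continuous_comp R (fun z => phi (U + z *: V)) id) => [z _|z z1]; first by move=> A.
  by apply: cf; rewrite z1.
have tau0 : 0 < tau by rewrite mulr_gt0// pi_gt0.
have -> : (\int[lebesgue_measure]_(t in `[0%R, tau])
    (phi (u + (a + r%:C * (cos t +i* sin t)) *: v)%R)%:E = (tau * circle_mean (fun z => phi (U + z *: V)))%:E)%E.
  by rewrite -(circle_integralE ccf); apply: eq_integral => t _; rewrite UVE.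
by rewrite -EFinM mulrA mulVf ?mul1r ?gt_eqF// lee_fin.
Qed.

Lemma body_pseudo_convex : pseudo_convex [set x | N x <= c]°.
Proof.
rewrite interior_body; split; [exact: open_body_open|exact: open_body_connected|].
exists (fun x => (phi x)%:E); split; last exact: body_exhaustion_relatively_compact.
  rewrite (continuous_open_subspace _ open_body_open) => x; rewrite inE => xO.
  exact: continuous_EFin (body_exhaustion_continuous xO).
exact: body_exhaustion_psh.
Qed.

End body_pseudoconvexity.

Close Scope complex_scope.

Theorem theorem2 (R : realType) (n : nat) (n_gt0 : (0 < n)%N)
    (C : set R[i]) (K : set 'rV[R[i]]_n) :
  convex_body0 C -> star_body K -> convex_set K -> circle_invariant K ->
  (forall p : R, -2 < p -> p < -1 ->
     pseudo_convex (Lp_intersection_body C p K)°)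
  /\
  (forall p : R, -1 <= p -> p != 0 ->
     convex_set (Lp_intersection_body C p K)).
Proof.
move=> hC sK cK rK; have [M [d hK]] := star_body_round n_gt0 sK cK rK.
split=> p p1.
  move=> p2; have p0 : p < 0 by lra.
  have pn : p != 0 by rewrite lt_eqF.
  have [c c0 ->] := Lp_intersection_bodyE hK p1 pn hC n_gt0.
  exact: (body_pseudo_convex hK n_gt0 p1 p0 c0).
move=> pn; have p2 : -2 < p by lra.
have [c c0 ->] := Lp_intersection_bodyE hK p2 pn hC n_gt0.
by apply/convex_setP => t x y t01 hx hy; exact: (body_gauge_convex hK n_gt0 p1 pn t01 c0 hx hy).
Qed.
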